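(* Let $n\in\mathbb N$, $1<p_1,p_2<\infty$, $\frac1p=\frac1{p_1}+\frac1{p_2}$, $1<u<\infty$ with $\frac1u+\frac1{u'}=1$, and $0<s<\infty$; let $p'$ satisfy $\frac1p+\frac1{p'}=1$. Suppose that $$\|T_m(f_1,f_2)\|_{L^p(\mathbb R^n)}\lesssim\mathcal A^u_s[m]\,\|f_1\|_{L^{p_1}(\mathbb R^n)}\|f_2\|_{L^{p_2}(\mathbb R^n)}$$ for all $m$ with $\mathcal A^u_s[m]<\infty$ and all Schwartz $f_1,f_2$. Then necessarily $$\frac sn>\max\Big\{\frac2u,\frac1p-\frac1{u'}\Big\}\quad\text{and}\quad\frac sn\ge\max\Big\{\frac12-\frac1{p'},0\Big\}+\sum_{i=1}^2\max\Big\{\frac12-\frac1{p_i},0\Big\}.$$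
   Context: For bounded $m$ on $\mathbb R^{2n}$: $T_m(f_1,f_2)(x)=\int_{(\mathbb R^n)^2}\widehat{f_1}(\xi_1)\widehat{f_2}(\xi_2)m(\xi_1,\xi_2)e^{2\pi i\langle x,\xi_1+\xi_2\rangle}d\xi_1d\xi_2$, $\widehat f(\xi)=\int f(x)e^{-2\pi i\langle x,\xi\rangle}dx$. $\Theta$ is a fixed Schwartz function on $\mathbb R^{2n}$ with $\widehat\Theta$ supported in $\{1/2\le|\vec\xi|\le2\}$; $\|F\|_{L^u_s(\mathbb R^{2n})}=\|[(1+4\pi^2|\cdot|^2)^{s/2}\widehat F]^\vee\|_{L^u}$; $\mathcal A^u_s[m]=\sup_{k\in\mathbb Z}\|m(2^k\cdot)\widehat\Theta\|_{L^u_s(\mathbb R^{2n})}$. *)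

(* Defs.v *)
From mathcomp Require Import all_boot all_order all_algebra.
From mathcomp Require Import all_classical all_reals all_analysis.
From mathcomp Require Import complex.
Set Implicit Arguments. Unset Strict Implicit. Unset Printing Implicit Defensive.
Import Order.TTheory GRing.Theory Num.Theory.
Local Open Scope ring_scope.
Local Open Scope classical_set_scope.

Section Defs.
Context {R : realType}.

Definition dotp n (x y : 'rV[R]_n) : R := \sum_(i < n) x ord0 i * y ord0 i.
Definition enorm n (x : 'rV[R]_n) : R := Num.sqrt (dotp x x).

Definition cabs (z : R[i]) : R :=
  Num.sqrt (complex.Re z ^+ 2 + complex.Im z ^+ 2).
Definition expi (t : R) : R[i] := Complex (cos t) (sin t).

(** Lebesgue integral over R^n of a non-negative (extended-real valued)
    function, as the iterated Lebesgue integral over R (Tonelli). *)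
Fixpoint iint (n : nat) : ('rV[R]_n -> \bar R) -> \bar R :=
  match n return ('rV[R]_n -> \bar R) -> \bar R with
  | 0 => fun f => f 0
  | n'.+1 => fun f =>
      (\int[lebesgue_measure]_t iint (fun y : 'rV[R]_n' =>
                                        f (row_mx (const_mx t : 'rV[R]_1) y)))%E
  end.

Definition rint n (g : 'rV[R]_n -> R) : R :=
  fine (iint (fun x => (Num.max (g x) 0)%:E))
  - fine (iint (fun x => (Num.max (- g x) 0)%:E)).
Definition cint n (f : 'rV[R]_n -> R[i]) : R[i] :=
  Complex (rint (fun x => complex.Re (f x))) (rint (fun x => complex.Im (f x))).

Definition LpNorm n (p : R) (f : 'rV[R]_n -> R[i]) : \bar R :=
  poweR (iint (fun x => (powR (cabs (f x)) p)%:E)) p^-1.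

Definition boxes n : set (set 'rV[R]_n) :=
  [set A | exists a b : 'rV[R]_n,
     A = [set x : 'rV[R]_n | forall i, a ord0 i < x ord0 i <= b ord0 i]].
Definition borel_measR n (g : 'rV[R]_n -> R) : Prop :=
  forall B : set R, measurable B -> smallest (sigma_algebra setT) (@boxes n) (g @^-1` B).
Definition borel_meas n (f : 'rV[R]_n -> R[i]) : Prop :=
  borel_measR (fun x => complex.Re (f x)) /\ borel_measR (fun x => complex.Im (f x)).

Definition bounded_cfun n (f : 'rV[R]_n -> R[i]) : Prop :=
  exists M : R, forall x, cabs (f x) <= M.

Definition Dmulti n (beta : seq 'I_n) (g : 'rV[R]_n -> R) : 'rV[R]_n -> R :=
  foldr (fun i h => fun x => derive h x (delta_mx 0 i)) g beta.

Definition schwartzR n (g : 'rV[R]_n -> R) : Prop :=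
  (forall beta x, differentiable (Dmulti beta g) x) /\
  (forall beta (k : nat), exists C : R, forall x,
      (1 + enorm x ^+ 2) ^+ k * `|Dmulti beta g x| <= C).
Definition schwartz n (f : 'rV[R]_n -> R[i]) : Prop :=
  schwartzR (fun x => complex.Re (f x)) /\ schwartzR (fun x => complex.Im (f x)).

Definition fhat n (f : 'rV[R]_n -> R[i]) (xi : 'rV[R]_n) : R[i] :=
  cint (fun x => f x * expi (- (2 * pi * dotp x xi))).

Definition Tm n (m : 'rV[R]_(n + n) -> R[i]) (f1 f2 : 'rV[R]_n -> R[i])
  (x : 'rV[R]_n) : R[i] :=
  cint (fun eta : 'rV[R]_(n + n) =>
    fhat f1 (lsubmx eta) * fhat f2 (rsubmx eta) * m eta
    * expi (2 * pi * dotp x (lsubmx eta + rsubmx eta))).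

(** G is the (distributional) inverse Fourier transform of H:
    hat G = H as tempered distributions, i.e. <G, hat phi> = <H, phi>. *)
Definition is_inv_fourier n (G H : 'rV[R]_n -> R[i]) : Prop :=
  forall phi, schwartz phi ->
    cint (fun x => G x * fhat phi x) = cint (fun xi => H xi * phi xi).

(** Sobolev norm ||F||_{L^u_s} = || [(1+4pi^2|.|^2)^{s/2} hat F]^vee ||_{L^u}
    (+oo if this inverse Fourier transform is not an L^u function). *)
Definition sob_weight n (s : R) (xi : 'rV[R]_n) : R :=
  powR (1 + 4 * pi ^+ 2 * enorm xi ^+ 2) (s / 2).
Definition sobnorm n (u s : R) (F : 'rV[R]_n -> R[i]) : \bar R :=
  ereal_inf [set r | exists G, borel_meas G /\
      is_inv_fourier G (fun xi => (sob_weight s xi)%:C * fhat F xi)%C /\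
      r = LpNorm u G].

Definition Aus n (u s : R) (Theta : 'rV[R]_(n + n) -> R[i])
  (m : 'rV[R]_(n + n) -> R[i]) : \bar R :=
  ereal_sup [set r | exists k : int,
     r = sobnorm u s (fun xi => m ((2 : R) ^ k *: xi) * fhat Theta xi)].

End Defs.

(* Main.v *)
(** The bound is tested on three families of multipliers built from Gaussians,
    against Gaussian inputs, so that [T_m] can be computed exactly.
    - Bumps [sum_(j < J) exp (- pi 4^j |xi - v|^2)] at a fixed frequency [v],
      here rescaled by [2^J]: [T_m] is of size [J], whereas [A^u_s] is
      [O(J^(1/u))] as soon as [s <= 2n/u]. Hence [s > 2n/u].
    - [sum_(j < J) 2^(-j gam) exp (- pi 4^j |xi1 + xi2|^2) exp (- pi |xi|^2)]
      with [gam = n (1/p - 1)]: the j-th term of [T_m] is of size [2^(-jn/p)]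
      on a dyadic cube of volume about [2^(jn)] and these cubes are disjoint,
      whence [|T_m|_p >= c J^(1/p)], whereas [A^u_s] is again [O(J^(1/u))] if
      [s <= gam + n/u]. Since the first family reduces the question to
      [1/p > 1 + 1/u], this gives [s > gam + n/u].
    - Chirps with phase [lam (c1 |xi1|^2 + c2 |xi2|^2 + c0 |xi1 + xi2|^2)] for
      [c_i] in {0, 1}, with [A^u_s = O(lam^s)]; letting [lam] tend to infinity
      gives the linear inequality indexed by [(c0, c1, c2)], and the eight of
      them amount to the second conclusion.
    The upper bounds for [A^u_s] rest on a pointwise estimate. Write
    [s = 2 l + 2 al] with [0 <= al < 1] and let [w] be the symbol
    [1 + 4 pi^2 |xi|^2]. Then [w^l] acts as [(1 - Laplacian)^l], and
    [(w / Lam^2)^al] is a superposition of heat multipliers, because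
    [I z^al] is the integral of [chi (z e^x) e^(- al x)] over the line for
    [chi v = e^(-v) - e^(-2v)]. Where [x < 0] one factor [w] is moved onto the
    function, which costs two more derivatives but makes the integral
    converge. If each derivative costs a factor [Lam], the result is
    dominated by [Lam^s] times Gaussian averages of the function. *)
Require Import Defs.
From HB Require Import structures.
From mathcomp Require Import all_boot all_order all_algebra.
From mathcomp Require Import all_classical all_reals all_analysis.
From mathcomp Require Import measurable_realfun complex.
From mathcomp Require Import ring lra.
Import Order.TTheory GRing.Theory Num.Theory.
Import numFieldNormedType.Exports.

Set Implicit Arguments. Unset Strict Implicit. Unset Printing Implicit Defensive.
Local Open Scope ring_scope.
Local Open Scope classical_set_scope.

(** Two features of the statement shape the proof. [sobnorm] is an infimum over functions [G] tied
    to the multiplier only through pairings with Schwartz functions, so an upper bound needs one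
    explicit [G], and neither inversion nor uniqueness of the Fourier transform. [Aus] is a supremum
    over all dilations, so every estimate must be uniform in [k]: on the annulus carrying
    [fhat Theta], what a dilation costs is paid by a Gaussian factor or by the distance of the bumps
    from the annulus, and a sum over scales remains. Gaussian averages occur at all widths at once.
    Uniformly in the width, the average of exp(-nu^2 |x - v|^2) in dimension D is only O((1 + nu |x
    - v|)^-D). This slow decay just suffices: with weights 2^(jD/u) the sum over scales 2^j is still
    dominated by a single term, because 1 < 2^(D/u) < 2^D. Each scale then adds a bounded amount to
    the u-th power of the norm, which is where J^(1/u) comes from. Test functions are chosen so that
    the integrand of [Tm] is Gaussian up to a phase in xi1 + xi2; lower bounds are then read off
    explicit sums. *)

Notation V R n := (g_sigma_algebraType (@boxes R n)).

(** * Lebesgue measure on row vectors *)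

Section MeasureRn.
Context {R : realType}.

(** The generators are boxes bounded in every direction, so a slab is exhausted by boxes whose other
    sides grow with [k]. *)
Lemma measurable_coord n (i : 'I_n) :
  measurable_fun setT (fun x : V R n => x ord0 i : R).
Proof.
apply: (measurability (@ocitv R)) => // _ [_ [[a b] _ <-] <-].
rewrite setTI.
have -> : (fun x : V R n => x ord0 i) @^-1` `]a, b]%classic =
    \bigcup_k [set x : 'rV[R]_n | forall j,
      (if j == i then a else - k%:R) < x ord0 j <= (if j == i then b else k%:R)].
  apply/seteqP; split=> [x /=|x [k _ /=] /(_ i)]; last by rewrite eqxx in_itv.
  rewrite in_itv/= => xab.
  pose M := \sum_(j < n) `|x ord0 j|.
  have M0 : 0 <= M by exact: sumr_ge0.
  exists (Num.truncn M).+1 => //= j; case: eqVneq => [->//|_].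
  have : `|x ord0 j| < (Num.truncn M).+1%:R.
    apply: le_lt_trans (truncnS_gt M).
    by rewrite /M (bigD1 j)//= lerDl sumr_ge0.
  by rewrite ltr_norml => /andP[-> /ltW].
apply: bigcupT_measurable => k; apply: sub_sigma_algebra.
exists (\row_j (if j == i then a else - k%:R)), (\row_j (if j == i then b else k%:R)).
by apply/seteqP; split=> x /= + j => /(_ j); rewrite !mxE.
Qed.

Lemma measurable_funV d (T : measurableType d) n (f : T -> V R n) :
  (forall i, measurable_fun setT (fun t => f t ord0 i : R)) ->
  measurable_fun setT f.
Proof.
move=> mf; apply: (@measurability _ _ _ (V R n) setT f (@boxes R n) erefl) => // _ [_ [a [b ->]] <-].
rewrite setTI.
have -> : f @^-1` [set x : 'rV[R]_n | forall i, a ord0 i < x ord0 i <= b ord0 i] =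
   \bigcap_(i in [set: 'I_n]) ((fun t => f t ord0 i) @^-1` `]a ord0 i, b ord0 i]).
  apply/seteqP; split=> x /= H i; first by move=> _; rewrite /= in_itv/= H.
  by have := H i I; rewrite /= in_itv.
apply: fin_bigcap_measurable => [|i _]; first exact: finite_finset.
rewrite -[X in measurable X]setTI; apply: mf => //.
Qed.

Definition consV n (p : R * V R n) : V R n.+1 :=
  row_mx (const_mx p.1 : 'rV[R]_1) (p.2 : 'rV[R]_n).
Definition headV n (x : V R n.+1) : R := x ord0 ord0.
Definition tailV n (x : V R n.+1) : V R n := \row_(i < n) x ord0 (lift ord0 i).

Lemma consV0 n (p : R * V R n) : (consV p : 'rV[R]_n.+1) ord0 ord0 = p.1.
Proof.
rewrite /consV (_ : (ord0 : 'I_n.+1) = @lshift 1 n ord0); last exact/val_inj.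
by rewrite (@row_mxEl _ 1 1 n) mxE.
Qed.

Lemma consVS n (p : R * V R n) (i : 'I_n) :
  (consV p : 'rV[R]_n.+1) ord0 (lift ord0 i) = (p.2 : 'rV[R]_n) ord0 i.
Proof.
rewrite /consV (_ : lift ord0 i = rshift 1 i); last exact/val_inj.
by rewrite (@row_mxEr _ 1 1 n).
Qed.

Lemma headtailK n : cancel (@consV n) (fun x : V R n.+1 => (headV x, tailV x)).
Proof.
move=> [t y]; rewrite /headV consV0/=; congr pair.
by apply/rowP => i; rewrite mxE consVS.
Qed.

Lemma measurable_consV n : measurable_fun setT (@consV n).
Proof.
apply: measurable_funV => i; case: (unliftP ord0 i) => [j|] ->.
  rewrite (_ : (fun _ => _) = (fun x : V R n => x ord0 j) \o snd); last first.
    by apply/funext => p; rewrite consVS.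
  by apply: measurableT_comp => //; exact: measurable_coord.
rewrite (_ : (fun _ => _) = fst) //.
by apply/funext => p; rewrite consV0.
Qed.

Lemma measurable_headtail n :
  measurable_fun setT (fun x : V R n.+1 => (headV x, tailV x)).
Proof.
apply/measurable_fun_pairP; split => /=; first exact: measurable_coord.
apply: measurable_funV => i.
rewrite (_ : (fun _ => _) = (fun x : V R n.+1 => x ord0 (lift ord0 i))).
  exact: measurable_coord.
by apply/funext => x /=; rewrite mxE.
Qed.

Section prodm.
Context d1 d2 (T1 : measurableType d1) (T2 : measurableType d2).
Variable m1 : {sigma_finite_measure set T1 -> \bar R}.
Variable m2 : {sigma_finite_measure set T2 -> \bar R}.

(* The library declares the sigma-finiteness of [m1 \x m2] after the canonical
   instance for finite measures, so it is never inferred: hence this alias. *)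
Definition prodm : set (T1 * T2) -> \bar R := (m1 \x m2)%E.

HB.instance Definition _ := Measure.on prodm.

Let prodm_sigma_finite : sigma_finite setT prodm.
Proof.
have /sigma_finiteP[F [FT Fnd Foo]] := sigma_finiteT m1.
have /sigma_finiteP[G [GT Gnd Goo]] := sigma_finiteT m2.
exists (fun k => F k `*` G k).
  apply/seteqP; split=> // -[x y] _.
  have [i _ Fi] : (\bigcup_i F i) x by rewrite -FT.
  have [j _ Gj] : (\bigcup_i G i) y by rewrite -GT.
  exists (maxn i j) => //; split=> /=.
    by move: Fi; apply/subsetPset/Fnd/leq_maxl.
  by move: Gj; apply/subsetPset/Gnd/leq_maxr.
move=> k; have [mF Fk] := Foo k; have [mG Gk] := Goo k.
split; first exact: measurableX.
by rewrite /prodm product_measure1E// lte_mul_pinfty// ge0_fin_numE.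
Qed.

HB.instance Definition _ :=
  Measure_isSigmaFinite.Build _ _ _ prodm prodm_sigma_finite.

End prodm.

Section step.
Variables (n : nat) (m : {sigma_finite_measure set (V R n) -> \bar R}).

Definition stepm : set (V R n.+1) -> \bar R :=
  pushforward (prodm (@lebesgue_measure R) m) (@consV n).

HB.instance Definition _ := Measure.copy stepm
  (measure_function_pushforward__canonical__measure_function_Measure (prodm (@lebesgue_measure R) m) (@measurable_consV n)).

Let sf : sigma_finite setT stepm.
Proof.
have [F FT Foo] := sigma_finiteT (prodm (@lebesgue_measure R) m).
exists (fun k => (fun x : V R n.+1 => (headV x, tailV x)) @^-1` F k).
  apply/seteqP; split=> // x _.
  have : setT (headV x, tailV x) by [].
  by rewrite FT => -[k _ Fk]; exists k.
move=> k; have [mF Fk] := Foo k; split.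
  by rewrite -[X in measurable X]setTI; exact: measurable_headtail.
rewrite /stepm /pushforward -comp_preimage.
by rewrite (_ : _ \o _ = id) //; apply/funext => p /=; rewrite headtailK.
Qed.

HB.instance Definition _ := Measure_isSigmaFinite.Build _ _ _ stepm sf.
End step.

(** The recursion on the first coordinate copies that of [iint], so [iintE] is one use of Tonelli
    per dimension; dimension zero carries a unit point mass. *)
Fixpoint mu n : {sigma_finite_measure set (V R n) -> \bar R} :=
  match n with
  | 0 => dirac ((0 : 'rV[R]_0) : V R 0)
  | n'.+1 => stepm (mu n')
  end.

Lemma iintE n (f : V R n -> \bar R) : measurable_fun setT f ->
  (forall x, (0 <= f x)%E) -> iint f = (\int[mu n]_x f x)%E.
Proof.
elim: n f => [|n IH] f mf f0.
  by rewrite /= integral_dirac// diracT mul1e.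
rewrite [RHS]ge0_integral_pushforward//; last exact: measurable_consV.
have mfc : measurable_fun setT (f \o @consV n).
  by apply: measurableT_comp => //; exact: measurable_consV.
rewrite preimage_setT /prodm fubini_tonelli1//; last by move=> x; exact: f0.
apply: eq_integral => t _; rewrite /fubini_F /= -IH//.
apply: measurableT_comp => //; apply: measurableT_comp (@measurable_consV n) _.
exact: pair1_measurable.
Qed.

(** The translated measure gives half-open intervals their length, hence is Lebesgue measure by
    uniqueness. *)
Lemma lebesgue_shift (a : R) (f : measurableTypeR R -> \bar R) : measurable_fun setT f ->
  (forall x, (0 <= f x)%E) ->
  (\int[lebesgue_measure]_t f (t + a)%R = \int[lebesgue_measure]_t f t)%E.
Proof.
move=> mf f0.
pose sh := fun t : measurableTypeR R => (t + a)%R : measurableTypeR R.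
have ms : measurable_fun setT sh by apply: measurable_funD.
have <- : (\int[pushforward lebesgue_measure sh]_t f t =
   \int[lebesgue_measure]_t f (t + a)%R)%E.
  by rewrite ge0_integral_pushforward.
apply: eq_measure_integral => A mA _.
apply/esym.
apply: (@lebesgue_measure_unique R
  (measure_function_pushforward__canonical__measure_function_Measure lebesgue_measure ms)) => //.
move=> _ [[x y] _ <-] /=; rewrite /pushforward.
have -> : sh @^-1` `]x, y] = `]x - a, y - a]%classic.
  by apply/seteqP; split => t /=; rewrite !in_itv/= ltrBlDr lerBrDr.
rewrite !lebesgue_measure_itv/= !lte_fin ltrD2r; case: ifP => // _.
by rewrite -!EFinB; congr EFin; ring.
Qed.

Lemma measurable_shift n (a : 'rV[R]_n) :
  measurable_fun setT (fun x : V R n => (x + a : 'rV[R]_n) : V R n).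
Proof.
apply: measurable_funV => i.
rewrite (_ : (fun _ => _) = (fun x : V R n => x ord0 i + a ord0 i)).
  by apply: measurable_funD => //; exact: measurable_coord.
by apply/funext => x; rewrite mxE.
Qed.

Lemma ge0_integral_shift n (a : 'rV[R]_n) (f : V R n -> \bar R) :
  measurable_fun setT f -> (forall x, (0 <= f x)%E) ->
  (\int[mu n]_x f (x + a)%R = \int[mu n]_x f x)%E.
Proof.
elim: n a f => [|n IH] a f mf f0.
  by apply: eq_integral => x _; congr f; apply/rowP => -[].
have mfa : measurable_fun setT (fun x : V R n.+1 => f (x + a)).
  exact: measurableT_comp mf (measurable_shift a).
rewrite -!iintE//=.
have E t y : row_mx (const_mx t : 'rV[R]_1) y + a =
    consV (t + headV a, (y + tailV a)).
  apply/rowP => i; case: (unliftP ord0 i) => [j|] ->.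
    by rewrite mxE consVS (consVS (t, y)) !mxE.
  by rewrite mxE consV0 (consV0 (t, y)).
under eq_integral do under eq_fun do rewrite E.
have ms t : measurable_fun setT (fun y : V R n => f (consV (t, y))).
  apply: measurableT_comp => //; apply: measurableT_comp (@measurable_consV n) _.
  exact: pair1_measurable.
transitivity (\int[lebesgue_measure]_t (\int[mu n]_y f (consV ((t + headV a)%R, y))))%E.
  apply: eq_integral => t _; rewrite iintE//.
    exact: (IH (tailV a) (fun y => f (consV (t + headV a, y)))).
  apply: (@measurableT_comp _ _ _ _ _ _ (fun y : V R n => f (consV (t + headV a, y)))) => //.
  exact: measurable_shift.
rewrite (@lebesgue_shift _ (fun t => \int[mu n]_y f (consV (t, y)))%E).
- by apply: eq_integral => t _; rewrite (iintE (ms t)).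
- apply: (@measurable_fun_fubini_tonelli_F _ _ _ _ _ (mu n) (f \o @consV n)) => //.
  by apply: measurableT_comp => //; exact: measurable_consV.
- by move=> [t y]; exact: f0.
- by move=> t; apply: integral_ge0.
Qed.

Lemma integral_shift n (a : 'rV[R]_n) (f : V R n -> \bar R) :
  measurable_fun setT f ->
  (\int[mu n]_x f (x + a)%R = \int[mu n]_x f x)%E.
Proof.
move=> mf; rewrite integralE [RHS]integralE; congr (_ - _)%E.
  rewrite -[RHS](ge0_integral_shift a (measurable_funepos mf))//.
  by apply: eq_integral => x _; rewrite !funeposE.
rewrite -[RHS](ge0_integral_shift a (measurable_funeneg mf))//.
by apply: eq_integral => x _; rewrite !funenegE.
Qed.

End MeasureRn.

(** * Complex-valued integrals *)

Section Complex.
Context {R : realType}.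
Implicit Types z w : R[i].

Lemma cabsE z : cabs z = Normc.normc z.
Proof. by case: z. Qed.

Lemma cabs_ge0 z : 0 <= cabs z.
Proof. exact: sqrtr_ge0. Qed.

Lemma cabsM z w : cabs (z * w) = cabs z * cabs w.
Proof. by rewrite !cabsE Normc.normcM. Qed.

Lemma cabsD z w : cabs (z + w) <= cabs z + cabs w.
Proof. by rewrite !cabsE le_normcD. Qed.

Lemma cabsN z : cabs (- z) = cabs z.
Proof. by rewrite !cabsE normcN. Qed.

Lemma cabsB z w : cabs (z - w) <= cabs z + cabs w.
Proof. by rewrite (le_trans (cabsD _ _))// cabsN. Qed.

Lemma cabsR (x : R) : cabs (x%:C)%C = `|x|.
Proof. by rewrite /cabs/= expr0n/= addr0 sqrtr_sqr. Qed.

Lemma cabs0 : cabs (0 : R[i]) = 0.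
Proof. by rewrite (cabsR 0) normr0. Qed.

Lemma cabs1 : cabs (1 : R[i]) = 1.
Proof. by rewrite (cabsR 1) normr1. Qed.

Lemma cabs_eq0 z : cabs z = 0 -> z = 0.
Proof. by rewrite cabsE; exact: Normc.eq0_normc. Qed.

Lemma cabsX z k : cabs (z ^+ k) = cabs z ^+ k.
Proof. by elim: k => [|k IH]; rewrite ?expr0 ?cabs1// !exprS cabsM IH. Qed.

Lemma cabs_sqr z : cabs z ^+ 2 = complex.Re z ^+ 2 + complex.Im z ^+ 2.
Proof. by rewrite /cabs sqr_sqrtr// addr_ge0// sqr_ge0. Qed.

Lemma normr_Re z : `|complex.Re z| <= cabs z.
Proof. by rewrite -sqrtr_sqr ler_wsqrtr// lerDl sqr_ge0. Qed.

Lemma normr_Im z : `|complex.Im z| <= cabs z.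
Proof. by rewrite -sqrtr_sqr ler_wsqrtr// lerDr sqr_ge0. Qed.

Lemma cabs_le_ReIm z : cabs z <= `|complex.Re z| + `|complex.Im z|.
Proof.
rewrite -ler_sqr ?nnegrE ?addr_ge0 ?cabs_ge0 ?normr_ge0// cabs_sqr sqrrD.
by rewrite !real_normK ?num_real// lerD2r lerDl mulrn_wge0 ?mulr_ge0.
Qed.

Lemma cabs_expi (t : R) : cabs (expi t) = 1.
Proof. by rewrite /cabs/= cos2Dsin2 sqrtr1. Qed.

Lemma expiD (s t : R) : expi (s + t) = expi s * expi t.
Proof. by rewrite /expi cosD sinD; apply/eqP; rewrite eq_complex/= eqxx/= addrC. Qed.

Lemma expi0 : expi (0 : R) = 1.
Proof. by rewrite /expi cos0 sin0. Qed.

Lemma ReM z w : complex.Re (z * w) =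
  complex.Re z * complex.Re w - complex.Im z * complex.Im w.
Proof. by case: z w => [? ?] [? ?]. Qed.

Lemma ImM z w : complex.Im (z * w) =
  complex.Re z * complex.Im w + complex.Im z * complex.Re w.
Proof. by case: z w => [? ?] [? ?]. Qed.

Lemma ReD z w : complex.Re (z + w) = complex.Re z + complex.Re w.
Proof. by case: z w => [? ?] [? ?]. Qed.

Lemma ImD z w : complex.Im (z + w) = complex.Im z + complex.Im w.
Proof. by case: z w => [? ?] [? ?]. Qed.

Lemma complexP z w : complex.Re z = complex.Re w ->
  complex.Im z = complex.Im w -> z = w.
Proof. by case: z w => [? ?] [? ?] /= -> ->. Qed.

Lemma realCM (x y : R) : ((x * y)%:C = x%:C * y%:C)%C.
Proof. by rewrite rmorphM. Qed.

End Complex.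

Section ComplexMeasurable.
Context {R : realType} d (T : measurableType d).
Implicit Types f g : T -> R[i].

Definition cmeas f := measurable_fun setT (fun x => complex.Re (f x)) /\
  measurable_fun setT (fun x => complex.Im (f x)).

Lemma cmeas_cst (z : R[i]) : cmeas (fun _ => z).
Proof. by split; exact: measurable_cst. Qed.

Lemma cmeasD f g : cmeas f -> cmeas g -> cmeas (fun x => f x + g x).
Proof.
move=> [f1 f2] [g1 g2]; split.
  by under eq_fun do rewrite ReD; exact: measurable_funD.
by under eq_fun do rewrite ImD; exact: measurable_funD.
Qed.

Lemma cmeasM f g : cmeas f -> cmeas g -> cmeas (fun x => f x * g x).
Proof.
move=> [f1 f2] [g1 g2]; split.
  by under eq_fun do rewrite ReM; apply: measurable_funB; exact: measurable_funM.
by under eq_fun do rewrite ImM; apply: measurable_funD; exact: measurable_funM.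
Qed.

Lemma cmeasR (u : T -> R) : measurable_fun setT u -> cmeas (fun x => (u x)%:C%C).
Proof. by move=> mu; split => //; exact: measurable_cst. Qed.

Lemma cmeas_expi (u : T -> R) : measurable_fun setT u -> cmeas (fun x => expi (u x)).
Proof.
move=> mu; split => /=; apply: (@measurableT_comp _ _ _ _ _ _ _ _ _ _ mu).
  by apply: continuous_measurable_fun; exact: continuous_cos.
by apply: continuous_measurable_fun; exact: continuous_sin.
Qed.

Lemma cmeas_cabs f : cmeas f -> measurable_fun setT (fun x => cabs (f x)).
Proof.
move=> [f1 f2]; apply: (@measurableT_comp _ _ _ _ _ _ (@Num.sqrt R)).
  by apply: continuous_measurable_fun; exact: sqrt_continuous.
by apply: measurable_funD; exact: measurable_funX.
Qed.

Lemma cmeas_sum (I : Type) (r : seq I) (F : I -> T -> R[i]) :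
  (forall i, cmeas (F i)) -> cmeas (fun x => \sum_(i <- r) F i x).
Proof.
move=> mF; elim: r => [|i r IH].
  by under [X in cmeas X]eq_fun do rewrite big_nil; exact: cmeas_cst.
by under [X in cmeas X]eq_fun do rewrite big_cons; exact: cmeasD.
Qed.

End ComplexMeasurable.

Lemma cmeas_comp (R : realType) d1 d2 (T1 : measurableType d1)
  (T2 : measurableType d2) (f : T2 -> R[i]) (g : T1 -> T2) :
  cmeas f -> measurable_fun setT g -> cmeas (fun x => f (g x)).
Proof.
move=> [f1 f2] mg; split.
  exact: (measurableT_comp f1 mg).
exact: (measurableT_comp f2 mg).
Qed.

Section ComplexIntegral.
Context {R : realType} d (T : measurableType d).
Variable m : {measure set T -> \bar R}.
Implicit Types f g : T -> R[i].

Definition rig (u : T -> R) := m.-integrable setT (EFin \o u).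
Definition cig f := rig (fun x => complex.Re (f x)) /\ rig (fun x => complex.Im (f x)).
Definition cI f : R[i] :=
  Complex (\int[m]_x complex.Re (f x)) (\int[m]_x complex.Im (f x)).

Lemma rig_meas (u : T -> R) : rig u -> measurable_fun setT u.
Proof. by move=> /integrableP[/measurable_EFinP]. Qed.

Lemma rig_le (u v : T -> R) : measurable_fun setT u -> rig v ->
  (forall x, `|u x| <= v x) -> rig u.
Proof.
move=> mu iv uv; apply: (le_integrable measurableT _ _ iv).
  exact/measurable_EFinP.
by move=> x _ /=; rewrite lee_fin (le_trans (uv x))// ler_norm.
Qed.

Lemma rig_norm (u : T -> R) : rig u -> rig (fun x => `|u x|).
Proof.
move=> iu; apply: (le_integrable measurableT _ _ iu).
  exact/measurable_EFinP/measurableT_comp/rig_meas.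
by move=> x _ /=; rewrite normr_id.
Qed.

Lemma rigD (u v : T -> R) : rig u -> rig v -> rig (fun x => u x + v x).
Proof. by move=> iu iv; exact: (integrableD measurableT iu iv). Qed.

Lemma rigZ (k : R) (u : T -> R) : rig u -> rig (fun x => k * u x).
Proof. by move=> iu; exact: (integrableZl measurableT k iu). Qed.

Lemma rigN (u : T -> R) : rig u -> rig (fun x => - u x).
Proof. by move=> iu; have := rigZ (-1) iu; under eq_fun do rewrite mulN1r. Qed.

Lemma rigB (u v : T -> R) : rig u -> rig v -> rig (fun x => u x - v x).
Proof. by move=> iu iv; apply: rigD => //; exact: rigN. Qed.

Lemma cig_meas f : cig f -> cmeas f.
Proof. by move=> [/rig_meas ? /rig_meas ?]. Qed.

Lemma cig_le f (v : T -> R) : cmeas f -> rig v ->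
  (forall x, cabs (f x) <= v x) -> cig f.
Proof.
move=> [f1 f2] iv fv; split; apply: rig_le iv _ => // x.
  exact: le_trans (normr_Re _) _.
exact: le_trans (normr_Im _) _.
Qed.

Lemma cig_cabs f : cig f -> rig (fun x => cabs (f x)).
Proof.
move=> if_; have [f1 f2] := if_.
apply: (@rig_le _ (fun x => `|complex.Re (f x)| + `|complex.Im (f x)|)).
- exact/cmeas_cabs/cig_meas.
- by apply: rigD; [exact: (rig_norm f1)|exact: (rig_norm f2)].
- by move=> x; rewrite ger0_norm ?cabs_ge0// cabs_le_ReIm.
Qed.

Lemma cigD f g : cig f -> cig g -> cig (fun x => f x + g x).
Proof.
move=> [f1 f2] [g1 g2]; split.
  by under eq_fun do rewrite ReD; exact: rigD.
by under eq_fun do rewrite ImD; exact: rigD.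
Qed.

Lemma cigZ (z : R[i]) f : cig f -> cig (fun x => z * f x).
Proof.
move=> [f1 f2]; split.
  by under eq_fun do rewrite ReM; apply: rigB; exact: rigZ.
by under eq_fun do rewrite ImM; apply: rigD; exact: rigZ.
Qed.

Lemma cI_eq f g : f =1 g -> cI f = cI g.
Proof. by move=> fg; congr cI; apply/funext. Qed.

Lemma cID f g : cig f -> cig g -> cI (fun x => f x + g x) = cI f + cI g.
Proof.
move=> [f1 f2] [g1 g2]; apply: complexP => /=.
  by under eq_Rintegral do rewrite ReD; rewrite RintegralD.
by under eq_Rintegral do rewrite ImD; rewrite RintegralD.
Qed.

Lemma cIZ (z : R[i]) f : cig f -> cI (fun x => z * f x) = z * cI f.
Proof.
move=> [f1 f2]; apply: complexP => /=.
  under eq_Rintegral do rewrite ReM.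
  rewrite RintegralB//; [|exact: rigZ|exact: rigZ].
  by rewrite !RintegralZl// ReM.
under eq_Rintegral do rewrite ImM.
rewrite RintegralD//; [|exact: rigZ|exact: rigZ].
by rewrite !RintegralZl// ImM.
Qed.

Lemma cigN f : cig f -> cig (fun x => - f x).
Proof. by move=> if_; under [X in cig X]eq_fun do rewrite -mulN1r; exact: cigZ. Qed.

Lemma cIN f : cig f -> cI (fun x => - f x) = - cI f.
Proof.
by move=> if_; under cI_eq do rewrite -mulN1r; rewrite cIZ// mulN1r.
Qed.

Lemma cI0 : cI (fun _ => 0) = 0.
Proof. by apply: complexP; rewrite /= /Rintegral integral0. Qed.

Lemma cig0 : cig (fun _ => 0).
Proof. by split; exact: integrable0. Qed.

Lemma cig_sum (I : Type) (r : seq I) (F : I -> T -> R[i]) :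
  (forall i, cig (F i)) -> cig (fun x => \sum_(i <- r) F i x).
Proof.
move=> mF; elim: r => [|i r IH].
  by under [X in cig X]eq_fun do rewrite big_nil; exact: cig0.
by under [X in cig X]eq_fun do rewrite big_cons; exact: cigD.
Qed.

Lemma cI_sum (I : Type) (r : seq I) (F : I -> T -> R[i]) :
  (forall i, cig (F i)) ->
  cI (fun x => \sum_(i <- r) F i x) = \sum_(i <- r) cI (F i).
Proof.
move=> mF; elim: r => [|i r IH].
  by under cI_eq do rewrite big_nil; rewrite cI0 big_nil.
under cI_eq do rewrite big_cons.
by rewrite cID// ?IH ?big_cons//; exact: cig_sum.
Qed.

(** Real and imaginary parts are estimated separately, whence the factor 2; only the growth of
    constants in the parameters matters later. *)
Lemma cabs_cI f (v : T -> R) : cmeas f -> rig v ->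
  (forall x, cabs (f x) <= v x) -> cabs (cI f) <= 2 * \int[m]_x v x.
Proof.
move=> mf iv fv; have [f1 f2] := cig_le mf iv fv.
rewrite (le_trans (cabs_le_ReIm _))//= mulr_natl mulr2n lerD//.
  rewrite (le_trans (le_normr_Rintegral measurableT f1))// le_Rintegral//.
    exact: (rig_norm f1).
  by move=> x _; exact: le_trans (normr_Re _) _.
rewrite (le_trans (le_normr_Rintegral measurableT f2))// le_Rintegral//.
  exact: (rig_norm f2).
by move=> x _; exact: le_trans (normr_Im _) _.
Qed.

Lemma cIR (u : T -> R) : cI (fun x => (u x)%:C%C) = (\int[m]_x u x)%:C%C.
Proof. by apply: complexP => //=; rewrite /Rintegral integral0. Qed.

Lemma cigR (u : T -> R) : rig u -> cig (fun x => (u x)%:C%C).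
Proof. by move=> iu; split => //; exact: integrable0. Qed.

Lemma ge0_rig (u : T -> R) : measurable_fun setT u -> (forall x, 0 <= u x) ->
  (\int[m]_x (u x)%:E < +oo)%E -> rig u.
Proof.
move=> mu u0 uoo; apply/integrableP; split; first exact/measurable_EFinP.
by under eq_integral do rewrite /= ger0_norm//.
Qed.

Lemma EFin_Rintegral (u : T -> R) : rig u ->
  ((\int[m]_x u x)%:E = \int[m]_x (u x)%:E)%E.
Proof. by move=> iu; rewrite /Rintegral fineK//; exact: integrable_fin_num. Qed.

End ComplexIntegral.

Section Fubini.
Context {R : realType} d1 d2 (T1 : measurableType d1) (T2 : measurableType d2).
Variable m1 : {sigma_finite_measure set T1 -> \bar R}.
Variable m2 : {sigma_finite_measure set T2 -> \bar R}.

Lemma rig_prod (f : T1 * T2 -> R) (a : T1 -> R) (b : T2 -> R) :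
  measurable_fun setT f -> rig m1 a -> rig m2 b ->
  (forall x y, `|f (x, y)| <= a x * b y) -> rig (prodm m1 m2) f.
Proof.
move=> mf ia ib fab; apply/integrable12ltyP; first exact/measurable_EFinP.
(* [a] and [b] carry no sign, so their absolute values dominate instead. *)
have a'b' x y : `|f (x, y)| <= `|a x| * `|b y|.
  by rewrite (le_trans (fab x y))// -normrM ler_norm.
apply: (@le_lt_trans _ _ (\int[m1]_x (`|a x|%:E * \int[m2]_y `|b y|%:E))%E).
  apply: ge0_le_integral => //.
  - by move=> x _; exact: integral_ge0.
  - apply: (@measurable_fun_fubini_tonelli_F _ _ _ _ _ m2 (fun z => `|(f z)%:E|%E)) => //.
    exact/measurableT_comp/measurable_EFinP.
  - apply: emeasurable_funM => //; apply/measurable_EFinP/measurableT_comp => //.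
    exact: rig_meas ia.
  move=> x _; rewrite -ge0_integralZl//; last first.
    exact/measurable_EFinP/measurableT_comp/(rig_meas ib).
  apply: ge0_le_integral => //.
  - apply/measurableT_comp => //; apply/measurable_EFinP.
    exact: measurableT_comp mf (pair1_measurable x).
  - apply: emeasurable_funM => //.
    exact/measurable_EFinP/measurableT_comp/(rig_meas ib).
  - by move=> y _; rewrite /= -EFinM lee_fin.
rewrite ge0_integralZr//; last 2 first.
- exact/measurable_EFinP/measurableT_comp/(rig_meas ia).
- exact: integral_ge0.
have [_ ioo] := integrableP _ _ _ (rig_norm ia).
have [_ joo] := integrableP _ _ _ (rig_norm ib).
rewrite lte_mul_pinfty//; first exact: integral_ge0.
  rewrite ge0_fin_numE//; last exact: integral_ge0.
  by move: ioo; under eq_integral do rewrite /= normr_id.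
by move: joo; under eq_integral do rewrite /= normr_id.
Qed.

Lemma cig_prod (f : T1 * T2 -> R[i]) (a : T1 -> R) (b : T2 -> R) :
  cmeas f -> rig m1 a -> rig m2 b ->
  (forall x y, cabs (f (x, y)) <= a x * b y) -> cig (prodm m1 m2) f.
Proof.
move=> [f1 f2] ia ib fab; split; apply: rig_prod ia ib _ => // x y.
  exact: le_trans (normr_Re _) _.
exact: le_trans (normr_Im _) _.
Qed.

Lemma RFubini (f : T1 * T2 -> R) : rig (prodm m1 m2) f ->
  (forall x, rig m2 (fun y => f (x, y))) ->
  rig m1 (fun x => \int[m2]_y f (x, y)) /\
  \int[m1]_x \int[m2]_y f (x, y) = \int[prodm m1 m2]_z f z.
Proof.
move=> if_ f1.
have E : (EFin \o (fun x => \int[m2]_y f (x, y))) = fubini_F m2 (EFin \o f).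
  by apply/funext => x /=; rewrite EFin_Rintegral.
split; first by rewrite /rig E; exact: integrable_fubini_F.
rewrite /Rintegral -[in RHS](integral12_prod_meas1 if_); congr fine.
by apply: eq_integral => x _; rewrite -(f_equal (@^~ x) E).
Qed.

Lemma cFubini1 (f : T1 * T2 -> R[i]) : cig (prodm m1 m2) f ->
  (forall x, cig m2 (fun y => f (x, y))) ->
  cig m1 (fun x => cI m2 (fun y => f (x, y))) /\
  cI m1 (fun x => cI m2 (fun y => f (x, y))) = cI (prodm m1 m2) f.
Proof.
move=> [f1 f2] f3.
have [i1 e1] := RFubini f1 (fun x => (f3 x).1).
have [i2 e2] := RFubini f2 (fun x => (f3 x).2).
by split=> //; apply: complexP.
Qed.

End Fubini.

Section FubiniSwap.
Context {R : realType} d1 d2 (T1 : measurableType d1) (T2 : measurableType d2).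
Variable m1 : {sigma_finite_measure set T1 -> \bar R}.
Variable m2 : {sigma_finite_measure set T2 -> \bar R}.

Lemma RFubini2 (f : T1 * T2 -> R) : rig (prodm m1 m2) f ->
  (forall y, rig m1 (fun x => f (x, y))) ->
  rig m2 (fun y => \int[m1]_x f (x, y)) /\
  \int[m2]_y \int[m1]_x f (x, y) = \int[prodm m1 m2]_z f z.
Proof.
move=> if_ f1.
have E : (EFin \o (fun y => \int[m1]_x f (x, y))) = fubini_G m1 (EFin \o f).
  by apply/funext => x /=; rewrite EFin_Rintegral.
split.
  rewrite /rig E; apply/integrableP; split; first exact: (measurable_fubini_G if_).
  apply: le_lt_trans ((integrable21ltyP m1 m2 (measurable_int _ if_)).1 if_).
  apply: ge0_le_integral => //.
  - by apply: measurableT_comp => //; exact: (measurable_fubini_G if_).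
  - apply: (@measurable_fun_fubini_tonelli_G _ _ _ _ _ m1 (fun z => `|(f z)%:E|%E)) => //.
    exact: measurableT_comp (measurable_int _ if_).
  - move=> y _; apply: le_abse_integral => //.
    exact: measurableT_comp (measurable_int _ if_) (pair2_measurable y).
rewrite /Rintegral -[in RHS](integral21_prod_meas1 if_); congr fine.
by apply: eq_integral => x _; rewrite -(f_equal (@^~ x) E).
Qed.

Lemma cFubini2 (f : T1 * T2 -> R[i]) : cig (prodm m1 m2) f ->
  (forall y, cig m1 (fun x => f (x, y))) ->
  cig m2 (fun y => cI m1 (fun x => f (x, y))) /\
  cI m2 (fun y => cI m1 (fun x => f (x, y))) = cI (prodm m1 m2) f.
Proof.
move=> [f1 f2] f3.
have [i1 e1] := RFubini2 f1 (fun x => (f3 x).1).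
have [i2 e2] := RFubini2 f2 (fun x => (f3 x).2).
by split=> //; apply: complexP.
Qed.

Lemma cFubini (f : T1 * T2 -> R[i]) : cig (prodm m1 m2) f ->
  (forall x, cig m2 (fun y => f (x, y))) ->
  (forall y, cig m1 (fun x => f (x, y))) ->
  cI m1 (fun x => cI m2 (fun y => f (x, y))) =
  cI m2 (fun y => cI m1 (fun x => f (x, y))).
Proof. by move=> cf f1 f2; rewrite (cFubini1 cf f1).2 (cFubini2 cf f2).2. Qed.

End FubiniSwap.

Section Rn.
Context {R : realType} (n : nat).
Implicit Types f g : V R n -> R[i].

Lemma borel_measP f : borel_meas f <-> cmeas f.
Proof.
split=> -[f1 f2]; split.
- by move=> _ B mB; rewrite setTI; exact: f1.
- by move=> _ B mB; rewrite setTI; exact: f2.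
- by move=> B mB; have := f1 measurableT B mB; rewrite setTI.
- by move=> B mB; have := f2 measurableT B mB; rewrite setTI.
Qed.

Lemma rintE (g : V R n -> R) : rig (mu n) g -> rint g = \int[mu n]_x g x.
Proof.
move=> ig; have mg := rig_meas ig.
rewrite /rint [in RHS]/Rintegral integralE fineB; last 2 first.
- exact: integrable_pos_fin_num.
- exact: integrable_neg_fin_num.
congr (fine _ - fine _).
  rewrite iintE//.
  - by apply: eq_integral => x _; rewrite funeposE/= EFin_max.
  - by apply/measurable_EFinP; apply: measurable_maxr.
  - by move=> x; rewrite lee_fin le_max lexx orbT.
rewrite iintE//.
- by apply: eq_integral => x _; rewrite funenegE/= EFin_max.
- by apply/measurable_EFinP; apply: measurable_maxr => //; exact: measurableT_comp.
- by move=> x; rewrite lee_fin le_max lexx orbT.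
Qed.

Lemma cintE f : cig (mu n) f -> cint f = cI (mu n) f.
Proof. by move=> [f1 f2]; rewrite /cint (rintE f1) (rintE f2). Qed.

Lemma rig_shift (u : V R n -> R) (a : 'rV[R]_n) : rig (mu n) u ->
  rig (mu n) (fun x => u (x + a)).
Proof.
move=> iu; have mu_ := rig_meas iu; apply/integrableP; split.
  apply/measurable_EFinP; exact: (measurableT_comp mu_ (measurable_shift a)).
have [_] := integrableP _ _ _ iu.
rewrite -(@ge0_integral_shift _ _ a (fun x => `|(EFin \o u) x|%E))//.
exact/measurableT_comp/measurable_EFinP.
Qed.

Lemma cig_shift f (a : 'rV[R]_n) : cig (mu n) f -> cig (mu n) (fun x => f (x + a)).
Proof. by move=> [f1 f2]; split; [exact: (rig_shift a f1)|exact: (rig_shift a f2)]. Qed.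

Lemma Rint_shift (u : V R n -> R) (a : 'rV[R]_n) : measurable_fun setT u ->
  \int[mu n]_x u (x + a) = \int[mu n]_x u x.
Proof.
move=> mu_; congr fine; apply: (@integral_shift _ _ a (EFin \o u)).
exact/measurable_EFinP.
Qed.

Lemma cI_shift f (a : 'rV[R]_n) : cmeas f ->
  cI (mu n) (fun x => f (x + a)) = cI (mu n) f.
Proof.
by move=> [f1 f2]; apply: complexP; [exact: (Rint_shift a f1)|exact: (Rint_shift a f2)].
Qed.

(** An open set is the union of the countably many boxes with rational corners that it contains.
    Continuous functions, in particular Schwartz functions, thereby become measurable for the
    sigma-algebra of the statement. *)
Lemma open_measurableV (U : set 'rV[R]_n) : open U ->
  measurable (U : set (V R n)).
Proof.
move=> oU.
pose box (q : {ffun 'I_n -> rat * rat}) : set 'rV[R]_n :=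
  [set x | forall i, ratr (q i).1 < x ord0 i <= ratr (q i).2].
have -> : U = \bigcup_(q in [set q | box q `<=` U]) box q.
  apply/seteqP; split=> x; last by move=> [q /= qU]; exact: qU.
  move=> Ux.
  have [e /= e0 eU] := (nbhs_ballP x U).1 (open_nbhs_nbhs (conj oU Ux)).
  have Q i : exists q : rat * rat, x ord0 i - e < ratr q.1 < x ord0 i /\
      x ord0 i < ratr q.2 < x ord0 i + e.
    have [q1 /itvP q1P] := @rat_in_itvoo R (x ord0 i - e) (x ord0 i) ltac:(by rewrite ltrBlDr ltrDl).
    have [q2 /itvP q2P] := @rat_in_itvoo R (x ord0 i) (x ord0 i + e) ltac:(by rewrite ltrDl).
    by exists (q1, q2); rewrite !q1P !q2P.
  have [q qP] := choice Q.
  exists [ffun i => q i] => [y /= yq|i]; last first.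
    by rewrite ffunE; have [/andP[_ ->] /andP[/ltW ->]] := qP i.
  apply: eU; split=> // i j; rewrite (ord1 i); have := yq j; rewrite ffunE.
  have [/andP[q1 q2] /andP[q3 q4]] := qP j => /andP[y1 y2].
  rewrite /ball/= ltr_distl; apply/andP; split; lra.
rewrite bigcup_mkcond; apply: countable_bigcupT_measurable => // q.
case: ifP => // _; apply: sub_sigma_algebra.
exists (\row_i ratr (q i).1), (\row_i ratr (q i).2).
by apply/seteqP; split=> x /= + j => /(_ j); rewrite !mxE.
Qed.

Lemma continuous_measurableV (g : 'rV[R]_n -> R) : continuous g ->
  measurable_fun setT (g : V R n -> R).
Proof.
move=> cg; apply: (measurability _ (@RGenOpens.measurableE R)) => _ [_ [x [y ->]] <-].
by rewrite setTI; apply: open_measurableV; apply: open_comp.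
Qed.

End Rn.

(** * Gaussian integrals *)

Section Cexp.
Context {R : realType}.
Implicit Types z w : R[i].

Definition cexp z : R[i] := (expR (complex.Re z))%:C%C * expi (complex.Im z).

Lemma cexpD z w : cexp (z + w) = cexp z * cexp w.
Proof. by rewrite /cexp ReD ImD expRD expiD realCM; ring. Qed.

Lemma cexp0 : cexp 0 = 1.
Proof. by rewrite /cexp/= expR0 expi0 mulr1. Qed.

Lemma cabs_cexp z : cabs (cexp z) = expR (complex.Re z).
Proof. by rewrite /cexp cabsM cabs_expi mulr1 cabsR ger0_norm ?expR_ge0. Qed.

Lemma cexpR (x : R) : cexp (x%:C)%C = (expR x)%:C%C.
Proof. by rewrite /cexp/= expi0 mulr1. Qed.

Lemma cmeas_cexp d (T : measurableType d) (f : T -> R[i]) :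
  cmeas f -> cmeas (fun x => cexp (f x)).
Proof.
move=> [f1 f2]; apply: cmeasM; last exact: cmeas_expi.
by apply: cmeasR; exact: measurableT_comp.
Qed.

Lemma expR_sub1_le (x : R) : expR x - 1 <= x * expR x.
Proof.
have := expR_ge1Dx (- x); rewrite -(ler_pM2r (expR_gt0 x)).
by rewrite -expRD addNr expR0; lra.
Qed.

Lemma normr_expR_sub1 (x : R) : `|expR x - 1| <= `|x| * expR `|x|.
Proof.
have h1 := expR_sub1_le x; have h2 := expR_ge1Dx x.
have [x0|x0] := leP 0 x.
  by rewrite !ger0_norm// subr_ge0; lra.
have e1 : expR x < 1 by rewrite expR_lt1.
have e2 : 1 <= expR (- x) by rewrite -expR0 ler_expR oppr_ge0 ltW.
rewrite ltr0_norm ?subr_lt0// (ltr0_norm x0); nra.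
Qed.

Lemma normr_expR_sub1D (x : R) : `|expR x - 1 - x| <= x ^+ 2 * expR `|x|.
Proof.
have h2 := expR_ge1Dx x; rewrite ger0_norm; last by lra.
have h1 := expR_sub1_le x.
apply: (@le_trans _ _ (`|x| * `|expR x - 1|)).
  by rewrite -normrM (le_trans _ (ler_norm _))//; lra.
rewrite (le_trans (ler_wpM2l (normr_ge0 x) (normr_expR_sub1 x)))//.
by rewrite mulrA -normrM -expr2 ger0_norm ?sqr_ge0.
Qed.

Lemma sin_lip (y : R) : `|sin y| <= `|y|.
Proof.
have pos (x : R) : 0 < x -> `|sin x| <= x.
  move=> x0; have [c _] := @MVT_segment R sin cos 0 x (ltW x0)
    (fun t _ => is_derive_sin t) (continuous_subspaceT (@continuous_sin R)).
  rewrite sin0 !subr0 => ->; rewrite normrM (gtr0_norm x0) ger_pMl//.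
  exact: cos_max.
have [y0|y0|->] := ltgtP y 0; last by rewrite sin0 !normr0.
  by rewrite -normrN -sinN (ltr0_norm y0) pos ?oppr_gt0.
by rewrite (gtr0_norm y0) pos.
Qed.

Lemma cos_sub1_le (y : R) : `|cos y - 1| <= y ^+ 2.
Proof.
have -> : cos y - 1 = - (sin (y / 2) ^+ 2 *+ 2).
  have -> : cos y = cos (y / 2 + y / 2) by congr cos; lra.
  rewrite cosD -!expr2; have := cos2Dsin2 (y / 2); lra.
have := sin_lip (y / 2); rewrite -ler_sqr ?nnegrE// !real_normK ?num_real// => h.
rewrite normrN ger0_norm ?mulrn_wge0 ?sqr_ge0//.
have := sqr_ge0 y; have : (y / 2) ^+ 2 = y ^+ 2 / 4 by field.
lra.
Qed.

Lemma sin_subx_le (y : R) : `|sin y - y| <= 2 * y ^+ 2.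
Proof.
have pos (x : R) : 0 < x -> `|sin x - x| <= 2 * x ^+ 2.
  move=> x0; have [c] := @MVT_segment R (sin \- id) (cos \- cst 1) 0 x (ltW x0)
    (fun t _ => is_deriveB (is_derive_sin t) (is_derive_id t 1))
    (continuous_subspaceT (fun t => continuousB (@continuous_sin R t) cvg_id)).
  rewrite /= in_itv/= => /andP[c0 cx]; rewrite sin0 !subr0 => ->.
  rewrite normrM (gtr0_norm x0); have c1 := cos_sub1_le c.
  have [x1|x1] := leP x 1.
    have : `|cos c - 1| <= x by nra.
    nra.
  have : `|cos c - 1| <= 2.
    rewrite ler_norml; have := cos_max c; rewrite ler_norml => /andP[? ?].
    by apply/andP; split; lra.
  nra.
have [y0|y0|->] := ltgtP y 0; last by rewrite sin0 subrr normr0 expr0n/= mulr0.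
  have := pos (- y); rewrite oppr_gt0 sinN -opprD normrN sqrrN; exact.
exact: pos.
Qed.

(** With r = |w|, the elementary remainders of [expR], [cos] and [sin] contribute at most 1, 1, 1
    and 2 times r^2 e^r; the constant 8 leaves room. *)
Lemma cabs_cexp_sub1D w :
  cabs (cexp w - 1 - w) <= 8 * cabs w ^+ 2 * expR (cabs w).
Proof.
set x := complex.Re w; set y := complex.Im w.
have -> : cexp w - 1 - w = Complex
    ((expR x - 1 - x) + expR x * (cos y - 1)) ((expR x - 1) * sin y + (sin y - y)).
  by rewrite /x /y; case: (w) => a b; apply: complexP => /=; ring.
rewrite (le_trans (cabs_le_ReIm _))//=.
have hx : `|x| <= cabs w := normr_Re w.
have hy : `|y| <= cabs w := normr_Im w.
set r := cabs w in hx hy *.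
have r0 : 0 <= r := cabs_ge0 w.
have ex : expR `|x| <= expR r by rewrite ler_expR.
have ex2 : expR x <= expR r by rewrite ler_expR (le_trans (ler_norm x)).
have er : 1 <= expR r by rewrite -expR0 ler_expR.
have x2 : x ^+ 2 <= r ^+ 2 by rewrite -real_normK ?num_real// lerXn2r ?nnegrE.
have y2 : y ^+ 2 <= r ^+ 2 by rewrite -real_normK ?num_real// lerXn2r ?nnegrE.
have r2 : 0 <= r ^+ 2 := sqr_ge0 r.
have t1 : `|expR x - 1 - x| <= r ^+ 2 * expR r.
  by rewrite (le_trans (normr_expR_sub1D x))// ler_pM ?sqr_ge0 ?expR_ge0.
have t2 : `|expR x * (cos y - 1)| <= r ^+ 2 * expR r.
  rewrite normrM ger0_norm ?expR_ge0// mulrC ler_pM ?expR_ge0//.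
  by rewrite (le_trans (cos_sub1_le y)).
have t3 : `|(expR x - 1) * sin y| <= r ^+ 2 * expR r.
  rewrite normrM (le_trans (ler_pM _ _ (normr_expR_sub1 x) (sin_lip y)))//.
  have -> : `|x| * expR `|x| * `|y| = `|x| * `|y| * expR `|x| by ring.
  by rewrite expr2 !ler_pM ?mulr_ge0 ?expR_ge0.
have t4 : `|sin y - y| <= 2 * (r ^+ 2 * expR r).
  by rewrite (le_trans (sin_subx_le y))// ler_pM2l// (le_trans y2)// ler_peMr.
have := ler_normD (expR x - 1 - x) (expR x * (cos y - 1)).
have := ler_normD ((expR x - 1) * sin y) (sin y - y).
have : 0 <= r ^+ 2 * expR r by rewrite mulr_ge0 ?expR_ge0.
rewrite -mulrA; lra.
Qed.

End Cexp.

(** * Derivatives with an explicit quadratic remainder *)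

Section QuantDeriv.
Context {R : realType}.

(* A differentiability notion whose remainder is explicit, so that it can be
   integrated against a dominating function. *)
Definition qD (f : R -> R[i]) (x : R) (f' : R[i]) := exists C : R,
  forall h : R, `|h| <= 1 -> cabs (f (x + h) - f x - h%:C%C * f') <= C * h ^+ 2.

Lemma qD_lip (f : R -> R[i]) (x : R) (f' : R[i]) : qD f x f' ->
  exists C : R, forall h : R, `|h| <= 1 -> cabs (f (x + h) - f x) <= C * `|h|.
Proof.
move=> [C Cf]; exists (`|C| + cabs f') => h h1.
have -> : f (x + h) - f x = (f (x + h) - f x - h%:C%C * f') + h%:C%C * f' by ring.
rewrite (le_trans (cabsD _ _))// cabsM cabsR mulrDl lerD//; last by rewrite mulrC.
rewrite (le_trans (Cf h h1))// -real_normK ?num_real//.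
have := ler_norm C; have := normr_ge0 h; have := normr_ge0 C.
move: h1; set a := `|h|; set c := `|C|; move=> a1 c0 a0 Cc.
have : C * a ^+ 2 <= c * a ^+ 2 by rewrite ler_wpM2r ?sqr_ge0.
have : c * a ^+ 2 <= c * a by rewrite ler_wpM2l// expr2 ler_piMl.
lra.
Qed.

Lemma qDM (f g : R -> R[i]) (x : R) (f' g' : R[i]) :
  qD f x f' -> qD g x g' -> qD (fun t => f t * g t) x (f' * g x + f x * g').
Proof.
move=> Df Dg; have [C1 L1] := qD_lip Df; have [C2 L2] := qD_lip Dg.
have [A1 T1] := Df; have [A2 T2] := Dg.
exists (A1 * cabs (g x) + cabs (f x) * A2 + C1 * C2) => h h1.
have -> : f (x + h) * g (x + h) - f x * g x - h%:C%C * (f' * g x + f x * g') =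
  (f (x + h) - f x - h%:C%C * f') * g x + f x * (g (x + h) - g x - h%:C%C * g')
  + (f (x + h) - f x) * (g (x + h) - g x) by ring.
rewrite (le_trans (cabsD _ _))// [leRHS]mulrDl lerD//.
  rewrite (le_trans (cabsD _ _))// !cabsM [leRHS]mulrDl lerD//.
    by rewrite mulrAC ler_wpM2r ?cabs_ge0 ?T1.
  by rewrite -mulrA ler_wpM2l ?cabs_ge0 ?T2.
rewrite cabsM (le_trans (ler_pM (cabs_ge0 _) (cabs_ge0 _) (L1 h h1) (L2 h h1)))//.
by rewrite mulrACA -expr2 real_normK ?num_real.
Qed.

(** The exponent is allowed a term in h^2, so that one estimate covers both a change of frequency
    and a translation of a Gaussian. The bound involves only |cexp e|, |f'| and |q|, hence can be
    integrated over a parameter. *)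
Lemma cexp_taylor (e f' q : R[i]) (h : R) : `|h| <= 1 ->
  cabs (cexp (e + h%:C%C * f' + (h ^+ 2)%:C%C * q) - cexp e - h%:C%C * (f' * cexp e)) <=
  cabs (cexp e) * (8 * (cabs f' + cabs q) ^+ 2 * expR (cabs f' + cabs q) + cabs q) * h ^+ 2.
Proof.
set B := cabs f' + cabs q => h1.
have B0 : 0 <= B by rewrite addr_ge0 ?cabs_ge0.
pose w : R[i] := h%:C%C * f' + (h ^+ 2)%:C%C * q.
have -> : cexp (e + h%:C%C * f' + (h ^+ 2)%:C%C * q) - cexp e - h%:C%C * (f' * cexp e) =
    cexp e * ((cexp w - 1 - w) + (h ^+ 2)%:C%C * q).
  have -> : e + h%:C%C * f' + (h ^+ 2)%:C%C * q = e + w by rewrite addrA.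
  rewrite cexpD.
  by move: (cexp w) (cexp e) => E1 E2; rewrite /w; ring.
rewrite cabsM -mulrA ler_wpM2l ?cabs_ge0// (le_trans (cabsD _ _))// mulrDl lerD//; last first.
  by rewrite cabsM cabsR ger0_norm ?sqr_ge0// mulrC.
have wB : cabs w <= `|h| * B.
  rewrite (le_trans (cabsD _ _))// !cabsM !cabsR mulrDr lerD// ler_wpM2r ?cabs_ge0//.
  by rewrite normrX expr2 ler_piMl.
have wB1 : cabs w <= B by rewrite (le_trans wB)// ler_piMl.
rewrite (le_trans (cabs_cexp_sub1D w))//.
have -> : 8 * B ^+ 2 * expR B * h ^+ 2 = 8 * (`|h| * B) ^+ 2 * expR B.
  by rewrite exprMn real_normK ?num_real//; ring.
rewrite ler_pM ?mulr_ge0 ?sqr_ge0 ?expR_ge0 ?ler_expR ?cabs_ge0//.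
by rewrite ler_wpM2l// lerXn2r ?nnegrE ?cabs_ge0// mulr_ge0.
Qed.

Lemma qD_cexp (f : R -> R[i]) (x : R) (f' q : R[i]) :
  (forall h, f (x + h) = f x + h%:C%C * f' + (h ^+ 2)%:C%C * q) ->
  qD (fun t => cexp (f t)) x (f' * cexp (f x)).
Proof. by move=> fE; eexists => h h1; rewrite fE; exact: cexp_taylor. Qed.

Lemma qD_is_derive (f : R -> R) (x C : R) :
  (forall h, `|h| <= 1 -> `|f (x + h) - f x| <= C * h ^+ 2) -> is_derive x 1 f 0.
Proof.
move=> fC.
suff H : (fun h : R => h^-1 *: (f (h *: (1:R) + x) - f x)) @ 0^' --> (0 : R).
  apply: DeriveDef; first by apply/cvg_ex; exists 0.
  exact: (cvg_lim _ H).
apply/cvgrPdist_le => e e0; near=> h.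
rewrite sub0r normrN normrM.
have h1 : `|h| <= 1 by near: h; apply: dnbhs0_le.
have hn0 : h != 0 by near: h; exact: nbhs_dnbhs_neq.
have := fC h h1; rewrite -[h *: 1]/(h * 1) mulr1 [h + x]addrC => fh.
rewrite (le_trans (ler_wpM2l (normr_ge0 _) fh))// normfV.
rewrite -[h ^+ 2]real_normK ?num_real//.
have -> : `|h|^-1 * (C * `|h| ^+ 2) = C * `|h| by field; rewrite normr_eq0.
have : `|h| <= e / (`|C| + 1) by near: h; apply: dnbhs0_le; rewrite divr_gt0// ltr_wpDl.
rewrite ler_pdivlMr ?ltr_wpDl// => h2.
rewrite (le_trans _ h2)// mulrC ler_wpM2l// (le_trans (ler_norm C))// lerDl//.
Unshelve. all: by end_near. Qed.

Lemma qD0_cst (f : R -> R[i]) : (forall x, qD f x 0) -> forall x y, f x = f y.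
Proof.
move=> f0 x y; apply: complexP.
  apply: (@is_derive_0_is_cst _ (fun t => complex.Re (f t))) => t.
  have [C Cf] := f0 t; apply: (@qD_is_derive _ _ C) => h /Cf.
  rewrite mulr0 subr0; apply: le_trans; apply: le_trans (normr_Re _).
  by rewrite ReD -/(complex.Re _); case: (f t).
apply: (@is_derive_0_is_cst _ (fun t => complex.Im (f t))) => t.
have [C Cf] := f0 t; apply: (@qD_is_derive _ _ C) => h /Cf.
rewrite mulr0 subr0; apply: le_trans; apply: le_trans (normr_Im _).
by rewrite ImD; case: (f t).
Qed.

End QuantDeriv.

Section IntTaylor.
Context {R : realType} d (T : measurableType d).
Variable m : {measure set T -> \bar R}.

Lemma cI_taylor (fh f0 f1 : T -> R[i]) (D : T -> R) (h : R) :
  cig m fh -> cig m f0 -> cig m f1 -> rig m D ->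
  (forall t, cabs (fh t - f0 t - h%:C%C * f1 t) <= D t * h ^+ 2) ->
  cabs (cI m fh - cI m f0 - h%:C%C * cI m f1) <= 2 * (\int[m]_t D t) * h ^+ 2.
Proof.
move=> ih i0 i1 iD fD.
have -> : cI m fh - cI m f0 - h%:C%C * cI m f1 =
    cI m (fun t => fh t - f0 t - h%:C%C * f1 t).
  rewrite -cIZ// -!cIN//; last exact: cigZ.
  rewrite -!cID//; [exact: cigD (cigN i0)|exact/cigN/cigZ|exact: cigN].
have mm : cmeas (fun t => fh t - f0 t - h%:C%C * f1 t).
  apply: (@cig_meas _ _ _ m); apply: cigD; last exact/cigN/cigZ.
  by apply: cigD => //; exact: cigN.
have iDh : rig m (fun t => D t * h ^+ 2).
  by have := rigZ (h ^+ 2) iD; under eq_fun do rewrite mulrC.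
by rewrite (le_trans (cabs_cI mm iDh fD))// RintegralZr// mulrA.
Qed.

Lemma cI_conj (f : T -> R[i]) : cig m f -> cI m (fun x => (f x)^*%C) = (cI m f)^*%C.
Proof.
move=> [f1 f2]; apply: complexP => /=.
  by apply: eq_Rintegral => x _; case: (f x).
rewrite -mulN1r -RintegralZl//; apply: eq_Rintegral => x _.
by case: (f x) => ? ? /=; rewrite mulN1r.
Qed.

End IntTaylor.

(** * Fourier transform of a chirped Gaussian on the line *)

Section Gauss1.
Context {R : realType}.
Notation leb := (@lebesgue_measure R).

Lemma integral_lshift (a : R) (f : measurableTypeR R -> \bar R) :
  measurable_fun setT f ->
  (\int[leb]_t f (t + a)%R = \int[leb]_t f t)%E.
Proof.
move=> mf; rewrite integralE [RHS]integralE; congr (_ - _)%E.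
  rewrite -[RHS](lebesgue_shift a (measurable_funepos mf))//.
  by apply: eq_integral => x _; rewrite !funeposE.
rewrite -[RHS](lebesgue_shift a (measurable_funeneg mf))//.
by apply: eq_integral => x _; rewrite !funenegE.
Qed.

Lemma Rint_lshift (u : R -> R) (a : R) : measurable_fun (setT : set (measurableTypeR R)) u ->
  \int[leb]_x u (x + a) = \int[leb]_x u x.
Proof.
move=> mu_; congr fine; apply: (@integral_lshift a (EFin \o u)).
exact/measurable_EFinP.
Qed.

Lemma cI_lshift (f : R -> R[i]) (a : R) : cmeas (f : measurableTypeR R -> R[i]) ->
  cI leb (fun x => f (x + a)) = cI leb f.
Proof.
by move=> [f1 f2]; apply: complexP; [exact: (Rint_lshift a f1)|exact: (Rint_lshift a f2)].
Qed.

Lemma cig_lshift (f : R -> R[i]) (a : R) : cig leb f -> cig leb (fun x => f (x + a)).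
Proof.
have H (u : R -> R) : rig leb u -> rig leb (fun x => u (x + a)).
  move=> iu; have mu_ := rig_meas iu.
  have ms : measurable_fun (setT : set (measurableTypeR R)) (fun t : R => t + a).
    exact: measurable_funD.
  apply/integrableP; split.
    by apply/measurable_EFinP; exact: (measurableT_comp mu_ ms).
  have [_] := integrableP _ _ _ iu.
  rewrite -(@lebesgue_shift _ a (fun x => `|(EFin \o u) x|%E))//.
  exact/measurableT_comp/measurable_EFinP.
by move=> [f1 f2]; split; [exact: H f1|exact: H f2].
Qed.

(** Plays the role of uniqueness of derivatives: divide by h and let h tend to 0. *)
Lemma small_quadratic_eq0 (z : R[i]) (C : R) :
  (forall h, `|h| <= 1 -> cabs (h%:C%C * z) <= C * h ^+ 2) -> z = 0.
Proof.
move=> H; apply: cabs_eq0; apply/eqP; rewrite eq_le cabs_ge0 andbT leNgt.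
(* So small that C h is less than |z|, which contradicts the hypothesis at this [h]. *)
apply/negP => z0; pose h := Num.min 1 (cabs z / (2 * (`|C| + 1))).
have C0 : 0 < 2 * (`|C| + 1) by rewrite mulr_gt0// ltr_wpDl.
have h0 : 0 < h by rewrite lt_min ltr01 divr_gt0.
have h1 : h <= 1 by rewrite ge_min lexx.
have h2 : h * (2 * (`|C| + 1)) <= cabs z by rewrite -ler_pdivlMr// ge_min lexx orbT.
have := H h; rewrite cabsM cabsR gtr0_norm// => /(_ h1).
rewrite expr2 mulrCA ler_pM2l//; have := ler_norm C; have := normr_ge0 C; nra.
Qed.

Lemma gauss_int (c : R) : 0 < c ->
  rig leb (fun t => expR (- (c * t ^+ 2))) /\
  \int[leb]_t expR (- (c * t ^+ 2)) = Num.sqrt (pi / c).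
Proof.
(* The standard deviation for which exp(-c t^2) is the unnormalised normal density, 1/(2 s^2) =
   c. *)
move=> c0; pose s := (Num.sqrt (2 * c))^-1.
have s0 : 0 < s by rewrite invr_gt0 sqrtr_gt0 mulr_gt0.
have s2 : s ^+ 2 = (2 * c)^-1 by rewrite exprVn sqr_sqrtr// mulr_ge0// ltW.
have E t : normal_pdf 0 s t = (Num.sqrt (pi / c))^-1 * expR (- (c * t ^+ 2)).
  rewrite /normal_pdf gt_eqF// /normal_peak /normal_fun subr0 s2.
  congr (_ * _); first by congr (_ (Num.sqrt _)); field; rewrite gt_eqF.
  by congr expR; field; rewrite gt_eqF.
have r0 : 0 < Num.sqrt (pi / c) by rewrite sqrtr_gt0 divr_gt0// pi_gt0.
have mE : measurable_fun (setT : set (measurableTypeR R)) (fun t => expR (- (c * t ^+ 2))).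
  apply: measurableT_comp => //; apply: measurableT_comp => //.
  by apply: measurable_funM => //; exact: measurable_funX.
have I : (\int[leb]_t (expR (- (c * t ^+ 2)))%:E = (Num.sqrt (pi / c))%:E)%E.
  have := integral_normal_pdf 0 s; under eq_integral do rewrite E EFinM.
  rewrite ge0_integralZl ?lee_fin ?invr_ge0 ?(ltW r0)//; last exact/measurable_EFinP.
  move=> /(congr1 (fun x => (Num.sqrt (pi / c))%:E * x)%E).
  by rewrite muleA -EFinM divff ?gt_eqF// mul1e mule1.
split; last by rewrite /Rintegral I.
by apply: ge0_rig => [//|t|]; [exact: expR_ge0|rewrite I ltry].
Qed.

Lemma gauss_exp_dom (c k t : R) : 0 < c ->
  expR (k * `|t|) * expR (- (c * t ^+ 2)) <=
  expR (k ^+ 2 / (2 * c)) * expR (- (c / 2 * t ^+ 2)).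
Proof.
move=> c0; rewrite -!expRD ler_expR -real_normK ?num_real//; set r := `|t|.
have : 0 <= (k / c - r) ^+ 2 * (c / 2) by rewrite mulr_ge0 ?sqr_ge0 ?divr_ge0 ?ltW.
have -> : (k / c - r) ^+ 2 * (c / 2) = k ^+ 2 / (2 * c) - k * r + c / 2 * r ^+ 2.
  by field; rewrite gt_eqF.
lra.
Qed.

Lemma rig_gauss_exp (c k : R) : 0 < c ->
  rig leb (fun t => expR (k * `|t|) * expR (- (c * t ^+ 2))).
Proof.
move=> c0; have c2 : 0 < c / 2 by rewrite divr_gt0.
apply: (rig_le _ (rigZ (expR (k ^+ 2 / (2 * c))) (gauss_int c2).1)).
  apply: measurable_funM; apply: measurableT_comp => //.
    by apply: measurable_funM => //; exact: measurableT_comp.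
  apply: measurableT_comp => //.
  by apply: measurable_funM => //; exact: measurable_funX.
by move=> t; rewrite ger0_norm ?mulr_ge0 ?expR_ge0// gauss_exp_dom.
Qed.

(** The exponent -pi (a + ib) t^2 - 2 pi i eta t. The integral [gJ] of [gau] is thus the Fourier
    transform at [eta] of a Gaussian with complex parameter a + ib. *)
Definition garg (a b eta t : R) : R[i] :=
  Complex (- (pi * a * t ^+ 2)) (- (pi * b * t ^+ 2 + 2 * pi * eta * t)).
Definition gau a b eta t := cexp (garg a b eta t).

Lemma cabs_gau a b eta t : cabs (gau a b eta t) = expR (- (pi * a * t ^+ 2)).
Proof. by rewrite cabs_cexp. Qed.

Lemma cmeas_gau a b eta : cmeas (gau a b eta : measurableTypeR R -> R[i]).
Proof.
apply: cmeas_cexp; split; apply: measurableT_comp => //.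
  by apply: measurable_funM => //; exact: measurable_funX.
apply: measurable_funD; apply: measurable_funM => //; exact: measurable_funX.
Qed.

Lemma le_1D_expR (r : R) : 1 + r <= expR r.
Proof. exact: expR_ge1Dx. Qed.

Lemma le_expR_id (r : R) : r <= expR r.
Proof. by rewrite (le_trans _ (le_1D_expR r))// lerDr. Qed.

Lemma cig_gau a b eta (k : R) (P : R -> R[i]) : 0 < a ->
  cmeas (P : measurableTypeR R -> R[i]) ->
  (exists C, forall t, cabs (P t) <= C * expR (k * `|t|)) ->
  cig leb (fun t => P t * gau a b eta t).
Proof.
move=> a0 mP [C PC].
have pa : 0 < pi * a by rewrite mulr_gt0// pi_gt0.
apply: (cig_le _ (rigZ C (rig_gauss_exp k pa))).
  by apply: cmeasM => //; exact: cmeas_gau.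
by move=> t; rewrite cabsM cabs_gau mulrA ler_wpM2r ?expR_ge0.
Qed.

Lemma cig_gau0 a b eta : 0 < a -> cig leb (gau a b eta).
Proof.
move=> a0; have := @cig_gau a b eta 0 (fun _ => 1) a0.
under [X in _ -> _ -> cig _ X]eq_fun do rewrite mul1r.
apply; first exact: cmeas_cst.
by exists 1 => t; rewrite cabs1 mul0r expR0 mulr1.
Qed.

Lemma cig_gau1 a b eta : 0 < a -> cig leb (fun t => t%:C%C * gau a b eta t).
Proof.
move=> a0; apply: (@cig_gau a b eta 1) => //; first exact: cmeasR.
by exists 1 => t; rewrite cabsR !mul1r le_expR_id.
Qed.

Definition gJ a b eta := cI leb (gau a b eta).

Lemma gau_taylor_dom a (k0 k1 : R) : 0 < a -> 0 <= k0 -> 0 <= k1 ->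
  rig leb (fun t => expR (- (pi * a * t ^+ 2)) *
   (8 * (k0 + k1 * `|t|) ^+ 2 * expR (k0 + k1 * `|t|) + k0)).
Proof.
move=> a0 k00 k10; have pa : 0 < pi * a by rewrite mulr_gt0// pi_gt0.
have mm : measurable_fun (setT : set (measurableTypeR R)) (fun t => expR (- (pi * a * t ^+ 2)) *
   (8 * (k0 + k1 * `|t|) ^+ 2 * expR (k0 + k1 * `|t|) + k0)).
  have m1 : measurable_fun (setT : set (measurableTypeR R)) (fun t : R => k0 + k1 * `|t|).
    by apply: measurable_funD => //; apply: measurable_funM => //; exact: measurableT_comp.
  apply: measurable_funM.
    apply: measurableT_comp => //; apply: measurableT_comp => //.
    by apply: measurable_funM => //; exact: measurable_funX.
  apply: measurable_funD => //; apply: measurable_funM.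
    by apply: measurable_funM => //; exact: measurable_funX.
  exact: measurableT_comp.
apply: (rig_le mm (rigZ (9 * expR (3 * k0)) (rig_gauss_exp (3 * k1) pa))) => t.
set r := k0 + k1 * `|t|; have r0 : 0 <= r by rewrite addr_ge0 ?mulr_ge0.
rewrite ger0_norm ?mulr_ge0 ?expR_ge0 ?addr_ge0 ?mulr_ge0 ?sqr_ge0 ?expR_ge0//.
have -> : 9 * expR (3 * k0) * (expR (3 * k1 * `|t|) * expR (- (pi * a * t ^+ 2))) =
  expR (- (pi * a * t ^+ 2)) * (9 * (expR (3 * k0) * expR (3 * k1 * `|t|))) by ring.
rewrite ler_wpM2l ?expR_ge0// -expRD.
have -> : 3 * k0 + 3 * k1 * `|t| = 3 * r by rewrite /r; ring.
have e1 := le_expR_id r.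
have e2 : k0 <= expR (3 * r).
  by rewrite (le_trans _ (le_expR_id _))// /r; have := mulr_ge0 k10 (normr_ge0 t); lra.
have -> : 3 * r = r + r + r by ring.
have : r ^+ 2 * expR r <= expR (r + r + r).
  rewrite (expRD (r + r) r) ler_wpM2r ?expR_ge0// (expRD r r) expr2.
  by apply: ler_pM.
move: e2; have -> : 3 * r = r + r + r by ring.
lra.
Qed.

Lemma gJ_qD a b eta : 0 < a ->
  qD (gJ a b) eta (cI leb (fun t => Complex 0 (- (2 * pi * t)) * gau a b eta t)).
Proof.
move=> a0; eexists => h h1.
have im : cig leb (fun t => Complex 0 (- (2 * pi * t)) * gau a b eta t).
  have := cigZ (Complex 0 (- (2 * pi))) (@cig_gau1 a b eta a0).
  congr cig; apply/funext => t; rewrite mulrA; congr (_ * _).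
  by apply: complexP => /=; ring.
apply: (cI_taylor (cig_gau0 _ _ a0) (cig_gau0 _ _ a0) im
   (@gau_taylor_dom a 0 (2 * pi) a0 (lexx _) _)).
  by rewrite mulr_ge0// pi_ge0.
move=> t; have := @cexp_taylor R (garg a b eta t) (Complex 0 (- (2 * pi * t))) 0 h h1.
rewrite mulr0 addr0 cabs0 addr0 add0r.
have -> : garg a b eta t + h%:C%C * Complex 0 (- (2 * pi * t)) = garg a b (eta + h) t.
  by apply: complexP => /=; ring.
rewrite -/(gau _ _ _ _) -/(gau _ _ _ _) cabs_gau addr0.
have -> : cabs (Complex 0 (- (2 * pi * t))) = 2 * pi * `|t|.
  rewrite /cabs/= expr0n/= add0r sqrtr_sqr normrN !normrM ger0_norm//.
  by rewrite (ger0_norm (pi_ge0 R)).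
by rewrite addr0.
Qed.

(** Integration by parts from translation invariance: the integral of the translate by h does not
    depend on h, so its first-order term, the integral of the derivative, vanishes. *)
Lemma gJ_ibp a b eta : 0 < a ->
  Complex a b * cI leb (fun t => t%:C%C * gau a b eta t) = - (Complex 0 eta * gJ a b eta).
Proof.
move=> a0.
pose f' t := Complex (- (2 * pi * a * t)) (- (2 * pi * b * t + 2 * pi * eta)) : R[i].
pose q := Complex (- (pi * a)) (- (pi * b)) : R[i].
have i1 := @cig_gau1 a b eta a0; have i0 := @cig_gau0 a b eta a0.
have fE t : f' t * gau a b eta t =
    (- (2 * pi)%:C)%C * (Complex a b * (t%:C%C * gau a b eta t) + Complex 0 eta * gau a b eta t).
  rewrite !mulrA -mulrDl mulrA; congr (_ * _).
  by apply: complexP => /=; ring.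
have im : cig leb (fun t => f' t * gau a b eta t).
  under [X in cig _ X]eq_fun do rewrite fE.
  by apply: cigZ; apply: cigD; exact: cigZ.
have IE : cI leb (fun t => f' t * gau a b eta t) =
   (- (2 * pi)%:C)%C * (Complex a b * cI leb (fun t => t%:C%C * gau a b eta t) + Complex 0 eta * gJ a b eta).
  under cI_eq do rewrite fE.
  by rewrite cIZ ?cID ?cIZ//; [exact: cigZ|exact: cigZ|apply: cigD; exact: cigZ].
pose k1 := 2 * pi * a + 2 * pi * `|b|.
pose k0 := 2 * pi * `|eta| + pi * a + pi * `|b|.
have p0 := pi_gt0 R.
have k10 : 0 <= k1 by rewrite addr_ge0 ?mulr_ge0// ltW.
have k00 : 0 <= k0 by rewrite !addr_ge0 ?mulr_ge0// ltW.
have taylor h : `|h| <= 1 -> cabs (cI leb (fun t => gau a b eta (t + h)) - gJ a b eta -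
    h%:C%C * cI leb (fun t => f' t * gau a b eta t)) <=
    2 * (\int[leb]_t (expR (- (pi * a * t ^+ 2)) *
   (8 * (k0 + k1 * `|t|) ^+ 2 * expR (k0 + k1 * `|t|) + k0))) * h ^+ 2.
  move=> h1.
  have ih : cig leb (fun t => gau a b eta (t + h)).
    exact: cig_lshift i0.
  apply: (cI_taylor ih i0 im (gau_taylor_dom a0 k00 k10)) => t.
  have := @cexp_taylor R (garg a b eta t) (f' t) q h h1.
  have -> : garg a b eta t + h%:C%C * f' t + (h ^+ 2)%:C%C * q = garg a b eta (t + h).
    by apply: complexP => /=; ring.
  rewrite -/(gau _ _ _ _) -/(gau _ _ _ _) cabs_gau => /le_trans; apply.
  rewrite ler_wpM2r ?sqr_ge0// ler_wpM2l ?expR_ge0//.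
  have qk : cabs q <= k0.
    rewrite (le_trans (cabs_le_ReIm _))//= !normrN !normrM (gtr0_norm p0) (gtr0_norm a0) /k0.
    by rewrite -addrA lerDr mulr_ge0// mulr_ge0// ltW.
  have fk : cabs (f' t) + cabs q <= k0 + k1 * `|t|.
    have : cabs q <= pi * a + pi * `|b|.
      by rewrite (le_trans (cabs_le_ReIm _))//= !normrN !normrM (gtr0_norm p0) (gtr0_norm a0).
    have := cabs_le_ReIm (f' t); rewrite /= !normrN.
    have := ler_normD (2 * pi * b * t) (2 * pi * eta).
    rewrite !normrM (gtr0_norm p0) (gtr0_norm a0) (@ger0_norm _ 2)// /k0 /k1; lra.
  have f0 : 0 <= cabs (f' t) + cabs q by rewrite addr_ge0 ?cabs_ge0.
  rewrite lerD// ler_pM ?mulr_ge0 ?sqr_ge0 ?expR_ge0 ?ler_expR//.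
  by rewrite ler_wpM2l// lerXn2r ?nnegrE// (le_trans f0).
have X0 : cI leb (fun t => f' t * gau a b eta t) = 0.
  apply: small_quadratic_eq0 => h h1; have := taylor h h1.
  by rewrite cI_lshift; [rewrite subrr sub0r cabsN; exact|exact: cmeas_gau].
move: X0; rewrite IE => /eqP; rewrite mulf_eq0 => /orP[|/eqP/eqP].
  by rewrite oppr_eq0 eq_complex/= eqxx andbT mulf_eq0 pnatr_eq0/= gt_eqF.
by rewrite addr_eq0 => /eqP.
Qed.

(* With [z = a + ib], the transform solves [J' = - (2 pi eta / z) J]. *)
Lemma gJE a b eta : 0 < a ->
  gJ a b eta = gJ a b 0 * gau (a / (a ^+ 2 + b ^+ 2)) (- b / (a ^+ 2 + b ^+ 2)) 0 eta.
Proof.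
move=> a0; set N := a ^+ 2 + b ^+ 2.
have N0 : 0 < N by rewrite ltr_pwDl ?exprn_gt0// sqr_ge0.
(* The reciprocal of the expected Gaussian in [eta]; the product [gJ a b x * E x] then has
   derivative zero. *)
pose E t := cexp (Complex (pi * (a / N) * t ^+ 2) (pi * (- b / N) * t ^+ 2)) : R[i].
have EE t : E t * gau (a / N) (- b / N) 0 t = 1.
  rewrite /E /gau -cexpD (_ : _ + _ = 0) ?cexp0//.
  by apply: complexP => /=; ring.
have E0 : E 0 = 1 by rewrite /E expr0n/= !mulr0 cexp0.
have K x y : gJ a b x * E x = gJ a b y * E y.
  apply: (@qD0_cst _ (fun x => gJ a b x * E x)) => {x y} x.
  have D1 := @gJ_qD a b x a0.
  pose e' := Complex (2 * pi * (a / N) * x) (2 * pi * (- b / N) * x) : R[i].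
  have D2 : qD E x (e' * E x).
    apply: (@qD_cexp _ _ _ _ (Complex (pi * (a / N)) (pi * (- b / N)))) => h.
    by apply: complexP => /=; ring.
  have := qDM D1 D2; set X := cI leb _; suff -> : X = - (e' * gJ a b x).
    by congr qD; ring.
  have XE : X = Complex 0 (- (2 * pi)) * cI leb (fun t => t%:C%C * gau a b x t).
    rewrite /X -cIZ; last exact: cig_gau1.
    apply: cI_eq => t; rewrite mulrA; congr (_ * _).
    by apply: complexP => /=; ring.
  have z0 : Complex a b != 0 :> R[i] by rewrite eq_complex/= negb_and gt_eqF.
  apply: (mulfI z0); rewrite XE mulrCA gJ_ibp// !mulrN; congr (- _).
  rewrite !mulrA; congr (_ * _).
  have N0' : N != 0 by rewrite gt_eqF.
  by apply: complexP => /=; rewrite /N; field; rewrite -/N.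
have := K eta 0; rewrite E0 mulr1 => <-.
by rewrite -mulrA EE mulr1.
Qed.

Lemma gJ_real a : 0 < a -> gJ a 0 0 = ((Num.sqrt a)^-1)%:C%C.
Proof.
move=> a0; have pa : 0 < pi * a by rewrite mulr_gt0// pi_gt0.
rewrite /gJ; under cI_eq => t.
  rewrite /gau (_ : garg a 0 0 t = (- (pi * a * t ^+ 2))%:C%C); last first.
    by apply: complexP => //=; ring.
  rewrite cexpR; over.
rewrite cIR (gauss_int pa).2 -sqrtrV; last exact: ltW.
by rewrite invfM mulrA divff ?mul1r// gt_eqF ?pi_gt0.
Qed.

Lemma gJ_conj a b : 0 < a -> gJ a (- b) 0 = (gJ a b 0)^*%C.
Proof.
move=> a0; have E t : gau a (- b) 0 t = (gau a b 0 t)^*%C.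
  rewrite /gau; have -> : garg a (- b) 0 t = (garg a b 0 t)^*%C by apply: complexP => /=; ring.
  by apply: complexP; rewrite /cexp /garg /= ?cosN ?sinN; ring.
transitivity (cI leb (fun t => (gau a b 0 t)^*%C)); first exact: cI_eq.
by apply: cI_conj; exact: cig_gau0.
Qed.

(** Only the modulus is needed, so no branch of the complex square root is chosen: the product with
    the conjugate is a double integral, and difference and midpoint variables turn it into real
    Gaussian integrals. *)
Lemma gJ_norm a b : 0 < a ->
  cabs (gJ a b 0) ^+ 2 = (Num.sqrt (a ^+ 2 + b ^+ 2))^-1.
Proof.
move=> a0; set N := a ^+ 2 + b ^+ 2.
have N0 : 0 < N by rewrite ltr_pwDl ?exprn_gt0// sqr_ge0.
have a20 : 0 < 2 * a by rewrite mulr_gt0.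
suff E : gJ a b 0 * gJ a (- b) 0 = ((Num.sqrt N)^-1)%:C%C.
  have := congr1 (@cabs R) E; rewrite cabsM gJ_conj// cabsR ger0_norm ?invr_ge0 ?sqrtr_ge0// => <-.
  by rewrite expr2; congr (_ * _); rewrite /cabs; case: (gJ a b 0) => x y /=; rewrite sqrrN.
have ig c : cig leb (gau a c 0) := @cig_gau0 a c 0 a0.
have mg c : cmeas (gau a c 0 : measurableTypeR R -> R[i]) := @cmeas_gau a c 0.
(* In the difference [q] and the midpoint [y] the chirps cancel up to a character of frequency b q,
   so the integral in [y] is the transform of a real Gaussian. *)
have e1 y q : gau a b 0 (q / 2 + y) * gau a (- b) 0 (y - q / 2) =
    gau (a / 2) 0 0 q * gau (2 * a) 0 (b * q) y.
  by rewrite -!cexpD; congr cexp; apply: complexP => /=; field.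
have m2 : cmeas (fun z : measurableTypeR R * measurableTypeR R => gau a b 0 (z.1 + z.2) * gau a (- b) 0 z.2).
  apply: cmeasM; last by apply: (cmeas_comp (mg _)).
  by apply: (cmeas_comp (mg _)); exact: measurable_funD.
have dom q y : cabs (gau a b 0 (q + y) * gau a (- b) 0 y) <=
    expR (- (pi * (a / 4) * q ^+ 2)) * expR (- (pi * (a / 4) * y ^+ 2)).
  rewrite cabsM !cabs_gau -!expRD ler_expR.
  rewrite -subr_ge0.
  have -> : - (pi * (a / 4) * q ^+ 2) - pi * (a / 4) * y ^+ 2 -
    (- (pi * a * (q + y) ^+ 2) - pi * a * y ^+ 2) =
    pi * a * (3 / 4 * (q + 4 / 3 * y) ^+ 2 + 5 / 12 * y ^+ 2) by field.
  rewrite mulr_ge0//; first by rewrite mulr_ge0 ?pi_ge0 ?ltW.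
  by have := sqr_ge0 (q + 4 / 3 * y); have := sqr_ge0 y; lra.
have i4 : rig leb (fun q => expR (- (pi * (a / 4) * q ^+ 2))).
  by apply: (gauss_int _).1; rewrite mulr_gt0 ?pi_gt0// divr_gt0.
have i2 := cig_prod m2 i4 i4 dom.
have s1 q : cig leb (fun y => gau a b 0 (q + y) * gau a (- b) 0 y).
  apply: (cig_le _ (rigZ _ i4) (dom q)).
  exact: cmeas_comp m2 (pair1_measurable q).
have s2 y : cig leb (fun q => gau a b 0 (q + y) * gau a (- b) 0 y).
  apply: (cig_le _ (rigZ (expR (- (pi * (a / 4) * y ^+ 2))) i4)).
    exact: cmeas_comp m2 (pair2_measurable y).
  by move=> q; rewrite [leRHS]mulrC; exact: dom.
have := cFubini i2 s1 s2.
rewrite /=; under [RHS]cI_eq => y.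
  under cI_eq do rewrite mulrC.
  rewrite cIZ; last exact/cig_lshift/ig.
  rewrite (cI_lshift _ (mg b)) mulrC; over.
rewrite cIZ// => <-.
have e2 q : cI leb (fun y => gau a b 0 (q + y) * gau a (- b) 0 y) =
    ((Num.sqrt (2 * a))^-1 * expR (- (pi * (N / (2 * a)) * q ^+ 2)))%:C%C.
  rewrite -(@cI_lshift _ (- (q / 2))); last exact: cmeas_comp m2 (pair1_measurable q).
  under cI_eq => y.
    rewrite (_ : q + (y - q / 2) = q / 2 + y); last by field.
    rewrite e1; over.
  rewrite cIZ; last exact: cig_gau0.
  rewrite -/(gJ _ _ _) gJE// gJ_real// mulrCA realCM; congr (_ * _).
  rewrite -cexpR -cexpD; congr cexp; apply: complexP => /=.
    by rewrite /N expr0n/= addr0; field; rewrite gt_eqF.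
  by rewrite expr0n/=; field; rewrite gt_eqF.
under cI_eq do rewrite e2.
have c0 : 0 < pi * (N / (2 * a)) by rewrite mulr_gt0 ?pi_gt0// divr_gt0.
rewrite cIR RintegralZl ?(gauss_int c0).2//; last exact: (gauss_int c0).1.
congr (_%:C)%C; rewrite -!sqrtrV ?ltW// -sqrtrM ?invr_ge0 ?ltW//.
have an : a != 0 by rewrite gt_eqF.
have pn : pi != 0 :> R by rewrite gt_eqF ?pi_gt0.
have nn : N != 0 by rewrite gt_eqF.
clearbody N; congr (Num.sqrt _); move: (pi : R) pn => P pn; field.
by rewrite nn an pn.
Qed.

End Gauss1.

(** * Chirped Gaussians in several variables *)

Section GaussN.
Context {R : realType}.
Notation leb := (@lebesgue_measure R).

Lemma cmeas_prod d (T : measurableType d) (I : Type) (r : seq I) (F : I -> T -> R[i]) :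
  (forall i, cmeas (F i)) -> cmeas (fun x => \prod_(i <- r) F i x).
Proof.
move=> mF; elim: r => [|i r IH].
  by under [X in cmeas X]eq_fun do rewrite big_nil; exact: cmeas_cst.
by under [X in cmeas X]eq_fun do rewrite big_cons; exact: cmeasM.
Qed.

Lemma ge0_integral_consV n (f : V R n.+1 -> \bar R) : measurable_fun setT f ->
  (forall x, (0 <= f x)%E) ->
  (\int[mu n.+1]_x f x = \int[prodm leb (mu n)]_p f (consV p))%E.
Proof.
move=> mf f0; rewrite [LHS]ge0_integral_pushforward//.
exact: measurable_consV.
Qed.

(** Lifts a change of variables from nonnegative functions to complex ones through positive and
    negative parts. It is applied to splitting off one coordinate and to splitting a vector into two
    halves. *)
Lemma cI_transfer d1 d2 (T1 : measurableType d1) (T2 : measurableType d2)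
  (m1 : {measure set T1 -> \bar R}) (m2 : {measure set T2 -> \bar R}) (h : T1 -> T2)
  (f : T2 -> R[i]) :
  (forall g : T2 -> \bar R, measurable_fun setT g -> (forall x, (0 <= g x)%E) ->
    (\int[m2]_x g x = \int[m1]_x g (h x))%E) ->
  cmeas f -> cig m1 (fun x => f (h x)) ->
  cig m2 f /\ cI m2 f = cI m1 (fun x => f (h x)).
Proof.
move=> E; have H (u : T2 -> R) : measurable_fun setT u -> rig m1 (fun x => u (h x)) ->
    rig m2 u /\ \int[m2]_x u x = \int[m1]_x u (h x).
  move=> mu_ iu; have mE : measurable_fun setT (EFin \o u) by exact/measurable_EFinP.
  split.
    apply/integrableP; split=> //; rewrite E//.
      by have [_] := integrableP _ _ _ iu.
    exact: measurableT_comp.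
  congr fine; rewrite integralE [RHS]integralE; congr (_ - _)%E.
    rewrite E//; last exact: measurable_funepos.
    by apply: eq_integral => x _; rewrite !funeposE.
  rewrite E//; last exact: measurable_funeneg.
  by apply: eq_integral => x _; rewrite !funenegE.
move=> [f1 f2] [i1 i2]; have [j1 e1] := H _ f1 i1; have [j2 e2] := H _ f2 i2.
by split => //; apply: complexP.
Qed.

Lemma cI_tensor n (g : 'I_n -> R -> R[i]) : (forall i, cig leb (g i)) ->
  cig (mu n) (fun x : V R n => \prod_(i < n) g i (x ord0 i)) /\
  cI (mu n) (fun x : V R n => \prod_(i < n) g i (x ord0 i)) = \prod_(i < n) cI leb (g i).
Proof.
elim: n g => [|n IH] g ig.
  under [X in cig _ X]eq_fun do rewrite big_ord0.
  under cI_eq do rewrite big_ord0.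
  have E (u : V R 0 -> R) : measurable_fun setT u -> \int[mu 0]_x u x = u 0.
    move=> mu_; rewrite /Rintegral /= integral_dirac//; last exact/measurable_EFinP.
    by rewrite diracT mul1e.
  have I (k : R) : rig (mu 0) (fun _ => k).
    apply/integrableP; split; first exact/measurable_EFinP/measurable_cst.
    by rewrite /= integral_dirac// diracT mul1e ltry.
  rewrite big_ord0; split; first by split; exact: I.
  by apply: complexP => /=; rewrite E.
have [iT eT] := IH (fun i => g (lift ord0 i)) (fun i => ig _).
have mg i : cmeas (g i : measurableTypeR R -> R[i]) by exact: cig_meas (ig i).
have m1 : cmeas (fun x : V R n.+1 => \prod_(i < n.+1) g i (x ord0 i)).
  by apply: cmeas_prod => i; exact: cmeas_comp (mg i) (measurable_coord i).
have fE t (y : V R n) : \prod_(i < n.+1) g i (consV (t, y) ord0 i) =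
    g ord0 t * \prod_(i < n) g (lift ord0 i) (y ord0 i).
  rewrite big_ord_recl; congr (_ * _); first by congr (g _ _); rewrite (consV0 (t, y)).
  by apply: eq_bigr => i _; congr (g _ _); rewrite (consVS (t, y)).
have m2 : cmeas (fun p : measurableTypeR R * V R n => \prod_(i < n.+1) g i (consV p ord0 i)).
  exact: cmeas_comp m1 (@measurable_consV R n).
have i2 : cig (prodm leb (mu n)) (fun p => \prod_(i < n.+1) g i (consV p ord0 i)).
  apply: (cig_prod m2 (cig_cabs (ig ord0)) (cig_cabs iT)) => t y.
  by rewrite fE cabsM.
have [j1 ->] := cI_transfer (@ge0_integral_consV n) m1 i2; split=> //.
have s1 t : cig (mu n) (fun y => \prod_(i < n.+1) g i (consV (t, y) ord0 i)).
  under [X in cig _ X]eq_fun do rewrite fE.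
  exact: cigZ.
have [_ <-] := cFubini1 i2 s1.
under cI_eq => t.
  under cI_eq do rewrite fE.
  rewrite cIZ// eT mulrC; over.
by rewrite cIZ// big_ord_recl mulrC.
Qed.

Lemma measurable_dotp d (T : measurableType d) n (f g : T -> V R n) :
  measurable_fun setT f -> measurable_fun setT g ->
  measurable_fun setT (fun t => dotp (f t) (g t)).
Proof.
move=> mf mg; apply: measurable_sum => i; apply: measurable_funM.
  exact: measurableT_comp (measurable_coord i) mf.
exact: measurableT_comp (measurable_coord i) mg.
Qed.

Lemma cexp_sum (I : Type) (r : seq I) (F : I -> R[i]) :
  cexp (\sum_(i <- r) F i) = \prod_(i <- r) cexp (F i).
Proof.
elim: r => [|i r IH]; first by rewrite !big_nil cexp0.
by rewrite !big_cons cexpD IH.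
Qed.

Lemma Re_sum (I : Type) (r : seq I) (F : I -> R[i]) :
  complex.Re (\sum_(i <- r) F i) = \sum_(i <- r) complex.Re (F i).
Proof. by elim: r => [|i r IH]; rewrite ?big_nil// !big_cons ReD IH. Qed.

Lemma Im_sum (I : Type) (r : seq I) (F : I -> R[i]) :
  complex.Im (\sum_(i <- r) F i) = \sum_(i <- r) complex.Im (F i).
Proof. by elim: r => [|i r IH]; rewrite ?big_nil// !big_cons ImD IH. Qed.

Definition gauV n a b (xi x : 'rV[R]_n) : R[i] :=
  cexp (Complex (- (pi * a * dotp x x)) (- (pi * b * dotp x x + 2 * pi * dotp x xi))).

Lemma gauV_tensor n a b (xi x : 'rV[R]_n) :
  gauV a b xi x = \prod_(i < n) gau a b (xi ord0 i) (x ord0 i).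
Proof.
rewrite /gauV /gau -cexp_sum; congr cexp; apply: complexP.
  rewrite Re_sum /= sumrN; congr (- _).
  by rewrite mulr_sumr; apply: eq_bigr => i _; rewrite expr2.
rewrite Im_sum /= sumrN; congr (- _).
rewrite !mulr_sumr -big_split; apply: eq_bigr => i _ /=; ring.
Qed.

Lemma cabs_gauV n a b (xi x : 'rV[R]_n) :
  cabs (gauV a b xi x) = expR (- (pi * a * dotp x x)).
Proof. by rewrite cabs_cexp. Qed.

Lemma cmeas_gauV n a b (xi : 'rV[R]_n) : cmeas (gauV a b xi : V R n -> R[i]).
Proof.
have m1 : measurable_fun setT (fun x : V R n => dotp x x) by exact: measurable_dotp.
have m2 : measurable_fun setT (fun x : V R n => dotp x xi) by exact: measurable_dotp.
apply: cmeas_cexp; split; apply: measurableT_comp => //.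
  exact: measurable_funM.
by apply: measurable_funD; apply: measurable_funM.
Qed.

Lemma cig_gauV n a b (xi : 'rV[R]_n) : 0 < a -> cig (mu n) (gauV a b xi).
Proof.
move=> a0; rewrite (_ : gauV a b xi =
    fun x : V R n => \prod_(i < n) gau a b (xi ord0 i) (x ord0 i)); last first.
  by apply/funext => x; exact: gauV_tensor.
exact: (cI_tensor (fun i => cig_gau0 b (xi ord0 i) a0)).1.
Qed.

Lemma gauV_fourier n a b (xi : 'rV[R]_n) : 0 < a ->
  cI (mu n) (gauV a b xi) = gJ a b 0 ^+ n *
    gauV (a / (a ^+ 2 + b ^+ 2)) (- b / (a ^+ 2 + b ^+ 2)) 0 xi.
Proof.
move=> a0; under cI_eq do rewrite gauV_tensor.
rewrite (cI_tensor (fun i => cig_gau0 b (xi ord0 i) a0)).2 gauV_tensor.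
rewrite -[in gJ _ _ _ ^+ n](card_ord n) -prodr_const -big_split/=.
by apply: eq_bigr => i _; rewrite mxE -/(gJ _ _ _) gJE.
Qed.

Lemma gauV_real n a (x : 'rV[R]_n) :
  gauV a 0 0 x = (expR (- (pi * a * dotp x x)))%:C%C.
Proof.
rewrite /gauV -cexpR; congr cexp; apply: complexP => //=.
rewrite mulr0 mul0r add0r (_ : dotp x 0 = 0) ?mulr0 ?oppr0//.
by rewrite /dotp big1// => i _; rewrite mxE mulr0.
Qed.

Lemma gaussV_int n (c : R) : 0 < c ->
  rig (mu n) (fun x => expR (- (c * dotp x x))) /\
  \int[mu n]_x expR (- (c * dotp x x)) = Num.sqrt (pi / c) ^+ n.
Proof.
move=> c0; have p0 := pi_gt0 R; have a0 : 0 < c / pi by rewrite divr_gt0.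
have E (x : V R n) : gauV (c / pi) 0 0 x = (expR (- (c * dotp x x)))%:C%C.
  by rewrite gauV_real (mulrC pi) divfK// gt_eqF.
have [i1 _] := @cig_gauV n _ 0 0 a0.
split; first by move: i1; congr rig; apply/funext => x; rewrite E.
have := @gauV_fourier n _ 0 0 a0; under cI_eq do rewrite E.
rewrite oppr0 mul0r cIR gJ_real// => /(congr1 (@complex.Re R)) /= ->.
rewrite gauV_real /dotp big1 ?mulr0 ?oppr0 ?expR0 ?mulr1; last by move=> i _; rewrite mxE mul0r.
by rewrite -rmorphXn/= -sqrtrV ?ltW// invf_div.
Qed.

End GaussN.

(** * Fractional powers as superpositions of exponentials *)

Section Kern.
Context {R : realType}.
Notation leb := (@lebesgue_measure R).
Notation mR := (setT : set (measurableTypeR R)).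

Lemma lebesgue_opp (f : measurableTypeR R -> \bar R) : measurable_fun setT f ->
  (forall x, (0 <= f x)%E) ->
  (\int[leb]_t f (- t)%R = \int[leb]_t f t)%E.
Proof.
move=> mf f0; pose sh := fun t : measurableTypeR R => (- t)%R : measurableTypeR R.
have ms : measurable_fun setT sh by exact: measurableT_comp.
have <- : (\int[pushforward leb sh]_t f t = \int[leb]_t f (- t)%R)%E.
  by rewrite ge0_integral_pushforward.
apply: eq_measure_integral => A mA _; apply/esym.
apply: (@lebesgue_measure_unique R
  (measure_function_pushforward__canonical__measure_function_Measure leb ms)) => //.
move=> _ [[x y] _ <-] /=; rewrite /pushforward.
have -> : sh @^-1` `]x, y] = `[- y, - x[%classic.
  by apply/seteqP; split => t /=; rewrite /sh !in_itv/= => /andP[? ?]; apply/andP; split; lra.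
rewrite !lebesgue_measure_itv/= !lte_fin ltrN2; case: ifP => // _.
by rewrite -!EFinB; congr EFin; ring.
Qed.

(** Dominated by the exponential density plus its mirror image, up to the factor 1/c. *)
Lemma rig_expR_abs (c : R) : 0 < c -> rig leb (fun x => expR (- (c * `|x|))).
Proof.
move=> c0; have ip : rig leb (exponential_pdf c).
  apply: ge0_rig; first exact: measurable_exponential_pdf.
    by move=> x; apply: exponential_pdf_ge0; exact: ltW.
  by rewrite integral_exponential_pdf// ltry.
have im : rig leb (fun x => exponential_pdf c (- x)).
  apply: ge0_rig.
  - by apply: measurableT_comp => //; exact: measurable_exponential_pdf.
  - by move=> x; apply: exponential_pdf_ge0; exact: ltW.
  rewrite (@lebesgue_opp (EFin \o exponential_pdf c)) ?integral_exponential_pdf ?ltry//.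
    by apply/measurable_EFinP; exact: measurable_exponential_pdf.
  by move=> x; rewrite lee_fin exponential_pdf_ge0// ltW.
apply: (rig_le _ (rigZ c^-1 (rigD ip im))).
  by do 3 apply: measurableT_comp => //.
move=> x; rewrite ger0_norm ?expR_ge0//.
have [x0|x0] := leP 0 x.
  rewrite exponential_pdfE// mulrDr mulKf ?gt_eqF// ger0_norm// mulNr lerDl.
  by rewrite mulr_ge0 ?invr_ge0 ?exponential_pdf_ge0 ?ltW.
rewrite ltr0_norm// [X in _ + X]exponential_pdfE ?oppr_ge0 ?(ltW x0)// mulrDr mulKf ?gt_eqF//.
by rewrite mulNr lerDr mulr_ge0 ?invr_ge0 ?exponential_pdf_ge0 ?(ltW c0).
Qed.

Definition negpart (x : R) : R := \1_(`]-oo, 0[%classic : set R) x.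
Definition pospart (x : R) : R := \1_(`[0, +oo[%classic : set R) x.
Definition in12 (x : R) : R := \1_(`[1, 2]%classic : set R) x.

Lemma negpartE x : negpart x = (x < 0)%R%:R.
Proof. by rewrite /negpart indicE mem_setE in_itv/=. Qed.

Lemma pospartE x : pospart x = (0 <= x)%R%:R.
Proof. by rewrite /pospart indicE mem_setE in_itv/= andbT. Qed.

Lemma in12E x : in12 x = (1 <= x <= 2)%R%:R.
Proof. by rewrite /in12 indicE mem_setE in_itv/=. Qed.

Lemma measurable_negpart : measurable_fun mR negpart.
Proof. exact: measurable_indic. Qed.

Lemma measurable_pospart : measurable_fun mR pospart.
Proof. exact: measurable_indic. Qed.

Lemma measurable_in12 : measurable_fun mR in12.
Proof. exact: measurable_indic. Qed.

(** Kernels for the two halves of the integral of chi(z e^x) e^(-al x). For x < 0, chi v is v times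
    the integral of e^(-v t) over [1, 2]; the factor z e^x leaves z outside and turns the weight
    into e^((1 - al) x), integrable at minus infinity. Hence [k1], with the extra variable t and
    heat time [r1]; the maximum in [r1] agrees with t on [1, 2] and keeps [r1] positive everywhere.
    For x >= 0 the two exponentials of chi are kept and the weight is [k2]. *)
Definition kA (al x : R) := negpart x * expR ((1 - al) * x).
Definition k1 (al : R) (p : R * R) := kA al p.1 * in12 p.2.
Definition r1 (p : R * R) := expR p.1 * Num.max 1 p.2.
Definition k2 (al x : R) := pospart x * expR (- (al * x)).

Lemma measurable_kA al : measurable_fun mR (kA al).
Proof.
apply: measurable_funM; first exact: measurable_negpart.
by apply: measurableT_comp => //; exact: measurable_funM.
Qed.

Lemma measurable_k2 al : measurable_fun mR (k2 al).
Proof.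
apply: measurable_funM; first exact: measurable_pospart.
by apply: measurableT_comp => //; apply: measurableT_comp => //; exact: measurable_funM.
Qed.

Lemma kA_ge0 al x : 0 <= kA al x.
Proof. by rewrite /kA negpartE mulr_ge0 ?expR_ge0. Qed.

Lemma k2_ge0 al x : 0 <= k2 al x.
Proof. by rewrite /k2 pospartE mulr_ge0 ?expR_ge0. Qed.

Lemma k1_ge0 al p : 0 <= k1 al p.
Proof. by rewrite /k1 in12E mulr_ge0 ?kA_ge0. Qed.

Lemma r1_gt0 p : 0 < r1 p.
Proof. by rewrite /r1 mulr_gt0 ?expR_gt0// lt_max ltr01. Qed.

Lemma rig_kA al : al < 1 -> rig leb (kA al).
Proof.
move=> a1; have c0 : 0 < 1 - al by rewrite subr_gt0.
apply: (rig_le (measurable_kA al) (rig_expR_abs c0)) => x.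
rewrite ger0_norm ?kA_ge0// /kA negpartE; have [x0|x0] := ltP x 0.
  by rewrite mul1r ler_expR ltr0_norm// mulrN opprK.
by rewrite mul0r expR_ge0.
Qed.

Lemma rig_k2 al : 0 < al -> rig leb (k2 al).
Proof.
move=> a0; apply: (rig_le (measurable_k2 al) (rig_expR_abs a0)) => x.
rewrite ger0_norm ?k2_ge0// /k2 pospartE; have [x0|x0] := leP 0 x.
  by rewrite mul1r ger0_norm.
by rewrite mul0r expR_ge0.
Qed.

Lemma rig_in12 : rig leb in12.
Proof.
apply: ge0_rig; first exact: measurable_in12.
  by move=> x; rewrite in12E.
rewrite integral_indic//= setIT lebesgue_measure_itv/= lte_fin ltr1n -EFinB ltry//.
Qed.

Lemma measurable_k1 al : measurable_fun (setT : set (measurableTypeR R * measurableTypeR R)) (k1 al).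
Proof.
apply: measurable_funM; first exact: measurableT_comp (measurable_kA al) _.
exact: measurableT_comp measurable_in12 _.
Qed.

Lemma measurable_r1 : measurable_fun (setT : set (measurableTypeR R * measurableTypeR R)) r1.
Proof.
apply: measurable_funM; first exact: measurableT_comp.
exact: measurable_maxr.
Qed.

Lemma rig_k1 al : al < 1 -> rig (prodm leb leb) (k1 al).
Proof.
move=> a1; apply: (rig_prod (measurable_k1 al) (rig_kA a1) rig_in12) => x y.
by rewrite ger0_norm ?k1_ge0.
Qed.

(** The representation of chi(c) used on the negative half-line. *)
Lemma int_in12_expR (c : R) : 0 < c ->
  c * (\int[leb]_t (in12 t * expR (- (c * Num.max 1 t)))) = expR (- c) - expR (- (2 * c)).
Proof.
move=> c0.
have -> : \int[leb]_t (in12 t * expR (- (c * Num.max 1 t))) =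
    \int[leb]_(t in `[1, 2]) expR (- (c * t)).
  rewrite [RHS]Rintegral_mkcond; apply: eq_Rintegral => t _.
  rewrite patchE mem_setE in_itv/= in12E; case: ifP => [/andP[t1 _]|_]; last by rewrite mul0r.
  by rewrite mul1r max_r.
pose F t := - c^-1 * expR (- c * t).
have D (t : R) : is_derive t 1 F (expR (- (c * t))).
  have D1 := is_derive1_comp (is_derive_expR (- c * t)) (is_deriveZ (- c) (is_derive_id t 1)).
  apply: (is_derive_eq (is_deriveZ (- c^-1) D1)).
  have -> : (- c)%:A = - c :> R by exact: mulr1.
  transitivity (- c^-1 * (expR (- c * t) * - c)); first by [].
  rewrite mulrCA mulrNN mulVf ?gt_eqF//.
  by rewrite mulr1 mulNr.
have cF t : {for t, continuous F}.
  by apply: differentiable_continuous; apply/derivable1_diffP; have [] := D t.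
rewrite /Rintegral (@continuous_FTC2 _ (fun t => expR (- (c * t))) F)//.
- rewrite -EFinB/= /F mulr1 (mulNr c 2) (mulrC c 2) -mulrBr mulrA mulrN divff ?gt_eqF//.
  by rewrite mulN1r opprB.
- by rewrite ltr1n.
- apply: continuous_subspaceT => t.
  apply: continuous_comp; last exact: continuous_expR.
  by apply: continuousN; apply: continuousM => //; exact: cvg_cst.
- split; [by move=> t _; have [] := D t| |].
    apply: cvg_at_right_filter; exact: cF.
  apply: cvg_at_left_filter; exact: cF.
- by move=> t _; rewrite derive1E; have [] := D t.
Qed.

Definition chi (v : R) := expR (- v) - expR (- (2 * v)).

Lemma chi_ge0 v : 0 <= v -> 0 <= chi v.
Proof. by move=> v0; rewrite subr_ge0 ler_expR; lra. Qed.

(** The linear bound gives convergence at minus infinity, where al < 1; the bound by 1 gives it at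
    plus infinity, where al > 0. *)
Lemma chi_le v : 0 <= v -> chi v <= v.
Proof.
move=> v0; rewrite /chi; have -> : - (2 * v) = - v + - v by ring.
rewrite expRD; have := expR_ge1Dx (- v); have := expR_gt0 (- v).
have : expR (- v) <= 1 by rewrite -expR0 ler_expR oppr_le0.
nra.
Qed.

Lemma chi_le1 v : 0 <= v -> chi v <= 1.
Proof.
move=> v0; rewrite /chi (le_trans (ler_wnDr _ (lexx _)))// ?oppr_le0 ?expR_ge0//.
by rewrite -expR0 ler_expR oppr_le0.
Qed.

Lemma measurable_chi : measurable_fun mR chi.
Proof.
apply: measurable_funB; first by apply: measurableT_comp => //.
by apply: measurableT_comp => //; apply: measurableT_comp => //; exact: measurable_funM.
Qed.

(** By translation invariance of dx, replacing z by 1 amounts to shifting x by ln z, which brings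
    out z^al; [I] is the value at z = 1. *)
Lemma powR_kernel (al : R) : 0 < al < 1 -> exists2 I : R, 0 < I & forall z : R, 0 < z ->
  I * powR z al = z * (\int[prodm leb leb]_p (k1 al p * expR (- (z * r1 p))))
    + (\int[leb]_x (k2 al x * expR (- (z * expR x))))
    - (\int[leb]_x (k2 al x * expR (- (z * (2 * expR x))))).
Proof.
move=> /andP[a0 a1].
pose phi z x := chi (z * expR x) * expR (- (al * x)).
have mphi z : measurable_fun mR (phi z).
  apply: measurable_funM.
    by apply: (measurableT_comp measurable_chi); exact: measurable_funM.
  by apply: measurableT_comp => //; apply: measurableT_comp => //; exact: measurable_funM.
have phi0 z x : 0 <= z -> 0 <= phi z x.
  by move=> z0; rewrite mulr_ge0 ?expR_ge0// chi_ge0// mulr_ge0 ?expR_ge0.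
have iphi z : 0 <= z -> rig leb (phi z).
  move=> z0; apply: (rig_le (mphi z) (rigD (rigZ z (rig_kA a1)) (rig_k2 a0))) => x.
  have ze : 0 <= z * expR x by rewrite mulr_ge0 ?expR_ge0.
  rewrite ger0_norm ?phi0// /kA /k2 negpartE pospartE.
  case: (ltP x 0) => x0; rewrite /phi ?mul1r ?mul0r ?mulr0 ?addr0 ?add0r.
    rewrite (le_trans (ler_wpM2r (expR_ge0 _) (chi_le ze)))// -mulrA -expRD.
    by rewrite mulrBl mul1r.
  by rewrite ler_piMl ?expR_ge0// chi_le1.
exists (\int[leb]_x phi 1 x) => [|z z0].
  (* A lower bound for the integrand on [0, 1]: there v = e^x lies in [1, e] and chi v = e^(-v) (1 -
     e^(-v)). *)
  pose c := (expR (- expR 1) * (1 - expR (-1))) * expR (- al).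
  have c0 : 0 < c.
    by rewrite /c !mulr_gt0 ?expR_gt0// subr_gt0 expR_lt1 oppr_lt0.
  have i01 : rig leb (fun x => c * \1_(`[0, 1]%classic : set R) x).
    apply: rigZ; apply: ge0_rig; first exact: measurable_indic.
      by move=> x; rewrite indicE.
    by rewrite integral_indic//= setIT lebesgue_measure_itv/= lte_fin ltr01 -EFinB ltry.
  apply: (@lt_le_trans _ _ (\int[leb]_x (c * \1_(`[0, 1]%classic : set R) x))).
    rewrite RintegralZl//; last first.
      apply: ge0_rig; first exact: measurable_indic.
        by move=> x; rewrite indicE.
      by rewrite integral_indic//= setIT lebesgue_measure_itv/= lte_fin ltr01 -EFinB ltry.
    rewrite /Rintegral integral_indic//= setIT lebesgue_measure_itv/= lte_fin ltr01 -EFinB/=.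
    by rewrite subr0 mulr1.
  apply: le_Rintegral => //; first exact: iphi.
  move=> x _; rewrite indicE mem_setE in_itv/=; case: andP => [[x0 x1]|_]; last by rewrite mulr0 phi0.
  have e1 : 0 <= 1 - expR (-1) :> R by rewrite ltW// subr_gt0 expR_lt1 oppr_lt0.
  rewrite mulr1 /c /phi mul1r; apply: ler_pM; rewrite ?mulr_ge0 ?expR_ge0//.
    rewrite /chi; have -> : - (2 * expR x) = - expR x + - expR x by ring.
    rewrite expRD.
    have -> : expR (- expR x) - expR (- expR x) * expR (- expR x) =
      expR (- expR x) * (1 - expR (- expR x)) by ring.
    apply: ler_pM; rewrite ?expR_ge0//.
      by rewrite ler_expR lerN2 ler_expR.
    by rewrite lerB// ler_expR lerN2 -[leLHS]expR0 ler_expR.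
  by rewrite ler_expR lerN2 ger_pMr.
have E1 : \int[leb]_x phi z x = powR z al * \int[leb]_x phi 1 x.
  rewrite -(@Rint_lshift _ _ (ln z) (mphi 1)) -RintegralZl//; last first.
    have [] := @cig_lshift _ (fun x => (phi 1 x)%:C%C) (ln z) (cigR (iphi 1 ler01)).
    by [].
  apply: eq_Rintegral => x _; rewrite /phi mul1r expRD lnK ?posrE// (mulrC (expR x)).
  rewrite /powR gt_eqF// mulrCA; congr (_ * _).
  by rewrite -expRD; congr expR; ring.
rewrite mulrC -E1.
have ik1 : rig (prodm leb leb) (fun p => k1 al p * expR (- (z * r1 p))).
  apply: (rig_le _ (rig_k1 a1)).
    apply: measurable_funM; first exact: measurable_k1.
    do 2 apply: measurableT_comp => //; apply: measurable_funM => //.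
    exact: measurable_r1.
  move=> p; rewrite ger0_norm ?mulr_ge0 ?k1_ge0 ?expR_ge0// ler_piMr ?k1_ge0//.
  by rewrite -expR0 ler_expR oppr_le0 mulr_ge0 ?ltW ?r1_gt0.
have ik2 c : 0 <= c -> rig leb (fun x => k2 al x * expR (- (z * (c * expR x)))).
  move=> c0; apply: (rig_le _ (rig_k2 a0)).
    apply: measurable_funM; first exact: measurable_k2.
    do 2 apply: measurableT_comp => //; apply: measurable_funM => //.
    exact: measurable_funM.
  move=> x; rewrite ger0_norm ?mulr_ge0 ?k2_ge0 ?expR_ge0// ler_piMr ?k2_ge0//.
  by rewrite -expR0 ler_expR oppr_le0 !mulr_ge0 ?expR_ge0 ?(ltW z0).
have iin12 x : rig leb (fun y => in12 y * expR (- (z * expR x * Num.max 1 y))).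
  apply: (rig_le _ rig_in12).
    apply: measurable_funM; first exact: measurable_in12.
    do 2 apply: measurableT_comp => //; apply: measurable_funM => //.
    exact: measurable_maxr.
  move=> y; have y0 : 0 <= in12 y by rewrite in12E.
  rewrite ger0_norm ?mulr_ge0 ?expR_ge0// ler_piMr//.
  by rewrite -[leRHS]expR0 ler_expR oppr_le0 !mulr_ge0 ?expR_ge0 ?(ltW z0)// le_max ler01.
have ik1x x : rig leb (fun y => k1 al (x, y) * expR (- (z * r1 (x, y)))).
  have := rigZ (kA al x) (iin12 x); congr rig; apply/funext => y.
  by rewrite /k1 /r1/= !mulrA.
have [iF <-] := RFubini ik1 ik1x.
have ik21 : rig leb (fun x => k2 al x * expR (- (z * expR x))).
  by have := ik2 1 ler01; under eq_fun do rewrite mul1r.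
rewrite -RintegralZl// -RintegralD//; last exact: rigZ.
rewrite -RintegralB//; [|by apply: rigD => //; exact: rigZ|exact: ik2].
apply: eq_Rintegral => x _; have ze : 0 < z * expR x by rewrite mulr_gt0 ?expR_gt0.
have -> : \int[leb]_y (k1 al (x, y) * expR (- (z * r1 (x, y)))) =
    kA al x * \int[leb]_y (in12 y * expR (- (z * expR x * Num.max 1 y))).
  rewrite -RintegralZl//; last exact: iin12.
  by apply: eq_Rintegral => y _; rewrite /k1 /r1/= !mulrA.
rewrite /phi.
have -> : z * (kA al x * \int[leb]_y (in12 y * expR (- (z * expR x * Num.max 1 y)))) =
   negpart x * expR (- (al * x)) * (z * expR x * \int[leb]_y (in12 y * expR (- (z * expR x * Num.max 1 y)))).
  rewrite /kA mulrBl mul1r expRD; ring.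
rewrite int_in12_expR// -/(chi _) /k2 negpartE pospartE.
have -> : z * (2 * expR x) = 2 * (z * expR x) by ring.
case: (ltP x 0) => x0; rewrite /chi/= ?mul1r ?mul0r; ring.
Qed.

End Kern.

(** * Euclidean norm and decay *)

Section Euclid.
Context {R : realType}.
Variable n : nat.
Implicit Types x y z : 'rV[R]_n.

Lemma dotpC x y : dotp x y = dotp y x.
Proof. by apply: eq_bigr => i _; rewrite mulrC. Qed.

Lemma dotpDl x y z : dotp (x + y) z = dotp x z + dotp y z.
Proof. by rewrite -big_split; apply: eq_bigr => i _; rewrite mxE mulrDl. Qed.

Lemma dotpDr x y z : dotp z (x + y) = dotp z x + dotp z y.
Proof. by rewrite dotpC dotpDl !(dotpC z). Qed.

Lemma dotpZl (c : R) x y : dotp (c *: x) y = c * dotp x y.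
Proof. by rewrite mulr_sumr; apply: eq_bigr => i _; rewrite mxE mulrA. Qed.

Lemma dotpZr (c : R) x y : dotp y (c *: x) = c * dotp y x.
Proof. by rewrite dotpC dotpZl dotpC. Qed.

Lemma dotpNl x y : dotp (- x) y = - dotp x y.
Proof. by rewrite -scaleN1r dotpZl mulN1r. Qed.

Lemma dotpNr x y : dotp y (- x) = - dotp y x.
Proof. by rewrite dotpC dotpNl dotpC. Qed.

Lemma dotp0l x : dotp 0 x = 0.
Proof. by rewrite -(scale0r 0) dotpZl mul0r. Qed.

Lemma dotp0r x : dotp x 0 = 0.
Proof. by rewrite dotpC dotp0l. Qed.

Lemma dotp_ge0 x : 0 <= dotp x x.
Proof. by apply: sumr_ge0 => i _; rewrite -expr2 sqr_ge0. Qed.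

Lemma dotp_delta x (i : 'I_n) : dotp x (delta_mx 0 i) = x ord0 i.
Proof.
rewrite /dotp (bigD1 i)//= big1 => [|j ji]; first by rewrite !mxE !eqxx mulr1 addr0.
by rewrite mxE (negbTE ji) andbF mulr0.
Qed.

Lemma enorm_ge0 x : 0 <= enorm x.
Proof. exact: sqrtr_ge0. Qed.

Lemma enorm_sqr x : enorm x ^+ 2 = dotp x x.
Proof. by rewrite sqr_sqrtr// dotp_ge0. Qed.

Lemma enorm_coord x (i : 'I_n) : `|x ord0 i| <= enorm x.
Proof.
rewrite -sqrtr_sqr ler_wsqrtr// /dotp (bigD1 i)//= -expr2 lerDl.
by apply: sumr_ge0 => j _; rewrite -expr2 sqr_ge0.
Qed.

Lemma enorm_eq0 x : enorm x = 0 -> x = 0.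
Proof.
move=> x0; apply/rowP => i; rewrite mxE; apply/eqP; rewrite -normr_le0.
by rewrite (le_trans (enorm_coord x i))// x0.
Qed.

Lemma dotp_le x y : dotp x y <= enorm x * enorm y.
Proof.
have [a0|a0] := eqVneq (enorm x) 0; first by rewrite a0 (enorm_eq0 a0) dotp0l mul0r.
have [b0|b0] := eqVneq (enorm y) 0; first by rewrite b0 (enorm_eq0 b0) dotp0r mulr0.
have ap : 0 < enorm x by rewrite lt_neqAle eq_sym a0 enorm_ge0.
have bp : 0 < enorm y by rewrite lt_neqAle eq_sym b0 enorm_ge0.
have := dotp_ge0 (enorm y *: x - enorm x *: y).
rewrite dotpDl !dotpDr dotpNl !dotpNr dotpNl opprK !dotpZl !dotpZr (dotpC y x) -!enorm_sqr.
set a := enorm x in ap *; set b := enorm y in bp *; set d := dotp x y => h.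
have : 0 <= (2 * (a * b)) * (a * b - d).
  have -> : 2 * (a * b) * (a * b - d) =
    b * (b * a ^+ 2) - b * (a * d) + (- (a * (b * d)) + a * (a * b ^+ 2)) by ring.
  move: h; lra.
by rewrite pmulr_rge0 ?subr_ge0// !mulr_gt0.
Qed.

Lemma enormN x : enorm (- x) = enorm x.
Proof. by rewrite /enorm dotpNl dotpNr opprK. Qed.

Lemma enormD x y : enorm (x + y) <= enorm x + enorm y.
Proof.
rewrite -ler_sqr ?nnegrE ?addr_ge0 ?enorm_ge0// enorm_sqr dotpDl !dotpDr sqrrD.
rewrite !enorm_sqr (dotpC y x); have := dotp_le x y; lra.
Qed.

Lemma enormB x y : enorm x - enorm y <= enorm (x - y).
Proof. by rewrite lerBlDr (le_trans _ (enormD _ _))// subrK. Qed.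

Lemma enormZ (c : R) x : enorm (c *: x) = `|c| * enorm x.
Proof.
by rewrite /enorm dotpZl dotpZr mulrA -expr2 sqrtrM ?sqr_ge0// sqrtr_sqr.
Qed.

Lemma normr_dotp_le x y : `|dotp x y| <= enorm x * enorm y.
Proof.
rewrite ler_norml dotp_le andbT lerNl -dotpNl (le_trans (dotp_le _ _))//.
by rewrite enormN.
Qed.

Lemma enorm_delta (i : 'I_n) : enorm (delta_mx 0 i : 'rV[R]_n) = 1.
Proof. by rewrite /enorm dotp_delta mxE !eqxx sqrtr1. Qed.

Lemma measurable_enorm d (T : measurableType d) (f : T -> V R n) :
  measurable_fun setT f -> measurable_fun setT (fun t => enorm (f t)).
Proof.
move=> mf; apply: (@measurableT_comp _ _ _ _ _ _ (@Num.sqrt R)).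
  by apply: continuous_measurable_fun; exact: sqrt_continuous.
exact: measurable_dotp.
Qed.

Lemma measurable_addV d (T : measurableType d) (f g : T -> V R n) :
  measurable_fun setT f -> measurable_fun setT g ->
  measurable_fun setT (fun t => (f t + g t : 'rV[R]_n) : V R n).
Proof.
move=> mf mg; apply: measurable_funV => i; under eq_fun do rewrite mxE.
apply: measurable_funD.
  exact: measurableT_comp (measurable_coord i) mf.
exact: measurableT_comp (measurable_coord i) mg.
Qed.

Lemma measurable_scaleV d (T : measurableType d) (c : R) (f : T -> V R n) :
  measurable_fun setT f ->
  measurable_fun setT (fun t => (c *: (f t : 'rV[R]_n)) : V R n).
Proof.
move=> mf; apply: measurable_funV => i; under eq_fun do rewrite mxE.
by apply: measurable_funM => //; exact: measurableT_comp (measurable_coord i) mf.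
Qed.

End Euclid.

(** * Integrability of polynomially decaying functions *)

Section Decay.
Context {R : realType}.
Notation leb := (@lebesgue_measure R).

Lemma rig_tensor n (u : 'I_n -> R -> R) : (forall i, rig leb (u i)) ->
  rig (mu n) (fun x : V R n => \prod_(i < n) u i (x ord0 i)) /\
  \int[mu n]_x (\prod_(i < n) u i (x ord0 i)) = \prod_(i < n) \int[leb]_t u i t.
Proof.
move=> iu; have [i1 e1] := cI_tensor (fun i => cigR (iu i)).
have E (x : V R n) : \prod_(i < n) ((u i (x ord0 i))%:C)%C =
    ((\prod_(i < n) u i (x ord0 i))%:C)%C by rewrite rmorph_prod.
split.
  by case: i1 => + _; congr rig; apply/funext => x; rewrite E.
move: e1; under cI_eq do rewrite E.
rewrite cIR; under [RHS]eq_bigr do rewrite cIR.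
by rewrite -rmorph_prod => /complexI.
Qed.

Lemma measurable_inv_pos d (T : measurableType d) (u : T -> R) :
  measurable_fun setT u -> (forall x, 0 < u x) ->
  measurable_fun setT (fun x => (u x)^-1).
Proof.
move=> mu_ u0; have -> : (fun x => (u x)^-1) = (fun x => expR (- ln (u x))).
  by apply/funext => x; rewrite expRN lnK// posrE.
by do 2 apply: measurableT_comp => //; exact: measurableT_comp (@measurable_ln R) mu_.
Qed.

Lemma rig_inv_sqr : rig leb (fun t => (1 + `|t|) ^- 2).
Proof.
have mf : measurable_fun (setT : set (measurableTypeR R)) (fun t : R => (1 + `|t|) ^- 2).
  apply: measurable_inv_pos; last by move=> t; rewrite exprn_gt0// ltr_wpDr.
  by apply: measurable_funX; apply: measurable_funD => //; exact: measurableT_comp.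
have If : (\int[leb]_(t in `[0%R, +oo[) ((1 + `|t|) ^- 2)%:E = 1)%E.
  pose F (t : R) := - (1 + t)^-1.
  have D (t : R) : 0 <= t -> is_derive t 1 F ((1 + `|t|) ^- 2).
    move=> t0; have nz : 1 + t != 0 by rewrite gt_eqF// ltr_wpDr.
    have d1 : is_derive t 1 (fun t : R => 1 + t) 1.
      by apply: (is_derive_eq (is_deriveD (is_derive_cst (1 : R) t 1) (is_derive_id t 1))); rewrite add0r.
    have d2 := is_deriveN (is_deriveV nz d1).
    apply: (is_derive_eq d2); rewrite ger0_norm//.
    have -> : (- (1 + t) ^- 2)%:A = - (1 + t) ^- 2 :> R by exact: mulr1.
    by rewrite opprK.
  have cF t : 0 <= t -> {for t, continuous F}.
    move=> t0; apply: differentiable_continuous; apply/derivable1_diffP.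
    by have [] := D t t0.
  rewrite (@ge0_continuous_FTC2y _ _ F 0 0)//.
  - by rewrite /F addr0 invr1 -EFinB sub0r opprK.
  - apply: continuous_subspaceT => t; apply: (@continuousV _ _ (fun t : R => (1 + `|t|) ^+ 2)).
      by rewrite expf_neq0// gt_eqF// ltr_wpDr.
    apply: (@continuous_comp _ _ _ (fun t : R => 1 + `|t|) (fun u : R => u ^+ 2)); last exact: exprn_continuous.
    by apply: continuousD; [exact: cvg_cst|exact: norm_continuous].
  - rewrite -oppr0; apply: cvgN; apply/cvgrPdist_le => e e0; near=> t.
    have t0 : 0 < t by near: t; exact: nbhs_pinfty_gt.
    have u0 : 0 < 1 + t by rewrite addr_gt0.
    rewrite sub0r normrN gtr0_norm ?invr_gt0//.
    rewrite invf_ple ?posrE//.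
    apply: (@le_trans _ _ t); last by rewrite lerDr.
    by near: t; apply: nbhs_pinfty_ge; exact: num_real.
  - by move=> t t0; have [] := D t (ltW t0).
  - by apply: cvg_at_right_filter; exact: cF.
  - by move=> t; rewrite in_itv/= andbT => t0; rewrite derive1E; have [] := D t (ltW t0).
have E : (\int[leb]_(t in `[0%R, +oo[) ((1 + `|t|) ^- 2)%:E =
    \int[leb]_t (pospart t * (1 + `|t|) ^- 2)%:E)%E.
  rewrite integral_mkcond; apply: eq_integral => t _.
  rewrite patchE mem_setE in_itv/= andbT pospartE; case: ifP => _; first by rewrite mul1r.
  by rewrite mul0r.
have mp : measurable_fun (setT : set (measurableTypeR R)) (fun t : R => pospart t * (1 + `|t|) ^- 2).
  by apply: measurable_funM => //; exact: measurable_pospart.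
have p0 t : 0 <= pospart t * (1 + `|t|) ^- 2.
  by rewrite pospartE mulr_ge0// invr_ge0 exprn_ge0// addr_ge0.
have ip : rig leb (fun t => pospart t * (1 + `|t|) ^- 2).
  by apply: ge0_rig => //; rewrite -E If ltry.
have im : rig leb (fun t => pospart (- t) * (1 + `|- t|) ^- 2).
  apply: ge0_rig => //.
    have mo : measurable_fun (setT : set (measurableTypeR R)) (fun t : R => - t).
      by apply: measurable_funN; exact: measurable_id.
    exact: (measurableT_comp mp mo).
  rewrite (@lebesgue_opp _ (fun t => (pospart t * (1 + `|t|) ^- 2)%:E)).
  - by rewrite -E If ltry.
  - by apply/measurable_EFinP; exact: mp.
  - by move=> t; rewrite lee_fin p0.
apply: (rig_le mf (rigD ip im)) => t.
rewrite ger0_norm ?invr_ge0 ?exprn_ge0 ?addr_ge0// normrN -mulrDl ler_peMl ?invr_ge0 ?exprn_ge0 ?addr_ge0//.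
by rewrite !pospartE oppr_ge0; case: (leP 0 t) => t0; [rewrite lerDl ler0n|rewrite (ltW t0) add0r].
Unshelve. all: by end_near. Qed.

Definition pdecay n (x : V R n) : R := (1 + enorm x ^+ 2) ^- n.

(** Each of the n factors (1 + |x|^2)^-1 is spent on one coordinate, where it is at most 2 (1 +
    |x_i|)^-2. *)
Lemma rig_pdecay n : rig (mu n) (@pdecay n).
Proof.
have s0 (x : V R n) : 0 < 1 + enorm x ^+ 2 by rewrite ltr_wpDr ?sqr_ge0.
have m1 : measurable_fun setT (@pdecay n).
  apply: measurable_inv_pos; last by move=> x; rewrite exprn_gt0.
  by apply: measurable_funX; apply: measurable_funD => //; apply: measurable_funX; exact: measurable_enorm.
apply: (rig_le m1 (rigZ (2 ^+ n) (rig_tensor (fun _ : 'I_n => rig_inv_sqr)).1)) => x.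
rewrite ger0_norm ?invr_ge0 ?exprn_ge0 ?(ltW (s0 x))//.
have -> : pdecay x = \prod_(i < n) (1 + enorm x ^+ 2)^-1.
  by rewrite prodr_const card_ord exprVn.
have -> : 2 ^+ n = \prod_(i < n) (2 : R) by rewrite prodr_const card_ord.
rewrite -big_split/= ler_prod// => i _.
rewrite invr_ge0 (ltW (s0 x))/=; have c := enorm_coord x i.
have t0 : 0 < 1 + `|x ord0 i| by rewrite ltr_wpDr.
rewrite -[leRHS]invrK lef_pV2 ?posrE ?invr_gt0 ?divr_gt0 ?exprn_gt0//.
rewrite invf_div ler_pdivrMr//.
have : `|x ord0 i| ^+ 2 <= enorm x ^+ 2 by rewrite lerXn2r ?nnegrE ?enorm_ge0.
have := sqr_ge0 (1 - `|x ord0 i|); rewrite !expr2; lra.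
Qed.

End Decay.

(** * Fourier transform *)

Section MoreFubini.
Context {R : realType} d1 d2 (T1 : measurableType d1) (T2 : measurableType d2).
Variable m1 : {sigma_finite_measure set T1 -> \bar R}.
Variable m2 : {sigma_finite_measure set T2 -> \bar R}.

(** Controls the sections only in mean. Superpositions of translates need this, as they need not be
    dominated by a product of functions of the two variables. *)
Lemma rig_prod_sections (f : T1 * T2 -> R) (c : T2 -> R) :
  measurable_fun setT f -> rig m2 c -> (forall y, rig m1 (fun x => f (x, y))) ->
  (forall y, \int[m1]_x `|f (x, y)| <= c y) -> rig (prodm m1 m2) f.
Proof.
move=> mf ic fi fc; apply/integrable21ltyP; first exact/measurable_EFinP.
apply: (@le_lt_trans _ _ (\int[m2]_y `|c y|%:E)%E).
  apply: ge0_le_integral => //.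
  - by move=> y _; exact: integral_ge0.
  - apply: (@measurable_fun_fubini_tonelli_G _ _ _ _ _ m1 (fun z => `|(f z)%:E|%E)) => //.
    exact/measurableT_comp/measurable_EFinP.
  - by apply/measurable_EFinP/measurableT_comp => //; exact: rig_meas ic.
  move=> y _; rewrite -(EFin_Rintegral (rig_norm (fi y))) lee_fin.
  exact: le_trans (fc y) (ler_norm _).
have [_] := integrableP _ _ _ (rig_norm ic).
by under eq_integral do rewrite /= normr_id.
Qed.

Lemma cig_prod_sections (f : T1 * T2 -> R[i]) (c : T2 -> R) :
  cmeas f -> rig m2 c -> (forall y, cig m1 (fun x => f (x, y))) ->
  (forall y, \int[m1]_x cabs (f (x, y)) <= c y) -> cig (prodm m1 m2) f.
Proof.
move=> cf ic fi fc; have [f1 f2] := cf.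
split; apply: (rig_prod_sections _ ic) => // y; try exact: (fi y).1; try exact: (fi y).2.
  apply: le_trans (fc y); apply: le_Rintegral => //; first exact: (rig_norm (fi y).1).
    exact: (cig_cabs (fi y)).
  by move=> x _; exact: normr_Re.
apply: le_trans (fc y); apply: le_Rintegral => //; first exact: (rig_norm (fi y).2).
  exact: (cig_cabs (fi y)).
by move=> x _; exact: normr_Im.
Qed.

End MoreFubini.

Section Fourier.
Context {R : realType}.
Variable n : nat.
Implicit Types f g : V R n -> R[i].

Lemma cig_mul_bdd d (T : measurableType d) (m : {measure set T -> \bar R})
  (f g : T -> R[i]) (B : R) : cig m f -> cmeas g ->
  (forall x, cabs (g x) <= B) -> cig m (fun x => f x * g x).
Proof.
move=> if_ mg gB; apply: (@cig_le _ _ _ _ _ (fun x => B * cabs (f x))).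
- by apply: cmeasM => //; exact: cig_meas if_.
- by apply: rigZ; exact: cig_cabs.
- by move=> x; rewrite cabsM mulrC ler_wpM2r ?cabs_ge0.
Qed.

Definition chr (xi x : 'rV[R]_n) : R[i] := expi (- (2 * pi * dotp x xi)).

Lemma cabs_chr xi x : cabs (chr xi x) = 1.
Proof. exact: cabs_expi. Qed.

Lemma chrD xi x y : chr xi (x + y) = chr xi x * chr xi y.
Proof. by rewrite /chr dotpDl mulrDr opprD expiD. Qed.

Lemma chrDl xi eta x : chr (xi + eta) x = chr xi x * chr eta x.
Proof. by rewrite /chr dotpDr mulrDr opprD expiD. Qed.

Lemma chrC xi x : chr xi x = chr x xi.
Proof. by rewrite /chr dotpC. Qed.

Lemma chrNl xi x : chr (- xi) x = chr xi (- x).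
Proof. by rewrite /chr dotpNl dotpNr. Qed.

Lemma chrNK xi x : chr xi x * chr xi (- x) = 1.
Proof. by rewrite -chrD subrr /chr dotp0l mulr0 oppr0 expi0. Qed.

Lemma cmeas_chr d (T : measurableType d) (u v : T -> V R n) :
  measurable_fun setT u -> measurable_fun setT v -> cmeas (fun t => chr (u t) (v t)).
Proof.
move=> mu_ mv; apply: cmeas_expi; apply: measurableT_comp => //.
by apply: measurable_funM => //; exact: measurable_dotp.
Qed.

Lemma cig_chr f xi : cig (mu n) f -> cig (mu n) (fun x => f x * chr xi x).
Proof.
move=> cf; apply: (cig_mul_bdd cf _ (B := 1)); last by move=> x; rewrite cabs_chr.
by apply: cmeas_chr => //.
Qed.

Lemma fhatE f xi : cig (mu n) f -> fhat f xi = cI (mu n) (fun x => f x * chr xi x).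
Proof. by move=> cf; rewrite /fhat cintE//; exact: cig_chr. Qed.

Lemma cabs_fhat f xi : cig (mu n) f -> cabs (fhat f xi) <= 2 * \int[mu n]_x cabs (f x).
Proof.
move=> cf; rewrite fhatE//; apply: cabs_cI.
- exact: cig_meas (cig_chr xi cf).
- exact: cig_cabs.
- by move=> x; rewrite cabsM cabs_chr mulr1.
Qed.

(** Fubini yields measurability of a parameter integral only for integrands integrable on the
    product. A Gaussian in the frequency is inserted for that purpose and divided out at the end. *)
Lemma cmeas_fhat f : cig (mu n) f -> cmeas (fhat f : V R n -> R[i]).
Proof.
move=> cf; pose c := 1 : R.
have [ig _] := @gaussV_int R n c ltr01.
have mg : measurable_fun setT (fun x : V R n => - (c * dotp x x)).
  by apply: measurableT_comp => //; apply: measurable_funM => //; exact: measurable_dotp.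
pose F (p : V R n * V R n) := (f p.1 * (expR (- (c * dotp p.2 p.2)))%:C%C) * chr p.2 p.1.
have mF : cmeas F.
  apply: cmeasM; last by apply: cmeas_chr.
  apply: cmeasM; first exact: cmeas_comp (cig_meas cf) measurable_fst.
  by apply: cmeasR; apply: measurableT_comp => //; exact: measurableT_comp mg measurable_snd.
have [i1 e1] : cig (mu n) (fun y => cI (mu n) (fun x => F (x, y))) /\ True.
  split=> //; apply: (cFubini2 _ _).1.
    apply: (cig_prod mF (cig_cabs cf) ig) => x y.
    by rewrite !cabsM cabs_chr mulr1 cabsR ger0_norm ?expR_ge0.
  move=> y; rewrite /F/=; apply: (@cig_chr (fun x => f x * _)).
  by under [X in cig _ X]eq_fun do rewrite mulrC; exact: cigZ.
have mg' : measurable_fun setT (fun x : V R n => expR (c * dotp x x)).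
  by apply: measurableT_comp => //; apply: measurable_funM => //; exact: measurable_dotp.
have := cmeasM (cmeasR mg') (cig_meas i1).
congr cmeas; apply/funext => xi.
under cI_eq do rewrite /F/= (mulrC (f _)) -mulrA.
rewrite (cIZ _ (cig_chr xi cf)) mulrA -realCM expRN divff ?mul1r ?(fhatE xi cf)//.
by rewrite gt_eqF ?expR_gt0.
Qed.

(** Fubini for the symmetric kernel [chr]. The shift [a] is carried along because convolutions are
    treated as superpositions of translates. *)
Lemma fhat_mult f phi (a : 'rV[R]_n) : cig (mu n) f -> cig (mu n) phi ->
  cI (mu n) (fun x => f (x + a) * fhat phi x) =
  cI (mu n) (fun xi => fhat f xi * phi xi * chr (- a) xi).
Proof.
move=> cf cphi; have cfa := cig_shift a cf.
pose F (p : V R n * V R n) := f (p.1 + a) * phi p.2 * chr p.1 p.2.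
have mF : cmeas F.
  apply: cmeasM; last exact: cmeas_chr.
  by apply: cmeasM; [exact: cmeas_comp (cig_meas cfa) measurable_fst|exact: cmeas_comp (cig_meas cphi) measurable_snd].
have E := @cFubini _ _ _ _ _ (mu n) (mu n) F.
transitivity (cI (mu n) (fun x => cI (mu n) (fun y => F (x, y)))).
  apply: cI_eq => x; rewrite (fhatE x cphi).
  apply: etrans (esym (cIZ (f (x + a)) (cig_chr x cphi))) _.
  by apply: cI_eq => y; rewrite /F/= mulrA.
rewrite E; first last.
- move=> y; rewrite /F/=; under [X in cig _ X]eq_fun do rewrite chrC.
  by apply: cig_chr; under [X in cig _ X]eq_fun do rewrite mulrC; exact: cigZ.
- by move=> x; rewrite /F/=; apply: cig_chr; exact: cigZ.
- apply: (cig_prod mF (cig_cabs cfa) (cig_cabs cphi)) => x y.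
  by rewrite !cabsM cabs_chr mulr1.
apply: cI_eq => xi; rewrite /F/= (fhatE xi cf).
have mfx : cmeas (fun x : V R n => f x * chr xi x) by exact: cig_meas (cig_chr xi cf).
have ia := cig_shift a (cig_chr xi cf).
rewrite -(cI_shift a mfx) -mulrA mulrC; apply: etrans _ (cIZ _ ia).
apply: cI_eq => x; rewrite chrD (chrC xi x) (chrC xi a).
have K : chr a xi * chr (- a) xi = 1 by rewrite chrNl chrNK.
rewrite [RHS](_ : _ = f (x + a) * phi xi * chr x xi * (chr a xi * chr (- a) xi)); last by ring.
by rewrite K mulr1.
Qed.

End Fourier.

Section Schwartz.
Context {R : realType}.
Variable n : nat.

Lemma schwartzR_meas (g : 'rV[R]_n -> R) : schwartzR g ->
  measurable_fun setT (g : V R n -> R).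
Proof.
move=> [dg _]; apply: continuous_measurableV => x.
by apply: differentiable_continuous; exact: (dg [::] x).
Qed.

Lemma schwartz_meas (f : 'rV[R]_n -> R[i]) : schwartz f -> cmeas (f : V R n -> R[i]).
Proof. by move=> [f1 f2]; split; exact: schwartzR_meas. Qed.

Lemma schwartz_decay (f : 'rV[R]_n -> R[i]) (k : nat) : schwartz f ->
  exists2 C : R, 0 <= C & forall x, (1 + enorm x ^+ 2) ^+ k * cabs (f x) <= C * pdecay x.
Proof.
move=> [[_ f1] [_ f2]]; have [C1 h1] := f1 [::] (k + n)%N; have [C2 h2] := f2 [::] (k + n)%N.
have s0 (x : 'rV[R]_n) : 0 < 1 + enorm x ^+ 2 by rewrite ltr_wpDr ?sqr_ge0.
have h x : (1 + enorm x ^+ 2) ^+ (k + n) * cabs (f x) <= C1 + C2.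
  apply: le_trans (lerD (h1 x) (h2 x)); rewrite -mulrDr ler_pM2l ?exprn_gt0//.
  exact: cabs_le_ReIm.
exists (C1 + C2).
  by apply: le_trans (h 0); rewrite mulr_ge0 ?cabs_ge0// exprn_ge0// ltW.
move=> x; rewrite /pdecay ler_pdivlMr ?exprn_gt0//; apply: le_trans (h x).
by rewrite exprD mulrAC.
Qed.

Lemma schwartz_cig (f : 'rV[R]_n -> R[i]) : schwartz f -> cig (mu n) f.
Proof.
move=> sf; have [C C0 h] := schwartz_decay 0 sf.
apply: (cig_le (schwartz_meas sf) (rigZ C (@rig_pdecay R n))) => x.
by apply: le_trans (h x); rewrite expr0 mul1r.
Qed.

End Schwartz.

(** * Sobolev norm bounds *)

Section SB.
Context {R : realType}.
Variable n : nat.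
Implicit Types f F G H Phi : V R n -> R[i].
Implicit Types g : V R n -> R.

(** [G] plays the role of the inverse Fourier transform of [Phi]: bounds on
    Sobolev norms are obtained by exhibiting the dominating function [g]. *)
Definition SB Phi g := cmeas Phi /\ (exists B, forall xi, cabs (Phi xi) <= B) /\
  exists G, cig (mu n) G /\ (forall x, cabs (G x) <= g x) /\
    forall phi, schwartz phi ->
      cI (mu n) (fun x => G x * fhat phi x) = cI (mu n) (fun xi => Phi xi * phi xi).

Lemma fhat_bounded f : cig (mu n) f -> exists B : R, forall xi, cabs (fhat f xi) <= B.
Proof. by move=> cf; eexists => xi; exact: cabs_fhat. Qed.

Lemma cig_mul_fhat G f : cig (mu n) G -> cig (mu n) f ->
  cig (mu n) (fun x => G x * fhat f x).
Proof.
move=> cG cf; have [B fB] := fhat_bounded cf.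
exact: (cig_mul_bdd cG (cmeas_fhat cf) fB).
Qed.

Lemma cig_bm Phi f : cmeas Phi -> (exists B, forall xi, cabs (Phi xi) <= B) ->
  cig (mu n) f -> cig (mu n) (fun x => Phi x * f x).
Proof.
move=> mPhi [B PB] cf; under [X in cig _ X]eq_fun do rewrite mulrC.
exact: cig_mul_bdd cf mPhi PB.
Qed.

Lemma SB_add Phi1 Phi2 g1 g2 : SB Phi1 g1 -> SB Phi2 g2 ->
  SB (fun xi => Phi1 xi + Phi2 xi) (fun x => g1 x + g2 x).
Proof.
move=> [m1 [b1 [G1 [c1 [d1 e1]]]]] [m2 [b2 [G2 [c2 [d2 e2]]]]]; split; first exact: cmeasD.
split.
  have [B1 h1] := b1; have [B2 h2] := b2; exists (B1 + B2) => xi.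
  exact: le_trans (cabsD _ _) (lerD (h1 xi) (h2 xi)).
exists (fun x => G1 x + G2 x); split; first exact: cigD.
split; first by move=> x; exact: le_trans (cabsD _ _) (lerD (d1 x) (d2 x)).
move=> phi sphi; have cp := schwartz_cig sphi.
rewrite (@cI_eq _ _ _ _ _ (fun x => G1 x * fhat phi x + G2 x * fhat phi x)); last first.
  by move=> x; rewrite mulrDl.
rewrite [RHS](@cI_eq _ _ _ _ _ (fun x => Phi1 x * phi x + Phi2 x * phi x)); last first.
  by move=> x; rewrite mulrDl.
rewrite (cID (cig_mul_fhat c1 cp) (cig_mul_fhat c2 cp)).
by rewrite (cID (cig_bm m1 b1 cp) (cig_bm m2 b2 cp)) e1// e2.
Qed.

Lemma SB_scale (z : R[i]) Phi g : SB Phi g ->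
  SB (fun xi => z * Phi xi) (fun x => cabs z * g x).
Proof.
move=> [m1 [b1 [G1 [c1 [d1 e1]]]]]; split; first by apply: cmeasM => //; exact: cmeas_cst.
split.
  by have [B1 h1] := b1; exists (cabs z * B1) => xi; rewrite cabsM ler_wpM2l ?cabs_ge0.
exists (fun x => z * G1 x); split; first exact: cigZ.
split; first by move=> x; rewrite cabsM ler_wpM2l ?cabs_ge0.
move=> phi sphi; have cp := schwartz_cig sphi.
rewrite (@cI_eq _ _ _ _ _ (fun x => z * (G1 x * fhat phi x))); last by move=> x; rewrite mulrA.
rewrite [RHS](@cI_eq _ _ _ _ _ (fun x => z * (Phi x * phi x))); last by move=> x; rewrite mulrA.
by rewrite (cIZ _ (cig_mul_fhat c1 cp)) (cIZ _ (cig_bm m1 b1 cp)) e1.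
Qed.

Lemma SB_le Phi g g' : (forall x, g x <= g' x) -> SB Phi g -> SB Phi g'.
Proof.
move=> gg' [m1 [b1 [G1 [c1 [d1 e1]]]]]; split => //; split => //.
by exists G1; split => //; split => // x; exact: le_trans (d1 x) (gg' x).
Qed.

Lemma SB_eq Phi Phi' g : Phi =1 Phi' -> SB Phi g -> SB Phi' g.
Proof. by move=> /funext ->. Qed.

Lemma SB0 : SB (fun _ => 0) (fun _ => 0).
Proof.
split; first exact: cmeas_cst.
split; first by exists 0 => xi; rewrite cabs0.
exists (fun _ => 0); split; first exact: cig0.
split; first by move=> x; rewrite cabs0.
by move=> phi _; apply: cI_eq => x; rewrite !mul0r.
Qed.

Lemma SB_sum (I : Type) (r : seq I) (Phi : I -> V R n -> R[i]) (g : I -> V R n -> R) :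
  (forall i, SB (Phi i) (g i)) ->
  SB (fun xi => \sum_(i <- r) Phi i xi) (fun x => \sum_(i <- r) g i x).
Proof.
move=> h; elim: r => [|i r IH].
  apply: (SB_le _ (SB_eq _ SB0)) => x; by rewrite big_nil.
apply: (SB_le _ (SB_eq _ (SB_add (h i) IH))) => x; by rewrite big_cons.
Qed.

Lemma SB_fhat H : cig (mu n) H -> SB (fhat H) (fun x => cabs (H x)).
Proof.
move=> cH; split; first exact: cmeas_fhat.
split; first exact: fhat_bounded.
exists H; split=> //; split=> // phi sphi.
have := fhat_mult 0 cH (schwartz_cig sphi).
rewrite (@cI_eq _ _ _ _ _ (fun x => H x * fhat phi x)); last by move=> x; rewrite addr0.
move=> ->; apply: cI_eq => xi.
by rewrite /chr oppr0 dotp0r mulr0 oppr0 expi0 mulr1.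
Qed.

(** The witness is the superposition of the translates H(x + a t) with weights [kap t]. The
    parameter space is arbitrary so that heat time and Gaussian variable can later be integrated
    together. *)
Lemma SB_conv d (T : measurableType d) (m : {sigma_finite_measure set T -> \bar R})
  (kap : T -> R) (a : T -> V R n) H (B : R) : rig m kap -> measurable_fun setT a ->
  cig (mu n) H -> (forall x, cabs (H x) <= B) ->
  SB (fun xi => cI m (fun t => (kap t)%:C%C * chr (- a t) xi) * fhat H xi)
     (fun x => 2 * \int[m]_t (`|kap t| * cabs (H (x + a t)))).
Proof.
move=> ik ma cH HB; have mk := rig_meas ik.
have mHa : cmeas (fun z : V R n * T => H (z.1 + a z.2)).
  apply: (cmeas_comp (cig_meas cH)); apply: measurable_addV => //.
  exact: measurableT_comp ma measurable_snd.
have mka : cmeas (fun z : V R n * T => (kap z.2)%:C%C).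
  by apply: cmeasR; exact: measurableT_comp mk measurable_snd.
have mchr : cmeas (fun z : V R n * T => chr (- a z.2) z.1).
  apply: cmeas_chr => //.
  have -> : (fun z : V R n * T => - a z.2) = (fun z => (-1) *: a z.2).
    by apply/funext => z; rewrite scaleN1r.
  by apply: measurable_scaleV; exact: measurableT_comp ma measurable_snd.
have mchr1 (xi : V R n) : cmeas (fun t : T => chr (- a t) xi).
  exact: (cmeas_comp mchr (pair1_measurable xi)).
have ck : cig m (fun t => (kap t)%:C%C) by exact: cigR.
have ckc (xi : V R n) : cig m (fun t => (kap t)%:C%C * chr (- a t) xi).
  by apply: (cig_mul_bdd ck (mchr1 xi) (B := 1)) => t; rewrite cabs_chr.
have ckH (x : V R n) : cig m (fun t => (kap t)%:C%C * H (x + a t)).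
  have mx : cmeas (fun t : T => H (x + a t)) by exact: (cmeas_comp mHa (pair1_measurable x)).
  exact: (cig_mul_bdd ck mx (fun t => HB _)).
have mcH := cmeas_cabs (cig_meas cH).
pose N := \int[mu n]_x cabs (H x).
(* Every translate of [H] has the same integral, so the sections have mean |kap t| times a
   constant. *)
have cF : cig (prodm (mu n) m) (fun z : V R n * T => (kap z.2)%:C%C * H (z.1 + a z.2)).
  apply: (cig_prod_sections (c := fun t => `|kap t| * N)).
  - exact: cmeasM.
  - by under [X in rig _ X]eq_fun do rewrite mulrC; apply: rigZ; exact: rig_norm.
  - by move=> t /=; exact: (cigZ _ (cig_shift (a t) cH)).
  move=> t /=; under eq_Rintegral do rewrite cabsM cabsR.
  rewrite RintegralZl//; last exact: (cig_cabs (cig_shift (a t) cH)).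
  by rewrite (Rint_shift (a t) mcH).
have [iG _] := cFubini1 cF ckH.
pose K (xi : V R n) := cI m (fun t => (kap t)%:C%C * chr (- a t) xi).
have bK xi : cabs (K xi) <= 2 * \int[m]_t `|kap t|.
  apply: cabs_cI; [exact: cig_meas (ckc xi)|exact: rig_norm|move=> t].
  by rewrite cabsM cabsR cabs_chr mulr1.
have cw f : cig (mu n) f -> cig (prodm (mu n) m) (fun z => (kap z.2)%:C%C * chr (- a z.2) z.1 * f z.1).
  move=> cf; apply: (cig_prod (a := fun x => cabs (f x)) (b := fun t => `|kap t|)).
  - by apply: cmeasM; [exact: cmeasM|exact: cmeas_comp (cig_meas cf) measurable_fst].
  - exact: cig_cabs.
  - exact: rig_norm.
  - by move=> x t /=; rewrite !cabsM cabsR cabs_chr mulr1 mulrC.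
have cwt (f : R[i]) (xi : V R n) : cig m (fun t => (kap t)%:C%C * chr (- a t) xi * f).
  by under [X in cig _ X]eq_fun do rewrite mulrC; exact: cigZ.
have KE (f : R[i]) (xi : V R n) : cI m (fun t => (kap t)%:C%C * chr (- a t) xi * f) = K xi * f.
  by rewrite mulrC -(cIZ _ (ckc xi)); apply: cI_eq => t; rewrite mulrC.
(* Same device as for [fhat]: a Gaussian weight makes Fubini applicable and is then removed. *)
have mK : cmeas (fun xi => K xi * fhat H xi).
  apply: cmeasM; last exact: cmeas_fhat.
  have [i0 _] := @gaussV_int R n 1 ltr01.
  have [i1 _] := cFubini1 (cw _ (cigR i0)) (fun xi => cwt (expR (- (1 * dotp xi xi)))%:C%C xi).
  have mg' : measurable_fun setT (fun x : V R n => expR (1 * dotp x x)).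
    by apply: measurableT_comp => //; apply: measurable_funM => //; exact: measurable_dotp.
  have := cmeasM (cig_meas i1) (cmeasR mg'); congr cmeas; apply/funext => xi /=.
  by rewrite KE -mulrA -realCM expRN mulVf ?mulr1// gt_eqF ?expR_gt0.
have [B' HB'] := fhat_bounded cH.
have bKH : exists B0, forall xi, cabs (K xi * fhat H xi) <= B0.
  exists ((2 * \int[m]_t `|kap t|) * B') => xi.
  by rewrite cabsM ler_pM ?cabs_ge0.
split=> //; split=> //; eexists; split; first exact: iG.
split.
  move=> x; apply: cabs_cI; first exact: cig_meas (ckH x).
    by have := cig_cabs (ckH x); congr rig; apply/funext => t; rewrite cabsM cabsR.
  by move=> t; rewrite cabsM cabsR.
move=> phi sphi; have cp := schwartz_cig sphi; have [Bp hp] := fhat_bounded cp.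
pose f1 (z : V R n * T) := (kap z.2)%:C%C * H (z.1 + a z.2) * fhat phi z.1.
transitivity (cI (mu n) (fun x => cI m (fun t => f1 (x, t)))).
  apply: cI_eq => x; rewrite /f1/= mulrC; apply: etrans (esym (cIZ _ (ckH x))) _.
  by apply: cI_eq => t; rewrite mulrC.
have sec t : cig (mu n) (fun x => (kap t)%:C%C * (H (x + a t) * fhat phi x)).
  by apply: cigZ; apply: cig_mul_fhat => //; exact: cig_shift.
rewrite cFubini; first last.
- by move=> t; rewrite /f1/=; under [X in cig _ X]eq_fun do rewrite -mulrA; exact: sec.
- by move=> x; rewrite /f1/=; under [X in cig _ X]eq_fun do rewrite mulrC; apply: cigZ; exact: ckH.
- apply: (cig_prod_sections (c := fun t => `|kap t| * (Bp * N))).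
  + by apply: cmeasM; [exact: cmeasM|exact: cmeas_comp (cmeas_fhat cp) measurable_fst].
  + by under [X in rig _ X]eq_fun do rewrite mulrC; apply: rigZ; exact: rig_norm.
  + by move=> t; rewrite /f1/=; under [X in cig _ X]eq_fun do rewrite -mulrA; exact: sec.
  move=> t; have iH := cig_cabs (cig_shift (a t) cH).
  have -> : N = \int[mu n]_x cabs (H (x + a t)).
    by rewrite (Rint_shift (a t) mcH).
  rewrite -RintegralZl// -RintegralZl//; last exact: rigZ.
  apply: le_Rintegral => //.
  + have := cig_cabs (sec t); congr rig; apply/funext => x /=; by rewrite /f1/= mulrA.
  + by do 2 apply: rigZ.
  move=> x _; rewrite /f1/= !cabsM cabsR -mulrA ler_wpM2l// mulrC ler_wpM2r ?cabs_ge0//.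
have cHp := cig_bm (cmeas_fhat cH) (fhat_bounded cH) cp.
transitivity (cI m (fun t => cI (mu n) (fun xi => (kap t)%:C%C * chr (- a t) xi * (fhat H xi * phi xi)))).
  apply: cI_eq => t; rewrite /f1/=.
  have cHc : cig (mu n) (fun xi => fhat H xi * phi xi * chr (- a t) xi).
    apply: (cig_mul_bdd cHp (B := 1)).
      exact: (cmeas_comp mchr (pair2_measurable t)).
    by move=> xi; rewrite cabs_chr.
  transitivity ((kap t)%:C%C * cI (mu n) (fun x => H (x + a t) * fhat phi x)).
    apply: etrans _ (cIZ _ (cig_mul_fhat (cig_shift (a t) cH) cp)).
    by apply: cI_eq => x; rewrite mulrA.
  rewrite (fhat_mult _ cH cp); apply: etrans (esym (cIZ _ cHc)) _.
  by apply: cI_eq => xi; rewrite -!mulrA; congr (_ * _); rewrite mulrA mulrC.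
have cw1 := cw _ cHp.
rewrite -(cFubini cw1 (fun xi => cwt (fhat H xi * phi xi) xi)).
- by apply: cI_eq => xi /=; rewrite KE mulrA.
- move=> t /=; under [X in cig _ X]eq_fun do rewrite -mulrA; apply: cigZ.
  under [X in cig _ X]eq_fun do rewrite mulrC.
  apply: (cig_mul_bdd _ _ (B := 1)) => [//||xi]; last by rewrite cabs_chr.
  exact: (cmeas_comp mchr (pair2_measurable t)).
Qed.

End SB.

Section Sobolev.
Context {R : realType}.
Variable n : nat.

Lemma is_inv_fourierP (G H : V R n -> R[i]) : cig (mu n) G -> cmeas H ->
  (exists B, forall xi, cabs (H xi) <= B) ->
  (forall phi, schwartz phi ->
    cI (mu n) (fun x => G x * fhat phi x) = cI (mu n) (fun xi => H xi * phi xi)) ->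
  is_inv_fourier G H.
Proof.
move=> cG mH bH h phi sphi; have cp := schwartz_cig sphi.
by rewrite (cintE (cig_mul_fhat cG cp)) (cintE (cig_bm mH bH cp)) h.
Qed.

Definition Lpn (p : R) (g : V R n -> R) : \bar R :=
  poweR (\int[mu n]_x (powR (g x) p)%:E) p^-1.

Lemma LpNormE (p : R) (f : V R n -> R[i]) : cmeas f ->
  LpNorm p f = Lpn p (fun x => cabs (f x)).
Proof.
move=> mf; rewrite /LpNorm /Lpn iintE//; last by move=> x; rewrite lee_fin powR_ge0.
by apply/measurable_EFinP; apply: (@measurableT_comp _ _ _ _ _ _ (fun x : R => x `^ p)) => //; exact: cmeas_cabs.
Qed.

Lemma le_Lpn (p : R) (f g : V R n -> R) : 0 <= p ->
  measurable_fun setT f -> measurable_fun setT g ->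
  (forall x, 0 <= f x <= g x) -> (Lpn p f <= Lpn p g)%E.
Proof.
move=> p0 mf mg fg; apply: gt0_ler_poweR; rewrite ?invr_ge0//.
- by rewrite in_itv/= leey andbT; apply: integral_ge0 => x _; rewrite lee_fin powR_ge0.
- by rewrite in_itv/= leey andbT; apply: integral_ge0 => x _; rewrite lee_fin powR_ge0.
apply: ge0_le_integral => //.
- by move=> x _; rewrite lee_fin powR_ge0.
- by apply/measurable_EFinP; apply: (@measurableT_comp _ _ _ _ _ _ (fun x : R => x `^ p)).
- by apply/measurable_EFinP; apply: (@measurableT_comp _ _ _ _ _ _ (fun x : R => x `^ p)).
move=> x _; rewrite lee_fin; have /andP[a b] := fg x.
by apply: ge0_ler_powR => //; rewrite nnegrE// (le_trans a b).
Qed.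

(** The norm is an infimum, so the witness contained in [SB] bounds it. *)
Lemma sobnorm_le_Lpn (u s : R) (F g : V R n -> _) : 0 <= u -> measurable_fun setT g ->
  SB (fun xi => (sob_weight s xi)%:C%C * fhat F xi) g ->
  (sobnorm u s F <= Lpn u g)%E.
Proof.
move=> u0 mg [m1 [b1 [G [cG [Gg e]]]]]; have mG := cig_meas cG.
apply: (@le_trans _ _ (LpNorm u G)); last first.
  rewrite LpNormE//; apply: le_Lpn => //; first exact: cmeas_cabs.
  by move=> x; rewrite cabs_ge0 Gg.
apply: ereal_inf_lbound; exists G; split; first exact/borel_measP.
by split=> //; exact: is_inv_fourierP.
Qed.

End Sobolev.

(** * Superpositions of heat multipliers *)

Section Heat.
Context {R : realType}.
Variable n : nat.

Definition heat_w (xi : 'rV[R]_n) : R := 1 + 4 * pi ^+ 2 * enorm xi ^+ 2.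
(** [gw] is the heat kernel at time 1. Of its exponent |y|^2/4, a part |y|^2/16 is spent on spatial
    decay in [SB_heat]; the remaining 3/16 is [gq]. *)
Definition gq (y : V R n) : R := expR (- (3 / 16 * dotp y y)).
Definition gw (y : V R n) : R := Num.sqrt (4 * pi) ^- n * expR (- (4^-1 * dotp y y)).

Lemma heat_w_gt0 xi : 0 < heat_w xi.
Proof.
by rewrite ltr_wpDr// mulr_ge0 ?sqr_ge0// mulr_ge0 ?sqr_ge0.
Qed.

Lemma rig_gq : rig (mu n) gq.
Proof. by apply: (gaussV_int _ _).1; rewrite divr_gt0. Qed.

Lemma rig_gw : rig (mu n) gw.
Proof. by apply: rigZ; apply: (gaussV_int _ _).1; rewrite invr_gt0. Qed.

Lemma gw_ge0 y : 0 <= gw y.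
Proof. by rewrite mulr_ge0 ?expR_ge0// invr_ge0 exprn_ge0// sqrtr_ge0. Qed.

Lemma gw_fourier (r : R) (xi : V R n) :
  cI (mu n) (fun y => (gw y)%:C%C * chr (- (r *: y)) xi) =
  (expR (- (r ^+ 2 * (4 * pi ^+ 2 * dotp xi xi))))%:C%C.
Proof.
have p0 := pi_gt0 R; have a0 : 0 < (4 * pi : R)^-1 by rewrite invr_gt0 mulr_gt0.
have E (y : V R n) : (gw y)%:C%C * chr (- (r *: y)) xi =
    ((Num.sqrt (4 * pi) ^- n)%:C%C * gauV (4 * pi)^-1 0 (- (r *: xi)) y).
  rewrite /gw realCM -mulrA; congr (_ * _); rewrite /gauV /chr /cexp/=.
  rewrite mulr0 mul0r add0r !dotpNr !dotpZr (dotpC y xi).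
  rewrite (_ : pi * (4 * pi)^-1 = 4^-1 :> R)//.
  by rewrite invfM mulrCA divff ?mulr1 ?gt_eqF.
rewrite (cI_eq _ E) (cIZ _ (cig_gauV _ _ a0)) gauV_fourier//.
rewrite oppr0 mul0r (expr2 0) mul0r addr0 gJ_real// gauV_real.
rewrite -rmorphXn/= mulrA -!realCM; congr (_%:C%C).
rewrite sqrtrV ?invrK ?mulVf ?mul1r ?expf_neq0 ?gt_eqF ?sqrtr_gt0 ?mulr_gt0 ?(ltW a0)//; last first.
  by rewrite mulr_ge0// ltW.
congr (expR (- _)).
rewrite dotpNl dotpNr opprK dotpZl dotpZr invfM.
have P0 : (pi : R) != 0 by rewrite gt_eqF.
move: P0; move: (pi : R) (dotp xi xi) => P D P0; field; exact: P0.
Qed.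

(** A multiplier exp(-w rho^2) is exp(-rho^2) times the transform of the heat kernel at scale rho.
    The factor exp(-rho^2), due to the 1 in w, pays for long heat times: together with the support
    of [H] in the ball of radius 2 it gives the decay e^(-|x|/2) uniformly in rho. *)
Lemma SB_heat d (P : measurableType d) (mP : {sigma_finite_measure set P -> \bar R})
  (k rho : P -> R) (H : V R n -> R[i]) (b1 b : V R n -> R) (A B : R) :
  rig mP k -> (forall p, 0 <= k p) -> measurable_fun setT rho ->
  cig (mu n) H -> 0 <= A -> (forall x, cabs (H x) <= A * b1 x) ->
  (forall x, 2 < enorm x -> H x = 0) ->
  measurable_fun setT b1 -> (forall x, 0 <= b1 x <= B) ->
  (forall (r : R) (x : V R n), \int[mu n]_y (gq y * b1 (x + r *: y)) <= b x) ->
  SB (fun xi => (\int[mP]_p (k p * expR (- (heat_w xi * rho p ^+ 2))))%:C%C * fhat H xi)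
     (fun x => (2 * expR 1 * Num.sqrt (4 * pi) ^- n * \int[mP]_p k p) * A *
               (expR (- (enorm x / 2)) * b x)).
Proof.
move=> ik k0 mrho cH A0 Hb1 H0 mb1 b1B b1b.
pose k' p := k p * expR (- rho p ^+ 2).
have mk := rig_meas ik.
have mr2 : measurable_fun setT (fun p => - rho p ^+ 2).
  by apply: measurableT_comp => //; exact: measurable_funX.
have ik' : rig mP k'.
  apply: (rig_le _ ik).
    by apply: measurable_funM => //; exact: measurableT_comp.
  move=> p; rewrite normrM (ger0_norm (k0 p)) ger0_norm ?expR_ge0// ler_piMr//.
  by rewrite -[leRHS]expR0 ler_expR oppr_le0 sqr_ge0.
have k'0 p : 0 <= k' p by rewrite mulr_ge0 ?expR_ge0.
pose kap (t : P * V R n) := k' t.1 * gw t.2.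
have ikap : rig (prodm mP (mu n)) kap.
  apply: (rig_prod (a := k') (b := gw) _ ik' rig_gw).
    apply: measurable_funM.
      exact: measurableT_comp (rig_meas ik') measurable_fst.
    exact: measurableT_comp (rig_meas rig_gw) measurable_snd.
  by move=> p y; rewrite ger0_norm// mulr_ge0// gw_ge0.
pose a (t : P * V R n) : V R n := rho t.1 *: (t.2 : 'rV[R]_n).
have ma : measurable_fun setT a.
  apply: measurable_funV => i; under eq_fun do rewrite mxE.
  apply: measurable_funM; first exact: measurableT_comp mrho measurable_fst.
  exact: measurableT_comp (measurable_coord i) measurable_snd.
have HB x : cabs (H x) <= A * B.
  by have /andP[_ h] := b1B x; apply: le_trans (Hb1 x) _; rewrite ler_wpM2l.
have SBc := SB_conv ikap ma cH HB.
apply: SB_le (SB_eq _ SBc); last first.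
  move=> xi; congr (_ * _).
  have W (p : P) : k' p * expR (- (rho p ^+ 2 * (4 * pi ^+ 2 * dotp xi xi))) =
      k p * expR (- (heat_w xi * rho p ^+ 2)).
    by rewrite /k' -mulrA -expRD /heat_w enorm_sqr; congr (_ * expR _); ring.
  have cs (p : P) : cig (mu n) (fun y => (gw y)%:C%C * chr (- (rho p *: y)) xi).
    apply: (cig_mul_bdd (cigR rig_gw) (B := 1)).
      apply: cmeas_chr => //; have -> : (fun y : V R n => - (rho p *: y)) = (fun y => (- rho p) *: y).
        by apply/funext => y; rewrite scaleNr.
      exact: measurable_scaleV.
    by move=> y; rewrite cabs_chr.
  have F1 := @cFubini1 _ _ _ _ _ mP (mu n) (fun t => (kap t)%:C%C * chr (- a t) xi).
  rewrite -(F1 _ _).2; first last.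
  - move=> p; have := cigZ (k' p)%:C%C (cs p); congr cig; apply/funext => y.
    by rewrite /kap/= (realCM (k' p)) mulrA.
  - apply: (cig_mul_bdd (cigR ikap) (B := 1)); last by move=> y; rewrite cabs_chr.
    apply: cmeas_chr => //; have -> : (fun t => - a t) = (fun t => (-1) *: a t).
      by apply/funext => y; rewrite scaleN1r.
    exact: measurable_scaleV.
  rewrite -cIR; apply: cI_eq => p; rewrite -W (realCM (k' p)) -gw_fourier; apply: etrans _ (cIZ _ (cs p)).
  by apply: cI_eq => y; rewrite /kap/= realCM mulrA.
move=> x; set e := expR (- (enorm x / 2)).
pose c : R := expR 1 * Num.sqrt (4 * pi) ^- n.
have c0 : 0 <= c by rewrite mulr_ge0 ?expR_ge0// invr_ge0 exprn_ge0// sqrtr_ge0.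
have key p y : `|kap (p, y)| * cabs (H (x + a (p, y))) <=
    k p * (c * e * A * (gq y * b1 (x + rho p *: y))).
  rewrite ger0_norm ?mulr_ge0 ?gw_ge0// /kap /a/=.
  have [b10 _] := andP (b1B (x + rho p *: y)).
  have [h|h] := ltP 2 (enorm (x + rho p *: y)).
    by rewrite H0// cabs0 mulr0 !mulr_ge0 ?expR_ge0.
  have h1 : enorm x <= 2 + `|rho p| * enorm y.
    rewrite -enormZ -lerBlDr; apply: le_trans h.
    by have := enormB x (- (rho p *: y)); rewrite opprK enormN.
  rewrite /k' /gw -!mulrA ler_wpM2l// /c.
  have -> : expR (- rho p ^+ 2) * (Num.sqrt (4 * pi) ^- n * (expR (- (4^-1 * dotp y y)) *
      cabs (H (x + rho p *: y)))) = Num.sqrt (4 * pi) ^- n *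
      (expR (- rho p ^+ 2 - 4^-1 * dotp y y) * cabs (H (x + rho p *: y))).
    by rewrite expRD; ring.
  have -> : expR 1 * (Num.sqrt (4 * pi) ^- n * (e * (A * (gq y * b1 (x + rho p *: y))))) =
      Num.sqrt (4 * pi) ^- n * (expR (1 - enorm x / 2 - 3 / 16 * dotp y y) *
       (A * b1 (x + rho p *: y))).
    by rewrite /e /gq !expRD; ring.
  rewrite ler_wpM2l ?invr_ge0 ?exprn_ge0 ?sqrtr_ge0//.
  apply: ler_pM; rewrite ?expR_ge0 ?cabs_ge0// ler_expR -enorm_sqr.
  (* Since |x| <= 2 + |rho| |y|, this square yields |x|/2 <= 1 + rho^2 + |y|^2/16: the first term
     becomes the constant [expR 1], the other two are taken from exp(-rho^2) and from the heat
     kernel. *)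
  have := sqr_ge0 (`|rho p| - enorm y / 4); rewrite sqrrB real_normK ?num_real//.
  by move: h1; rewrite expr_div_n; lra.
have ga p : rig (mu n) (fun y => gq y * b1 (x + rho p *: y)).
  apply: (rig_le _ (rigZ B rig_gq)).
    apply: measurable_funM; first exact: rig_meas rig_gq.
    apply: (measurableT_comp mb1); apply: measurable_addV => //.
    exact: measurable_scaleV.
  move=> y; have /andP[b0 bB] := b1B (x + rho p *: y).
  by rewrite ger0_norm ?mulr_ge0 ?expR_ge0// mulrC ler_wpM2r ?expR_ge0.
have mH1 : measurable_fun setT (fun t : P * V R n => `|kap t| * cabs (H (x + a t))).
  apply: measurable_funM.
    by apply: measurableT_comp => //; exact: rig_meas ikap.
  apply: cmeas_cabs; apply: (cmeas_comp (cig_meas cH)); exact: measurable_addV.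
have iH1 : rig (prodm mP (mu n)) (fun t : P * V R n => `|kap t| * cabs (H (x + a t))).
  apply: (rig_le mH1 (rigZ (A * B) (rig_norm ikap))) => t.
  by rewrite ger0_norm ?mulr_ge0 ?cabs_ge0// mulrC ler_wpM2r.
have sH1 p : rig (mu n) (fun y => `|kap (p, y)| * cabs (H (x + a (p, y)))).
  apply: (rig_le _ (rigZ (k p) (rigZ (c * e * A) (ga p)))).
    exact: (measurableT_comp mH1 (pair1_measurable p)).
  by move=> y; rewrite ger0_norm ?key// mulr_ge0 ?cabs_ge0.
have [iF eF] := RFubini iH1 sH1.
rewrite -mulrA -[in leLHS]eF -!(mulrA 2) ler_pM2l//.
have -> : expR 1 * Num.sqrt (4 * pi) ^- n * \int[mP]_p k p * (A * (e * b x)) =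
    (c * e * A * b x) * \int[mP]_p k p by rewrite /c; ring.
rewrite -RintegralZl//; apply: le_Rintegral => //; first exact: rigZ.
move=> p _; rewrite (mulrC _ (k p)); apply: le_trans (_ : k p * (c * e * A * \int[mu n]_y (gq y * b1 (x + rho p *: y))) <= _); last first.
  by rewrite ler_wpM2l// ler_wpM2l// !mulr_ge0 ?expR_ge0.
have gp := ga p; have gp' := rigZ (c * e * A) gp.
have -> : k p * (c * e * A * \int[mu n]_y (gq y * b1 (x + rho p *: y))) =
    \int[mu n]_y (k p * (c * e * A * (gq y * b1 (x + rho p *: y)))).
  by rewrite RintegralZl// RintegralZl.
have gp2 := rigZ (k p) gp'; have sp := sH1 p.
by apply: (le_Rintegral measurableT sp gp2) => y _; exact: key.
Qed.

End Heat.

(** * Bessel potentials of fractional order *)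

Section Bessel.
Context {R : realType}.
Variable n : nat.
Notation leb := (@lebesgue_measure R).

Lemma integral_gq_gt0 : 0 < \int[mu n]_y (@gq R n y).
Proof.
rewrite (gaussV_int _ _).2 ?divr_gt0// exprn_gt0// sqrtr_gt0 divr_gt0 ?pi_gt0//.
Qed.

Lemma sob_weightE (l : nat) (al : R) (xi : 'rV[R]_n) :
  sob_weight (2 * (l%:R + al)) xi = heat_w xi ^+ l * powR (heat_w xi) al.
Proof.
rewrite /sob_weight -/(heat_w xi) (_ : 2 * (l%:R + al) / 2 = l%:R + al); last by field.
rewrite powRD ?powR_mulrn ?(ltW (heat_w_gt0 _))//.
by apply/implyP => _; rewrite gt_eqF// heat_w_gt0.
Qed.

(** [H i] stands for (1 - Laplacian)^i F, each application costing [Lam ^+ 2]. Writing w^al as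
    Lam^(2 al) times (w / Lam^2)^al makes heat times scale by 1/Lam^2, so that the terms with [H l]
    and [H l.+1] come out of the same order Lam^s. *)
Lemma SB_bessel (l : nat) (al : R) : 0 <= al < 1 -> exists2 C : R, 0 <= C &
  forall (F : V R n -> R[i]) (H : nat -> V R n -> R[i]) (b1 b : V R n -> R) (Lam B : R),
  1 <= Lam ->
  (forall i, (i <= l.+1)%N -> [/\ cmeas (H i), (forall x, 2 < enorm x -> H i x = 0),
     (forall x, cabs (H i x) <= Lam ^+ (2 * i) * b1 x) &
     (forall xi, fhat (H i) xi = (heat_w xi ^+ i)%:C%C * fhat F xi)]) ->
  measurable_fun setT b1 -> (forall x, 0 <= b1 x <= B) ->
  (forall (r : R) (x : V R n), \int[mu n]_y (gq y * b1 (x + r *: y)) <= b x) ->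
  SB (fun xi => (sob_weight (2 * (l%:R + al)) xi)%:C%C * fhat F xi)
     (fun x => C * powR Lam (2 * (l%:R + al)) * (expR (- (enorm x / 2)) * b x)).
Proof.
move=> /andP[al0 al1].
have suppcig (b1 : V R n -> R) (B : R) (K : V R n -> R[i]) (A : R) : cmeas K -> 0 <= A ->
    (forall x, 2 < enorm x -> K x = 0) -> (forall x, 0 <= b1 x <= B) ->
    (forall x, cabs (K x) <= A * b1 x) -> cig (mu n) K.
  move=> mK A0 K0 b1B Kb.
  have e0 (x : V R n) : 0 < 1 + enorm x ^+ 2 by rewrite ltr_wpDr// sqr_ge0.
  have B0 : 0 <= B by have /andP[h1 h2] := b1B 0; exact: le_trans h2.
  apply: (cig_le mK (rigZ (A * B * 5 ^+ n) (@rig_pdecay R n))) => x.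
  have [h|h] := ltP 2 (enorm x).
    rewrite (K0 _ h) cabs0 !mulr_ge0 ?exprn_ge0// /pdecay invr_ge0 exprn_ge0// ltW//.
  apply: le_trans (Kb x) _; rewrite -!mulrA ler_wpM2l//.
  have /andP[h1 h2] := b1B x; apply: le_trans h2 _; rewrite ler_peMr// /pdecay -exprVn -exprMn.
  apply: exprn_ege1; rewrite ler_pdivlMr// mul1r.
  have : enorm x ^+ 2 <= 2 ^+ 2 by rewrite lerXn2r ?nnegrE ?enorm_ge0.
  by rewrite (expr2 2); lra.
(* The averaging hypothesis at radius r = 0 compares [b1] itself with [b]. *)
have exp0 (x : V R n) (b1 b : V R n -> R) (B : R) : (forall x, 0 <= b1 x <= B) ->
    (forall (r : R) (x : V R n), \int[mu n]_y (gq y * b1 (x + r *: y)) <= b x) ->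
    b1 x <= (\int[mu n]_y (gq y))^-1 * b x.
  move=> b1B /(_ 0 x); under eq_Rintegral do rewrite scale0r addr0 mulrC.
  rewrite RintegralZl//; last exact: rig_gq.
  by rewrite mulrC -ler_pdivlMl// integral_gq_gt0.
have [->|alN] := eqVneq al 0.
  exists (expR 1 * (\int[mu n]_y (gq y))^-1).
    by rewrite mulr_ge0 ?expR_ge0// invr_ge0 ltW// integral_gq_gt0.
  move=> F H b1 b Lam B L1 HH mb1 b1B b1b; have [mH H0 Hb Hf] := HH l (leqnSn l).
  have L0 : 0 <= Lam by exact: le_trans ler01 L1.
  have cH := suppcig b1 B (H l) _ mH (exprn_ge0 _ L0) H0 b1B Hb.
  apply: SB_le (SB_eq _ (SB_fhat cH)); last first.
    by move=> xi; rewrite Hf sob_weightE powRr0 mulr1.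
  move=> x /=; rewrite addr0 -natrM powR_mulrn//.
  have [h|h] := ltP 2 (enorm x).
    rewrite H0// cabs0 !mulr_ge0 ?expR_ge0 ?exprn_ge0//.
      by rewrite invr_ge0 ltW// integral_gq_gt0.
    have := exp0 x b1 b B b1B b1b; have /andP[h1 _] := b1B x => /(le_trans h1).
    by rewrite pmulr_rge0 ?invr_gt0 ?integral_gq_gt0.
  apply: le_trans (Hb x) _.
  have -> : expR 1 * (\int[mu n]_y (gq y))^-1 * Lam ^+ (2 * l) * (expR (- (enorm x / 2)) * b x) =
    Lam ^+ (2 * l) * (expR (1 - enorm x / 2) * ((\int[mu n]_y (gq y))^-1 * b x)).
    by rewrite expRD; ring.
  rewrite ler_wpM2l ?exprn_ge0//; apply: le_trans (exp0 x b1 b B b1B b1b) _.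
  rewrite ler_peMl//.
    by have /andP[h1 _] := b1B x; exact: le_trans (exp0 x b1 b B b1B b1b).
  by rewrite -[leLHS]expR0 ler_expR; lra.
have {}al0 : 0 < al by rewrite lt_neqAle eq_sym alN.
have [I I0 ker] := @powR_kernel R al (introT andP (conj al0 al1)).
pose cn : R := 2 * expR 1 * Num.sqrt (4 * pi) ^- n.
pose J1 : R := \int[prodm leb leb]_p k1 al p.
pose J2 : R := \int[leb]_p k2 al p.
have cn0 : 0 <= cn.
  by rewrite /cn mulr_ge0 ?mulr_ge0 ?expR_ge0// invr_ge0 exprn_ge0// sqrtr_ge0.
have J10 : 0 <= J1 by apply: Rintegral_ge0 => p _; exact: k1_ge0.
have J20 : 0 <= J2 by apply: Rintegral_ge0 => p _; exact: k2_ge0.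
exists (I^-1 * (cn * J1 + 2 * (cn * J2))).
  by rewrite mulr_ge0 ?invr_ge0 ?(ltW I0)// addr_ge0 ?mulr_ge0.
move=> F H b1 b Lam B L1 HH mb1 b1B b1b.
have Lp : 0 < Lam by exact: lt_le_trans ltr01 L1.
have L0 : 0 <= Lam by exact: ltW.
have [mH H0 Hb Hf] := HH l (leqnSn l).
have [mH' H0' Hb' Hf'] := HH l.+1 (leqnn _).
have cH := suppcig b1 B (H l) _ mH (exprn_ge0 _ L0) H0 b1B Hb.
have cH' := suppcig b1 B (H l.+1) _ mH' (exprn_ge0 _ L0) H0' b1B Hb'.
have mrho d (T : measurableType d) (f : T -> R) : measurable_fun setT f ->
    measurable_fun setT (fun p => Num.sqrt (f p) / Lam).
  move=> mf; apply: measurable_funM => //; apply: (@measurableT_comp _ _ _ _ _ _ (@Num.sqrt R)) => //.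
  by apply: continuous_measurable_fun; exact: sqrt_continuous.
have mexp : measurable_fun (setT : set (measurableTypeR R)) (fun x : R => expR x) by exact: measurable_expR.
have mexp2 : measurable_fun (setT : set (measurableTypeR R)) (fun x : R => 2 * expR x).
  exact: measurable_funM.
(* The half x < 0 carries the extra factor w and therefore acts on [H l.+1]; the two terms from x >=
   0 act on [H l]. *)
have S1 := SB_heat (rig_k1 al1) (@k1_ge0 _ al) (mrho _ _ _ (@measurable_r1 R)) cH' (exprn_ge0 _ L0) Hb' H0' mb1 b1B b1b.
have S2 := SB_heat (rig_k2 al0) (@k2_ge0 _ al) (mrho _ _ _ mexp) cH (exprn_ge0 _ L0) Hb H0 mb1 b1B b1b.
have S3 := SB_heat (rig_k2 al0) (@k2_ge0 _ al) (mrho _ _ _ mexp2) cH (exprn_ge0 _ L0) Hb H0 mb1 b1B b1b.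
(* Normalises the kernel formula and undoes the scaling of w by Lam^2; the further [Lam ^- 2] in
   front of [S1] cancels the two extra derivatives of [H l.+1]. *)
pose z := powR Lam (2 * al) / I.
have z0 : 0 <= z by rewrite divr_ge0 ?powR_ge0 ?ltW.
have SS := SB_add (SB_scale (z * Lam ^- 2)%:C%C S1) (SB_add (SB_scale z%:C%C S2) (SB_scale (- z)%:C%C S3)).
apply: SB_le (SB_eq _ SS).
  move=> x; rewrite -/J1 -/J2 -/cn !cabsR normrN !ger0_norm//; last first.
    by rewrite mulr_ge0// invr_ge0 exprn_ge0.
  have -> : powR Lam (2 * (l%:R + al)) = Lam ^+ (2 * l) * powR Lam (2 * al).
    rewrite mulrDr powRD; last by apply/implyP => _; rewrite gt_eqF.
    by rewrite -natrM powR_mulrn.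
  rewrite /z mulnS exprD.
  have LL : Lam ^+ 2 != 0 by rewrite expf_neq0 ?gt_eqF.
  have II : I != 0 by rewrite gt_eqF.
  rewrite le_eqVlt; apply/orP; left; apply/eqP.
  move: LL II; move: (Lam ^+ 2) (Lam ^+ (2 * l)) (powR Lam _) (expR (- _)) (b x) => L2 L2l L2a e bx LL II.
  by field; rewrite LL II.
move=> xi; have W0 := heat_w_gt0 xi; set W := heat_w xi in W0 *.
have LL : Lam ^+ 2 != 0 by rewrite expf_neq0 ?gt_eqF.
have II : I != 0 by rewrite gt_eqF.
rewrite sob_weightE -/W Hf Hf' -/W.
set A1 := \int[prodm leb leb]_p (k1 al p * expR (- (W * (Num.sqrt (r1 p) / Lam) ^+ 2))).
set A2 := \int[leb]_p (k2 al p * expR (- (W * (Num.sqrt (expR p) / Lam) ^+ 2))).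
set A3 := \int[leb]_p (k2 al p * expR (- (W * (Num.sqrt (2 * expR p) / Lam) ^+ 2))).
have comb (a1 a2 a3 v w p : R) (f : R[i]) : z * Lam ^- 2 * a1 * v + (z * a2 - z * a3) * w = p ->
    (z / Lam ^+ 2)%:C%C * (a1%:C%C * (v%:C%C * f)) + (z%:C%C * (a2%:C%C * (w%:C%C * f)) +
      (- z)%:C%C * (a3%:C%C * (w%:C%C * f))) = p%:C%C * f.
  by move=> <-; rewrite !mulrA -!realCM -!mulrDl -!rmorphD/=; congr (_%:C%C * _); ring.
apply: comb.
have zz : 0 < W / Lam ^+ 2 by rewrite divr_gt0// exprn_gt0.
have := ker _ zz.
have Z (r : R) : 0 <= r -> expR (- (W / Lam ^+ 2 * r)) = expR (- (W * (Num.sqrt r / Lam) ^+ 2)).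
  by move=> r0; rewrite expr_div_n sqr_sqrtr// mulrAC mulrA.
under eq_Rintegral do rewrite Z ?(ltW (r1_gt0 _))//.
under [X in _ + X - _]eq_Rintegral do rewrite Z ?expR_ge0//.
under [X in _ - X]eq_Rintegral do rewrite Z ?mulr_ge0 ?expR_ge0//.
rewrite -/A1 -/A2 -/A3 => E.
have -> : powR W al = powR Lam (2 * al) * powR (W / Lam ^+ 2) al.
  have -> : powR Lam (2 * al) = powR (Lam ^+ 2) al by rewrite -powR_mulrn// -powRrM.
  by rewrite -powRM ?exprn_ge0 ?(ltW zz)//; congr powR; rewrite mulrC divfK.
have -> : powR (W / Lam ^+ 2) al = I^-1 * (I * powR (W / Lam ^+ 2) al) by rewrite mulKf.
rewrite E /z (exprS W l); move: LL II.
move: (Lam ^+ 2) (W ^+ l) (powR Lam _) => L2 Wl L2a LL II.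
by field; rewrite LL II.
Qed.

End Bessel.

(** * Differentiable families and Bessel potentials *)

Section Taylor.
Context {R : realType}.
Variable n : nat.
Implicit Types (F G : V R n -> R[i]) (j k : 'I_n).

Definition locbd F := forall r : R, exists B, forall x : V R n, enorm x <= r -> cabs (F x) <= B.

Definition bvec j : V R n := delta_mx 0 j.

(** [F'] is the partial derivative of [F] along the [j]-th axis, with a
    second-order remainder that is uniform on bounded sets. *)
Definition isD j F F' := forall r : R, exists B, forall (x : V R n) (h : R),
  enorm x <= r -> `|h| <= 1 ->
  cabs (F (x + h *: bvec j) - F x - h%:C%C * F' x) <= B * h ^+ 2.

Lemma locbd_cst z : locbd (fun _ => z).
Proof. by move=> r; exists (cabs z). Qed.

Lemma locbdD F G : locbd F -> locbd G -> locbd (fun x => F x + G x).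
Proof.
move=> bF bG r; have [B1 h1] := bF r; have [B2 h2] := bG r; exists (B1 + B2) => x xr.
by apply: le_trans (cabsD _ _) _; rewrite lerD ?h1 ?h2.
Qed.

Lemma locbdM F G : locbd F -> locbd G -> locbd (fun x => F x * G x).
Proof.
move=> bF bG r; have [B1 h1] := bF r; have [B2 h2] := bG r; exists (B1 * B2) => x xr.
by rewrite cabsM ler_pM ?cabs_ge0 ?h1 ?h2.
Qed.

Lemma isD_cst j z : isD j (fun _ => z) (fun _ => 0).
Proof. by move=> r; exists 0 => x h _ _; rewrite mulr0 subr0 subrr cabs0 mul0r. Qed.

Lemma isDD j F F' G G' : isD j F F' -> isD j G G' ->
  isD j (fun x => F x + G x) (fun x => F' x + G' x).
Proof.
move=> dF dG r; have [B1 h1] := dF r; have [B2 h2] := dG r; exists (B1 + B2) => x h xr hr.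
have -> : F (x + h *: bvec j) + G (x + h *: bvec j) - (F x + G x) - h%:C%C * (F' x + G' x) =
  (F (x + h *: bvec j) - F x - h%:C%C * F' x) + (G (x + h *: bvec j) - G x - h%:C%C * G' x) by ring.
by apply: le_trans (cabsD _ _) _; rewrite mulrDl lerD ?h1 ?h2.
Qed.

Lemma isD_lip j F F' : locbd F' -> isD j F F' -> forall r : R, exists2 B, 0 <= B &
  forall (x : V R n) (h : R), enorm x <= r -> `|h| <= 1 ->
  cabs (F (x + h *: bvec j) - F x) <= B * `|h|.
Proof.
move=> bF dF r; have [B1 h1] := dF r; have [B2 h2] := bF r; exists (`|B1| + `|B2|).
  by rewrite addr_ge0.
move=> x h xr hr.
have -> : F (x + h *: bvec j) - F x =
  (F (x + h *: bvec j) - F x - h%:C%C * F' x) + h%:C%C * F' x by ring.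
apply: le_trans (cabsD _ _) _; rewrite mulrDl lerD//.
  apply: le_trans (h1 x h xr hr) _; apply: (@le_trans _ _ (`|B1| * h ^+ 2)).
    by rewrite ler_wpM2r ?sqr_ge0 ?ler_norm.
  by rewrite ler_wpM2l// -real_normK ?num_real// expr2 ler_piMl.
by rewrite cabsM cabsR mulrC ler_wpM2r// (le_trans (h2 x xr)) ?ler_norm.
Qed.

Lemma isDM j F F' G G' : locbd F -> locbd F' -> locbd G -> locbd G' ->
  isD j F F' -> isD j G G' ->
  isD j (fun x => F x * G x) (fun x => F' x * G x + F x * G' x).
Proof.
move=> bF bF' bG bG' dF dG r.
have [B1 h1] := dF r; have [B2 h2] := dG r.
have [A1 k1] := bF r; have [A2 k2] := bG r.
have [L1 L10 l1] := isD_lip bF' dF r; have [L2 L20 l2] := isD_lip bG' dG r.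
exists (B1 * A2 + A1 * B2 + L1 * L2) => x h xr hr.
set y := x + h *: bvec j.
have -> : F y * G y - F x * G x - h%:C%C * (F' x * G x + F x * G' x) =
  (F y - F x - h%:C%C * F' x) * G x + F x * (G y - G x - h%:C%C * G' x) +
  (F y - F x) * (G y - G x) by ring.
apply: le_trans (cabsD _ _) _; rewrite [leRHS]mulrDl lerD//.
  apply: le_trans (cabsD _ _) _; rewrite !cabsM [leRHS]mulrDl lerD//.
    by rewrite mulrAC ler_pM ?cabs_ge0 ?h1 ?k2.
  by rewrite -mulrA ler_pM ?cabs_ge0 ?h2 ?k1.
have -> : L1 * L2 * h ^+ 2 = (L1 * `|h|) * (L2 * `|h|).
  by rewrite -[in LHS]real_normK ?num_real//; ring.
by rewrite cabsM ler_pM ?cabs_ge0 ?l1 ?l2.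
Qed.

Lemma isD_cexp j (q l : V R n -> R[i]) (c : R[i]) : locbd q -> locbd l ->
  (forall (x : V R n) (h : R), q (x + h *: bvec j) = q x + h%:C%C * l x + (h ^+ 2)%:C%C * c) ->
  isD j (fun x => cexp (q x)) (fun x => l x * cexp (q x)).
Proof.
move=> bq bl E r; have [B1 h1] := bq r; have [B2 h2] := bl r.
exists (expR B1 * (8 * (B2 + cabs c) ^+ 2 * expR (B2 + cabs c) + cabs c)) => x h xr hr.
rewrite E; apply: le_trans (cexp_taylor _ _ _ hr) _.
have l2 := h2 x xr; have c0 := cabs_ge0 c; have l0 := cabs_ge0 (l x).
rewrite ler_wpM2r ?sqr_ge0//; apply: ler_pM; rewrite ?cabs_ge0//.
- by rewrite addr_ge0// mulr_ge0 ?expR_ge0// mulr_ge0// sqr_ge0.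
- by rewrite cabs_cexp ler_expR (le_trans (ler_norm _))// (le_trans (normr_Re _))// h1.
rewrite lerD2r; apply: ler_pM; rewrite ?expR_ge0 ?ler_expR ?lerD2r//.
  by rewrite mulr_ge0// sqr_ge0.
by rewrite ler_wpM2l// lerXn2r ?nnegrE ?lerD2r ?addr_ge0// (le_trans l0).
Qed.

Definition ann (x : V R n) := 2^-1 <= enorm x <= 2.
Definition supp F := forall x, ~ ann x -> F x = 0.

(** The annulus is closed, so [F] vanishes near a point outside it, and the expansion leaves h F' =
    O(h^2). *)
Lemma isD_supp j F F' : isD j F F' -> supp F -> supp F'.
Proof.
move=> dF sF x nx; have [B h1] := dF (enorm x).
have [d /andP[d0 d1] hd] : exists2 d : R, 0 < d <= 1 & forall h : R, `|h| < d -> ~ ann (x + h *: bvec j).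
  have T (h : R) : enorm (x + h *: bvec j) <= enorm x + `|h|.
    by apply: le_trans (enormD _ _) _; rewrite enormZ enorm_delta mulr1.
  have T' (h : R) : enorm x - `|h| <= enorm (x + h *: bvec j).
    have := enormB x (- (h *: bvec j)).
    by rewrite opprK enormN enormZ enorm_delta mulr1.
  have [c1|c1] := ltP (enorm x) 2^-1.
    exists (Num.min 1 (2^-1 - enorm x)); first by rewrite lt_min ltr01 subr_gt0 c1 ge_min lexx.
    by move=> h; rewrite lt_min => /andP[_ hx] /andP[+ _]; have := T h; lra.
  have c2 : 2 < enorm x by rewrite ltNge; apply/negP => c2; apply: nx; rewrite /ann c1.
  exists (Num.min 1 (enorm x - 2)); first by rewrite lt_min ltr01 subr_gt0 c2 ge_min lexx.
  by move=> h; rewrite lt_min => /andP[_ hx] /andP[_ +]; have := T' h; lra.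
(* The second summand covers |h| >= d, where |h| is at most h^2 / d. *)
apply: (@small_quadratic_eq0 _ _ (`|B| + cabs (F' x) / d)) => h hr.
have s0 := sqr_ge0 h; have f0 := cabs_ge0 (F' x).
rewrite mulrDl; have [hs|hs] := ltP `|h| d.
  have := h1 x h (lexx _) hr; rewrite (sF _ nx) (sF _ (hd h hs)) !sub0r oppr0 add0r cabsN => /le_trans; apply.
  apply: ler_wpDr; first by rewrite mulr_ge0// divr_ge0// ltW.
  by rewrite ler_wpM2r// ler_norm.
apply: ler_wpDl; first by rewrite mulr_ge0.
rewrite cabsM cabsR mulrC -mulrA ler_wpM2l// mulrC ler_pdivlMr//.
by rewrite -[leRHS]real_normK ?num_real// expr2 ler_wpM2l.
Qed.

Lemma pdecay_ge0 (x : V R n) : 0 <= pdecay x.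
Proof. by rewrite /pdecay invr_ge0 exprn_ge0// addr_ge0// sqr_ge0. Qed.

Lemma enorm_pdecay (x : V R n) (r : R) : 0 <= r -> enorm x <= r ->
  1 <= (1 + r ^+ 2) ^+ n * pdecay x.
Proof.
move=> r0 xr; rewrite /pdecay ler_pdivlMr ?mul1r.
  by rewrite lerXn2r ?nnegrE ?addr_ge0 ?sqr_ge0// lerD2l lerXn2r ?nnegrE ?enorm_ge0.
by rewrite exprn_gt0// ltr_wpDr ?sqr_ge0.
Qed.

Lemma supp_cig F : cmeas F -> locbd F -> supp F -> cig (mu n) F.
Proof.
move=> mF bF sF; have [B hB] := bF 2.
apply: (cig_le mF (rigZ (`|B| * (1 + 2 ^+ 2) ^+ n) (@rig_pdecay R n))) => x.
have [h|h] := leP (enorm x) 2; last first.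
  rewrite sF; last by move=> /andP[_]; rewrite leNgt h.
  by rewrite cabs0 !mulr_ge0 ?pdecay_ge0 ?exprn_ge0 ?addr_ge0 ?sqr_ge0.
apply: le_trans (hB x h) _; apply: le_trans (ler_norm _) _.
by rewrite -mulrA ler_peMr// enorm_pdecay.
Qed.

(** Integration by parts by translation: shifting [F] by h multiplies its transform by a character,
    and the first-order terms in h of the two descriptions must agree. *)
Lemma isD_fhat j F F' xi : cmeas F -> cmeas F' -> locbd F -> locbd F' -> supp F ->
  isD j F F' -> fhat F' xi = Complex 0 (2 * pi * xi ord0 j) * fhat F xi.
Proof.
move=> mF mF' bF bF' sF dF; have sF' := isD_supp dF sF.
have cF := supp_cig mF bF sF; have cF' := supp_cig mF' bF' sF'.
(* A function supported in |x| <= 2, moved by |h| <= 1, lives in |x| <= 3. *)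
have [B hB] := dF 3.
pose c : R[i] := Complex 0 (2 * pi * xi ord0 j).
apply/esym/eqP; rewrite -subr_eq0; apply/eqP.
have mt (h : R) : cmeas (fun x : V R n => F (x + h *: bvec j)).
  exact: (cmeas_comp mF (measurable_shift _)).
have E (h : R) : cI (mu n) (fun x => F (x + h *: bvec j) * chr xi x) = cexp (h%:C%C * c) * fhat F xi.
  rewrite (fhatE xi cF) -(cIZ _ (cig_chr xi cF)).
  rewrite -[RHS](cI_shift (h *: bvec j)); last first.
    by apply: cmeasM; [exact: cmeas_cst|exact: cig_meas (cig_chr xi cF)].
  apply: cI_eq => x; rewrite chrD mulrCA; congr (_ * _).
  rewrite mulrCA -[LHS]mulr1; congr (_ * _).
  rewrite /chr (dotpC _ xi) dotpZr dotp_delta /cexp /c/= !mul0r mulr0 subr0 expR0 mul1r addr0 -expiD.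
  by rewrite (_ : _ - _ = 0 :> R) ?expi0//; ring.
have K := cI_taylor (cig_chr xi (cig_shift _ cF)) (cig_chr xi cF) (cig_chr xi cF')
  (rigZ (`|B| * (1 + 3 ^+ 2) ^+ n) (@rig_pdecay R n)).
set D := \int[mu n]_t _ in K.
pose A := 8 * (cabs c + cabs 0) ^+ 2 * expR (cabs c + cabs 0) + cabs (0 : R[i]).
apply: (@small_quadratic_eq0 _ _ (2 * D + A * cabs (fhat F xi))) => h hr.
have {}K := K (h *: bvec j) h; rewrite E -(fhatE xi cF) -(fhatE xi cF') in K.
have T : cabs (cexp (h%:C%C * c) - 1 - h%:C%C * c) <= A * h ^+ 2.
  have := cexp_taylor 0 c 0 hr; rewrite mulr0 addr0 add0r cexp0 mulr1 cabs1 mul1r; exact.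
have -> : h%:C%C * (c * fhat F xi - fhat F' xi) =
  (cexp (h%:C%C * c) * fhat F xi - fhat F xi - h%:C%C * fhat F' xi) -
  (cexp (h%:C%C * c) - 1 - h%:C%C * c) * fhat F xi by ring.
apply: le_trans (cabsB _ _) _; rewrite [leRHS]mulrDl; apply: lerD; last first.
  by rewrite cabsM mulrAC ler_wpM2r ?cabs_ge0.
apply: K => x.
have -> : F (x + h *: bvec j) * chr xi x - F x * chr xi x - h%:C%C * (F' x * chr xi x) =
  (F (x + h *: bvec j) - F x - h%:C%C * F' x) * chr xi x by ring.
rewrite cabsM cabs_chr mulr1.
have p0 := pdecay_ge0 x.
have [x3|x3] := leP (enorm x) 3.
  apply: le_trans (hB x h x3 hr) _; rewrite ler_wpM2r ?sqr_ge0//.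
  by apply: le_trans (ler_norm _) _; rewrite -mulrA ler_peMr// enorm_pdecay.
rewrite !sF ?sF' ?mulr0 ?subr0 ?subrr ?cabs0.
- apply: mulr_ge0 (sqr_ge0 _); apply: mulr_ge0 p0; exact: mulr_ge0.
- by move=> /andP[_]; lra.
- by move=> /andP[_]; lra.
move=> /andP[_]; have := enormB x (- (h *: bvec j)).
by rewrite opprK enormN enormZ enorm_delta mulr1; lra.
Qed.

End Taylor.

(** * Calculus of uniformly smooth families *)

Section Family.
Context {R : realType} (I : Type).
Variables (n : nat) (Z : I -> V R n -> R).
Hypothesis Z1 : forall i x, 1 <= Z i x.
Implicit Types (f g : I -> V R n -> R[i]) (e : I -> V R n -> R).

(** Families with [N] iterated partial derivatives such that the [k]-th
    derivatives are [O(Z ^ (w + k) e)] on the annulus, uniformly in the index. *)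
Fixpoint Fam (N w : nat) e f : Prop :=
  [/\ forall i, cmeas (f i), forall i, locbd (f i),
      exists2 C, 0 <= C & forall i x, ann x -> cabs (f i x) <= C * Z i x ^+ w * e i x &
      if N is N'.+1 then forall j, exists2 f', (forall i, isD j (f i) (f' i)) & Fam N' w.+1 e f'
      else True].

Definition one_env : I -> V R n -> R := fun _ _ => 1.

Lemma Fam_base N w e f : Fam N w e f ->
  [/\ forall i, cmeas (f i), forall i, locbd (f i) &
      exists2 C, 0 <= C & forall i x, ann x -> cabs (f i x) <= C * Z i x ^+ w * e i x].
Proof. by case: N => [|N] []. Qed.

Lemma FamS N w e f : Fam N.+1 w e f -> Fam N w e f.
Proof.
elim: N w f => [|N IH] w f [m1 b1 c1 d1]; split => // j.
by have [f' d' F'] := d1 j; exists f' => //; exact: IH.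
Qed.

Lemma FamSw N w e f : (forall i x, 0 <= e i x) -> Fam N w e f -> Fam N w.+1 e f.
Proof.
move=> e0; have Z0 i x : 0 <= Z i x by exact: le_trans ler01 (Z1 i x).
elim: N w f => [|N IH] w f [m1 b1 [C C0 c1] d1]; split => //.
- exists C => // i x ax; apply: le_trans (c1 i x ax) _.
  by rewrite ler_wpM2r// ler_wpM2l// exprS ler_peMl ?exprn_ge0.
- exists C => // i x ax; apply: le_trans (c1 i x ax) _.
  by rewrite ler_wpM2r// ler_wpM2l// exprS ler_peMl ?exprn_ge0.
by move=> j; have [f' d' F'] := d1 j; exists f' => //; exact: IH.
Qed.

Lemma FamD N w e f g : Fam N w e f -> Fam N w e g -> Fam N w e (fun i x => f i x + g i x).
Proof.
elim: N w f g => [|N IH] w f g [m1 b1 [C C0 c1] d1] [m2 b2 [D D0 c2] d2].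
  split=> //; [by move=> i; exact: cmeasD|by move=> i; exact: locbdD|].
  exists (C + D); rewrite ?addr_ge0// => i x ax.
  by apply: le_trans (cabsD _ _) _; rewrite !mulrDl lerD ?c1 ?c2.
split=> //; [by move=> i; exact: cmeasD|by move=> i; exact: locbdD| |].
  exists (C + D); rewrite ?addr_ge0// => i x ax.
  by apply: le_trans (cabsD _ _) _; rewrite !mulrDl lerD ?c1 ?c2.
move=> j; have [f' d' F'] := d1 j; have [g' k' G'] := d2 j.
by exists (fun i x => f' i x + g' i x); [move=> i; exact: isDD|exact: IH].
Qed.

Lemma FamM N w w' e e' f g : (forall i x, 0 <= e i x) -> (forall i x, 0 <= e' i x) ->
  Fam N w e f -> Fam N w' e' g ->
  Fam N (w + w') (fun i x => e i x * e' i x) (fun i x => f i x * g i x).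
Proof.
move=> e0 e'0; have Z0 i x : 0 <= Z i x by exact: le_trans ler01 (Z1 i x).
have B w1 w2 f1 f2 : (exists2 C, 0 <= C & forall i x, ann x -> cabs (f1 i x) <= C * Z i x ^+ w1 * e i x) ->
    (exists2 C, 0 <= C & forall i x, ann x -> cabs (f2 i x) <= C * Z i x ^+ w2 * e' i x) ->
    exists2 C, 0 <= C & forall i x, ann x ->
    cabs (f1 i x * f2 i x) <= C * Z i x ^+ (w1 + w2) * (e i x * e' i x).
  move=> [C C0 c1] [D D0 c2]; exists (C * D); rewrite ?mulr_ge0// => i x ax.
  rewrite cabsM (_ : C * D * _ * _ = (C * Z i x ^+ w1 * e i x) * (D * Z i x ^+ w2 * e' i x)).
    by rewrite ler_pM ?cabs_ge0 ?c1 ?c2.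
  by rewrite exprD; ring.
elim: N w w' f g => [|N IH] w w' f g Ff Fg; have [m1 b1 c1] := Fam_base Ff; have [m2 b2 c2] := Fam_base Fg.
  by split=> //; [by move=> i; exact: cmeasM|by move=> i; exact: locbdM|exact: B].
have Ff' := FamS Ff; have Fg' := FamS Fg.
have [_ _ _ d1] := Ff; have [_ _ _ d2] := Fg.
split=> //; [by move=> i; exact: cmeasM|by move=> i; exact: locbdM|exact: B|].
move=> j; have [f' d' F'] := d1 j; have [g' k' G'] := d2 j.
have [_ b1' _] := @Fam_base N _ _ _ F'; have [_ b2' _] := @Fam_base N _ _ _ G'.
exists (fun i x => f' i x * g i x + f i x * g' i x); first by move=> i; exact: isDM.
apply: FamD; first by rewrite -addSn; exact: IH.
by rewrite -addnS; exact: IH.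
Qed.

Lemma Fam_cst N w (c : I -> R[i]) : (exists2 C, 0 <= C & forall i x, cabs (c i) <= C * Z i x ^+ w) ->
  Fam N w one_env (fun i _ => c i).
Proof.
have Z0 i x : 0 <= Z i x by exact: le_trans ler01 (Z1 i x).
elim: N w c => [|N IH] w c hc.
  split=> //; first by move=> i; exact: locbd_cst.
  by have [C C0 h] := hc; exists C => // i x _; rewrite mulr1.
split=> //; [by move=> i; exact: locbd_cst| |].
  by have [C C0 h] := hc; exists C => // i x _; rewrite mulr1.
move=> j; exists (fun _ _ => 0); first by move=> i; exact: isD_cst.
by apply: (IH _ (fun _ => 0)); exists 0 => // i x; rewrite cabs0 mul0r.
Qed.

Lemma Fam_scale N w e f (z : R[i]) : (forall i x, 0 <= e i x) ->
  Fam N w e f -> Fam N w e (fun i x => z * f i x).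
Proof.
move=> e0 Ff; have H0 : Fam N 0 one_env (fun _ _ => z).
  by apply: Fam_cst; exists (cabs z); [exact: cabs_ge0|move=> i x; rewrite expr0 mulr1].
have one0 i x : 0 <= one_env i x by exact: ler01.
have := FamM one0 e0 H0 Ff; rewrite add0n; congr Fam.
by apply/funext => i; apply/funext => x; rewrite /one_env mul1r.
Qed.

Lemma Fam0 N w e : Fam N w e (fun _ _ => 0).
Proof.
elim: N w => [|N IHN] w.
  split=> //; first by move=> i; exact: locbd_cst.
  by exists 0 => // i x _; rewrite cabs0 !mul0r.
split=> //; [by move=> i; exact: locbd_cst| |].
  by exists 0 => // i x _; rewrite cabs0 !mul0r.
by move=> j; exists (fun _ _ => 0) => // i; exact: isD_cst.
Qed.

Lemma Fam_sum N w e (J : Type) (r : seq J) (f : J -> I -> V R n -> R[i]) :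
  (forall k, Fam N w e (f k)) ->
  Fam N w e (fun i x => \sum_(k <- r) f k i x).
Proof.
move=> Ff; elim: r => [|k r IH].
  rewrite (_ : (fun i x => _) = (fun i x => 0)); first exact: Fam0.
  by apply/funext => i; apply/funext => x; rewrite big_nil.
rewrite (_ : (fun i x => _) = (fun i x => f k i x + \sum_(k <- r) f k i x)); first exact: FamD.
by apply/funext => i; apply/funext => x; rewrite big_cons.
Qed.

(** [g] is f minus the sum of its second pure derivatives. This consumes two derivatives and adds
    two powers of [Z]; lower-order terms are raised to the same weight by [Z >= 1]. *)
Lemma bessel_step N w e f : (forall i x, 0 <= e i x) -> Fam N.+2 w e f -> (forall i, supp (f i)) ->
  exists g, [/\ Fam N w.+2 e g, forall i, supp (g i) &
    forall i xi, fhat (g i) xi = (heat_w xi)%:C%C * fhat (f i) xi].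
Proof.
move=> e0 Ff sf; have [mf bf _] := Fam_base Ff; have [_ _ _ df] := Ff.
have D j : exists g : I -> V R n -> R[i], [/\ Fam N w.+2 e g, forall i, supp (g i) &
    forall i xi, fhat (g i) xi = (- (4 * pi ^+ 2 * xi ord0 j ^+ 2))%:C%C * fhat (f i) xi].
  have [f' d' F'] := df j; have [mf' bf' _] := @Fam_base N.+1 w.+1 e f' F'.
  have [_ _ _ /(_ j) [g d'' G]] := F'; have [mg bg _] := Fam_base G.
  have sf' i := isD_supp (d' i) (sf i); exists g; split=> // i.
    exact: isD_supp (d'' i) (sf' i).
  move=> xi; rewrite (isD_fhat xi _ _ _ _ (sf' i) (d'' i))//.
  rewrite (isD_fhat xi _ _ _ _ (sf i) (d' i))// mulrA; congr (_ * _).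
  by apply: complexP => /=; ring.
have [g gP] := choice D.
pose G i x := f i x + -1 * \sum_(j < n) g j i x.
have Fg : Fam N w.+2 e G.
  apply: FamD; first by do 2 apply: FamSw => //; do 2 apply: FamS.
  by apply: Fam_scale => //; apply: Fam_sum => // j; have [] := gP j.
exists G; split=> // i.
  move=> x nx; rewrite /G (sf i x nx) big1 ?mulr0 ?addr0// => j _.
  by have [_ sg _] := gP j; exact: sg.
have cg j : cig (mu n) (g j i).
  have [Gj sg _] := gP j; have [mg bg _] := Fam_base Gj; exact: supp_cig.
have cf : cig (mu n) (f i) by exact: supp_cig.
have cG : cig (mu n) (G i) by apply: cigD => //; apply: cigZ; exact: cig_sum.
move=> xi; rewrite (fhatE xi cG).
rewrite (@cI_eq _ _ _ _ _ (fun x => f i x * chr xi x + -1 * \sum_(j < n) (g j i x * chr xi x))); last first.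
  by move=> x; rewrite /G mulrDl -mulrA mulr_suml.
have cgx j := cig_chr xi (cg j).
rewrite (cID (cig_chr xi cf) (cigZ _ (cig_sum _ cgx))) (cIZ _ (cig_sum _ cgx)) (cI_sum _ cgx).
rewrite -(fhatE xi cf) (eq_bigr (fun j : 'I_n => (- (4 * pi ^+ 2 * xi ord0 j ^+ 2))%:C%C * fhat (f i) xi)); last first.
  by move=> j _; have [_ _ hg] := gP j; rewrite -(fhatE xi (cg j)).
rewrite -mulr_suml mulrA -[X in X + _]mul1r -mulrDl; congr (_ * _).
rewrite /heat_w enorm_sqr /dotp mulN1r -rmorph_sum/= sumrN rmorphN/= opprK mulr_sumr rmorphD/=.
by congr (1 + _%:C%C); apply: eq_bigr => j _; rewrite expr2.
Qed.

Lemma bessel_iter l e f : (forall i x, 0 <= e i x) -> Fam (2 * l) 0 e f -> (forall i, supp (f i)) ->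
  exists H : nat -> I -> V R n -> R[i], forall k, (k <= l)%N -> [/\ Fam (2 * (l - k)) (2 * k) e (H k),
    forall i, supp (H k i) & forall i xi, fhat (H k i) xi = (heat_w xi ^+ k)%:C%C * fhat (f i) xi].
Proof.
move=> e0 Ff sf.
have Sk k : exists h : I -> V R n -> R[i], (k <= l)%N -> [/\ Fam (2 * (l - k)) (2 * k) e h,
    forall i, supp (h i) & forall i xi, fhat (h i) xi = (heat_w xi ^+ k)%:C%C * fhat (f i) xi].
  elim: k => [|k [h hP]].
    by exists f => _; rewrite muln0 subn0; split=> // i xi; rewrite expr0 mul1r.
  (* Beyond [l] nothing is claimed; [h] only fills the slot that [choice] requires. *)
  have [kl|kl] := leqP k.+1 l; last by exists h.
  have [h1 h2 h3] := hP (ltnW kl).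
  have e1 : (2 * (l - k) = (2 * (l - k.+1)).+2)%N.
    by rewrite -(subnSK kl) mulnS.
  rewrite e1 in h1; have [g [g1 g2 g3]] := bessel_step e0 h1 h2.
  exists g; rewrite mulnS; split=> // i xi.
  by rewrite g3 h3 mulrA -realCM exprS.
by have [H HP] := choice Sk; exists H.
Qed.

End Family.

(** * Derivatives of the transform of a rapidly decaying function *)

Section WeightedFourier.
Context {R : realType}.
Variable n : nat.
Implicit Types T : V R n -> R[i].

(** Finite moments of every order are stable under multiplication by a coordinate, hence under
    differentiating the transform. This class suffices for [fhat Theta] without showing that the
    transform is again Schwartz. *)
Definition wint T := cmeas T /\ forall k, rig (mu n) (fun x => (1 + enorm x ^+ 2) ^+ k * cabs (T x)).

Lemma measurable_weight k : measurable_fun setT (fun x : V R n => (1 + enorm x ^+ 2) ^+ k).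
Proof.
by apply: measurable_funX; apply: measurable_funD => //; apply: measurable_funX; exact: measurable_enorm.
Qed.

Lemma schwartz_wint (f : 'rV[R]_n -> R[i]) : schwartz f -> wint f.
Proof.
move=> sf; split; first exact: schwartz_meas.
move=> k; have [C C0 h] := schwartz_decay k sf.
apply: (rig_le _ (rigZ C (@rig_pdecay R n))).
  by apply: measurable_funM; [exact: measurable_weight|exact/cmeas_cabs/schwartz_meas].
by move=> x; rewrite ger0_norm ?mulr_ge0 ?cabs_ge0// exprn_ge0// addr_ge0// sqr_ge0.
Qed.

Lemma wint_cig T : wint T -> cig (mu n) T.
Proof.
move=> [mT /(_ 0)]; under [X in rig _ X]eq_fun do rewrite expr0 mul1r.
by move=> h; apply: (cig_le mT h).
Qed.

Lemma coord_le_weight (j : 'I_n) (x : V R n) : x ord0 j ^+ 2 <= 1 + enorm x ^+ 2.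
Proof.
rewrite -real_normK ?num_real//; apply: (@le_trans _ _ (enorm x ^+ 2)); last by rewrite lerDr.
by rewrite lerXn2r ?nnegrE ?enorm_ge0// enorm_coord.
Qed.

Lemma wint_coord T (j : 'I_n) (c : R) : wint T ->
  wint (fun x => Complex 0 (c * x ord0 j) * T x).
Proof.
move=> [mT iT].
have m1 : cmeas (fun x : V R n => Complex 0 (c * x ord0 j) * T x).
  apply: cmeasM => //; split; first exact: measurable_cst.
  by apply: measurable_funM => //; exact: measurable_coord.
split=> // k; apply: (rig_le _ (rigZ `|c| (iT k.+1))).
  by apply: measurable_funM; [exact: measurable_weight|exact: cmeas_cabs].
move=> x; have w0 : 0 <= 1 + enorm x ^+ 2 by rewrite addr_ge0// sqr_ge0.
rewrite ger0_norm ?mulr_ge0 ?cabs_ge0 ?exprn_ge0// cabsM.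
have -> : cabs (Complex 0 (c * x ord0 j)) = `|c| * `|x ord0 j|.
  by rewrite /cabs/= (expr2 0) mul0r add0r sqrtr_sqr normrM.
set W := 1 + enorm x ^+ 2 in w0 *; rewrite (exprS W k).
rewrite [leLHS](_ : _ = W ^+ k * cabs (T x) * (`|c| * `|x ord0 j|)); last by ring.
rewrite [leRHS](_ : _ = W ^+ k * cabs (T x) * (`|c| * W)); last by ring.
rewrite ler_wpM2l ?mulr_ge0 ?cabs_ge0 ?exprn_ge0// ler_wpM2l// /W; have := coord_le_weight j x; have := sqr_ge0 (1 - `|x ord0 j|).
rewrite -(real_normK (num_real (x ord0 j))) sqrrB; have := sqr_ge0 (enorm x); nra.
Qed.

Lemma cabs_expi_taylor (b : R) : cabs (expi b - 1 - Complex 0 b) <= 3 * b ^+ 2.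
Proof.
have -> : expi b - 1 - Complex 0 b = Complex (cos b - 1) (sin b - b).
  by apply: complexP => /=; ring.
apply: le_trans (cabs_le_ReIm _) _ => /=.
have := cos_sub1_le b; have := sin_subx_le b; lra.
Qed.

Lemma isD_fhat_wint T (j : 'I_n) : wint T ->
  isD j (fhat T) (fhat (fun x => Complex 0 (- (2 * pi) * x ord0 j) * T x)).
Proof.
move=> wT; have wT' := wint_coord j (- (2 * pi)) wT; have [mT iT] := wT.
have cT := wint_cig wT; have cT' := wint_cig wT'.
pose A : R := 3 * (2 * pi) ^+ 2; have A0 : 0 <= A by rewrite mulr_ge0// sqr_ge0.
move=> r; exists (2 * (\int[mu n]_x (A * ((1 + enorm x ^+ 2) ^+ 1 * cabs (T x))))) => xi h _ h1.
rewrite (fhatE xi cT) (fhatE xi cT') (fhatE (xi + h *: bvec j) cT).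
apply: (cI_taylor (cig_chr _ cT) (cig_chr _ cT) (cig_chr _ cT') (rigZ A (iT 1))) => x.
pose b := - (2 * pi * h * x ord0 j).
have E : chr (h *: bvec j) x = expi b.
  by rewrite /chr dotpZr dotp_delta; congr expi; rewrite /b; ring.
have -> : T x * chr (xi + h *: bvec j) x - T x * chr xi x -
    h%:C%C * (Complex 0 (- (2 * pi) * x ord0 j) * T x * chr xi x) =
    T x * chr xi x * (expi b - 1 - Complex 0 b).
  rewrite chrDl E (_ : Complex 0 b = h%:C%C * Complex 0 (- (2 * pi) * x ord0 j)); first by ring.
  by apply: complexP => /=; rewrite /b; ring.
rewrite !cabsM cabs_chr mulr1.
have -> : A * ((1 + enorm x ^+ 2) ^+ 1 * cabs (T x)) * h ^+ 2 =
  cabs (T x) * (A * (1 + enorm x ^+ 2) * h ^+ 2) by rewrite expr1; ring.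
rewrite ler_wpM2l ?cabs_ge0//; apply: le_trans (cabs_expi_taylor b) _.
have -> : 3 * b ^+ 2 = A * x ord0 j ^+ 2 * h ^+ 2 by rewrite /b /A; ring.
by rewrite ler_wpM2r ?sqr_ge0// ler_wpM2l// coord_le_weight.
Qed.

Lemma Fam_fhat (I : Type) (Z : I -> V R n -> R) (Z1 : forall i x, 1 <= Z i x) N w T :
  wint T -> Fam Z N w (@one_env R I n) (fun _ => fhat T).
Proof.
have base w' T' : wint T' -> [/\ forall i : I, cmeas (fhat T' : V R n -> R[i]), forall i : I, locbd (fhat T') &
    exists2 C, 0 <= C & forall i x, ann x -> cabs (fhat T' x) <= C * Z i x ^+ w' * one_env i x].
  move=> wT; have cT := wint_cig wT; split=> [_|_|]; first exact: cmeas_fhat.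
    by have [B hB] := fhat_bounded cT; move=> r; exists B.
  have [B hB] := fhat_bounded cT; exists `|B| => // i x _; rewrite mulr1.
  apply: le_trans (hB x) _; apply: le_trans (ler_norm _) _.
  by rewrite ler_peMr// exprn_ege1.
elim: N w T => [|N IH] w T wT; have [h1 h2 h3] := base w T wT; split=> //.
move=> j; exists (fun _ => fhat (fun x => Complex 0 (- (2 * pi) * x ord0 j) * T x)).
  by move=> _; exact: isD_fhat_wint.
by apply: IH; exact: wint_coord.
Qed.

End WeightedFourier.

(** * Exponentials of quadratic polynomials *)

Section Quadratic.
Context {R : realType} (I : Type).
Variables (n : nat) (Z : I -> V R n -> R).
Hypothesis Z1 : forall i x, 1 <= Z i x.

(** The exact finite-difference identities force [q i] to be a polynomial of
    degree at most two. *)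
Record quadF (q : I -> V R n -> R[i]) := QuadF {
  qgrad : I -> 'I_n -> V R n -> R[i];
  qhess : I -> 'I_n -> 'I_n -> R[i];
  qhalf : I -> 'I_n -> R[i];
  quad_meas : forall i, cmeas (q i) /\ forall j, cmeas (qgrad i j);
  quad_locbd : forall i, locbd (q i) /\ forall j, locbd (qgrad i j);
  quad_step : forall i j (x : V R n) (h : R),
    q i (x + h *: bvec j) = q i x + h%:C%C * qgrad i j x + (h ^+ 2)%:C%C * qhalf i j;
  qgrad_step : forall i j k (x : V R n) (h : R),
    qgrad i j (x + h *: bvec k) = qgrad i j x + h%:C%C * qhess i j k;
  quad_bd : exists2 C, 0 <= C & forall i j x, ann x -> cabs (qgrad i j x) <= C * Z i x;
  qhess_bd : exists2 C, 0 <= C & forall i j k x, cabs (qhess i j k) <= C * Z i x ^+ 2 }.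

Lemma quadFD q1 q2 : quadF q1 -> quadF q2 -> quadF (fun i x => q1 i x + q2 i x).
Proof.
move=> [l1 c1 d1 m1 b1 s1 g1 bd1 hb1] [l2 c2 d2 m2 b2 s2 g2 bd2 hb2].
apply: (@QuadF _ (fun i j x => l1 i j x + l2 i j x) (fun i j k => c1 i j k + c2 i j k)
  (fun i j => d1 i j + d2 i j)).
- move=> i; have [h1 h2] := m1 i; have [h3 h4] := m2 i.
  by split=> [|j]; apply: cmeasD.
- move=> i; have [h1 h2] := b1 i; have [h3 h4] := b2 i.
  by split=> [|j]; apply: locbdD.
- by move=> i j x h; rewrite s1 s2; ring.
- by move=> i j k x h; rewrite g1 g2; ring.
- have [C C0 h1] := bd1; have [D D0 h2] := bd2; exists (C + D); rewrite ?addr_ge0// => i j x ax.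
  by apply: le_trans (cabsD _ _) _; rewrite mulrDl lerD ?h1 ?h2.
have [C C0 h1] := hb1; have [D D0 h2] := hb2; exists (C + D); rewrite ?addr_ge0// => i j k x.
by apply: le_trans (cabsD _ _) _; rewrite mulrDl lerD ?h1 ?h2.
Qed.

(** [P] is linear in substance: the applications take the identity, the two projections and the sum
    xi1 + xi2. The two bounds say that gradient and Hessian cost one and two powers of [Z]. *)
Lemma quadF_term m (P : V R n -> V R m) (K : R) (a : I -> R[i]) (v : I -> 'rV[R]_m) :
  (forall x y (h : R), P (x + h *: y) = P x + h *: P y) ->
  (forall x, enorm (P x) <= K * enorm x) -> measurable_fun setT P ->
  (exists2 C, 0 <= C & forall i x, ann x -> cabs (a i) * enorm (P x - v i) <= C * Z i x) ->
  (exists2 C, 0 <= C & forall i x, cabs (a i) <= C * Z i x ^+ 2) ->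
  quadF (fun i x => a i * (dotp (P x - v i) (P x - v i))%:C%C).
Proof.
move=> lP bP mP b1 b2.
have K0 j : enorm (P (bvec j)) <= K.
  by apply: le_trans (bP _) _; rewrite enorm_delta mulr1.
have Kp (j : 'I_n) : 0 <= K by apply: le_trans (K0 j); exact: enorm_ge0.
have bPv i (x : V R n) (r : R) : enorm x <= r -> enorm (P x - v i) <= `|K| * r + enorm (v i).
  move=> xr; apply: le_trans (enormD _ _) _; rewrite enormN lerD2r.
  apply: le_trans (bP _) _; apply: le_trans (_ : `|K| * enorm x <= _); last by rewrite ler_wpM2l.
  by rewrite ler_wpM2r ?enorm_ge0 ?ler_norm.
have mPv i : measurable_fun setT (fun x : V R n => P x - v i : V R m).
  exact: (measurableT_comp (measurable_shift (- v i)) mP).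
apply: (@QuadF _ (fun i j x => a i * (2 * dotp (P x - v i) (P (bvec j)))%:C%C)
  (fun i j k => a i * (2 * dotp (P (bvec k)) (P (bvec j)))%:C%C)
  (fun i j => a i * (dotp (P (bvec j)) (P (bvec j)))%:C%C)).
- move=> i; split=> [|j]; apply: cmeasM; try exact: cmeas_cst.
    by apply: cmeasR; apply: measurable_dotp.
  by apply: cmeasR; apply: measurable_funM => //; apply: measurable_dotp.
- move=> i; split=> [|j]; apply: locbdM; try exact: locbd_cst.
    move=> r; exists ((`|K| * r + enorm (v i)) ^+ 2) => x xr.
    rewrite cabsR -enorm_sqr normrX ger0_norm ?enorm_ge0// lerXn2r ?nnegrE ?enorm_ge0 ?bPv//.
    by apply: le_trans (bPv i x r xr); exact: enorm_ge0.
  move=> r; exists (2 * ((`|K| * r + enorm (v i)) * enorm (P (bvec j)))) => x xr.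
  rewrite cabsR normrM ger0_norm// ler_wpM2l//; apply: le_trans (normr_dotp_le _ _) _.
  by rewrite ler_wpM2r ?enorm_ge0 ?bPv.
- move=> i j x h; rewrite lP.
  have -> : P x + h *: P (bvec j) - v i = (P x - v i) + h *: P (bvec j) by rewrite addrAC.
  move: (P x - v i) (P (bvec j)) => y e.
  rewrite dotpDl !dotpDr !dotpZl !dotpZr (dotpC e y).
  rewrite (mulrCA h%:C%C) (mulrCA (h ^+ 2)%:C%C) -!mulrDr -!realCM -!rmorphD/=.
  by congr (_ * _%:C%C); ring.
- move=> i j k x h; rewrite lP.
  have -> : P x + h *: P (bvec k) - v i = (P x - v i) + h *: P (bvec k) by rewrite addrAC.
  rewrite dotpDl dotpZl mulrCA -!mulrDr -!realCM -!rmorphD/=.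
  by congr (_ * _%:C%C); ring.
- have [C C0 hC] := b1; exists (2 * `|K| * C) => [|i j x ax]; first by rewrite !mulr_ge0.
  rewrite cabsM cabsR normrM ger0_norm//.
  apply: (@le_trans _ _ (2 * `|K| * (cabs (a i) * enorm (P x - v i)))); last first.
    by rewrite -(mulrA (_ * _)) ler_wpM2l ?mulr_ge0 ?hC.
  rewrite [leRHS](_ : _ = cabs (a i) * (2 * (enorm (P x - v i) * `|K|))); last by ring.
  rewrite ler_wpM2l ?cabs_ge0// ler_wpM2l//; apply: le_trans (normr_dotp_le _ _) _.
  by rewrite ler_wpM2l ?enorm_ge0// (le_trans (K0 j))// ler_norm.
have [C C0 hC] := b2; exists (2 * K ^+ 2 * C) => [|i j k x]; first by rewrite mulr_ge0// mulr_ge0// sqr_ge0.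
rewrite cabsM cabsR normrM ger0_norm//.
rewrite [leRHS](_ : _ = (C * Z i x ^+ 2) * (2 * (K * K))); last by ring.
apply: ler_pM; rewrite ?cabs_ge0 ?mulr_ge0 ?hC// ler_wpM2l//.
apply: le_trans (normr_dotp_le _ _) _.
by apply: ler_pM; rewrite ?enorm_ge0.
Qed.

Lemma Fam_qgrad q (Q : quadF q) N j : Fam Z N 1 (@one_env R I n) (fun i => qgrad Q i j).
Proof.
have [C C0 h1] := quad_bd Q.
have base : exists2 C, 0 <= C & forall i x, ann x -> cabs (qgrad Q i j x) <= C * Z i x ^+ 1 * one_env i x.
  by exists C => // i x ax; rewrite mulr1 expr1 h1.
have m1 i : cmeas (qgrad Q i j) by have [_] := quad_meas Q i.
have l1 i : locbd (qgrad Q i j) by have [_] := quad_locbd Q i.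
case: N => [|N]; split=> // k; exists (fun i _ => qhess Q i j k).
  move=> i r; exists 0 => x h _ _; rewrite qgrad_step mul0r.
  by rewrite (_ : _ - _ - _ = 0) ?cabs0//; ring.
by apply: Fam_cst => //; have [D D0 h2] := qhess_bd Q; exists D.
Qed.

(** The exponential is its own envelope: its Gaussian decay stays available to absorb the powers of
    [Z] produced by differentiation. *)
Definition gau_env (q : I -> V R n -> R[i]) i x := cabs (cexp (q i x)).

Lemma Fam_cexp q (Q : quadF q) N : Fam Z N 0 (gau_env q) (fun i x => cexp (q i x)).
Proof.
have g0 i x : 0 <= gau_env q i x by exact: cabs_ge0.
have o0 (i : I) (x : V R n) : 0 <= one_env i x :> R by exact: ler01.
have base : exists2 C, 0 <= C & forall i x, ann x -> cabs (cexp (q i x)) <= C * Z i x ^+ 0 * gau_env q i x.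
  by exists 1 => // i x ax; rewrite expr0 !mul1r.
have m1 i : cmeas (fun x => cexp (q i x)) by apply: cmeas_cexp; have [] := quad_meas Q i.
have l1 i : locbd (fun x => cexp (q i x)).
  move=> r; have [b _] := quad_locbd Q i; have [B hB] := b r; exists (expR B) => x xr.
  by rewrite cabs_cexp ler_expR (le_trans (ler_norm _))// (le_trans (normr_Re _))// hB.
elim: N => [|N IH]; split=> // j.
exists (fun i x => qgrad Q i j x * cexp (q i x)).
  move=> i; have [b1 b2] := quad_locbd Q i.
  by apply: (isD_cexp b1 (b2 j)) => x h; exact: quad_step.
have := FamM Z1 o0 g0 (Fam_qgrad Q N j) IH; rewrite addn0; congr (Fam _ _ _ _ _).
by apply/funext => i; apply/funext => x; rewrite /one_env mul1r.
Qed.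

End Quadratic.

(** * The Sobolev bound used for all three families *)

Section SobolevFamily.
Context {R : realType}.
Variable n : nat.

(** [Z] is the crude pointwise cost of a derivative, [Lam] the cost that remains once the decay of
    exp(q) has been used; the hypothesis on Z^(2k) |exp q| trades one for the other and leaves the
    localisation [b1]. Only points of the annulus count, because [fhat Theta] vanishes elsewhere. *)
Lemma SB_family (s : R) (Theta : 'rV[R]_n -> R[i]) (I : Type) (Z : I -> V R n -> R)
  (q : I -> V R n -> R[i]) (Lam B : I -> R) (b1 b : I -> V R n -> R) :
  0 < s -> schwartz Theta -> supp (fhat Theta) ->
  (forall i x, 1 <= Z i x) -> quadF Z q -> (forall i, 1 <= Lam i) ->
  (forall k : nat, exists2 C, 0 <= C & forall i x, ann x ->
     Z i x ^+ (2 * k) * cabs (cexp (q i x)) <= C * Lam i ^+ (2 * k) * b1 i x) ->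
  (forall i, measurable_fun setT (b1 i)) -> (forall i x, 0 <= b1 i x <= B i) ->
  (forall i (r : R) (x : V R n), \int[mu n]_y (gq y * b1 i (x + r *: y)) <= b i x) ->
  exists2 C, 0 <= C & forall i,
    SB (fun xi => (sob_weight s xi)%:C%C * fhat (fun x => cexp (q i x) * fhat Theta x) xi)
       (fun x => C * powR (Lam i) s * (expR (- (enorm x / 2)) * b i x)).
Proof.
move=> s0 sT suppT Z1 Q L1 Zb mb1 b1B b1b.
(* Integer and fractional parts of s/2; as w has order two, w^(s/2) splits into w^l and w^al. *)
pose l := Num.truncn (s / 2); pose al := s / 2 - l%:R.
have sE : s = 2 * (l%:R + al) by rewrite /al addrCA subrr addr0 mulrCA divff ?mulr1.
have alP : 0 <= al < 1.
  have /truncn_itv/andP[h1 h2] : 0 <= s / 2 by rewrite divr_ge0// ltW.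
  by rewrite /al subr_ge0 h1/= ltrBlDl natr1.
have [C0 C00 SB0] := @SB_bessel R n l al alP.
have g0 i x : 0 <= gau_env q i x by exact: cabs_ge0.
have o0 (i : I) (x : V R n) : 0 <= one_env i x :> R by exact: ler01.
pose F i x := cexp (q i x) * fhat Theta x.
have FF N : Fam Z N 0 (gau_env q) F.
  have := FamM Z1 g0 o0 (Fam_cexp Z1 Q N) (Fam_fhat Z1 N 0 (schwartz_wint sT)).
  rewrite addn0; congr (Fam _ _ _ _ _).
  by apply/funext => i; apply/funext => x; rewrite /one_env mulr1.
have sF i : supp (F i) by move=> x nx; rewrite /F suppT// mulr0.
have [H HP] := bessel_iter Z1 g0 (FF (2 * l.+1)%N) sF.
have [D D0 HD] : exists2 D, 0 <= D & forall k, (k <= l.+1)%N -> forall i x,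
    cabs (H k i x) <= D * (Lam i ^+ (2 * k) * b1 i x).
  have each k : exists D, 0 <= D /\ ((k <= l.+1)%N -> forall i x,
      cabs (H k i x) <= D * (Lam i ^+ (2 * k) * b1 i x)).
    have [kl|kl] := leqP k l.+1; last by exists 0.
    have [Fk sk _] := HP k kl; have [_ _ [C C1 hC]] := Fam_base Fk.
    have [C' C2 hC'] := Zb k; exists (C * C'); split=> [|_ i x]; first exact: mulr_ge0.
    have Lp : 0 <= Lam i by exact: le_trans ler01 (L1 i).
    have /andP[b0 _] := b1B i x.
    have [ax|nx] := pselect (ann x); last first.
      by rewrite (sk i x nx) cabs0 !mulr_ge0// exprn_ge0.
    by apply: le_trans (hC i x ax) _; rewrite -!mulrA ler_wpM2l// mulrA hC'.
  have [D hD] := choice each; exists (\sum_(k < l.+2) D k).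
    by apply: sumr_ge0 => k _; have [] := hD k.
  move=> k kl i x; have [Dk h] := hD k; apply: le_trans (h kl i x) _.
  have Lp : 0 <= Lam i by exact: le_trans ler01 (L1 i).
  have /andP[b0 _] := b1B i x.
  rewrite ler_wpM2r ?mulr_ge0 ?exprn_ge0//.
  rewrite (bigD1 (Ordinal (kl : (k < l.+2)%N)))//= lerDl.
  by apply: sumr_ge0 => k' _; have [] := hD k'.
exists (C0 * (D + 1)); first by rewrite mulr_ge0// addr_ge0.
move=> i; have D1 : 0 < D + 1 by rewrite ltr_wpDl.
have S1 : SB (fun xi => (sob_weight (2 * (l%:R + al)) xi)%:C%C * fhat (F i) xi)
    (fun x => C0 * powR (Lam i) (2 * (l%:R + al)) * (expR (- (enorm x / 2)) * ((D + 1) * b i x))).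
  apply: (SB0 (F i) (fun k => H k i) (fun x => (D + 1) * b1 i x) (fun x => (D + 1) * b i x) (Lam i) ((D + 1) * B i)) => //.
  - move=> k kl; have [Fk sk fk] := HP k kl; have [mk _ _] := Fam_base Fk; split=> //.
      by move=> x x2; apply: sk => /andP[_]; rewrite leNgt x2.
    move=> x; apply: le_trans (HD k kl i x) _.
    have Lp : 0 <= Lam i by exact: le_trans ler01 (L1 i).
    have /andP[b0 _] := b1B i x.
    by rewrite [leRHS]mulrCA ler_wpM2r ?mulr_ge0 ?exprn_ge0// lerDl.
  - exact: measurable_funM.
  - by move=> x; have /andP[h1 h2] := b1B i x; rewrite mulr_ge0 ?(ltW D1)//= ler_wpM2l// ltW.
  move=> r x; under eq_Rintegral do rewrite mulrCA.
  rewrite RintegralZl//; first by rewrite ler_wpM2l// ltW.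
  apply: (rig_le _ (rigZ (B i) (@rig_gq R n))).
    apply: measurable_funM; first exact: rig_meas (@rig_gq R n).
    by apply: (measurableT_comp (mb1 i)); apply: measurable_addV => //; exact: measurable_scaleV.
  move=> y; have /andP[b0 bB] := b1B i (x + r *: y).
  by rewrite ger0_norm ?mulr_ge0 ?expR_ge0// mulrC ler_wpM2r ?expR_ge0.
rewrite -sE in S1; apply: SB_le S1 => x.
by rewrite le_eqVlt; apply/orP; left; apply/eqP; ring.
Qed.

End SobolevFamily.

(** * Gaussians are Schwartz functions *)

Section PowExp.
Context {R : realType}.

Lemma pow_exp (N : nat) (c : R) : 0 < c ->
  exists2 C, 0 < C & forall t, 0 <= t -> (1 + t) ^+ N <= C * expR (c * t).
Proof.
(* Chosen so that 1 + t <= K (1 + c t / (N+1)); using N+1 keeps the quotient meaningful for N =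
   0. *)
move=> c0; pose K := 1 + N.+1%:R / c.
have N0 : 0 < N.+1%:R :> R by rewrite ltr0n.
have K0 : 0 < K by rewrite addr_gt0// divr_gt0.
exists (K ^+ N); first exact: exprn_gt0.
move=> t t0; have -> : expR (c * t) = expR (c * t / N.+1%:R) ^+ N.+1.
  by rewrite -expRM_natl; congr expR; rewrite [RHS]mulrC divfK// gt_eqF.
have e1 : 1 <= expR (c * t / N.+1%:R).
  by rewrite -[leLHS]expR0 ler_expR divr_ge0 ?mulr_ge0 ?(ltW c0) ?(ltW N0).
apply: (@le_trans _ _ ((K * expR (c * t / N.+1%:R)) ^+ N)); last first.
  by rewrite exprMn ler_wpM2l ?exprn_ge0 ?(ltW K0)// exprS ler_peMl// exprn_ge0 ?expR_ge0.
rewrite lerXn2r ?nnegrE ?addr_ge0 ?mulr_ge0 ?expR_ge0 ?(ltW K0)//.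
apply: (@le_trans _ _ (K * (1 + c * t / N.+1%:R))); last by rewrite ler_wpM2l ?(ltW K0)// expR_ge1Dx.
have -> : K * (1 + c * t / N.+1%:R) = 1 + t + (N.+1%:R / c + c * t / N.+1%:R).
  by rewrite /K; field; rewrite !gt_eqF.
by rewrite lerDl addr_ge0 ?divr_ge0 ?mulr_ge0 ?(ltW c0) ?(ltW N0).
Qed.

End PowExp.

Section SmoothClass.
Context {R : realType}.
Variable n : nat.
Implicit Types (f g p : 'rV[R]_n -> R) (i j : 'I_n).

Definition sm f (f' : 'I_n -> 'rV[R]_n -> R) := forall x, differentiable f x /\
  forall i, derive f x (delta_mx 0 i) = f' i x.

Lemma sm_cst (c : R) : sm (fun _ => c) (fun _ _ => 0).
Proof.
move=> x; split; first exact: differentiable_cst.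
by move=> i; exact: derive_cst.
Qed.

Lemma sm_coord j : sm (fun x => x ord0 j) (fun i _ => (i == j)%:R).
Proof.
move=> x; split; first exact: differentiable_coord.
move=> i; rewrite deriveE; last exact: differentiable_coord.
pose f (x : 'rV[R]_n) : R := x ord0 j.
have lf : linear f by move=> k u v; rewrite /f !mxE.
pose F := GRing.isLinear.Build R 'rV[R]_n R *:%R f lf.
pose fl : {linear 'rV[R]_n -> R} := HB.pack f F.
have cf : continuous f.
  by move=> y; apply: differentiable_continuous; exact: differentiable_coord.
rewrite (_ : (fun x : 'rV[R]_n => x ord0 j) = fl)// diff_lin//=.
by rewrite /f mxE eqxx eq_sym.
Qed.

Lemma sm_add f g (f' g' : 'I_n -> 'rV[R]_n -> R) : sm f f' -> sm g g' ->
  sm (fun x => f x + g x) (fun i x => f' i x + g' i x).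
Proof.
move=> sf sg x; have [df Df] := sf x; have [dg Dg] := sg x.
split; first exact: (differentiableD df dg).
by move=> i; rewrite -Df -Dg; apply: (@deriveD _ _ _ f g) => //; exact: diff_derivable.
Qed.

Lemma sm_mul f g (f' g' : 'I_n -> 'rV[R]_n -> R) : sm f f' -> sm g g' ->
  sm (fun x => f x * g x) (fun i x => f' i x * g x + f x * g' i x).
Proof.
move=> sf sg x; have [df Df] := sf x; have [dg Dg] := sg x.
split; first exact: (differentiableM df dg).
move=> i; rewrite -Df -Dg addrC (mulrC (derive f x _)).
by apply: (@deriveM _ _ f g); exact: diff_derivable.
Qed.

Lemma sm_comp (h dh : R -> R) f (f' : 'I_n -> 'rV[R]_n -> R) : (forall t : R, is_derive t 1 h (dh t)) -> sm f f' ->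
  sm (fun x => h (f x)) (fun i x => dh (f x) * f' i x).
Proof.
move=> Dh sf x; have [df Df] := sf x.
have [d1 e1] := Dh (f x); have dfx : differentiable h (f x) by apply/derivable1_diffP.
have dd := differentiable_comp df dfx.
split=> // i; rewrite (deriveE _ dd) (diff_comp df dfx)/= -(deriveE _ df) Df.
rewrite (_ : f' i x = f' i x *: 1); last by rewrite /GRing.scale/= mulr1.
by rewrite linearZ/= -deriveE// e1 /GRing.scale/= mulr1 mulrC.
Qed.

Inductive rpoly : ('rV[R]_n -> R) -> Prop :=
| rp_cst c : rpoly (fun _ => c)
| rp_coord j : rpoly (fun x => x ord0 j)
| rp_add f g : rpoly f -> rpoly g -> rpoly (fun x => f x + g x)
| rp_mul f g : rpoly f -> rpoly g -> rpoly (fun x => f x * g x).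

Lemma rpoly_sm p : rpoly p -> exists2 p', sm p p' & forall i, rpoly (p' i).
Proof.
elim=> [c|j|f g rf [f' sf rf'] rg [g' sg rg']|f g rf [f' sf rf'] rg [g' sg rg']].
- by exists (fun _ _ => 0); [exact: sm_cst|move=> i; exact: rp_cst].
- by exists (fun i _ => (i == j)%:R); [exact: sm_coord|move=> i; exact: rp_cst].
- by eexists; [exact: sm_add sf sg|move=> i; exact: rp_add].
by eexists; [exact: sm_mul sf sg|move=> i; apply: rp_add; exact: rp_mul].
Qed.

Lemma rpoly_sum (J : Type) (r : seq J) (f : J -> 'rV[R]_n -> R) : (forall k, rpoly (f k)) ->
  rpoly (fun x => \sum_(k <- r) f k x).
Proof.
move=> rf; elim: r => [|k r IH].
  rewrite (_ : (fun _ => _) = (fun _ => 0)); first exact: rp_cst.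
  by apply/funext => x; rewrite big_nil.
rewrite (_ : (fun _ => _) = (fun x => f k x + \sum_(k <- r) f k x)); first exact: rp_add.
by apply/funext => x; rewrite big_cons.
Qed.

Lemma rpoly_bound p : rpoly p -> exists2 C, 0 <= C & exists N, forall x, `|p x| <= C * (1 + enorm x ^+ 2) ^+ N.
Proof.
have W1 (x : 'rV[R]_n) : 1 <= 1 + enorm x ^+ 2 by rewrite lerDl sqr_ge0.
have mono (x : 'rV[R]_n) N M : (N <= M)%N -> (1 + enorm x ^+ 2) ^+ N <= (1 + enorm x ^+ 2) ^+ M.
  by move=> NM; rewrite ler_weXn2l.
elim=> [c|j|f g _ [C C0 [N hf]] _ [D D0 [M hg]]|f g _ [C C0 [N hf]] _ [D D0 [M hg]]].
- by exists `|c| => //; exists 0%N => x; rewrite expr0 mulr1.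
- exists 1 => //; exists 1%N => x; rewrite expr1 mul1r.
  apply: le_trans (enorm_coord x j) _; have := sqr_ge0 (enorm x - 1).
  by rewrite sqrrB mulr1 expr1n; have := sqr_ge0 (enorm x); lra.
- exists (C + D); first exact: addr_ge0.
  exists (N + M)%N => x; apply: le_trans (ler_normD _ _) _; rewrite mulrDl lerD//.
    by apply: le_trans (hf x) _; rewrite ler_wpM2l// mono// leq_addr.
  by apply: le_trans (hg x) _; rewrite ler_wpM2l// mono// leq_addl.
exists (C * D); first exact: mulr_ge0.
exists (N + M)%N => x; rewrite normrM exprD mulrACA ler_pM//.
Qed.

Variables (a b : R) (xi : 'rV[R]_n).
Hypothesis a0 : 0 < a.

Let Q (x : 'rV[R]_n) : R := - (pi * a * dotp x x).
Let th (x : 'rV[R]_n) : R := - (pi * b * dotp x x + 2 * pi * dotp x xi).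

Lemma rpoly_Q : rpoly Q.
Proof.
rewrite (_ : Q = fun x => - (pi * a) * \sum_(i < n) (x ord0 i * x ord0 i)); last first.
  by apply/funext => x; rewrite /Q mulNr.
by apply: rp_mul; [exact: rp_cst|apply: rpoly_sum => i; apply: rp_mul; exact: rp_coord].
Qed.

Lemma rpoly_th : rpoly th.
Proof.
rewrite (_ : th = fun x => - (pi * b) * \sum_(i < n) (x ord0 i * x ord0 i) +
    - (2 * pi) * \sum_(i < n) (x ord0 i * xi ord0 i)); last first.
  by apply/funext => x; rewrite /th opprD !mulNr.
apply: rp_add; apply: rp_mul; try exact: rp_cst.
  by apply: rpoly_sum => i; apply: rp_mul; exact: rp_coord.
by apply: rpoly_sum => i; apply: rp_mul; [exact: rp_coord|exact: rp_cst].
Qed.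

(** A class stable under partial derivatives that contains real and imaginary parts of chirped
    Gaussians, so that iterated derivatives need no formula. *)
Definition gclass f := exists p1 p2, [/\ rpoly p1, rpoly p2 &
  f = fun x => p1 x * (expR (Q x) * cos (th x)) + p2 x * (expR (Q x) * sin (th x))].

Lemma gclass_sm f : gclass f -> exists2 f', sm f f' & forall i, gclass (f' i).
Proof.
move=> [p1 [p2 [r1 r2 ->]]].
have [p1' s1 r1'] := rpoly_sm r1; have [p2' s2 r2'] := rpoly_sm r2.
have [Q' sQ rQ'] := rpoly_sm rpoly_Q; have [t' st rt'] := rpoly_sm rpoly_th.
have sE := sm_comp (fun t => is_derive_expR t) sQ.
have sc := sm_comp (fun t => is_derive_cos t) st.
have ss := sm_comp (fun t => is_derive_sin t) st.
eexists; first exact: (sm_add (sm_mul s1 (sm_mul sE sc)) (sm_mul s2 (sm_mul sE ss))).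
move=> i /=.
exists (fun x => p1' i x + p1 x * Q' i x + p2 x * t' i x),
  (fun x => p2' i x + p2 x * Q' i x + -1 * (p1 x * t' i x)); split.
- by apply: rp_add; [apply: rp_add => //; exact: rp_mul|exact: rp_mul].
- apply: rp_add; first by apply: rp_add => //; exact: rp_mul.
  by apply: rp_mul; [exact: rp_cst|exact: rp_mul].
by apply/funext => x; ring.
Qed.

Lemma gclass_Dmulti f (beta : seq 'I_n) : gclass f -> gclass (Dmulti beta f).
Proof.
move=> gf; elim: beta => [//|i beta IH] /=.
have [f' sf gf'] := gclass_sm IH.
rewrite (_ : (fun x => _) = f' i)//.
by apply/funext => x; have [_ <-] := sf x.
Qed.

Lemma gclass_schwartzR f : gclass f -> schwartzR f.
Proof.
move=> gf; split=> [beta x|beta k].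
  by have [f' sf _] := gclass_sm (gclass_Dmulti beta gf); have [] := sf x.
have [p1 [p2 [r1 r2 ->]]] := gclass_Dmulti beta gf.
have [C C0 [N hC]] := rpoly_bound r1; have [D D0 [M hD]] := rpoly_bound r2.
have [K K0 hK] := @pow_exp R (k + (N + M))%N (pi * a) (mulr_gt0 (pi_gt0 R) a0).
exists ((C + D) * K) => x; set W := 1 + enorm x ^+ 2.
have W1 : 1 <= W by rewrite lerDl sqr_ge0.
have W0 : 0 <= W by exact: le_trans ler01 W1.
have E0 := expR_ge0 (Q x).
have B : `|p1 x * (expR (Q x) * cos (th x)) + p2 x * (expR (Q x) * sin (th x))| <=
    (C + D) * W ^+ (N + M) * expR (Q x).
  apply: le_trans (ler_normD _ _) _; rewrite !mulrDl !normrM (ger0_norm E0) lerD//.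
    rewrite mulrCA [leRHS]mulrC; apply: (@le_trans _ _ (expR (Q x) * `|p1 x|)).
      by rewrite ler_wpM2l// ler_piMr// ler_norml cos_geN1 cos_le1.
    rewrite ler_wpM2l//; apply: le_trans (hC x) _.
    by rewrite ler_wpM2l// ler_weXn2l// leq_addr.
  rewrite mulrCA [leRHS]mulrC; apply: (@le_trans _ _ (expR (Q x) * `|p2 x|)).
    by rewrite ler_wpM2l// ler_piMr// ler_norml sin_geN1 sin_le1.
  rewrite ler_wpM2l//; apply: le_trans (hD x) _.
  by rewrite ler_wpM2l// ler_weXn2l// leq_addl.
apply: (@le_trans _ _ (W ^+ k * ((C + D) * W ^+ (N + M) * expR (Q x)))).
  by rewrite ler_wpM2l ?exprn_ge0.
have -> : W ^+ k * ((C + D) * W ^+ (N + M) * expR (Q x)) =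
  (C + D) * (W ^+ (k + (N + M)) * expR (Q x)) by rewrite (exprD W k); ring.
rewrite ler_wpM2l ?addr_ge0//; apply: le_trans (ler_wpM2r E0 (hK _ (sqr_ge0 (enorm x)))) _.
by rewrite -(mulrA K) -expRD /Q enorm_sqr subrr expR0 mulr1.
Qed.

Lemma schwartz_gauV : schwartz (gauV a b xi).
Proof.
split; apply: gclass_schwartzR.
  exists (fun _ => 1), (fun _ => 0); split; [exact: rp_cst|exact: rp_cst|].
  by apply/funext => x; rewrite mul0r addr0 mul1r /gauV /cexp/= mul0r subr0.
exists (fun _ => 0), (fun _ => 1); split; [exact: rp_cst|exact: rp_cst|].
by apply/funext => x; rewrite mul0r add0r mul1r /gauV /cexp/= mul0r addr0.
Qed.

End SmoothClass.

(** * Integrals over pairs of vectors *)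

Section Split.
Context {R : realType}.
Notation leb := (@lebesgue_measure R).

Definition rowV n m (p : V R n * V R m) : V R (n + m) :=
  row_mx (p.1 : 'rV[R]_n) (p.2 : 'rV[R]_m).

Lemma measurable_rowV n m : measurable_fun setT (@rowV n m).
Proof.
apply: measurable_funV => i; rewrite -(splitK i); case: (fintype.split i) => j /=.
  under eq_fun do rewrite row_mxEl.
  exact: measurableT_comp (measurable_coord j) measurable_fst.
under eq_fun do rewrite row_mxEr.
exact: measurableT_comp (measurable_coord j) measurable_snd.
Qed.

Lemma rowV_consV n m t (x : V R n) (y : V R m) :
  rowV (consV (t, x), y) = consV (t, rowV (x, y)) :> V R (n.+1 + m).
Proof.
apply/rowP => i; case: (unliftP (ord0 : 'I_(n + m).+1) i) => [k|] ->; last first.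
  rewrite (consV0 (t, rowV (x, y))) (_ : ord0 = lshift m (ord0 : 'I_n.+1)); last exact/val_inj.
  by rewrite /rowV row_mxEl (consV0 (t, x)).
rewrite (consVS (t, rowV (x, y))) /rowV/= -(splitK k); case: (fintype.split k) => j /=.
  rewrite row_mxEl (_ : lift ord0 (lshift m j) = lshift m (lift ord0 j)); last exact/val_inj.
  by rewrite row_mxEl (consVS (t, x)).
rewrite row_mxEr (_ : lift ord0 (rshift n j) = rshift n.+1 j); last exact/val_inj.
by rewrite row_mxEr.
Qed.

(** [mu (n + m)] is built by adding coordinates on the left, so the induction peels off the
    coordinates of the first block. *)
Lemma ge0_integral_iterated n m (f : V R (n + m) -> \bar R) : measurable_fun setT f ->
  (forall x, (0 <= f x)%E) ->
  (\int[mu (n + m)]_x f x = \int[mu n]_x \int[mu m]_y f (rowV (x, y)))%E.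
Proof.
elim: n f => [|n IH] f mf f0.
  have g0 : measurable_fun setT (fun x : V R 0 => \int[mu m]_y f (rowV (x, y)))%E.
    apply: (@measurable_fun_fubini_tonelli_F _ _ _ _ _ (mu m) (fun p => f (rowV p))) => //.
    exact: measurableT_comp mf (@measurable_rowV 0 m).
  rewrite [RHS]/= integral_dirac//; rewrite diracT mul1e.
  by apply: eq_integral => y _; congr f; apply/rowP => j; rewrite -(splitK j); case: (fintype.split j) => [[]//|k] /=; rewrite /rowV row_mxEr; congr (_ _ _); apply/val_inj.
have mF : measurable_fun setT (fun p : V R n.+1 * V R m => f (rowV p)).
  exact: measurableT_comp mf (@measurable_rowV n.+1 m).
have mG : measurable_fun setT (fun x : V R n.+1 => \int[mu m]_y f (rowV (x, y)))%E.
  exact: (@measurable_fun_fubini_tonelli_F _ _ _ _ _ (mu m) (fun p => f (rowV p))).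
have G0 (x : V R n.+1) : (0 <= \int[mu m]_y f (rowV (x, y)))%E by exact: integral_ge0.
have mc (k : nat) t : measurable_fun setT (fun z : V R k => consV (t, z)).
  by apply: measurableT_comp (@measurable_consV R k) _; exact: pair1_measurable.
rewrite -iintE// -[RHS](iintE mG G0)/=; apply: eq_integral => t _.
rewrite (@iintE _ (n + m) (fun y => f (consV (t, y)))); first last.
- by move=> y; exact: f0.
- exact: measurableT_comp mf (mc _ t).
rewrite (@iintE _ n (fun y => \int[mu m]_z f (rowV (consV (t, y), z)))%E); first last.
- by move=> y; exact: G0.
- exact: measurableT_comp mG (mc _ t).
rewrite (IH (fun y => f (consV (t, y)))); first last.
- by move=> y; exact: f0.
- exact: measurableT_comp mf (mc _ t).
apply: eq_integral => x _; apply: eq_integral => y _.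
by rewrite rowV_consV.
Qed.

Lemma ge0_integral_row n m (f : V R (n + m) -> \bar R) : measurable_fun setT f ->
  (forall x, (0 <= f x)%E) ->
  (\int[mu (n + m)]_x f x = \int[prodm (mu n) (mu m)]_p f (rowV p))%E.
Proof.
move=> mf f0; rewrite ge0_integral_iterated//.
have mF : measurable_fun setT (fun p : V R n * V R m => f (rowV p)).
  exact: measurableT_comp mf (@measurable_rowV n m).
by rewrite -(@fubini_tonelli1 _ _ _ _ _ (mu n) (mu m) (fun p => f (rowV p)))//.
Qed.

Lemma dotp_row n m (x z : V R n) (y w : V R m) :
  dotp (rowV (x, y)) (rowV (z, w)) = dotp x z + dotp y w.
Proof.
rewrite /dotp big_split_ord/=; congr (_ + _); apply: eq_bigr => i _.
  by rewrite /rowV !row_mxEl.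
by rewrite /rowV !row_mxEr.
Qed.

Definition addV n (x : 'rV[R]_(n + n)) : 'rV[R]_n := lsubmx x + rsubmx x.

Lemma addV_row n (x y : V R n) : addV (rowV (x, y)) = x + y.
Proof. by rewrite /addV /rowV row_mxKl row_mxKr. Qed.

Lemma addV_step n (x y : 'rV[R]_(n + n)) (h : R) : addV (x + h *: y) = addV x + h *: addV y.
Proof.
by apply/rowP => i; rewrite !mxE; ring.
Qed.

Lemma measurable_addVsub n : measurable_fun setT (@addV n : V R (n + n) -> V R n).
Proof.
apply: measurable_addV; apply: measurable_funV => i; under eq_fun do rewrite mxE;
  exact: measurable_coord.
Qed.

(** With z = x + y one has |x|^2 + |y|^2 = |z|^2/2 + 2 |x - z/2|^2. The integral over x of exp(-4 pi
    |x - z/2|^2) is 2^-n, and exp(-pi |z|^2) is left. *)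
Lemma gauss_fold n (g : V R n -> R[i]) (B : R) : cmeas g -> (forall x, cabs (g x) <= B) ->
  let F := fun x : V R (n + n) => (expR (- (2 * pi * dotp x x)))%:C%C * g (addV x) in
  cig (mu (n + n)) F /\
  cI (mu (n + n)) F = (2^-1 ^+ n)%:C%C * cI (mu n) (fun x => (expR (- (pi * dotp x x)))%:C%C * g x).
Proof.
move=> mg gB F; have p0 := pi_gt0 R; have p20 : 0 < 2 * (pi : R) by rewrite mulr_gt0.
have B0 : 0 <= B by apply: le_trans (gB 0); exact: cabs_ge0.
have mexp k (c : R) : measurable_fun setT (fun x : V R k => expR (- (c * dotp x x))).
  apply: measurableT_comp => //; apply: measurableT_comp => //.
  by apply: measurable_funM => //; exact: measurable_dotp.
have mF : cmeas F.
  apply: cmeasM; first by apply: cmeasR; exact: mexp.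
  exact: cmeas_comp mg (@measurable_addVsub n).
have Frow x y : F (rowV (x, y)) = (expR (- (2 * pi * dotp x x)) * expR (- (2 * pi * dotp y y)))%:C%C * g (x + y).
  by rewrite /F addV_row dotp_row -expRD; congr ((expR _)%:C%C * _); ring.
have [ie _] := gaussV_int n p20.
have cF : cig (prodm (mu n) (mu n)) (fun p => F (rowV p)).
  apply: (cig_prod (a := fun x : V R n => B * expR (- (2 * pi * dotp x x))) (b := fun y : V R n => expR (- (2 * pi * dotp y y)))).
  - exact: cmeas_comp mF (@measurable_rowV n n).
  - exact: rigZ.
  - by [].
  - move=> x y; rewrite Frow cabsM cabsR ger0_norm ?mulr_ge0 ?expR_ge0//.
    by rewrite mulrC -[leRHS]mulrA; apply: ler_wpM2r; [rewrite mulr_ge0 ?expR_ge0|exact: gB].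
have [iF ->] := cI_transfer (@ge0_integral_row n n) mF cF; split=> //.
have mgs (x : V R n) : cmeas (fun y : V R n => g (x + y)).
  rewrite (_ : (fun y : V R n => g (x + y)) = (fun y => g (y + x))).
    exact: (cmeas_comp mg (measurable_shift x)).
  by apply/funext => y; rewrite addrC.
have cFx x : cig (mu n) (fun y => F (rowV (x, y))).
  have := @cigZ _ _ _ (mu n) (expR (- (2 * pi * dotp x x)))%:C%C _ (cig_mul_bdd (cigR ie) (mgs x) (fun y => gB (x + y))).
  by congr cig; apply/funext => y; rewrite Frow realCM mulrA.
have [_ <-] := cFubini1 cF cFx.
pose E (x y : V R n) := expR (- (2 * pi * (dotp x x + dotp (y - x) (y - x)))).
transitivity (cI (mu n) (fun x => cI (mu n) (fun y => (E x y)%:C%C * g y))).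
  apply: cI_eq => x; rewrite -(cI_shift (- x) (cig_meas (cFx x))).
  apply: cI_eq => y; rewrite Frow (addrC x) subrK -expRD; congr ((expR _)%:C%C * _).
  by rewrite /E; ring.
have EE x y : E x y = expR (- (pi * dotp y y)) * expR (- (4 * pi * dotp (x - 2^-1 *: y) (x - 2^-1 *: y))).
  rewrite /E -expRD; congr expR; rewrite !(dotpDl, dotpDr, dotpNl, dotpNr, dotpZl, dotpZr) (dotpC y x).
  by field.
(* Separates the variables at the price of a smaller exponent; used only to justify Fubini. *)
have E4 x y : E x y <= expR (- (pi / 2 * dotp x x)) * expR (- (pi / 2 * dotp y y)).
  rewrite /E -expRD ler_expR -opprD lerN2.
  rewrite [leLHS](_ : _ = 2 * pi * (4^-1 * dotp x x + 4^-1 * dotp y y)); last by field.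
  rewrite ler_pM2l//; have := dotp_ge0 (y - (4 / 3) *: x); have := dotp_ge0 x.
  by rewrite !(dotpDl, dotpDr, dotpNl, dotpNr, dotpZl, dotpZr) (dotpC y x); lra.
have E0 x y : 0 <= E x y by exact: expR_ge0.
have [ih _] := gaussV_int n (divr_gt0 p0 (ltr0n R 2)).
have mE : measurable_fun setT (fun p : V R n * V R n => E p.1 p.2).
  apply: measurableT_comp => //; apply: measurableT_comp => //; apply: measurable_funM => //.
  apply: measurable_funD; apply: measurable_dotp => //.
    apply: measurable_addV => //; have -> : (fun t : V R n * V R n => - t.1) = (fun t => (-1) *: t.1).
      by apply/funext => t; rewrite scaleN1r.
    exact: measurable_scaleV.
  apply: measurable_addV => //; have -> : (fun t : V R n * V R n => - t.1) = (fun t => (-1) *: t.1).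
    by apply/funext => t; rewrite scaleN1r.
  exact: measurable_scaleV.
have cE : cig (prodm (mu n) (mu n)) (fun p => (E p.1 p.2)%:C%C * g p.2).
  apply: (cig_prod (a := fun x : V R n => B * expR (- (pi / 2 * dotp x x))) (b := fun y : V R n => expR (- (pi / 2 * dotp y y)))).
  - apply: cmeasM; first exact: cmeasR.
    exact: cmeas_comp mg measurable_snd.
  - exact: rigZ.
  - by [].
  move=> x y /=; rewrite cabsM cabsR ger0_norm// mulrC -mulrA; apply: ler_pM; rewrite ?cabs_ge0//.
have i4 : 0 < 4 * (pi : R) by rewrite mulr_gt0.
have [i4r i4e] := gaussV_int n i4.
have i4s (y : V R n) := rig_shift (- (2^-1 *: y)) i4r.
have sx (x : V R n) : cig (mu n) (fun y => (E x y)%:C%C * g y).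
  apply: cig_mul_bdd mg gB; apply: cigR.
  apply: (rig_le (measurableT_comp mE (pair1_measurable x)) (rigZ (expR (- (pi / 2 * dotp x x))) ih)) => y.
  by rewrite /= (ger0_norm (E0 x y)) E4.
have sy (y : V R n) : cig (mu n) (fun x => (E x y)%:C%C * g y).
  under [X in cig _ X]eq_fun do rewrite mulrC.
  apply: cigZ; apply: cigR; have := rigZ (expR (- (pi * dotp y y))) (i4s y).
  by congr rig; apply/funext => x; rewrite EE.
rewrite (cFubini cE sx sy) -(@cIZ _ _ _ (mu n)); last first.
  have [i1 _] := gaussV_int n p0.
  exact: cig_mul_bdd (cigR i1) mg gB.
apply: cI_eq => y /=.
transitivity ((expR (- (pi * dotp y y)))%:C%C * g y * cI (mu n) (fun x => (expR (- (4 * pi * dotp (x - 2^-1 *: y) (x - 2^-1 *: y))))%:C%C)).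
  rewrite -(cIZ _ (cigR (i4s y))); apply: cI_eq => x; rewrite EE realCM; ring.
rewrite cIR (Rint_shift (- (2^-1 *: y)) (rig_meas i4r)) i4e mulrC; congr (_%:C%C * _).
congr (_ ^+ n); rewrite (_ : pi / (4 * pi) = 2^-1 ^+ 2 :> R).
  by rewrite sqrtr_sqr ger0_norm// invr_ge0.
have P0 : (pi : R) != 0 by rewrite gt_eqF.
by move: (pi : R) P0 => P P0; field; exact: P0.
Qed.

End Split.

(** * Gaussian averages at arbitrary width *)

Section GaussConv.
Context {R : realType}.

Lemma gauss_conv n (c a r : R) (z : V R n) : 0 < c -> 0 <= a ->
  let q := c + a * r ^+ 2 in
  rig (mu n) (fun y => expR (- (c * dotp y y)) * expR (- (a * dotp (z + r *: y) (z + r *: y)))) /\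
  \int[mu n]_y (expR (- (c * dotp y y)) * expR (- (a * dotp (z + r *: y) (z + r *: y)))) =
  Num.sqrt (pi / q) ^+ n * expR (- (c * a / q * dotp z z)).
Proof.
move=> c0 a0 q; have q0 : 0 < q by rewrite ltr_wpDr// mulr_ge0// sqr_ge0.
have qn : q != 0 by rewrite gt_eqF.
have E (y : V R n) : expR (- (c * dotp y y)) * expR (- (a * dotp (z + r *: y) (z + r *: y))) =
    expR (- (c * a / q * dotp z z)) *
    expR (- (q * dotp (y + (a * r / q) *: z) (y + (a * r / q) *: z))).
  rewrite -!expRD; congr expR; rewrite !(dotpDl, dotpDr, dotpZl, dotpZr) (dotpC y z).
  move: qn; rewrite /q => qn; by field.
have [i1 e1] := gaussV_int n q0; have is_ := rig_shift ((a * r / q) *: z) i1.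
split; first by have := rigZ (expR (- (c * a / q * dotp z z))) is_; congr rig; apply/funext => y; rewrite E.
under eq_Rintegral do rewrite E.
rewrite RintegralZl// (Rint_shift ((a * r / q) *: z) (rig_meas i1)) e1.
by rewrite mulrC.
Qed.

(** The loss B^-D in height compensates the widening by B: for B >= 1, (1 + w)/B <= 1 + w/B, and a
    power of 1 + w/B is absorbed by the Gaussian in w/B. *)
Lemma gauss_tail (D : nat) : exists2 C : R, 0 < C & forall B w : R, 1 <= B -> 0 <= w ->
  B ^- D * expR (- (w ^+ 2 / B ^+ 2)) <= C / (1 + w) ^+ D.
Proof.
have [C C0 hC] := @pow_exp R D 1 ltr01; exists (C * expR 1); first by rewrite mulr_gt0 ?expR_gt0.
move=> B w B1 w0; have B0 : 0 < B by exact: lt_le_trans ltr01 B1.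
have w1 : 0 < 1 + w by rewrite ltr_wpDr.
have t0 : 0 <= w / B by rewrite divr_ge0// ltW.
rewrite ler_pdivlMr ?exprn_gt0//.
have -> : B ^- D * expR (- (w ^+ 2 / B ^+ 2)) * (1 + w) ^+ D = ((1 + w) / B) ^+ D * expR (- (w / B) ^+ 2).
  by rewrite !exprMn !exprVn; ring.
apply: (@le_trans _ _ ((1 + w / B) ^+ D * expR (- (w / B) ^+ 2))).
  rewrite ler_wpM2r ?expR_ge0// lerXn2r ?nnegrE ?addr_ge0 ?divr_ge0 ?(ltW B0) ?(ltW w1)//.
  by rewrite mulrDl mul1r lerD2r invf_le1.
apply: le_trans (ler_wpM2r (expR_ge0 _) (hC _ t0)) _.
rewrite -!mulrA ler_wpM2l ?(ltW C0)// -expRD ler_expR mul1r.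
by have := sqr_ge0 (w / B - 2^-1); rewrite sqrrB; lra.
Qed.

Lemma gauss_scale n (c B : R) : 0 < c -> 0 < B ->
  Num.sqrt (pi / (c * B ^+ 2)) ^+ n = Num.sqrt (pi / c) ^+ n * B ^- n.
Proof.
move=> c0 B0; rewrite invfM mulrA sqrtrM ?divr_ge0 ?pi_ge0 ?(ltW c0)//.
by rewrite -exprVn sqrtr_sqr ger0_norm ?invr_ge0 ?(ltW B0)// exprMn exprVn.
Qed.

(** [B] is the widening factor, B^2 = 1 + nu^2 r^2 / c. Since all radii r occur, what follows uses
    nothing about [B] except B >= 1. *)
Lemma gauss_conv_step n (c nu r : R) : 0 < c -> exists2 B, 1 <= B & forall z : V R n,
  rig (mu n) (fun y => expR (- (c * dotp y y)) * expR (- (nu ^+ 2 * dotp (z + r *: y) (z + r *: y)))) /\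
  \int[mu n]_y (expR (- (c * dotp y y)) * expR (- (nu ^+ 2 * dotp (z + r *: y) (z + r *: y)))) =
  Num.sqrt (pi / c) ^+ n * B ^- n * expR (- ((nu / B) ^+ 2 * dotp z z)).
Proof.
move=> c0; have b0 : 1 <= 1 + nu ^+ 2 * r ^+ 2 / c.
  by rewrite lerDl; apply: divr_ge0; [apply: mulr_ge0; exact: sqr_ge0|exact: ltW].
exists (Num.sqrt (1 + nu ^+ 2 * r ^+ 2 / c)).
  by rewrite -[leLHS]sqrtr1 ler_wsqrtr.
set B := Num.sqrt (1 + nu ^+ 2 * r ^+ 2 / c); move=> z.
have B0 : 0 < B by rewrite sqrtr_gt0; exact: lt_le_trans ltr01 b0.
have B2 : c + nu ^+ 2 * r ^+ 2 = c * B ^+ 2.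
  rewrite sqr_sqrtr ?(le_trans ler01 b0)//; have cn : c != 0 by rewrite gt_eqF.
  by field; exact: cn.
clearbody B; have [i1 e1] := gauss_conv r z c0 (sqr_ge0 nu); split; first exact: i1.
rewrite [LHS]e1 B2 (gauss_scale n c0 B0).
have cn : c != 0 by rewrite gt_eqF.
have Bn : B != 0 by rewrite gt_eqF.
suff -> : c * nu ^+ 2 / (c * B ^+ 2) = (nu / B) ^+ 2 by [].
by field; rewrite cn Bn.
Qed.

Let c0 : 0 < 3 / 16 :> R. Proof. by rewrite divr_gt0. Qed.

Lemma gq_conv_step n (nu r : R) : exists2 B, 1 <= B & forall z : V R n,
  rig (mu n) (fun y => gq y * expR (- (nu ^+ 2 * dotp (z + r *: y) (z + r *: y)))) /\
  \int[mu n]_y (gq y * expR (- (nu ^+ 2 * dotp (z + r *: y) (z + r *: y)))) =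
  Num.sqrt (pi / (3 / 16)) ^+ n * B ^- n * expR (- ((nu / B) ^+ 2 * dotp z z)).
Proof. exact: gauss_conv_step. Qed.

Lemma conv_id d : exists2 C : R, 0 < C & forall (nu : R) (v : 'rV[R]_d) (r : R) (x : V R d),
  0 <= nu ->
  \int[mu d]_y (gq y * expR (- (nu ^+ 2 * dotp (x + r *: y - v) (x + r *: y - v)))) <=
  C / (1 + nu * enorm (x - v)) ^+ d.
Proof.
have [C C0 hC] := gauss_tail d; exists (Num.sqrt (pi / (3 / 16)) ^+ d * C).
  by rewrite mulr_gt0// exprn_gt0// sqrtr_gt0 divr_gt0// pi_gt0.
move=> nu v r x nu0; have [B B1 hB] := gq_conv_step d nu r.
have B0 : 0 < B by exact: lt_le_trans ltr01 B1.
under eq_Rintegral do rewrite addrAC.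
rewrite (hB (x - v)).2 -mulrA -[leRHS]mulrA ler_wpM2l ?exprn_ge0 ?sqrtr_ge0//.
rewrite (_ : (nu / B) ^+ 2 * _ = (nu * enorm (x - v)) ^+ 2 / B ^+ 2); last first.
  by rewrite -enorm_sqr !exprMn exprVn; ring.
by apply: hC => //; rewrite mulr_ge0 ?enorm_ge0.
Qed.

(** A function of xi1 + xi2 is averaged over one half of the variables after the other, each time by
    a Gaussian in dimension n. The widening factors multiply, and the decay is only of order n
    although the space has dimension 2n. *)
Lemma conv_addV n : exists2 C : R, 0 < C & forall (nu : R) (r : R) (x : V R (n + n)),
  0 <= nu ->
  \int[mu (n + n)]_y (gq y * expR (- (nu ^+ 2 * dotp (addV (x + r *: y)) (addV (x + r *: y))))) <=
  C / (1 + nu * enorm (addV x)) ^+ n.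
Proof.
have [C C0 hC] := gauss_tail n; pose k : R := Num.sqrt (pi / (3 / 16)) ^+ n.
have k0 : 0 < k by rewrite exprn_gt0// sqrtr_gt0 divr_gt0// pi_gt0.
exists (k * k * C); first by rewrite !mulr_gt0.
move=> nu r x nu0; have [B B1 hB] := gq_conv_step n nu r.
have B0 : 0 < B by exact: lt_le_trans ltr01 B1.
have [B' B1' hB'] := gq_conv_step n (nu / B) r.
have B0' : 0 < B' by exact: lt_le_trans ltr01 B1'.
pose f (y : V R (n + n)) := gq y * expR (- (nu ^+ 2 * dotp (addV (x + r *: y)) (addV (x + r *: y)))).
have f0 y : 0 <= f y by rewrite mulr_ge0 ?expR_ge0.
have mf : measurable_fun setT f.
  apply: measurable_funM; first exact: rig_meas (@rig_gq R _).
  apply: measurableT_comp => //; apply: measurableT_comp => //; apply: measurable_funM => //.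
  have ma : measurable_fun setT (fun y : V R (n + n) => addV (x + r *: y) : V R n).
    apply: (measurableT_comp (@measurable_addVsub R n)); apply: measurable_addV => //.
    exact: measurable_scaleV.
  exact: measurable_dotp.
have E y1 y2 : f (rowV (y1, y2)) = gq y1 * (gq y2 * expR (- (nu ^+ 2 * dotp (addV x + r *: y1 + r *: y2) (addV x + r *: y1 + r *: y2)))).
  rewrite /f addV_step addV_row scalerDr addrA mulrA; congr (_ * _).
  by rewrite /gq dotp_row -expRD; congr expR; ring.
suff -> : \int[mu (n + n)]_y f y = k * k * ((B * B') ^- n * expR (- ((nu * enorm (addV x)) ^+ 2 / (B * B') ^+ 2))).
  rewrite -(mulrA (k * k)) ler_wpM2l ?mulr_ge0 ?(ltW k0)//; apply: hC; last by rewrite mulr_ge0 ?enorm_ge0.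
  by rewrite -[leLHS]mulr1 ler_pM.
have mfE : measurable_fun setT (fun y => (f y)%:E) by exact/measurable_EFinP.
have fE0 y : (0 <= (f y)%:E)%E by rewrite lee_fin.
rewrite /Rintegral (ge0_integral_iterated mfE fE0).
have inner y1 : (\int[mu n]_y2 (f (rowV (y1, y2)))%:E =
    (k * B ^- n * (gq y1 * expR (- ((nu / B) ^+ 2 * dotp (addV x + r *: y1) (addV x + r *: y1)))))%:E)%E.
  have [i1 e1] := hB (addV x + r *: y1).
  under eq_integral do rewrite E.
  rewrite -EFin_Rintegral; last exact: (rigZ _ i1).
  by rewrite RintegralZl// e1; congr (_%:E); rewrite -/k; ring.
under eq_integral do rewrite inner.
have [i1 e1] := hB' (addV x).
rewrite -EFin_Rintegral; last exact: (rigZ _ i1).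
rewrite RintegralZl// e1 -/k /= [RHS](_ : _ = k * B ^- n * (k * B' ^- n * expR (- ((nu * enorm (addV x)) ^+ 2 / (B * B') ^+ 2)))).
  congr (_ * (_ * expR (- _))); rewrite -enorm_sqr.
  have Bn : B != 0 by rewrite gt_eqF.
  have Bn' : B' != 0 by rewrite gt_eqF.
  by field; rewrite Bn Bn'.
by rewrite exprMn invfM; ring.
Qed.

End GaussConv.

(** * Dyadic sums *)

Section DyadicSum.
Context {R : realType}.

(** The pointwise envelope of a multiplier made of J dyadic scales, at distance t from the set where
    they concentrate; r is the growth of the derivative cost from one scale to the next. *)
Definition dsum (D : nat) (r : R) (J : nat) (t : R) : R :=
  \sum_(i < J) r ^+ i / (1 + 2 ^+ i * t) ^+ D.

Lemma dsumS D r J t : dsum D r J.+1 t = (1 + t) ^- D + r * dsum D r J (2 * t).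
Proof.
rewrite /dsum big_ord_recl !expr0 !mul1r mulr_sumr; congr (_ + _).
by apply: eq_bigr => i _; rewrite !lift0 exprS exprSr mulrA (mulrA _ 2).
Qed.

Lemma dsum_ge0 D r J t : 0 <= r -> 0 <= t -> 0 <= dsum D r J t.
Proof.
move=> r0 t0; apply: sumr_ge0 => i _.
by rewrite divr_ge0 ?exprn_ge0// addr_ge0// mulr_ge0// exprn_ge0.
Qed.

(** Only the terms with [2 ^ i * t <= 1] matter, and these grow geometrically. *)
Lemma dsum_bound (D : nat) (r : R) : 1 < r -> r < 2 ^+ D ->
  exists2 K, 0 < K & forall J t, 0 <= t ->
    (1 <= t -> dsum D r J t <= K) /\
    (t <= 1 -> exists i, [/\ (i <= J)%N, 2 ^+ i * t <= 1 & dsum D r J t <= K * r ^+ i]).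
Proof.
move=> r1 rD; have r0 : 0 < r by exact: lt_trans ltr01 r1.
have D0 : 0 < 2 ^+ D :> R by rewrite exprn_gt0.
(* The fixed point of K1 = 1 + (r / 2^D) K1, which closes the induction on t >= 1 through t -> 2
   t. *)
pose K1 := (1 - r / 2 ^+ D)^-1.
have k1 : 0 < 1 - r / 2 ^+ D by rewrite subr_gt0 ltr_pdivrMr// mul1r.
have K1g : 1 <= K1 by rewrite /K1 invf_ge1// gerBl divr_ge0 ?ltW.
have K1E : 1 + r / 2 ^+ D * K1 = K1.
  have kn : 1 - r / 2 ^+ D != 0 by rewrite gt_eqF.
  apply: (mulfI kn); rewrite mulrDr mulr1 mulrCA /K1 divff// mulr1; ring.
have big J t : 1 <= t -> dsum D r J t <= K1 / t ^+ D.
  elim: J t => [|J IH] t t1; have t0 : 0 < t by exact: lt_le_trans ltr01 t1.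
    by rewrite /dsum big_ord0 divr_ge0 ?exprn_ge0 ?(ltW t0)// (le_trans ler01).
  rewrite dsumS; apply: (@le_trans _ _ (t ^- D + r * (K1 / (2 * t) ^+ D))).
    rewrite lerD//; last by rewrite ler_wpM2l ?(ltW r0)// IH//; lra.
    rewrite lef_pV2 ?posrE ?exprn_gt0// ?addr_gt0// lerXn2r ?nnegrE ?addr_ge0 ?(ltW t0)//.
    by rewrite lerDr.
  rewrite le_eqVlt -{2}K1E exprMn invfM; apply/orP; left; apply/eqP; ring.
(* The subtracted constant with r K2 = 1 + K2: it absorbs the summand 1 of each step while t <=
   1. *)
pose K2 := (r - 1)^-1; have K20 : 0 < K2 by rewrite invr_gt0 subr_gt0.
have K2E : r * K2 = 1 + K2.
  by rewrite -{1}(subrK 1 r) mulrDl mul1r divff// gt_eqF// subr_gt0.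
(* Fits the step that crosses 1, where t <= 1 < 2 t and the sum is at most 1 + r K1 = K3 - K2. *)
pose K3 := 1 + r * K1 + K2.
have K30 : 0 < K3 by rewrite addr_gt0// addr_gt0// mulr_gt0// (lt_le_trans ltr01).
have K13 : K1 <= K3.
  rewrite /K3; apply: (@le_trans _ _ (r * K1)); first by rewrite ler_peMl ?(le_trans ler01)// ltW.
  by have := ltW K20; lra.
have small J t : 0 <= t -> t <= 1 -> exists i, [/\ (i <= J)%N, 2 ^+ i * t <= 1 & dsum D r J t <= K3 * r ^+ i - K2].
  elim: J t => [|J IH] t t0 t1.
    exists 0%N; rewrite /dsum big_ord0 !expr0 mul1r mulr1; split=> //.
    by rewrite /K3 addrK addr_ge0// mulr_ge0 ?(ltW r0)// (le_trans ler01).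
  have h : (1 + t) ^- D <= 1.
    by rewrite invf_le1 ?exprn_gt0 ?exprn_ege1 ?lerDl// ltr_wpDr.
  have [t2|t2] := leP (2 * t) 1.
    have [i [iJ it hi]] := IH (2 * t) (mulr_ge0 (ler0n _ _) t0) t2.
    exists i.+1; rewrite exprSr -mulrA; split=> //.
    rewrite dsumS; apply: (@le_trans _ _ (1 + r * (K3 * r ^+ i - K2))).
      by rewrite lerD// ler_wpM2l// ltW.
    by rewrite mulrBr K2E (exprS r); lra.
  exists 0%N; rewrite !expr0 mul1r mulr1; split=> //.
  rewrite dsumS /K3 addrK lerD// ler_wpM2l ?(ltW r0)//.
  apply: le_trans (big J _ (ltW t2)) _.
  rewrite ler_pdivrMr ?exprn_gt0 ?(lt_trans ltr01)// ler_peMr ?(le_trans ler01 K1g)//.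
  by rewrite exprn_ege1// ltW.
exists K3 => // J t t0; split=> t1.
  apply: le_trans (big J t t1) _; apply: le_trans _ K13.
  rewrite ler_pdivrMr ?exprn_gt0 ?(lt_le_trans ltr01)// ler_peMr ?(le_trans ler01 K1g)//.
  exact: exprn_ege1.
have [i [i1 i2 i3]] := small J t t0 t1; exists i; split=> //.
by apply: le_trans i3 _; rewrite gerBl ltW.
Qed.

Lemma ltr_powR_exp (a x y : R) : 1 < a -> x < y -> powR a x < powR a y.
Proof.
move=> a1 xy; rewrite /powR gt_eqF ?(lt_trans ltr01)//=.
by rewrite ltr_expR ltr_pM2r// ln_gt0.
Qed.

(** For r = 2^(D/u) the dominant term r^i has u-th power 2^(D i). Its index depends on t and
    satisfies 2^i t <= 1, so the Gaussian of 2^i t is at least 1/e there. Summing over all indices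
    up to J removes the dependence and leaves terms with bounded integrals. *)
Lemma dsum_powR (D : nat) (u : R) : (0 < D)%N -> 1 < u ->
  exists2 C, 0 < C & forall J t, 0 <= t ->
    powR (dsum D (powR 2 (D%:R / u)) J t) u <=
    C * (1 + \sum_(i < J.+1) 2 ^+ (D * i) * expR (- (2 ^+ i * t) ^+ 2)).
Proof.
move=> D0 u1; have u0 : 0 < u by exact: lt_trans ltr01 u1.
set r := powR 2 (D%:R / u).
have Dr : 0 < D%:R :> R by rewrite ltr0n.
have r1 : 1 < r by rewrite -(powRr0 2) ltr_powR_exp ?ltr1n// divr_gt0.
have r0 : 0 < r by exact: lt_trans ltr01 r1.
have rD : r < 2 ^+ D.
  by rewrite -powR_mulrn// ltr_powR_exp ?ltr1n// ltr_pdivrMr// ltr_pMr.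
have [K K0 hK] := dsum_bound r1 rD.
exists (powR K u * expR 1); first by rewrite mulr_gt0 ?powR_gt0 ?expR_gt0.
move=> J t t0; have [h1 h2] := hK J t t0.
have s0 := dsum_ge0 D J (ltW r0) t0.
have S0 : 0 <= \sum_(i < J.+1) 2 ^+ (D * i) * expR (- (2 ^+ i * t) ^+ 2) :> R.
  by apply: sumr_ge0 => i _; rewrite mulr_ge0 ?exprn_ge0 ?expR_ge0.
have mono (a b : R) : 0 <= a -> a <= b -> powR a u <= powR b u.
  by move=> a0 ab; apply: ge0_ler_powR; rewrite ?nnegrE ?(ltW u0)// (le_trans a0).
have [t1|t1] := leP 1 t.
  apply: le_trans (mono _ _ s0 (h1 t1)) _; rewrite -mulrA ler_peMr ?powR_ge0//.
  apply: (@le_trans _ _ (1 * 1)); first by rewrite mulr1.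
  by apply: ler_pM => //; rewrite ?lerDl// -[leLHS]expR0 ler_expR.
have [i [iJ it hi]] := h2 (ltW t1).
apply: le_trans (mono _ _ s0 hi) _.
rewrite powRM ?exprn_ge0 ?(ltW K0) ?(ltW r0)// -mulrA ler_wpM2l ?powR_ge0//.
have -> : powR (r ^+ i) u = 2 ^+ (D * i).
  rewrite -powR_mulrn ?(ltW r0)// /r -!powRrM -powR_mulrn//; congr powR.
  by rewrite natrM; field; rewrite gt_eqF.
apply: (@le_trans _ _ (expR 1 * (2 ^+ (D * i) * expR (- (2 ^+ i * t) ^+ 2)))).
  rewrite mulrCA ler_peMr ?exprn_ge0// -expRD -[leLHS]expR0 ler_expR subr_ge0.
  by rewrite expr_le1// mulr_ge0 ?exprn_ge0.
rewrite ler_wpM2l ?expR_ge0// (bigD1 (Ordinal (iJ : (i < J.+1)%N)))//= addrCA lerDl addr_ge0//.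
by apply: sumr_ge0 => k _; rewrite mulr_ge0 ?exprn_ge0 ?expR_ge0.
Qed.

End DyadicSum.

(** * Lebesgue norms of Gaussians and of dyadic envelopes *)

Section LpNorms.
Context {R : realType}.
Implicit Types (d n : nat).

Lemma measurable_powRf disp (T : measurableType disp) (p : R) (g : T -> R) :
  measurable_fun setT g -> measurable_fun setT (fun x => powR (g x) p).
Proof. by move=> mg; apply: (@measurableT_comp _ _ _ _ _ _ (fun x : R => x `^ p)). Qed.

Lemma Lpn_fin d (p : R) (g : V R d -> R) : rig (mu d) (fun x => powR (g x) p) ->
  Lpn p g = (powR (\int[mu d]_x powR (g x) p) p^-1)%:E.
Proof. by move=> ig; rewrite /Lpn -EFin_Rintegral// poweR_EFin. Qed.

Lemma Lpn_scale d (p k : R) (g : V R d -> R) : 0 < p -> 0 <= k ->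
  (forall x, 0 <= g x) -> rig (mu d) (fun x => powR (g x) p) ->
  Lpn p (fun x => k * g x) = (k * powR (\int[mu d]_x powR (g x) p) p^-1)%:E.
Proof.
move=> p0 k0 g0 ig.
have E x : powR (k * g x) p = powR k p * powR (g x) p by rewrite powRM.
rewrite Lpn_fin; last first.
  by have := rigZ (powR k p) ig; congr rig; apply/funext => x; rewrite E.
under eq_Rintegral do rewrite E.
rewrite RintegralZl// powRM ?powR_ge0//; last by apply: Rintegral_ge0 => x _; exact: powR_ge0.
by rewrite -powRrM divff ?gt_eqF// powRr1.
Qed.

Lemma gauss_powR d (p c : R) (x : V R d) :
  powR (expR (- (c * dotp x x))) p = expR (- (c * p * dotp x x)).
Proof. by rewrite -expRM; congr expR; ring. Qed.

Lemma Lpn_gauss d (p k c : R) : 0 < p -> 0 <= k -> 0 < c ->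
  Lpn p (fun x : V R d => k * expR (- (c * dotp x x))) =
  (k * powR (Num.sqrt (pi / (c * p)) ^+ d) p^-1)%:E.
Proof.
move=> p0 k0 c0; have [i1 e1] := gaussV_int d (mulr_gt0 c0 p0).
have E : (fun x : V R d => powR (expR (- (c * dotp x x))) p) = fun x => expR (- (c * p * dotp x x)).
  by apply/funext => x; exact: gauss_powR.
by rewrite Lpn_scale ?E ?e1// => x; exact: expR_ge0.
Qed.

Lemma rig_exp_enorm d (c : R) : 0 < c -> rig (mu d) (fun x => expR (- (c * enorm x))).
Proof.
move=> c0; have [C C0 hC] := @pow_exp R (2 * d) c c0.
apply: (rig_le _ (rigZ C (@rig_pdecay R d))).
  apply: measurableT_comp => //; apply: measurableT_comp => //.
  by apply: measurable_funM => //; exact: measurable_enorm.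
move=> x; rewrite ger0_norm ?expR_ge0// /pdecay.
have w0 : 0 < (1 + enorm x ^+ 2) ^+ d by rewrite exprn_gt0// ltr_wpDr// sqr_ge0.
rewrite ler_pdivlMr// mulrC -(ler_pM2r (expR_gt0 (c * enorm x))) -mulrA -expRD addNr expR0 mulr1.
apply: le_trans (hC _ (enorm_ge0 x)); rewrite exprM lerXn2r ?nnegrE ?addr_ge0 ?sqr_ge0//.
by rewrite sqrrD expr1n mul1r; have := enorm_ge0 x; lra.
Qed.

Definition wexp d (u : R) (x : V R d) := expR (- (u / 2 * enorm x)).

(** The u-th power of the norm receives one bounded contribution from the constant [A] and one from
    each of the J + 1 indices, hence J + 2. *)
Lemma Lpn_dsum d (D : nat) (u A B C0 : R) : (0 < D)%N -> 1 < u -> 0 <= A -> 0 <= B -> 0 <= C0 ->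
  exists2 C, 0 <= C & forall (X : V R d -> R) J, measurable_fun setT X -> (forall x, 0 <= X x) ->
    (forall i, \int[mu d]_x (wexp u x * (2 ^+ (D * i) * expR (- (2 ^+ i * X x) ^+ 2))) <= C0) ->
    (Lpn u (fun x : V R d => expR (- (enorm x / 2)) * (A + B * dsum D (powR 2 (D%:R / u)) J (X x)))%R <=
      (C * powR J.+2%:R u^-1)%:E)%E.
Proof.
move=> D0 u1 A0 B0 C00; have u0 : 0 < u by exact: lt_trans ltr01 u1.
have [K K0 hK] := dsum_powR D0 u1.
have iw := @rig_exp_enorm d (u / 2) (divr_gt0 u0 (ltr0n R 2)).
set r := powR 2 (D%:R / u) in hK *.
pose W := \int[mu d]_x wexp u x.
have W0 : 0 <= W by apply: Rintegral_ge0 => x _; exact: expR_ge0.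
(* From (a + b)^u <= 2^u (a^u + b^u). *)
pose M := powR 2 u * (powR A u + powR B u * K).
have M0 : 0 <= M by rewrite mulr_ge0 ?powR_ge0// addr_ge0 ?mulr_ge0 ?powR_ge0 ?(ltW K0).
exists (powR (M * (W + C0)) u^-1); first exact: powR_ge0.
move=> X J mX X0 hX.
pose T (i : nat) (x : V R d) : R := wexp u x * (2 ^+ (D * i) * expR (- (2 ^+ i * X x) ^+ 2)).
have T0 i x : 0 <= T i x by rewrite !mulr_ge0 ?expR_ge0 ?exprn_ge0.
have r0 : 0 <= r by exact: powR_ge0.
have mT i : measurable_fun setT (T i).
  apply: measurable_funM; first exact: rig_meas iw.
  apply: measurable_funM => //; apply: measurableT_comp => //; apply: measurableT_comp => //.
  by apply: measurable_funX; exact: measurable_funM.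
have iT i : rig (mu d) (T i).
  apply: (rig_le (mT i) (rigZ (2 ^+ (D * i)) iw)) => x; rewrite ger0_norm//.
  rewrite /T mulrC ler_wpM2r ?expR_ge0// ler_piMr ?exprn_ge0//.
  by rewrite -[leRHS]expR0 ler_expR oppr_le0 sqr_ge0.
have sum_le k : (exists2 F0 : V R d -> R, rig (mu d) F0 & F0 = (fun x => \sum_(i < k) T i x)) /\
    \int[mu d]_x \sum_(i < k) T i x <= k%:R * C0.
  elim: k => [|k [[F0 iS' SE] IHk]].
    split; last by under eq_Rintegral do rewrite big_ord0; rewrite /Rintegral integral0 mul0r.
    exists (fun _ => 0); first exact: integrable0.
    by apply/funext => x; rewrite big_ord0.
  have Es : (fun x => \sum_(i < k.+1) T i x) = (fun x => F0 x + T k x).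
    by apply/funext => x; rewrite big_ord_recr/= SE.
  split; first by exists (fun x => F0 x + T k x); [exact: rigD|rewrite Es].
  have iTk := iT k; rewrite Es RintegralD// -natr1 mulrDl mul1r lerD//; first by rewrite SE.
  exact: hX.
have [[F0 iS' SE] hS] := sum_le J.+1.
pose G (x : V R d) : R := expR (- (enorm x / 2)) * (A + B * dsum D r J (X x)).
have mG : measurable_fun setT G.
  apply: measurable_funM.
    apply: measurableT_comp => //; apply: measurableT_comp => //.
    by apply: measurable_funM => //; exact: measurable_enorm.
  apply: measurable_funD => //; apply: measurable_funM => //.
  apply: measurable_sum => i; apply: measurable_funM => //.
  apply: measurable_inv_pos; last first.
    by move=> x; rewrite exprn_gt0// ltr_wpDr// mulr_ge0 ?exprn_ge0.
  by apply: measurable_funX; apply: measurable_funD => //; exact: measurable_funM.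
have iS : rig (mu d) (fun x => wexp u x + \sum_(i < J.+1) T i x).
  by apply: rigD => //; rewrite -SE.
have GS x : powR (G x) u <= M * (wexp u x + \sum_(i < J.+1) T i x).
  have d0 := dsum_ge0 D J r0 (X0 x).
  rewrite /G powRM ?expR_ge0 ?addr_ge0 ?mulr_ge0//.
  have -> : powR (expR (- (enorm x / 2))) u = wexp u x.
    by rewrite -expRM /wexp; congr expR; ring.
  have -> : wexp u x + \sum_(i < J.+1) T i x =
      wexp u x * (1 + \sum_(i < J.+1) 2 ^+ (D * i) * expR (- (2 ^+ i * X x) ^+ 2)).
    by rewrite mulrDr mulr1 mulr_sumr.
  rewrite mulrCA ler_wpM2l ?expR_ge0// /M -!mulrA.
  set Q := 1 + _; have Q1 : 1 <= Q.
    by rewrite lerDl; apply: sumr_ge0 => i _; rewrite mulr_ge0 ?exprn_ge0 ?expR_ge0.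
  set a := A; set b := B * dsum D r J (X x).
  have b0 : 0 <= b by rewrite mulr_ge0.
  have mono (y z : R) : 0 <= y -> y <= z -> powR y u <= powR z u.
    by move=> y0 yz; apply: ge0_ler_powR; rewrite ?nnegrE ?(ltW u0)// (le_trans y0).
  apply: (@le_trans _ _ (powR 2 u * (powR a u + powR b u))).
    have [ab|ba] := leP a b.
      apply: (@le_trans _ _ (powR (2 * b) u)); first by apply: mono; [exact: addr_ge0|lra].
      by rewrite powRM// ler_wpM2l ?powR_ge0// lerDr powR_ge0.
    apply: (@le_trans _ _ (powR (2 * a) u)); first by apply: mono; [exact: addr_ge0|lra].
    by rewrite powRM// ler_wpM2l ?powR_ge0// lerDl powR_ge0.
  rewrite ler_wpM2l ?powR_ge0// mulrDl lerD//; first by rewrite ler_peMr ?powR_ge0.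
  by rewrite /b powRM// -mulrA ler_wpM2l ?powR_ge0// hK.
have iG : rig (mu d) (fun x => powR (G x) u).
  apply: (rig_le (measurable_powRf u mG) (rigZ M iS)) => x.
  by rewrite ger0_norm ?powR_ge0.
rewrite (Lpn_fin iG) lee_fin -powRM; last 2 first.
- by rewrite mulr_ge0// addr_ge0.
- by [].
apply: ge0_ler_powR.
- by rewrite invr_ge0 ltW.
- by rewrite nnegrE; apply: Rintegral_ge0 => x _; exact: powR_ge0.
- by rewrite nnegrE; apply: mulr_ge0 => //; apply: mulr_ge0 => //; exact: addr_ge0.
apply: (@le_trans _ _ (\int[mu d]_x (M * (wexp u x + \sum_(i < J.+1) T i x)))).
  by apply: le_Rintegral => //; exact: rigZ.
rewrite RintegralZl// -mulrA ler_wpM2l//.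
rewrite RintegralD//; last by rewrite -SE.
rewrite -/W -[J.+2%:R]natr1 mulrDr mulr1 addrC.
apply: lerD; last by rewrite lerDl.
apply: le_trans hS _; rewrite mulrC ler_wpM2r ?ler0n// lerDr//.
Qed.

(** The weight [wexp] is bounded by 1, and 2^(d i) is exactly the normalisation of the Gaussian at
    scale 2^-i. *)
Lemma dsum_int_id d (v : 'rV[R]_d) (u : R) (i : nat) : 0 <= u ->
  \int[mu d]_x (wexp u x * (2 ^+ (d * i) * expR (- (2 ^+ i * enorm (x - v)) ^+ 2))) <=
  Num.sqrt pi ^+ d.
Proof.
move=> u0; have c0 : 0 < (2 ^+ i : R) ^+ 2 by rewrite !exprn_gt0.
have [i1 e1] := gaussV_int d c0; have is_ := rig_shift (- v) i1.
have E (x : V R d) : expR (- (2 ^+ i * enorm (x - v)) ^+ 2) = expR (- ((2 ^+ i) ^+ 2 * dotp (x - v) (x - v))).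
  by rewrite exprMn enorm_sqr.
under eq_Rintegral do rewrite E.
have mw : measurable_fun setT (@wexp d u).
  apply: measurableT_comp => //; apply: measurableT_comp => //.
  by apply: measurable_funM => //; exact: measurable_enorm.
apply: (@le_trans _ _ (\int[mu d]_x (2 ^+ (d * i) * expR (- ((2 ^+ i) ^+ 2 * dotp (x - v) (x - v)))))).
  have w1 x : 0 <= @wexp d u x <= 1.
    rewrite expR_ge0 -[leRHS]expR0 ler_expR oppr_le0 mulr_ge0 ?enorm_ge0// divr_ge0//.
  have K0 x : 0 <= 2 ^+ (d * i) * expR (- ((2 ^+ i) ^+ 2 * dotp (x - v) (x - v))).
    by rewrite mulr_ge0 ?exprn_ge0 ?expR_ge0.
  have iz := rigZ (2 ^+ (d * i)) is_.
  apply: le_Rintegral => //.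
    apply: (rig_le _ iz); first by apply: measurable_funM => //; exact: rig_meas iz.
    by move=> x; have /andP[h1 h2] := w1 x; rewrite ger0_norm ?mulr_ge0// ler_piMl.
  by move=> x _; have /andP[h1 h2] := w1 x; rewrite ler_piMl.
rewrite RintegralZl// (Rint_shift (- v) (rig_meas i1)) e1.
rewrite sqrtrM ?pi_ge0// sqrtrV ?exprn_ge0// sqrtr_sqr ger0_norm ?exprn_ge0//.
rewrite exprMn mulrCA exprVn -exprM mulnC mulfV ?mulr1// expf_neq0//.
Qed.

(** The Gaussian in xi1 + xi2 integrates out one copy of the space; the exponential weight is what
    makes the integral over the other copy finite. *)
Lemma dsum_int_addV n (u : R) (i : nat) : 0 < u ->
  \int[mu (n + n)]_x (wexp u x * (2 ^+ (n * i) * expR (- (2 ^+ i * enorm (addV x)) ^+ 2))) <=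
  Num.sqrt pi ^+ n * \int[mu n]_x (wexp u x).
Proof.
move=> u0; have c0 : 0 < (2 ^+ i : R) ^+ 2 by rewrite !exprn_gt0.
have [i1 e1] := gaussV_int n c0.
pose f (x : V R (n + n)) := wexp u x * (2 ^+ (n * i) * expR (- (2 ^+ i * enorm (addV x)) ^+ 2)).
have f0 x : 0 <= f x by rewrite !mulr_ge0 ?expR_ge0 ?exprn_ge0.
have mw k : measurable_fun setT (@wexp k u).
  apply: measurableT_comp => //; apply: measurableT_comp => //.
  by apply: measurable_funM => //; exact: measurable_enorm.
have mf : measurable_fun setT f.
  apply: measurable_funM => //; apply: measurable_funM => //; apply: measurableT_comp => //.
  apply: measurableT_comp => //; apply: measurable_funX; apply: measurable_funM => //.
  by apply: measurable_enorm; exact: measurable_addVsub.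
have mfE : measurable_fun setT (fun y => (f y)%:E) by exact/measurable_EFinP.
have fE0 y : (0 <= (f y)%:E)%E by rewrite lee_fin.
have iw := @rig_exp_enorm n (u / 2) (divr_gt0 u0 (ltr0n R 2)).
have sq : 2 ^+ (n * i) * Num.sqrt (pi / (2 ^+ i) ^+ 2) ^+ n = Num.sqrt pi ^+ n :> R.
  rewrite sqrtrM ?pi_ge0// sqrtrV ?exprn_ge0// sqrtr_sqr ger0_norm ?exprn_ge0//.
  by rewrite exprMn mulrCA exprVn -exprM mulnC mulfV ?mulr1// expf_neq0.
have inner (x : V R n) : (\int[mu n]_y (f (rowV (x, y)))%:E <= (Num.sqrt pi ^+ n * wexp u x)%:E)%E.
  have is_ := rig_shift x i1.
  apply: (@le_trans _ _ (\int[mu n]_y (wexp u x * 2 ^+ (n * i) * expR (- ((2 ^+ i) ^+ 2 * dotp (y + x) (y + x))))%:E)%E).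
    apply: ge0_le_integral => //.
    - apply: (measurableT_comp mfE); apply: (measurableT_comp (@measurable_rowV R n n)).
      exact: pair1_measurable.
    - by apply/measurable_EFinP; exact: rig_meas (rigZ _ is_).
    move=> y _; rewrite lee_fin /f addV_row -mulrA (addrC y) exprMn enorm_sqr.
    rewrite ler_wpM2r ?mulr_ge0 ?exprn_ge0 ?expR_ge0// /wexp ler_expR lerN2.
    rewrite ler_wpM2l ?divr_ge0 ?(ltW u0)// /enorm ler_wsqrtr// dotp_row lerDl.
    exact: dotp_ge0.
  rewrite -EFin_Rintegral; last exact: (rigZ _ is_).
  rewrite lee_fin RintegralZl// (Rint_shift x (rig_meas i1)) e1 -mulrA sq mulrC//.
have iz := rigZ (Num.sqrt pi ^+ n) iw.
have h : (\int[mu (n + n)]_x (f x)%:E <= (Num.sqrt pi ^+ n * \int[mu n]_x wexp u x)%:E)%E.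
  rewrite (ge0_integral_iterated mfE fE0) -RintegralZl// EFin_Rintegral//.
  apply: ge0_le_integral => //.
  - by move=> x _; exact: integral_ge0.
  - apply: (@measurable_fun_fubini_tonelli_F _ _ _ _ _ (mu n) (fun p => (f (rowV p))%:E)) => //.
    exact: measurableT_comp mfE (@measurable_rowV R n n).
  - by apply/measurable_EFinP; exact: rig_meas iz.
rewrite -lee_fin; apply: (le_trans _ h); rewrite /Rintegral fineK//.
rewrite ge0_fin_numE; last by apply: integral_ge0 => y _; rewrite lee_fin; exact: f0.
by apply: le_lt_trans h _; rewrite ltry.
Qed.

End LpNorms.

(** * Oscillating multipliers *)

Section Testing.
Context {R : realType}.
Variable n : nat.

Lemma enorm_lsub (x : 'rV[R]_(n + n)) : enorm (lsubmx x) <= 1 * enorm x.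
Proof.
rewrite mul1r /enorm ler_wsqrtr// -[in leRHS](hsubmxK x) (dotp_row (lsubmx x : V R n) _ (rsubmx x : V R n)).
by rewrite lerDl dotp_ge0.
Qed.

Lemma enorm_rsub (x : 'rV[R]_(n + n)) : enorm (rsubmx x) <= 1 * enorm x.
Proof.
rewrite mul1r /enorm ler_wsqrtr// -[in leRHS](hsubmxK x) (dotp_row (lsubmx x : V R n) _ (rsubmx x : V R n)).
by rewrite lerDr dotp_ge0.
Qed.

Lemma enorm_addV (x : 'rV[R]_(n + n)) : enorm (addV x) <= 2 * enorm x.
Proof.
apply: le_trans (enormD _ _) _.
by have := enorm_lsub x; have := enorm_rsub x; lra.
Qed.

Lemma dotp_sub (x : 'rV[R]_(n + n)) :
  dotp x x = dotp (lsubmx x) (lsubmx x) + dotp (rsubmx x) (rsubmx x).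
Proof.
by rewrite -[in LHS](hsubmxK x) (dotp_row (lsubmx x : V R n) _ (rsubmx x : V R n)).
Qed.

Lemma lsub_step (x y : 'rV[R]_(n + n)) (h : R) : lsubmx (x + h *: y) = lsubmx x + h *: lsubmx y.
Proof. by apply/rowP => i; rewrite !mxE. Qed.

Lemma rsub_step (x y : 'rV[R]_(n + n)) (h : R) : rsubmx (x + h *: y) = rsubmx x + h *: rsubmx y.
Proof. by apply/rowP => i; rewrite !mxE. Qed.

Lemma measurable_lsub : measurable_fun setT (fun x : V R (n + n) => lsubmx x : V R n).
Proof. by apply: measurable_funV => i; under eq_fun do rewrite mxE; exact: measurable_coord. Qed.

Lemma measurable_rsub : measurable_fun setT (fun x : V R (n + n) => rsubmx x : V R n).
Proof. by apply: measurable_funV => i; under eq_fun do rewrite mxE; exact: measurable_coord. Qed.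

Lemma addVZ (c : R) (x : 'rV[R]_(n + n)) : addV (c *: x) = c *: addV x.
Proof. by rewrite /addV !linearZ/= scalerDr. Qed.

Lemma fhat_gauV d (a b : R) (v xi : 'rV[R]_d) : 0 < a ->
  fhat (gauV a b v) xi = gJ a b 0 ^+ d *
    gauV (a / (a ^+ 2 + b ^+ 2)) (- b / (a ^+ 2 + b ^+ 2)) 0 (v + xi).
Proof.
move=> a0; rewrite fhatE; last exact: cig_gauV.
rewrite -gauV_fourier//; apply: cI_eq => x.
by rewrite /gauV /chr /cexp/= dotpDr -mulrA -expiD; congr (_ * expi _); ring.
Qed.

Lemma LpNorm_gauV d (p a b : R) (v : 'rV[R]_d) : 0 < p -> 0 < a ->
  LpNorm p (gauV a b v) = (powR (Num.sqrt (a * p)^-1 ^+ d) p^-1)%:E.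
Proof.
move=> p0 a0; rewrite LpNormE; last exact: cmeas_gauV.
have E : (fun x : V R d => cabs (gauV a b v x)) = fun x => 1 * expR (- (pi * a * dotp x x)).
  by apply/funext => x; rewrite cabs_gauV mul1r.
have pa : 0 < pi * a by rewrite mulr_gt0 ?pi_gt0.
rewrite E (Lpn_gauss _ p0 ler01 pa) mul1r (_ : pi / (pi * a * p) = (a * p)^-1)//.
by rewrite -mulrA invfM mulrA divff ?mul1r// gt_eqF ?pi_gt0.
Qed.

Variables (p1 p2 p u s : R) (Theta : 'rV[R]_(n + n) -> R[i]).
Hypotheses (u1 : 1 < u) (s0 : 0 < s) (p_gt0 : 0 < p) (p1_gt0 : 0 < p1) (p2_gt0 : 0 < p2).
Hypotheses (sT : schwartz Theta) (suppT : supp (fhat Theta)).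

Definition mult_bound (C : R) := forall m : 'rV[R]_(n + n) -> R[i],
  borel_meas m -> bounded_cfun m -> (Aus u s Theta m < +oo)%E ->
  forall f1 f2 : 'rV[R]_n -> R[i], schwartz f1 -> schwartz f2 ->
  (LpNorm p (Tm m f1 f2) <= C%:E * Aus u s Theta m * LpNorm p1 f1 * LpNorm p2 f2)%E.

Lemma Aus_ge0 m : (0 <= Aus u s Theta m)%E.
Proof.
apply: (@le_trans _ _ (sobnorm u s (fun xi => m ((2 : R) ^ (0 : int) *: xi) * fhat Theta xi))).
  by apply/ereal_infP => _ [G [_ [_ ->]]]; exact: poweR_ge0.
by apply: ereal_sup_ubound; exists 0.
Qed.

Lemma Aus_le m (A : R) (g : int -> V R (n + n) -> R) :
  (forall k, measurable_fun setT (g k)) ->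
  (forall k, SB (fun xi => (sob_weight s xi)%:C%C * fhat (fun xi => m ((2 : R) ^ k *: xi) * fhat Theta xi) xi) (g k)) ->
  (forall k, Lpn u (g k) <= A%:E)%E -> (Aus u s Theta m <= A%:E)%E.
Proof.
move=> mg hS hA; apply/ereal_supP => _ [k ->]; apply: le_trans (hA k).
by apply: sobnorm_le_Lpn => //; exact: le_trans ler01 (ltW u1).
Qed.

(** [C] may be negative, hence |C|; all norms are replaced by finite real bounds. *)
Lemma mult_bound_use (C A N1 N2 : R) m (f1 f2 : 'rV[R]_n -> R[i]) : mult_bound C -> 0 <= A ->
  cmeas (m : V R (n + n) -> R[i]) -> bounded_cfun m -> (Aus u s Theta m <= A%:E)%E ->
  schwartz f1 -> schwartz f2 -> 0 <= N1 -> 0 <= N2 ->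
  LpNorm p1 f1 = N1%:E -> LpNorm p2 f2 = N2%:E ->
  (LpNorm p (Tm m f1 f2) <= (`|C| * A * N1 * N2)%:E)%E.
Proof.
move=> H A0 mm bm hA sf1 sf2 N10 N20 e1 e2.
have mb : borel_meas m by exact/borel_measP.
have Aoo : (Aus u s Theta m < +oo)%E by apply: le_lt_trans hA _; rewrite ltry.
apply: le_trans (H m mb bm Aoo f1 f2 sf1 sf2) _; rewrite e1 e2 !EFinM.
apply: lee_wpmul2r; first by rewrite lee_fin.
apply: lee_wpmul2r; first by rewrite lee_fin.
apply: (@le_trans _ _ (`|C|%:E * Aus u s Theta m)%E).
  by apply: lee_wpmul2r; [exact: Aus_ge0|rewrite lee_fin ler_norm].
by apply: lee_wpmul2l; rewrite ?lee_fin.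
Qed.

(** Change of variables [eta = xi1 + xi2]. *)
Lemma Tm_fold m (f1 f2 : 'rV[R]_n -> R[i]) (K : R[i]) (g : V R n -> R[i]) (B : R) (x : 'rV[R]_n) :
  cmeas g -> (forall y, cabs (g y) <= B) ->
  (forall xi, fhat f1 (lsubmx xi) * fhat f2 (rsubmx xi) * m xi =
     K * ((expR (- (2 * pi * dotp xi xi)))%:C%C * g (addV xi))) ->
  Tm m f1 f2 x = K * (2^-1 ^+ n)%:C%C *
    cI (mu n) (fun y => (expR (- (pi * dotp y y)))%:C%C * g y * chr (- x) y).
Proof.
move=> mg gB E; pose g' (y : V R n) := g y * chr (- x) y.
have mg' : cmeas g' by apply: cmeasM => //; exact: cmeas_chr.
have gB' y : cabs (g' y) <= B by rewrite cabsM cabs_chr mulr1.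
have [i1 e1] := gauss_fold mg' gB'.
have EE : (fun eta : 'rV[R]_(n + n) => fhat f1 (lsubmx eta) * fhat f2 (rsubmx eta) * m eta
    * expi (2 * pi * dotp x (lsubmx eta + rsubmx eta))) =
    fun eta : V R (n + n) => K * ((expR (- (2 * pi * dotp eta eta)))%:C%C * g' (addV eta)).
  apply/funext => eta; rewrite E -!mulrA; congr (_ * (_ * (_ * _))).
  by rewrite /chr dotpNr mulrN opprK (dotpC _ x) mulrA.
rewrite /Tm EE cintE; last exact: (cigZ K i1).
rewrite (cIZ K i1) e1 -mulrA; congr (_ * (_ * _)); apply: cI_eq => y.
by rewrite /g' mulrA.
Qed.

Lemma pow_exp_le (N : nat) (c : R) : 0 < c ->
  exists2 C, 0 < C & forall t, 0 <= t -> (1 + t) ^+ N * expR (- (c * t)) <= C.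
Proof.
move=> c0; have [C C0 hC] := @pow_exp R N c c0; exists C => // t t0.
by rewrite expRN ler_pdivrMr ?expR_gt0// hC.
Qed.

Lemma powR_growth (E F K : R) : (forall L : R, 1 <= L -> powR L E <= K * powR L F) -> E <= F.
Proof.
move=> H; rewrite leNgt; apply/negP => FE.
have d0 : 0 < E - F by rewrite subr_gt0.
have K0 : 0 < `|K| + 1 by rewrite ltr_wpDl.
(* Chosen so that L^(E - F) = |K| + 1 exceeds K. *)
pose L := powR (`|K| + 1) (E - F)^-1.
have L1 : 1 <= L.
  rewrite -(powRr0 (`|K| + 1)); apply: ler_powR; first by rewrite lerDr.
  by rewrite invr_ge0 ltW.
have L0 : 0 < L by exact: lt_le_trans ltr01 L1.
have := H L L1; rewrite -(subrK F E) powRD; last by apply/implyP => _; rewrite gt_eqF.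
rewrite ler_pM2r ?powR_gt0// /L -powRrM mulVf ?gt_eqF// powRr1 ?(ltW K0)//.
by have := ler_norm K; lra.
Qed.

Section OscillatingMultiplier.
Variables (c0 c1 c2 : bool).

Definition dil (k : int) : R := ((2 : R) ^ k) ^+ 2.

Lemma dil_ge0 k : 0 <= dil k.
Proof. exact: sqr_ge0. Qed.

(** The index is (lam, k): a Gaussian with up to three chirps of strength lam, all dilated by
    2^k. *)
Definition qosc (i : R * int) (x : V R (n + n)) : R[i] :=
  Complex (- (pi * dil i.2)) 0 * (dotp (x - 0) (x - 0))%:C%C +
  (Complex 0 (pi * i.1 * dil i.2 * c1%:R) * (dotp (lsubmx x - 0) (lsubmx x - 0))%:C%C +
  (Complex 0 (pi * i.1 * dil i.2 * c2%:R) * (dotp (rsubmx x - 0) (rsubmx x - 0))%:C%C +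
   Complex 0 (pi * i.1 * dil i.2 * c0%:R) * (dotp (addV x - 0) (addV x - 0))%:C%C)).

(** The factor with [dil] is absorbed by exp(-pi 4^k |x|^2), which on the annulus is at most
    exp(-(pi/4) 4^k); only 1 + |lam| survives. *)
Definition Zosc (i : R * int) (x : V R (n + n)) : R := (1 + dil i.2) * (1 + `|i.1|).

Lemma Zosc_ge1 i x : 1 <= Zosc i x.
Proof. by rewrite -[leLHS]mulr1 ler_pM// lerDl ?dil_ge0. Qed.

Lemma quad_osc : quadF Zosc qosc.
Proof.
have p0 : 0 <= pi :> R by exact: pi_ge0.
have Z0 i x : 0 <= Zosc i x by exact: le_trans ler01 (Zosc_ge1 i x).
have ZZ i x : Zosc i x <= Zosc i x ^+ 2 by rewrite expr2 ler_peMl// Zosc_ge1.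
have a1 i x : dil i.2 <= Zosc i x.
  rewrite -[leLHS]mulr1; apply: ler_pM => //; [exact: dil_ge0|by rewrite lerDr|by rewrite lerDl].
have a2 i x : `|i.1| * dil i.2 <= Zosc i x.
  by rewrite mulrC; apply: ler_pM => //; [exact: dil_ge0|rewrite lerDr|rewrite lerDr].
have ann2 (x : V R (n + n)) m (P : V R (n + n) -> 'rV[R]_m) K : 0 <= K -> (forall y, enorm (P y) <= K * enorm y) ->
    ann x -> enorm (P x - 0) <= K * 2.
  by move=> K0 hP /andP[_ x2]; rewrite subr0; apply: le_trans (hP x) _; rewrite ler_wpM2l.
have cim (y : R) : cabs (Complex 0 y) = `|y| by rewrite /cabs/= (expr2 0) mul0r add0r sqrtr_sqr.
have cre (y : R) : cabs (Complex y 0) = `|y| by rewrite /cabs/= (expr2 0) mul0r addr0 sqrtr_sqr.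
have aosc (c : bool) i x : cabs (Complex 0 (pi * i.1 * dil i.2 * c%:R)) <= pi * Zosc i x.
  rewrite cim; have := a2 i x; have := dil_ge0 i.2; move: (dil i.2) => e e0 h.
  rewrite !normrM (ger0_norm p0) (ger0_norm e0) -!mulrA ler_wpM2l// mulrA.
  by case: c; rewrite ?normr1 ?mulr1 ?normr0 ?mulr0.
have term (c : bool) m (P : V R (n + n) -> V R m) (K : R) : 0 <= K ->
    (forall x y (h : R), P (x + h *: y) = P x + h *: P y) ->
    (forall x, enorm (P x) <= K * enorm x) -> measurable_fun setT P ->
    quadF Zosc (fun i x => Complex 0 (pi * i.1 * dil i.2 * c%:R) * (dotp (P x - 0) (P x - 0))%:C%C).
  move=> K0 sP bP mP; apply: (@quadF_term _ _ _ _ m P K (fun i => Complex 0 (pi * i.1 * dil i.2 * c%:R)) (fun _ => 0)) => //.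
    exists (pi * (K * 2)); first by rewrite !mulr_ge0.
    move=> i x ax; rewrite [leRHS]mulrAC; apply: ler_pM; rewrite ?cabs_ge0 ?enorm_ge0//.
    exact: ann2.
  exists pi => // i x; apply: le_trans (aosc c i x) _; by rewrite ler_wpM2l.
apply: quadFD; last first.
  apply: quadFD; first exact: term ler01 lsub_step enorm_lsub measurable_lsub.
  apply: quadFD; first exact: term ler01 rsub_step enorm_rsub measurable_rsub.
  exact: term (ler0n _ 2) (@addV_step R n) enorm_addV (@measurable_addVsub R n).
apply: (@quadF_term _ _ _ _ (n + n) id 1 (fun i : R * int => Complex (- (pi * dil i.2)) 0) (fun _ => 0)) => //.
- by move=> x; rewrite mul1r.
- exists (pi * (1 * 2)); first by rewrite !mulr_ge0.
  move=> i x ax; rewrite [leRHS]mulrAC; apply: ler_pM; rewrite ?cabs_ge0 ?enorm_ge0//.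
    by rewrite cre normrN (ger0_norm (mulr_ge0 p0 (dil_ge0 _))) ler_wpM2l.
  by rewrite subr0 mul1r; have /andP[] := ax.
exists pi => // i x; rewrite cre normrN (ger0_norm (mulr_ge0 p0 (dil_ge0 _))) ler_wpM2l//.
exact: le_trans (a1 i x) (ZZ i x).
Qed.

Definition mosc (lam : R) (xi : 'rV[R]_(n + n)) : R[i] := cexp (qosc (lam, 0) xi).

Lemma mosc_dil lam (k : int) (xi : 'rV[R]_(n + n)) : mosc lam ((2 : R) ^ k *: xi) = cexp (qosc (lam, k) xi).
Proof.
have lz : lsubmx ((2 : R) ^ k *: xi) = (2 : R) ^ k *: lsubmx xi by exact: linearZ.
have rz : rsubmx ((2 : R) ^ k *: xi) = (2 : R) ^ k *: rsubmx xi by exact: linearZ.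
rewrite /mosc /qosc /= !subr0 addVZ lz rz !dotpZl !dotpZr.
have d0 : dil 0 = 1 by rewrite /dil expr0z expr1n.
rewrite d0 /dil; congr cexp; apply: complexP => /=; ring.
Qed.

Lemma Re_qosc i x : complex.Re (qosc i x) = - (pi * dil i.2 * dotp x x).
Proof. by rewrite /qosc /= !subr0; ring. Qed.

Lemma cabs_mosc lam k x : ann x -> cabs (cexp (qosc (lam, k) x)) <= expR (- (pi / 4 * dil k)).
Proof.
move=> /andP[x1 _]; have h : 4^-1 <= dotp x x.
  rewrite -enorm_sqr (_ : 4^-1 = 2^-1 ^+ 2 :> R); last by field.
  by rewrite lerXn2r ?nnegrE ?enorm_ge0 ?invr_ge0.
rewrite cabs_cexp Re_qosc ler_expR lerN2/= mulrAC.
by apply: ler_wpM2l => //; apply: mulr_ge0; [exact: pi_ge0|exact: dil_ge0].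
Qed.

Lemma Aus_osc : exists2 C, 0 <= C & forall lam, (Aus u s Theta (mosc lam) <= (C * powR (1 + `|lam|) s)%:E)%E.
Proof.
pose W : R := \int[mu (n + n)]_y (@gq R (n + n) y).
have W0 : 0 <= W by apply: ltW; exact: integral_gq_gt0.
have Zb (k : nat) : exists2 C, 0 <= C & forall (i : R * int) (x : V R (n + n)), ann x ->
     Zosc i x ^+ (2 * k) * cabs (cexp (qosc i x)) <= C * (1 + `|i.1|) ^+ (2 * k) * 1.
  have [C C0 hC] := @pow_exp_le (2 * k) (pi / 4) (divr_gt0 (pi_gt0 R) (ltr0n R 4)).
  exists C; first exact: ltW.
  move=> [lam j] x ax; rewrite /Zosc/= exprMn mulr1 mulrAC ler_wpM2r ?exprn_ge0 ?addr_ge0//.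
  apply: le_trans (hC (dil j) (dil_ge0 j)).
  by rewrite ler_wpM2l ?exprn_ge0 ?addr_ge0 ?dil_ge0// cabs_mosc.
(* There is no localisation here: the envelope [b1] is constant, so its averages are the constant
   [W]. *)
have [C C0 hS] := @SB_family R (n + n) s Theta (R * int) Zosc qosc (fun i => 1 + `|i.1|) (fun _ => 1) (fun _ _ => 1) (fun _ _ => W)
  s0 sT suppT Zosc_ge1 quad_osc (fun i => ltac:(by rewrite lerDl)) Zb (fun _ => measurable_cst _) (fun _ _ => ltac:(by rewrite ler01 lexx))
  (fun _ _ _ => ltac:(by under eq_Rintegral do rewrite mulr1)).
pose I := powR (\int[mu (n + n)]_x powR (expR (- (enorm x / 2))) u) u^-1.
have u0 : 0 < u by exact: lt_trans ltr01 u1.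
have ie : rig (mu (n + n)) (fun x => powR (expR (- (enorm x / 2))) u).
  have := @rig_exp_enorm R (n + n) (u / 2) (divr_gt0 u0 (ltr0n R 2)); congr rig.
  by apply/funext => x; rewrite -expRM; congr expR; ring.
exists (C * W * I); first by rewrite !mulr_ge0// powR_ge0.
move=> lam; apply: (@Aus_le _ _ (fun k x => C * powR (1 + `|lam|) s * (expR (- (enorm x / 2)) * W))).
- move=> k; apply: measurable_funM => //; apply: measurable_funM => //.
  apply: measurableT_comp => //; apply: measurableT_comp => //.
  by apply: measurable_funM => //; exact: measurable_enorm.
- move=> k; have E : (fun x => cexp (qosc (lam, k) x) * fhat Theta x) =
      (fun x => mosc lam ((2 : R) ^ k *: x) * fhat Theta x).
    by apply/funext => x; rewrite mosc_dil.
  by rewrite -E; exact: (hS (lam, k)).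
move=> k.
have -> : (fun x : V R (n + n) => C * powR (1 + `|lam|) s * (expR (- (enorm x / 2)) * W)) =
    (fun x => (C * powR (1 + `|lam|) s * W) * expR (- (enorm x / 2))).
  by apply/funext => x; ring.
have k0 : 0 <= C * powR (1 + `|lam|) s * W by rewrite !mulr_ge0 ?powR_ge0.
rewrite (Lpn_scale u0 k0 (fun x => expR_ge0 _) ie).
by rewrite lee_fin -/I le_eqVlt; apply/orP; left; apply/eqP; ring.
Qed.

Definition pown (d : nat) (q : R) : R := powR (Num.sqrt q^-1 ^+ d) q^-1.

Lemma pown_gt0 d q : 0 < q -> 0 < pown d q.
Proof. by move=> q0; rewrite powR_gt0// exprn_gt0// sqrtr_gt0 invr_gt0. Qed.

Lemma pownE d (q L : R) : 0 < q -> 0 < L ->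
  powR (Num.sqrt (L / q) ^+ d) q^-1 = powR L (d%:R / 2 / q) * pown d q.
Proof.
move=> q0 L0; rewrite /pown sqrtrM ?(ltW L0)// exprMn powRM ?exprn_ge0 ?sqrtr_ge0//.
congr (_ * _); rewrite -powR12_sqrt ?(ltW L0)// -powR_mulrn ?powR_ge0// -!powRrM.
by congr powR; ring.
Qed.

Lemma cabs_gJ (a b L : R) : 0 < a -> 0 < L -> a ^+ 2 + b ^+ 2 = L^-1 ->
  cabs (gJ a b 0) = powR L 4^-1.
Proof.
move=> a0 L0 E; apply/eqP; rewrite -(@eqrXn2 _ 2) ?cabs_ge0 ?powR_ge0// gJ_norm// E.
rewrite sqrtrV ?(ltW L0)// invrK -powR12_sqrt ?(ltW L0)// -powR_mulrn ?powR_ge0// -powRrM.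
by apply/eqP; congr powR; field.
Qed.

(** The inputs have transforms whose chirps cancel those of the multiplier in xi1 and xi2. A
    Gaussian times a chirp in xi1 + xi2 remains, whose transform is a Gaussian of width comparable
    to 1 or to lam. All norms are explicit powers of L = 1 + lam^2, and L tends to infinity. *)
Lemma osc_exponent C : mult_bound C ->
  n%:R * (c0%:R * (p^-1 - 2^-1) + c1%:R * (2^-1 - p1^-1) + c2%:R * (2^-1 - p2^-1)) <= s.
Proof.
move=> H; have [C1 C10 hA] := Aus_osc; have pi0 := pi_gt0 R.
pose a : R := 2^-1 ^+ n * pown n p.
have a_gt0 : 0 < a by rewrite mulr_gt0 ?pown_gt0// exprn_gt0 ?invr_gt0.
pose K := `|C| * (C1 * powR 2 (s / 2)) * pown n p1 * pown n p2.
pose e (c : bool) (q : R) : R := c%:R * q.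
(* The exponents of L in the norm of [Tm] and, for [eB], in the product of the input norms; [Aus]
   contributes s/2. *)
pose eA := e c1 (n%:R / 4) + e c2 (n%:R / 4) + e c0 (n%:R / 2 / p - n%:R / 4).
pose eB := e c1 (n%:R / 2 / p1) + e c2 (n%:R / 2 / p2).
suff h : eA - eB <= s / 2.
  move: h; rewrite ler_pdivlMr//; apply: le_trans; rewrite le_eqVlt; apply/orP; left; apply/eqP.
  rewrite /eA /eB /e; have pn : p != 0 by rewrite gt_eqF.
  have pn1 : p1 != 0 by rewrite gt_eqF.
  have pn2 : p2 != 0 by rewrite gt_eqF.
  by field; rewrite pn pn1 pn2.
apply: (@powR_growth _ _ (K / a)) => L L1.
have L0 : 0 < L by exact: lt_le_trans ltr01 L1.
pose lam := Num.sqrt (L - 1).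
have lam0 : 0 <= lam by exact: sqrtr_ge0.
have lam2 : lam ^+ 2 = L - 1 by rewrite sqr_sqrtr// subr_ge0.
pose Lc (c : bool) := if c then L else 1.
have Lc0 c : 0 < Lc c by case: c.
have LcE c : Lc c = 1 + (lam * c%:R) ^+ 2.
  by case: c; rewrite /Lc ?mulr1 ?mulr0 ?lam2 ?(expr2 0) ?mul0r ?addr0// addrC subrK.
have Lpow c q : powR (Lc c) q = powR L (e c q).
  by case: c; rewrite /Lc /e ?mul1r ?mul0r ?powRr0 ?powR1.
(* Thus ac + i bc = 1 / (1 + i lam c), the parameter whose Fourier dual is 1 + i lam c. *)
pose ac (c : bool) : R := (Lc c)^-1; pose bc (c : bool) : R := - (lam * c%:R) / Lc c.
have ac0 c : 0 < ac c by rewrite invr_gt0.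
have abN c : ac c ^+ 2 + bc c ^+ 2 = (Lc c)^-1.
  have Ln : Lc c != 0 by rewrite gt_eqF.
  transitivity ((1 + (lam * c%:R) ^+ 2) / Lc c ^+ 2); first by rewrite /ac /bc; field; exact: Ln.
  by rewrite -LcE; field; exact: Ln.
pose f (c : bool) := gauV (ac c) (bc c) (0 : 'rV[R]_n).
have fN c q : 0 < q -> LpNorm q (f c) = (powR L (e c (n%:R / 2 / q)) * pown n q)%:E.
  move=> q0; rewrite (LpNorm_gauV _ _ q0 (ac0 c)) -Lpow -(pownE _ q0 (Lc0 c)).
  by rewrite (_ : (ac c * q)^-1 = Lc c / q)// invfM /ac invrK.
have fF c xi : fhat (f c) xi = gJ (ac c) (bc c) 0 ^+ n * gauV 1 (lam * c%:R) 0 xi.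
  have Ln : Lc c != 0 by rewrite gt_eqF.
  rewrite (fhat_gauV _ _ _ (ac0 c)) add0r abN (_ : ac c / (Lc c)^-1 = 1); last first.
    by rewrite /ac mulfV// invr_eq0.
  by rewrite (_ : - bc c / (Lc c)^-1 = lam * c%:R)// /bc invrK -mulNr opprK divfK.
pose g (y : V R n) := gauV 0 (- (lam * c0%:R)) (0 : 'rV[R]_n) y.
have gB y : cabs (g y) <= 1 by rewrite cabs_gauV mulr0 mul0r oppr0 expR0.
pose K1 := gJ (ac c1) (bc c1) 0 ^+ n * gJ (ac c2) (bc c2) 0 ^+ n.
have prod xi : fhat (f c1) (lsubmx xi) * fhat (f c2) (rsubmx xi) * mosc lam xi =
    K1 * ((expR (- (2 * pi * dotp xi xi)))%:C%C * g (addV xi)).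
  have ring5 (A B D F E : R[i]) : A * D * (B * F) * E = A * B * (D * F * E) by ring.
  rewrite !fF ring5 -/K1; congr (_ * _).
  rewrite -cexpR /mosc /g /gauV -!cexpD; congr cexp.
  have d0 : dil 0 = 1 by rewrite /dil expr0z expr1n.
  rewrite /qosc /= d0 !dotp0r !subr0 (dotp_sub xi).
  by apply: complexP => /=; ring.
pose z := K1 * (2^-1 ^+ n)%:C%C * gJ 1 (- (lam * c0%:R)) 0 ^+ n.
pose N0 := Lc c0; have N0p : 0 < N0 := Lc0 c0.
have TE : Tm (mosc lam) (f c1) (f c2) = fun x => z * gauV N0^-1 (lam * c0%:R / N0) 0 x.
  apply/funext => x; rewrite (Tm_fold x (cmeas_gauV 0 (- (lam * c0%:R)) 0) gB prod).
  rewrite /z -[RHS]mulrA; congr (_ * _).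
  transitivity (cI (mu n) (gauV 1 (- (lam * c0%:R)) (- x))).
    apply: cI_eq => y; rewrite -cexpR /g /gauV /chr.
    rewrite (_ : expi _ = cexp (Complex 0 (- (2 * pi * dotp y (- x))))); last first.
      by rewrite /cexp/= expR0 mul1r.
    by rewrite -!cexpD; congr cexp; rewrite dotp0r; apply: complexP => /=; ring.
  rewrite gauV_fourier// expr1n sqrrN -LcE -/N0 div1r opprK; congr (_ * _).
  by rewrite /gauV !dotp0r dotpNl dotpNr opprK.
have zE : cabs z = powR L (e c1 (n%:R / 4) + e c2 (n%:R / 4) - e c0 (n%:R / 4)) * 2^-1 ^+ n.
  have g0E : cabs (gJ 1 (- (lam * c0%:R)) 0) = powR N0^-1 4^-1.
    apply: cabs_gJ => //; first by rewrite invr_gt0.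
    by rewrite invrK expr1n sqrrN -LcE.
  have pn (c : bool) (k : R) : powR k 4^-1 ^+ n = powR k (n%:R / 4).
    by rewrite -powR_mulrn ?powR_ge0// -powRrM mulrC.
  have GE c : cabs (gJ (ac c) (bc c) 0) = powR (Lc c) 4^-1.
    exact: cabs_gJ (ac0 c) (Lc0 c) (abN c).
  have cc (A B D E : R[i]) : cabs (A ^+ n * B ^+ n * D * E ^+ n) =
      cabs A ^+ n * cabs B ^+ n * cabs D * cabs E ^+ n by rewrite !cabsM !cabsX.
  rewrite /z /K1 cc g0E !GE cabsR.
  rewrite ger0_norm ?exprn_ge0 ?invr_ge0// !pn// !Lpow.
  have -> : powR N0^-1 (n%:R / 4) = powR L (- e c0 (n%:R / 4)).
    by rewrite powRN -Lpow -/N0 -powR_inv1 ?(ltW (Lc0 _))// -powRrM mulN1r powRN.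
  rewrite !powRD; try by apply/implyP => _; rewrite gt_eqF.
  ring.
have p0E := @Lpn_gauss R n p (cabs z) (pi / N0) p_gt0 (cabs_ge0 z) (divr_gt0 pi0 (Lc0 c0)).
have TN : LpNorm p (Tm (mosc lam) (f c1) (f c2)) = (powR L eA * a)%:E.
  rewrite TE LpNormE; last by apply: cmeasM; [exact: cmeas_cst|exact: cmeas_gauV].
  rewrite (_ : (fun x => _) = fun x : V R n => cabs z * expR (- (pi / N0 * dotp x x))); last first.
    by apply/funext => x; rewrite cabsM cabs_gauV.
  rewrite p0E; congr (_%:E); rewrite zE.
  have -> : pi / (pi / N0 * p) = N0 / p.
    have P0 : (pi : R) != 0 by rewrite gt_eqF.
    have N00 : N0 != 0 by rewrite gt_eqF.
    have pp : p != 0 by rewrite gt_eqF.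
    by move: (pi : R) P0 => P P0; field; rewrite pp N00 P0.
  rewrite pownE// Lpow /a /eA.
  have -> : e c0 (n%:R / 2 / p - n%:R / 4) = e c0 (n%:R / 2 / p) - e c0 (n%:R / 4) by rewrite /e mulrBr.
  rewrite addrA (addrAC _ (e c0 _)) [in RHS]powRD; last by apply/implyP => _; rewrite gt_eqF.
  by rewrite mulrACA [in RHS](mulrC (powR _ _) (powR _ _)); ring.
have mm : cmeas (mosc lam : V R (n + n) -> R[i]).
  by apply: cmeas_cexp; have [] := quad_meas quad_osc (lam, 0).
have bm : bounded_cfun (mosc lam).
  exists 1 => x; rewrite cabs_cexp Re_qosc -[leRHS]expR0 ler_expR oppr_le0.
  by rewrite mulr_ge0 ?dotp_ge0// mulr_ge0 ?dil_ge0// ltW.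
have sf c : schwartz (f c) by exact: schwartz_gauV.
have := mult_bound_use H _ mm bm (hA lam) (sf c1) (sf c2) _ _ (fN c1 p1 p1_gt0) (fN c2 p2 p2_gt0).
rewrite TN lee_fin !mulr_ge0 ?powR_ge0 ?(ltW (pown_gt0 _ _))// => /(_ isT isT isT) h.
(* From (1 + lam)^2 <= 2 (1 + lam^2) = 2 L. *)
have hs : powR (1 + `|lam|) s <= powR 2 (s / 2) * powR L (s / 2).
  rewrite -powRM ?(ltW L0)// (ger0_norm lam0).
  have -> : powR (1 + lam) s = powR ((1 + lam) ^+ 2) (s / 2).
    by rewrite -powR_mulrn ?addr_ge0// -powRrM; congr powR; field.
  apply: ge0_ler_powR; rewrite ?nnegrE ?sqr_ge0 ?divr_ge0 ?mulr_ge0 ?(ltW s0) ?(ltW L0)//.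
  by have := sqr_ge0 (1 - lam); rewrite !sqrrD !sqrrN lam2; lra.
have {}h : powR L eA * a <= K * powR L (s / 2) * powR L eB.
  apply: le_trans h _; rewrite /K /eB powRD; last by apply/implyP => _; rewrite gt_eqF.
  set x1 := powR L (e c1 _); set x2 := powR L (e c2 _).
  have x10 : 0 <= x1 by exact: powR_ge0.
  have x20 : 0 <= x2 by exact: powR_ge0.
  have P1 : 0 <= pown n p1 by rewrite ltW ?pown_gt0.
  have P2 : 0 <= pown n p2 by rewrite ltW ?pown_gt0.
  rewrite [leRHS](_ : _ = `|C| * (C1 * (powR 2 (s / 2) * powR L (s / 2))) * (x1 * pown n p1) * (x2 * pown n p2)); last by ring.
  by rewrite ler_wpM2r ?mulr_ge0// ler_wpM2r ?mulr_ge0// ler_wpM2l// ler_wpM2l.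
rewrite powRD; last by apply/implyP => _; rewrite gt_eqF.
rewrite (powRN L eB).
rewrite ler_pdivrMr ?powR_gt0// -(ler_pM2r a_gt0); apply: le_trans h _.
rewrite le_eqVlt; apply/orP; left; apply/eqP.
by have an : a != 0 by [rewrite gt_eqF]; field.
Qed.

End OscillatingMultiplier.

End Testing.

(** * Sums of bumps *)

Section BumpMultiplier.
Context {R : realType}.
Variable n : nat.

Lemma nat_growth (k K E F : R) : 0 < k -> 0 <= E -> 0 <= F ->
  (forall J : nat, k * powR J%:R E <= K * powR J.+2%:R F) -> E <= F.
Proof.
move=> k0 E0 F0 H; apply: (@powR_growth _ _ _ (`|K| * powR 4 F / k)) => L L1.
have L0 : 0 < L by exact: lt_le_trans ltr01 L1.
have /truncn_itv/andP[h1 h2] := ltW L0.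
(* Then L <= J, and J + 2 <= L + 3 <= 4 L as L >= 1. *)
pose J := (Num.truncn L).+1.
apply: (@le_trans _ _ (powR J%:R E)).
  by apply: ge0_ler_powR; rewrite ?nnegrE ?(ltW L0)// ltW.
rewrite mulrAC ler_pdivlMr// mulrC; apply: le_trans (H J) _.
rewrite -mulrA -powRM ?(ltW L0)//; apply: (@le_trans _ _ (`|K| * powR J.+2%:R F)).
  by rewrite ler_wpM2r ?powR_ge0// ler_norm.
rewrite ler_wpM2l//; apply: ge0_ler_powR; rewrite ?nnegrE ?mulr_ge0 ?(ltW L0)//.
rewrite /J -addn3 natrD; have : (3 : R) <= 3 * L by lra.
by move: h1; lra.
Qed.

Lemma poly_gauss (N : nat) : exists2 C : R, 0 < C &
  forall y, 0 <= y -> (1 + y) ^+ N * expR (- y ^+ 2) <= C.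
Proof.
have [C C0 hC] := @pow_exp_le R N 1 ltr01; exists (C * expR 4^-1); first by rewrite mulr_gt0 ?expR_gt0.
move=> y y0; apply: (@le_trans _ _ ((1 + y) ^+ N * expR (- (1 * y)) * expR 4^-1)).
  rewrite -mulrA -expRD ler_wpM2l ?exprn_ge0 ?addr_ge0// ler_expR.
  by have := sqr_ge0 (y - 2^-1); rewrite sqrrB; lra.
by rewrite ler_wpM2r ?expR_ge0// hC.
Qed.

Lemma gauV_chr d (a b : R) (v xi x : 'rV[R]_d) : gauV a b v x * chr xi x = gauV a b (v + xi) x.
Proof.
rewrite /gauV /chr /cexp/= dotpDr -mulrA -expiD.
suff -> : - (pi * b * dotp x x + 2 * pi * dotp x v) + - (2 * pi * dotp x xi) =
  - (pi * b * dotp x x + 2 * pi * (dotp x v + dotp x xi)) by [].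
ring.
Qed.

Lemma cI_gauV d (a : R) (x : 'rV[R]_d) : 0 < a ->
  cI (mu d) (gauV a 0 (- x)) = ((Num.sqrt a)^-1 ^+ d * expR (- (pi / a * dotp x x)))%:C%C.
Proof.
move=> a0; rewrite gauV_fourier// (expr2 0) mul0r addr0 oppr0 mul0r gJ_real// gauV_real dotpNl dotpNr opprK.
have aE : a / a ^+ 2 = a^-1 by rewrite expr2 invfM mulrA divff ?mul1r// gt_eqF.
by rewrite -rmorphXn/= -realCM aE.
Qed.

Lemma measurable_dsum_env d D (A B r : R) J (X : V R d -> R) : measurable_fun setT X ->
  (forall x, 0 <= X x) ->
  measurable_fun setT (fun x : V R d => expR (- (enorm x / 2)) * (A + B * dsum D r J (X x))).
Proof.
move=> mX X0; apply: measurable_funM.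
  apply: measurableT_comp => //; apply: measurableT_comp => //.
  by apply: measurable_funM => //; exact: measurable_enorm.
apply: measurable_funD => //; apply: measurable_funM => //.
apply: measurable_sum => i; apply: measurable_funM => //.
apply: measurable_inv_pos; last first.
  by move=> x; rewrite exprn_gt0// ltr_wpDr// mulr_ge0 ?exprn_ge0.
by apply: measurable_funX; apply: measurable_funD => //; exact: measurable_funM.
Qed.

Variables (i0 : 'I_n) (p1 p2 p u s : R) (Theta : 'rV[R]_(n + n) -> R[i]).
Hypotheses (u1 : 1 < u) (s0 : 0 < s) (p_gt0 : 0 < p) (p1_gt0 : 0 < p1) (p2_gt0 : 0 < p2).
Hypotheses (sT : schwartz Theta) (suppT : supp (fhat Theta)).

Let d := (n + n)%N.
Let v1 : V R d := rowV ((delta_mx 0 i0 : 'rV[R]_n), (0 : 'rV[R]_n)).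

Lemma enorm_v1 : enorm v1 = 1.
Proof.
by rewrite /enorm dotp_row dotp0l addr0 dotp_delta mxE !eqxx sqrtr1.
Qed.

(** The index is (J, j, k): number of bumps, bump, dilation. After dilating by 2^k all J bumps are
    centred at distance [bdist] from the origin, and the j-th has width 1 / [bscale]. With centre
    2^J at k = 0 every bump has width at least 1 there. *)
Definition bdist (i : nat * nat * int) : R := 2 ^+ i.1.1 / (2 : R) ^ i.2.
Definition bscale (i : nat * nat * int) : R := 2 ^+ i.1.2 / bdist i.
Definition bcent (i : nat * nat * int) : 'rV[R]_d := bdist i *: v1.

Definition qbump (i : nat * nat * int) (x : V R d) : R[i] :=
  Complex (- (pi * bscale i ^+ 2)) 0 * (dotp (x - bcent i) (x - bcent i))%:C%C.

Let y (i : nat * nat * int) (x : V R d) : R := bscale i * enorm (x - bcent i).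

(** The gradient of [qbump] is of size bscale times y and its Hessian of size bscale^2; the factor 1
    + y is paid by the Gaussian in y. *)
Definition Zbump (i : nat * nat * int) (x : V R d) : R := (1 + bscale i) * (1 + y i x).

Lemma bdist_gt0 i : 0 < bdist i.
Proof. by rewrite divr_gt0 ?exprn_gt0 ?exprz_gt0. Qed.

Lemma bscale_gt0 i : 0 < bscale i.
Proof. by rewrite divr_gt0 ?exprn_gt0 ?bdist_gt0. Qed.

Lemma y_ge0 i x : 0 <= y i x.
Proof. by rewrite mulr_ge0 ?enorm_ge0// ltW ?bscale_gt0. Qed.

Lemma y_sqr i x : y i x ^+ 2 = bscale i ^+ 2 * dotp (x - bcent i) (x - bcent i).
Proof. by rewrite /y (exprMn _ (bscale i) (enorm _)) enorm_sqr. Qed.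

Lemma Zbump_ge1 i x : 1 <= Zbump i x.
Proof. by rewrite -[leLHS]mulr1 ler_pM// lerDl ?y_ge0// ltW ?bscale_gt0. Qed.

Lemma quad_bump : quadF Zbump qbump.
Proof.
have p0 : 0 <= pi :> R by exact: pi_ge0.
have m0 i := ltW (bscale_gt0 i).
have cre (z : R) : cabs (Complex z 0) = `|z| by rewrite /cabs/= (expr2 0) mul0r addr0 sqrtr_sqr.
have Z0 i x : 0 <= Zbump i x by exact: le_trans ler01 (Zbump_ge1 i x).
have Zm i x : bscale i <= Zbump i x.
  rewrite -[leLHS]mulr1; apply: ler_pM => //; first by rewrite lerDr.
  by rewrite lerDl y_ge0.
have am i : cabs (Complex (- (pi * bscale i ^+ 2)) 0) = pi * (bscale i * bscale i).
  by rewrite cre normrN ger0_norm -?expr2// mulr_ge0// sqr_ge0.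
apply: (@quadF_term _ _ _ _ d id 1 (fun i => Complex (- (pi * bscale i ^+ 2)) 0) bcent) => //.
- by move=> x; rewrite mul1r.
- exists pi => // i x _; rewrite am -mulrA ler_wpM2l// -mulrA; apply: ler_pM => //.
  + exact: y_ge0.
  + by rewrite lerDr.
  + by rewrite /y lerDr.
by exists pi => // i x; rewrite am expr2 ler_wpM2l// ler_pM.
Qed.

Definition mbump (J : nat) (xi : 'rV[R]_d) : R[i] := \sum_(i < J) cexp (qbump (J, i : nat, 0) xi).

Lemma mbump_dil J (k : int) (xi : 'rV[R]_d) :
  mbump J ((2 : R) ^ k *: xi) = \sum_(i < J) cexp (qbump (J, i : nat, k) xi).
Proof.
apply: eq_bigr => i _; congr cexp; rewrite /qbump.
have k0 : (2 : R) ^ k != 0 by rewrite expfz_neq0.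
have E1 : (2 : R) ^ k *: xi - bcent (J, i : nat, 0) = (2 : R) ^ k *: (xi - bcent (J, i : nat, k)).
  rewrite scalerBr /bcent scalerA /bdist/= expr0z divr1; congr (_ - _ *: _).
  by rewrite mulrC divfK.
rewrite E1 dotpZl dotpZr /bscale /bdist/= expr0z divr1.
have J0 : (2 : R) ^+ J != 0 by rewrite expf_neq0.
move: (dotp _ _) ((2 : R) ^ k) k0 => D e e0.
by apply: complexP => /=; field; rewrite J0 e0.
Qed.

Lemma cabs_qbump i x : cabs (cexp (qbump i x)) = expR (- (pi * y i x ^+ 2)).
Proof.
rewrite cabs_cexp /qbump/=; congr expR; rewrite y_sqr; ring.
Qed.

Let near (i : nat * nat * int) : bool := 4^-1 < bdist i < 4.

(** With the centre at distance at most 1/4 or at least 4 from the origin, a point of the annulus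
    1/2 <= |x| <= 2 is at least 1/4 away from it, and at least half of [bdist]. *)
Lemma far_bounds i x : ~~ near i -> ann x -> 2 ^+ i.1.2 <= 2 * y i x /\ bscale i <= 4 * y i x.
Proof.
move=> ni /andP[x1 x2]; have t0 := bdist_gt0 i; have m0 := bscale_gt0 i.
have wE : 2 ^+ i.1.2 = bscale i * bdist i by rewrite /bscale divfK// gt_eqF.
have nc : enorm (bcent i) = bdist i by rewrite enormZ enorm_v1 mulr1 ger0_norm// ltW.
have h1 := enormB x (bcent i); have h2 := enormB (bcent i) x.
rewrite -(opprB x) enormN nc in h2; rewrite nc in h1.
have [c|c] := leP (bdist i) 4^-1.
  have h : 4^-1 <= enorm (x - bcent i) by lra.
  rewrite wE /y; split.
    by rewrite [leRHS]mulrCA ler_wpM2l ?(ltW m0)//; lra.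
  rewrite [leRHS]mulrCA ler_peMr ?(ltW m0)//; lra.
have {}c : 4 <= bdist i by move: ni; rewrite /near c/= -leNgt.
rewrite wE /y; split.
  by rewrite [leRHS]mulrCA ler_wpM2l ?(ltW m0)//; lra.
rewrite [leRHS]mulrCA ler_peMr ?(ltW m0)//; lra.
Qed.

(** Near the annulus derivatives cost [bscale] and the bump stays localised. Far from it the
    Gaussian tail pays for all derivatives and still leaves 2^-j, which makes the sum over the bumps
    bounded. *)
Let Lam i : R := if near i then 1 + bscale i else 1.
Let b1 i (x : V R d) : R := if near i then expR (- (bscale i ^+ 2 * dotp (x - bcent i) (x - bcent i))) else 2 ^- i.1.2.

Lemma bump_bound (k : nat) : exists2 C, 0 <= C & forall i x, ann x ->
  Zbump i x ^+ (2 * k) * cabs (cexp (qbump i x)) <= C * Lam i ^+ (2 * k) * b1 i x.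
Proof.
(* In the far case Zbump <= 16 (1 + y)^2, whence 4k powers of 1 + y; the extra one pays for 2^j <= 2
   (1 + y). *)
have [C1 C10 h1] := poly_gauss (2 * k)%N; have [C2 C20 h2] := poly_gauss (4 * k).+1.
exists (C1 + 2 * 16 ^+ (2 * k) * C2).
  by rewrite addr_ge0 ?mulr_ge0 ?exprn_ge0 ?(ltW C10) ?(ltW C20).
move=> i x ax; rewrite cabs_qbump; have y0 := y_ge0 i x; have m0 := ltW (bscale_gt0 i).
have pi2 := pi_ge2 R; have yy := sqr_ge0 (y i x).
have R0 : 0 <= 2 * 16 ^+ (2 * k) * C2 by rewrite !mulr_ge0 ?exprn_ge0 ?(ltW C20).
rewrite /Lam /b1; case: ifPn => ni.
  rewrite -y_sqr.
  apply: (@le_trans _ _ (C1 * (1 + bscale i) ^+ (2 * k) * expR (- y i x ^+ 2))); last first.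
    by rewrite ler_wpM2r ?expR_ge0// ler_wpM2r ?exprn_ge0 ?addr_ge0// lerDl.
  apply: (@le_trans _ _ ((1 + bscale i) ^+ (2 * k) * ((1 + y i x) ^+ (2 * k) * expR (- y i x ^+ 2)) * expR (- y i x ^+ 2))).
    rewrite /Zbump exprMn -!mulrA ler_wpM2l ?exprn_ge0 ?addr_ge0// ler_wpM2l ?exprn_ge0 ?addr_ge0//.
    by rewrite -expRD ler_expR; nra.
  by rewrite ler_wpM2r ?expR_ge0// mulrC ler_wpM2r ?exprn_ge0 ?addr_ge0// h1.
have [f1 f2] := far_bounds ni ax.
have w0 : 0 < 2 ^+ i.1.2 :> R by rewrite exprn_gt0.
rewrite expr1n mulr1; apply: (@le_trans _ _ ((2 * 16 ^+ (2 * k) * C2) * 2 ^- i.1.2)); last first.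
  by rewrite ler_wpM2r ?invr_ge0 ?(ltW w0)// lerDr ltW.
rewrite ler_pdivlMr//.
have Zle : Zbump i x ^+ (2 * k) <= 16 ^+ (2 * k) * (1 + y i x) ^+ (4 * k).
  have -> : (1 + y i x) ^+ (4 * k) = ((1 + y i x) ^+ 2) ^+ (2 * k).
    by rewrite -exprM; congr (_ ^+ _); rewrite mulnA.
  rewrite -exprMn lerXn2r ?nnegrE ?mulr_ge0 ?sqr_ge0 ?(le_trans ler01 (Zbump_ge1 i x)) ?addr_ge0//.
  by rewrite /Zbump; nra.
have E1 : expR (- (pi * y i x ^+ 2)) <= expR (- y i x ^+ 2) by rewrite ler_expR; nra.
apply: (@le_trans _ _ (16 ^+ (2 * k) * (1 + y i x) ^+ (4 * k) * expR (- y i x ^+ 2) * (2 * (1 + y i x)))).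
  have ZN0 : 0 <= Zbump i x ^+ (2 * k) by rewrite exprn_ge0// (le_trans ler01 (Zbump_ge1 i x)).
  have f3 : 2 ^+ i.1.2 <= 2 * (1 + y i x) by apply: (le_trans f1); rewrite ler_wpM2l// lerDr.
  exact: (ler_pM (mulr_ge0 ZN0 (expR_ge0 _)) (ltW w0) (ler_pM ZN0 (expR_ge0 _) Zle E1) f3).
rewrite [leLHS](_ : _ = 2 * 16 ^+ (2 * k) * ((1 + y i x) ^+ (4 * k).+1 * expR (- y i x ^+ 2))).
  by rewrite ler_wpM2l ?h2// mulr_ge0 ?exprn_ge0.
by rewrite (exprS _ (4 * k)); ring.
Qed.

Hypothesis s_le : s <= d%:R / u.

(** The centre depends on the dilation but not on the bump, so the J envelopes add up to a single
    [dsum] in the distance to that centre. *)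
Lemma Aus_bump : exists2 C, 0 <= C & forall J, (Aus u s Theta (mbump J) <= (C * powR J.+2%:R u^-1)%:E)%E.
Proof.
have u0 : 0 < u by exact: lt_trans ltr01 u1.
have [C1 C10 hconv] := @conv_id R d.
pose W : R := \int[mu d]_y (@gq R d y).
have W0 : 0 <= W by apply: ltW; exact: integral_gq_gt0.
have igq := @rig_gq R d.
pose b i (x : V R d) : R := if near i then C1 / (1 + bscale i * enorm (x - bcent i)) ^+ d else W * 2 ^- i.1.2.
have b10 i x : 0 <= b1 i x <= 1.
  rewrite /b1; case: ifPn => _; last by rewrite invr_ge0 exprn_ge0//= invf_le1 ?exprn_gt0// exprn_ege1// ler1n.
  by rewrite expR_ge0 -[leRHS]expR0 ler_expR oppr_le0 mulr_ge0 ?sqr_ge0 ?dotp_ge0.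
have mb1 i : measurable_fun setT (b1 i).
  rewrite /b1; case: (near i) => //; apply: measurableT_comp => //; apply: measurableT_comp => //.
  by apply: measurable_funM => //; apply: measurable_dotp; exact: measurable_shift.
have b1b i (r : R) (x : V R d) : \int[mu d]_y (gq y * b1 i (x + r *: y)) <= b i x.
  rewrite /b1 /b; case: ifP => _.
    exact: (hconv (bscale i) (bcent i) r x (ltW (bscale_gt0 i))).
  under eq_Rintegral do rewrite mulrC.
  have -> : \int[mu d]_y (2 ^- i.1.2 * gq y) = 2 ^- i.1.2 * W by apply: RintegralZl => //; exact: igq.
  by rewrite mulrC.
have L1 i : 1 <= Lam i by rewrite /Lam; case: ifP => // _; rewrite lerDl ltW ?bscale_gt0.
have [C C0 hS] := SB_family s0 sT suppT Zbump_ge1 quad_bump L1 bump_bound mb1 b10 b1b.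
pose r := powR 2 (d%:R / u).
(* [A] sums the far bumps, the 2 coming from the geometric series. In the near case 1/4 < bdist < 4,
   so 1 + bscale <= 5 2^j and 1 + 2^j X <= 4 (1 + bscale X), whence 5^s and 4^d in [B]. *)
pose A := C * (W * 2); pose B := C * (powR 5 s * (C1 * 4 ^+ d)).
have A0 : 0 <= A by rewrite !mulr_ge0.
have B0 : 0 <= B by rewrite !mulr_ge0 ?powR_ge0 ?exprn_ge0 ?(ltW C10).
have Cpi0 : 0 <= Num.sqrt (pi : R) ^+ d by rewrite exprn_ge0 ?sqrtr_ge0.
have d0 : (0 < d)%N by rewrite /d addn_gt0 (leq_ltn_trans (leq0n i0) (ltn_ord i0)).
have [C2 C20 hL] := @Lpn_dsum R d d u A B _ d0 u1 A0 B0 Cpi0.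
exists C2 => // J; pose X (k : int) (x : V R d) := enorm (x - bcent (J, 0%N, k)).
have mX k : measurable_fun setT (X k) by apply: measurable_enorm; exact: measurable_shift.
have X0 k x : 0 <= X k x by exact: enorm_ge0.
apply: (@Aus_le _ _ _ _ _ u1 _ _ (fun k (x : V R d) => expR (- (enorm x / 2)) * (A + B * dsum d r J (X k x)))).
- by move=> k; apply: measurable_dsum_env.
- move=> k.
  have cF i : cig (mu d) (fun x => cexp (qbump i x) * fhat Theta x).
    apply: supp_cig.
    + apply: cmeasM; first by apply: cmeas_cexp; have [] := quad_meas quad_bump i.
      exact: cmeas_fhat (schwartz_cig sT).
    + have [B' hB'] := fhat_bounded (schwartz_cig sT) => r'; exists (1 * B') => x _.
      rewrite cabsM; apply: ler_pM; rewrite ?cabs_ge0// cabs_qbump -[leRHS]expR0 ler_expR oppr_le0.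
      by rewrite mulr_ge0 ?pi_ge0 ?sqr_ge0.
    + by move=> x nx; rewrite suppT// mulr0.
  have E : (fun x => mbump J ((2 : R) ^ k *: x) * fhat Theta x) =
      (fun x : V R d => \sum_(i < J) (cexp (qbump (J, i : nat, k) x) * fhat Theta x)).
    by apply/funext => x; rewrite mbump_dil mulr_suml.
  have cS := cig_sum (index_enum 'I_J) (fun i : 'I_J => cF (J, i : nat, k)).
  apply: SB_le (SB_eq _ (SB_sum (index_enum 'I_J) (fun i : 'I_J => hS (J, i : nat, k)))); last first.
    move=> xi; rewrite -mulr_sumr E (fhatE xi cS); congr (_ * _).
    transitivity (\sum_(i < J) cI (mu d) (fun x => cexp (qbump (J, i : nat, k) x) * fhat Theta x * chr xi x)).
      by apply: eq_bigr => i _; exact: (fhatE xi (cF (J, i : nat, k))).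
    rewrite -(@cI_sum _ _ _ _ _ _ (fun (i : 'I_J) x => cexp (qbump (J, i : nat, k) x) * fhat Theta x * chr xi x)); last first.
      by move=> i; exact: (cig_chr xi (cF (J, i : nat, k))).
    by apply: cI_eq => x; rewrite mulr_suml.
  move=> x /=; set ex := expR (- (enorm x / 2)); have ex0 : 0 <= ex by exact: expR_ge0.
  have ds0 : 0 <= dsum d r J (X k x) by apply: dsum_ge0; rewrite ?powR_ge0.
  have nE (i : nat) : near (J, i, k) = near (J, 0%N, k) by [].
  have [nk|nk] := boolP (near (J, 0%N, k)).
    apply: (@le_trans _ _ (ex * (B * dsum d r J (X k x)))); last by rewrite ler_wpM2l// lerDr.
    rewrite /dsum mulrA mulr_sumr; apply: ler_sum => i _; rewrite /b /Lam nE nk.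
    set t := bdist (J, i : nat, k); have t0 : 0 < t := bdist_gt0 _.
    have /andP[t1 t2] : 4^-1 < t < 4 := nk.
    pose w : R := 2 ^+ i; have w1 : 1 <= w by rewrite exprn_ege1// ler1n.
    have w0 : 0 < w by exact: lt_le_trans ltr01 w1.
    have mE : bscale (J, i : nat, k) = w / t by [].
    have m5 : 1 + bscale (J, i : nat, k) <= 5 * w.
      have : w / t <= w * 4 by rewrite ler_wpM2l ?(ltW w0)// -[leRHS]invrK lef_pV2 ?posrE ?invr_gt0// ltW.
      by rewrite mE; lra.
    have Xe : enorm (x - bcent (J, i : nat, k)) = X k x by [].
    have den : (1 + w * X k x) ^+ d <= 4 ^+ d * (1 + bscale (J, i : nat, k) * X k x) ^+ d.
      have m0 := ltW (bscale_gt0 (J, i : nat, k)).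
      have q1 : 0 <= 1 + w * X k x by rewrite addr_ge0// mulr_ge0// ltW.
      have q2 : 0 <= 4 * (1 + bscale (J, i : nat, k) * X k x).
        by apply: mulr_ge0 => //; apply: addr_ge0 => //; exact: (mulr_ge0 m0 (X0 k x)).
      rewrite -exprMn lerXn2r ?nnegrE ?q1 ?q2//.
      have : w * X k x <= 4 * (bscale (J, i : nat, k) * X k x).
        rewrite mulrA ler_wpM2r// mE mulrCA ler_peMr ?(ltW w0)// ler_pdivlMr// mul1r ltW//.
      by lra.
    (* Here s <= d/u enters: the derivative cost 2^(j s) is at most r^j. *)
    have p1' : powR (1 + bscale (J, i : nat, k)) s <= powR 5 s * r ^+ i.
      apply: (@le_trans _ _ (powR (5 * w) s)).
        by apply: ge0_ler_powR; rewrite ?nnegrE ?mulr_ge0 ?(ltW s0) ?(ltW w0)// addr_ge0// ltW ?bscale_gt0.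
      rewrite powRM ?(ltW w0)// ler_wpM2l ?powR_ge0//.
      rewrite /w /r -!powR_mulrn ?powR_ge0// -!powRrM mulrC (mulrC (d%:R / u)).
      by apply: ler_powR; rewrite ?ler1n// mulrC ler_wpM2l.
    have D1 : 0 < (1 + w * X k x) ^+ d by rewrite exprn_gt0// ltr_wpDr// mulr_ge0// ltW.
    have D2 : 0 < (1 + bscale (J, i : nat, k) * X k x) ^+ d.
      by rewrite exprn_gt0// ltr_wpDr// mulr_ge0// ltW ?bscale_gt0.
    rewrite Xe -/w [leLHS](_ : _ = ex * (C * (C1 * powR (1 + bscale (J, i : nat, k)) s / (1 + bscale (J, i : nat, k) * X k x) ^+ d))); last by ring.
    rewrite [leRHS](_ : _ = ex * (C * (C1 * (powR 5 s * r ^+ i) * (4 ^+ d / (1 + w * X k x) ^+ d)))); last by rewrite /B; ring.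
    rewrite ler_wpM2l// ler_wpM2l//; apply: ler_pM.
    - by rewrite mulr_ge0 ?powR_ge0// ltW.
    - by rewrite invr_ge0 ltW.
    - by rewrite ler_wpM2l// ltW.
    by rewrite (ler_pdivlMr _ _ D1) mulrC (ler_pdivrMr _ _ D2).
  apply: (@le_trans _ _ (ex * A)); last by rewrite ler_wpM2l// lerDl mulr_ge0.
  rewrite (eq_bigr (fun i : 'I_J => ex * (C * W) * 2 ^- i)); last first.
    by move=> i _; rewrite /b /Lam nE (negbTE nk) powR1; ring.
  rewrite -mulr_sumr /A -!mulrA ler_wpM2l// ler_wpM2l// ler_wpM2l//.
  have : \sum_(i < J) (2 : R) ^- i = 2 - 2 * 2 ^- J.
    elim: (J) => [|m IH]; first by rewrite big_ord0 expr0 invr1; ring.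
    by rewrite big_ord_recr/= IH exprS invfM; field; rewrite expf_neq0.
  by move=> ->; rewrite gerBl mulr_ge0// invr_ge0 exprn_ge0.
move=> k; apply: hL => // i; exact: dsum_int_id (ltW u0).
Qed.

(** The first input is modulated so that the product of the transforms is a Gaussian at the common
    centre. All terms of [Tm] then share one unimodular factor and are otherwise positive, so they
    add up to J times a fixed Gaussian. A bound by J^(1/u) would give 1 <= 1/u. *)
Lemma bump_contra C : mult_bound p1 p2 p u s Theta C -> False.
Proof.
move=> H; have [Ca Ca0 hA] := Aus_bump; have pi0 := pi_gt0 R.
have u0 : 0 < u by exact: lt_trans ltr01 u1.
pose e : 'rV[R]_n := delta_mx 0 i0.
pose N1 := powR (Num.sqrt (1 * p1)^-1 ^+ n) p1^-1.
pose N2 := powR (Num.sqrt (1 * p2)^-1 ^+ n) p2^-1.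
pose kap : R := (Num.sqrt 2)^-1 ^+ d.
have kap0 : 0 < kap by rewrite exprn_gt0// invr_gt0 sqrtr_gt0.
pose N0 := powR (Num.sqrt (pi / (2 * pi * p)) ^+ n) p^-1.
have N00 : 0 < N0 by rewrite powR_gt0// exprn_gt0// sqrtr_gt0 divr_gt0// !mulr_gt0.
suff : 1 <= u^-1 by rewrite leNgt invf_lt1// u1.
apply: (@nat_growth (kap * N0) (`|C| * Ca * N1 * N2)) => //.
- by rewrite mulr_gt0.
- by rewrite invr_ge0 ltW.
move=> J; rewrite powRr1 ?ler0n//.
pose f1 := gauV 1 0 (- (2 ^+ J *: e)); pose f2 := gauV 1 0 (0 : 'rV[R]_n).
pose vJ := bcent (J, 0%N, 0).
have vE : vJ = row_mx (2 ^+ J *: e) 0.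
  by rewrite /vJ /bcent /bdist/= expr0z divr1 /v1 /rowV/= scale_row_mx scaler0.
have F1 xi : fhat f1 (lsubmx xi) * fhat f2 (rsubmx xi) = (expR (- (pi * dotp (xi - vJ) (xi - vJ))))%:C%C.
  rewrite (fhat_gauV _ _ _ ltr01) (fhat_gauV _ _ _ ltr01) expr1n (expr2 0) mul0r addr0 divr1 oppr0 mul0r.
  rewrite gJ_real// sqrtr1 invr1 expr1n !mul1r !gauV_real -realCM -expRD add0r.
  congr ((expR _)%:C%C); rewrite dotp_sub !linearB/= vE row_mxKl row_mxKr subr0 addrC -[lsubmx xi - _]addrC.
  by rewrite mulr1; ring.
(* At k = 0 the bumps have [bscale] at most 1, so 1 <= al <= 2 and the terms are comparable
   uniformly in i and J. *)
pose al (i : nat) := 1 + bscale (J, i, 0) ^+ 2.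
have al1 (i : 'I_J) : 1 <= al i <= 2.
  have b0 := ltW (bscale_gt0 (J, i : nat, 0)).
  have : bscale (J, i : nat, 0) <= 1.
    rewrite /bscale /bdist/= expr0z divr1 ler_pdivrMr ?exprn_gt0// mul1r ler_weXn2l ?ler1n//.
    exact: ltnW.
  move=> b1'; rewrite /al lerDl sqr_ge0/= -[X in _ <= X]/(1 + 1) lerD2l expr_le1//.
have al0 (i : nat) : 0 < al i by rewrite ltr_wpDr// sqr_ge0.
pose XX (x : 'rV[R]_n) : V R d := rowV ((x : V R n), (x : V R n)).
pose G (i : nat) (xi : V R d) := gauV (al i) 0 0 (xi - vJ).
have G_cig i : cig (mu d) (G i).
  exact: (cig_shift (- vJ) (cig_gauV 0 0 (al0 i))).
have TE : Tm (mbump J) f1 f2 = fun x => \sum_(i < J) (chr (- XX x) vJ *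
    (((Num.sqrt (al i))^-1 ^+ d * expR (- (pi / al i * dotp (XX x) (XX x))))%:C%C)).
  apply/funext => x.
  have E : (fun eta : 'rV[R]_(n + n) => fhat f1 (lsubmx eta) * fhat f2 (rsubmx eta) * mbump J eta
      * expi (2 * pi * dotp x (lsubmx eta + rsubmx eta))) =
      fun eta : V R d => \sum_(i < J) (G i eta * chr (- XX x) eta).
    apply/funext => eta; rewrite F1 /mbump mulr_sumr mulr_suml; apply: eq_bigr => i _.
    congr (_ * _).
      rewrite /G gauV_real -cexpR /qbump -/vJ -[bcent _]/vJ.
      rewrite -cexpD -cexpR; congr cexp; apply: complexP => /=; rewrite /al; ring.
    rewrite /chr dotpNr mulrN opprK -[eta in RHS]hsubmxK (dotp_row (lsubmx eta : V R n) _ (rsubmx eta : V R n)).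
    by rewrite -dotpDl (dotpC x).
  rewrite /Tm E cintE; last by apply: cig_sum => i; exact: cig_chr.
  rewrite cI_sum; last by move=> i; exact: cig_chr.
  apply: eq_bigr => i _.
  rewrite -(cI_shift vJ (cig_meas (cig_chr _ (G_cig i)))).
  transitivity (cI (mu d) (fun y => chr (- XX x) vJ * gauV (al i) 0 (- XX x) y)).
    apply: cI_eq => z; have -> : gauV (al i) 0 (- XX x) z = gauV (al i) 0 0 z * chr (- XX x) z.
      by rewrite gauV_chr add0r.
    by rewrite /G addrK chrD; ring.
  by rewrite (cIZ _ (cig_gauV _ _ (al0 i))) cI_gauV.
have XXE x : dotp (XX x) (XX x) = 2 * dotp x x by rewrite dotp_row; ring.
have TB x : J%:R * kap * expR (- (2 * pi * dotp x x)) <= cabs (Tm (mbump J) f1 f2 x).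
  rewrite TE -mulr_sumr cabsM cabs_chr mul1r -rmorph_sum/= cabsR.
  apply: le_trans (ler_norm _).
  rewrite -mulrA mulr_natl -[X in _ *+ X]card_ord -sumr_const; apply: ler_sum => i _.
  have /andP[a1 a2] := al1 i.
  apply: ler_pM; rewrite ?expR_ge0 ?(ltW kap0)//.
    rewrite /kap lerXn2r ?nnegrE ?invr_ge0 ?sqrtr_ge0// lef_pV2 ?posrE ?sqrtr_gt0//.
    by rewrite ler_wsqrtr.
  rewrite ler_expR lerN2 XXE mulrCA mulrA ler_wpM2r ?dotp_ge0// ler_wpM2l//.
  by rewrite ler_pdivrMr// ler_peMr// ltW.
have mT : cmeas (Tm (mbump J) f1 f2 : V R n -> R[i]).
  have mXX : measurable_fun setT (XX : V R n -> V R d).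
    apply: measurable_funV => k; rewrite -(splitK k); case: (fintype.split k) => j /=.
      by rewrite /XX; under eq_fun do rewrite /rowV row_mxEl; exact: measurable_coord.
    by rewrite /XX; under eq_fun do rewrite /rowV row_mxEr; exact: measurable_coord.
  rewrite TE; apply: cmeas_sum => i; apply: cmeasM.
    apply: cmeas_chr => //; have -> : (fun t : V R n => - XX t) = (fun t => (-1) *: XX t).
      by apply/funext => t; rewrite scaleN1r.
    exact: measurable_scaleV.
  apply: cmeasR; apply: measurable_funM => //; apply: measurableT_comp => //.
  by apply: measurableT_comp => //; apply: measurable_funM => //; exact: measurable_dotp.
have mm : cmeas (mbump J : V R d -> R[i]).
  by apply: cmeas_sum => i; apply: cmeas_cexp; have [] := quad_meas quad_bump (J, i : nat, 0).
have bm : bounded_cfun (mbump J).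
  have : forall K : nat, exists M : R, forall x, cabs (\sum_(i < K) cexp (qbump (J, i : nat, 0) x)) <= M.
    elim=> [|K [M hM]]; first by exists 0 => x; rewrite big_ord0 cabs0.
    exists (M + 1) => x; rewrite big_ord_recr/=; apply: le_trans (cabsD _ _) _.
    rewrite lerD// cabs_qbump -[leRHS]expR0 ler_expR oppr_le0.
    by rewrite mulr_ge0 ?pi_ge0 ?sqr_ge0.
  exact.
have P0 : 0 <= Ca * powR J.+2%:R u^-1 by rewrite mulr_ge0 ?powR_ge0.
have := mult_bound_use H P0 mm bm (hA J) (schwartz_gauV 0 _ ltr01) (schwartz_gauV 0 _ ltr01)
  (powR_ge0 _ _) (powR_ge0 _ _) (LpNorm_gauV 0 (- (2 ^+ J *: e)) p1_gt0 ltr01) (LpNorm_gauV 0 (0 : 'rV[R]_n) p2_gt0 ltr01).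
rewrite -/f1 -/f2 (LpNormE _ mT) -/N1 -/N2 => h.
have k0 : 0 <= J%:R * kap by rewrite mulr_ge0// ltW.
have pp : 0 < 2 * (pi : R) by rewrite mulr_gt0.
have := @le_Lpn R n p (fun x => J%:R * kap * expR (- (2 * pi * dotp x x))) (fun x => cabs (Tm (mbump J) f1 f2 x)) (ltW p_gt0).
rewrite (Lpn_gauss _ p_gt0 k0 pp) -/N0 => /(_ _ _ _)/le_trans /(_ h).
rewrite lee_fin => h2; rewrite [leLHS](_ : _ = J%:R * kap * N0); last by ring.
rewrite [leRHS](_ : _ = `|C| * (Ca * powR J.+2%:R u^-1) * N1 * N2); last by ring.
apply: h2.
- apply: measurable_funM => //; apply: measurableT_comp => //; apply: measurableT_comp => //.
  by apply: measurable_funM => //; exact: measurable_dotp.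
- exact: cmeas_cabs.
by move=> x; rewrite TB andbT !mulr_ge0 ?expR_ge0// ltW.
Qed.

End BumpMultiplier.

(** * Multipliers concentrated near the antidiagonal *)

Section ParaproductMultiplier.
Context {R : realType}.
Variable n : nat.
Notation leb := (@lebesgue_measure R).

(** For contracting dilations the first [kap] scales are wider than the annulus and are summed as a
    geometric series [G]; the others, renumbered from 0, are compared with [D]. Positivity allows
    both sums to be extended to J terms. *)
Lemma sum_shift_le (kap J : nat) (F G D : nat -> R) : (forall j, 0 <= G j) -> (forall j, 0 <= D j) ->
  (forall j, (j < kap)%N -> F j <= G j) -> (forall j, F (j + kap)%N <= D j) ->
  \sum_(j < J) F j <= \sum_(j < J) G j + \sum_(j < J) D j.
Proof.
move=> G0 D0 hG hD; apply: (@le_trans _ _ (\sum_(j < J) G j + \sum_(j < (J - kap)%N) D j)).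
  elim: J => [|J IH]; first by rewrite sub0n !big_ord0 addr0.
  have [c|c] := leqP kap J.
    rewrite subSn// !big_ord_recr/=; have := hD (J - kap)%N; rewrite subnK// => h.
    by have := G0 J; lra.
  have -> : (J.+1 - kap)%N = 0%N by apply/eqP; rewrite subn_eq0.
  move: IH; have -> : (J - kap)%N = 0%N by apply/eqP; rewrite subn_eq0 ltnW.
  by rewrite !big_ord0 !big_ord_recr/= => IH; have := hG J c; lra.
rewrite lerD2l -(big_mkord xpredT D) -(big_mkord xpredT D) [leRHS](@big_cat_nat _ _ _ (J - kap)) ?leq_subr//=.
by rewrite lerDl; apply: sumr_ge0.
Qed.

Lemma geom_sum_le (g : R) J : 0 <= g -> g < 1 -> \sum_(j < J) g ^+ j <= (1 - g)^-1.
Proof.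
move=> g0 g1; have h : 0 < 1 - g by rewrite subr_gt0.
rewrite -[leRHS]mul1r ler_pdivlMr//.
have -> : (\sum_(j < J) g ^+ j) * (1 - g) = 1 - g ^+ J.
  by rewrite mulrC -opprB mulNr -subrX1 opprB.
by rewrite gerBl exprn_ge0.
Qed.

Definition box_ind (a b : R) (x : V R n) : R := \prod_(i < n) ((a < x ord0 i <= b)%R : bool)%:R.

Lemma box_indE a b x : box_ind a b x = [forall i, a < x ord0 i <= b]%:R.
Proof.
rewrite /box_ind; case: forallP => [h|/forallP].
  by rewrite big1// => i _; rewrite h.
by rewrite negb_forall => /existsP[i /negbTE h]; rewrite (bigD1 i)//= h mul0r.
Qed.

Lemma rig_box_ind a b : a <= b -> rig (mu n) (box_ind a b) /\ \int[mu n]_x box_ind a b x = (b - a) ^+ n.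
Proof.
move=> ab; pose h (t : R) : R := ((a < t <= b)%R : bool)%:R.
have hE : h = \1_(`]a, b]%classic : set R).
  by apply/funext => t; rewrite /h indicE mem_setE in_itv.
have ih : rig leb h by rewrite hE; exact: integrable_indic_itv.
have eh : \int[leb]_t h t = b - a.
  have mI : lebesgue_measure (`]a, b]%classic : set R) = (b - a)%:E.
    by rewrite lebesgue_measure_itv/= lte_fin; case: ltgtP ab => // -> _; rewrite subrr.
  by rewrite hE /Rintegral integral_indic//; rewrite setIT; exact: (congr1 fine mI).
have [i1 e1] := rig_tensor (fun _ : 'I_n => ih); split => //.
by rewrite /box_ind e1 eh prodr_const card_ord.
Qed.

(** On this cube |x| is comparable to 2^j, the width of the j-th term of [Tm]. *)
Definition dyad (j : nat) : V R n -> R := box_ind (2 ^+ j / 2) (2 ^+ j).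

Lemma dyad_disjoint j k x : (0 < n)%N -> j != k -> dyad j x * dyad k x = 0.
Proof.
move=> n0; wlog jk : j k / (j < k)%N.
  by move=> H; rewrite neq_ltn => /orP[h|h]; [|rewrite mulrC]; apply: H => //; rewrite neq_ltn h.
move=> _; rewrite /dyad !box_indE; case: forallP => [h1|]; last by rewrite mul0r.
case: forallP => [h2|]; last by rewrite mulr0.
have /andP[_ b1] := h1 (Ordinal n0); have /andP[b2 _] := h2 (Ordinal n0).
have : 2 ^+ j <= 2 ^+ k / 2 :> R.
  by rewrite ler_pdivlMr// -exprSr ler_weXn2l// ler1n.
by move=> h; move: (le_lt_trans (le_trans b1 h) b2); rewrite ltxx.
Qed.

(** At most one summand is nonzero at each point, so the power passes through the sum for every p >
    0, including p < 1. *)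
Lemma powR_dyad_sum (w p : R) J x : (0 < n)%N -> 0 < p -> 0 <= w ->
  powR (\sum_(j < J) w ^+ j * dyad j x) p = \sum_(j < J) powR w p ^+ j * dyad j x.
Proof.
move=> n0 p0 w0; elim: J => [|J IH]; first by rewrite !big_ord0 powR0// gt_eqF.
rewrite !big_ord_recr/=; have := box_indE (2 ^+ J / 2) (2 ^+ J) x; rewrite -/(dyad J x).
case: forallP => _ h; last by rewrite h !mulr0 !addr0.
have Z (v : R) : \sum_(j < J) v ^+ j * dyad j x = 0.
  apply: big1 => j _; have := @dyad_disjoint j J x n0.
  by rewrite h mulr1 neq_ltn ltn_ord => /(_ isT) ->; rewrite mulr0.
rewrite !Z !add0r h !mulr1.
by rewrite -(powR_mulrn _ w0) -(powR_mulrn _ (powR_ge0 w p)) -!powRrM (mulrC p).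
Qed.

Variables (p1 p2 p u s gam : R) (Theta : 'rV[R]_(n + n) -> R[i]).
Hypotheses (n0 : (0 < n)%N) (u1 : 1 < u) (s0 : 0 < s) (p_gt0 : 0 < p) (p1_gt0 : 0 < p1) (p2_gt0 : 0 < p2).
Hypotheses (sT : schwartz Theta) (suppT : supp (fhat Theta)).
Hypotheses (gam0 : 0 < gam) (gamE : n%:R / p = n%:R + gam).

Let g : R := powR 2 (- gam).

Lemma gg0 : 0 < g.
Proof. exact: powR_gt0. Qed.

Lemma gg1 : g < 1.
Proof. have h : powR 2 0 < powR 2 gam :> R by apply: ltr_powR_exp => //; rewrite ltr1n.
by rewrite /g powRN invf_lt1 ?powR_gt0//; move: h; rewrite powRr0. Qed.

(** [kap] and [pos] are the negative and positive parts of k, kept as natural numbers for use as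
    exponents and as an index shift. *)
Let kap (k : int) : nat := if k is Negz m then m.+1 else 0%N.
Let pos (k : int) : nat := if k is Posz m then m else 0%N.

Lemma two_pow_split (k : int) : (2 : R) ^ k = 2 ^+ pos k / 2 ^+ kap k.
Proof.
case: k => m; rewrite /pos /kap; first by rewrite expr0 invr1 mulr1 -exprnP.
by rewrite expr0 mul1r NegzE -exprnN.
Qed.

Definition scl (i : nat * int) : R := 2 ^+ i.1 * (2 : R) ^ i.2.
(** The scale 2^(j + k) with the growth for k > 0 removed, that is 2^(j + min(k, 0)): the derivative
    cost left after the Gaussian factor has absorbed positive dilations. *)
Definition nuc (i : nat * int) : R := 2 ^+ i.1 / 2 ^+ kap i.2.

Lemma scl_gt0 i : 0 < scl i.
Proof. by rewrite mulr_gt0 ?exprn_gt0 ?exprz_gt0. Qed.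

Lemma nuc_gt0 i : 0 < nuc i.
Proof. by rewrite divr_gt0 ?exprn_gt0. Qed.

Lemma nuc_le i : nuc i <= scl i.
Proof.
rewrite /scl two_pow_split /nuc ler_wpM2l ?exprn_ge0// ler_peMl ?invr_ge0 ?exprn_ge0//.
by rewrite exprn_ege1// ler1n.
Qed.

(** The excess 2^k for k > 0 is below 1 + 4^k, which exp(-pi 4^k |x|^2) pays for on the annulus. *)
Lemma scl_le i : 1 + scl i <= (1 + nuc i) * (1 + @dil R i.2).
Proof.
have -> : scl i = nuc i * 2 ^+ pos i.2 by rewrite /scl two_pow_split /nuc mulrA mulrAC.
have h : 2 ^+ pos i.2 <= 1 + @dil R i.2.
  rewrite /dil; case: (i.2) => m; rewrite /pos; last by rewrite expr0 lerDl sqr_ge0.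
  by rewrite -exprnP; have := sqr_ge0 ((2 : R) ^+ m - 1); rewrite sqrrB; nra.
have := nuc_gt0 i; move: (nuc i) (2 ^+ _ : R) h (@dil_ge0 R i.2) => a b h e a0; nra.
Qed.

Definition qpar (i : nat * int) (x : V R (n + n)) : R[i] :=
  Complex (- (pi * dil i.2)) 0 * (dotp (x - 0) (x - 0))%:C%C +
  Complex (- (pi * scl i ^+ 2)) 0 * (dotp (addV x - 0) (addV x - 0))%:C%C.

Let y (i : nat * int) (x : V R (n + n)) : R := scl i * enorm (addV x).

Lemma ypar_ge0 i x : 0 <= y i x.
Proof. by apply: mulr_ge0; [exact: ltW (scl_gt0 i)|exact: enorm_ge0]. Qed.

Definition Zpar (i : nat * int) (x : V R (n + n)) : R := (1 + scl i) * (1 + dil i.2) * (1 + y i x).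

Lemma Zpar_le i x : [/\ 1 <= Zpar i x, scl i <= Zpar i x, dil i.2 <= Zpar i x & scl i * y i x <= Zpar i x].
Proof.
rewrite /Zpar; have := ltW (scl_gt0 i); have := @dil_ge0 R i.2; have := ypar_ge0 i x.
move: (scl i) (@dil R i.2) (y i x) => a b c c0 b0 a0.
have ab := mulr_ge0 a0 b0; have ac := mulr_ge0 a0 c0; have bc := mulr_ge0 b0 c0; have abc := mulr_ge0 ab c0.
by rewrite !mulrDl !mulrDr; split; lra.
Qed.

Lemma quad_par : quadF Zpar qpar.
Proof.
have p0 : 0 <= pi :> R by exact: pi_ge0.
have Z0 i x : 0 <= Zpar i x by have [h _ _ _] := Zpar_le i x; exact: le_trans ler01 h.
have ZZ i x : Zpar i x <= Zpar i x ^+ 2 by rewrite expr2 ler_peMl//; have [] := Zpar_le i x.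
have cre (z : R) : 0 <= z -> cabs (Complex (- z) 0) = z.
  by move=> z0; rewrite /cabs/= (expr2 0) mul0r addr0 sqrtr_sqr normrN ger0_norm.
have dE i : cabs (Complex (- (pi * @dil R i)) 0) = pi * dil i by rewrite cre//; apply: mulr_ge0; [|exact: dil_ge0].
have sE i : cabs (Complex (- (pi * scl i ^+ 2)) 0) = pi * scl i ^+ 2 by rewrite cre// mulr_ge0 ?sqr_ge0.
apply: quadFD.
  apply: (@quadF_term _ _ _ _ (n + n) id 1 (fun i : nat * int => Complex (- (pi * dil i.2)) 0) (fun _ => 0)) => //.
  - by move=> x; rewrite mul1r.
  - exists (pi * 2); first by rewrite mulr_ge0.
    move=> i x /andP[_ ax]; have [_ _ h _] := Zpar_le i x.
    rewrite dE subr0 [leRHS]mulrAC; apply: ler_pM; rewrite ?enorm_ge0//; last by rewrite ler_wpM2l.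
    by apply: mulr_ge0; [|exact: dil_ge0].
  exists pi => // i x; have [_ _ h _] := Zpar_le i x; rewrite dE ler_wpM2l//.
  exact: le_trans h (ZZ i x).
apply: (@quadF_term _ _ _ _ n (@addV R n) 2 (fun i : nat * int => Complex (- (pi * scl i ^+ 2)) 0) (fun _ => 0)).
- exact: addV_step.
- exact: enorm_addV.
- exact: measurable_addVsub.
- exists pi => // i x _; have [_ _ _ h] := Zpar_le i x; rewrite sE subr0.
  by rewrite (expr2 (scl i)) -mulrA ler_wpM2l// -mulrA.
exists pi => // i x; have [_ h _ _] := Zpar_le i x; rewrite sE ler_wpM2l//.
by rewrite lerXn2r ?nnegrE// ltW ?scl_gt0.
Qed.

Lemma cabs_qpar i x :
  cabs (cexp (qpar i x)) = expR (- (pi * dil i.2 * dotp x x)) * expR (- (pi * y i x ^+ 2)).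
Proof.
have yE : y i x ^+ 2 = scl i ^+ 2 * dotp (addV x) (addV x).
  by rewrite /y (exprMn _ (scl i) (enorm _)) enorm_sqr.
by rewrite cabs_cexp -expRD yE /qpar/= !subr0; congr expR; ring.
Qed.

Lemma cabs_qpar_le1 i x : cabs (cexp (qpar i x)) <= 1.
Proof.
rewrite cabs_qpar -expRD -[leRHS]expR0 ler_expR -opprD oppr_le0 addr_ge0//.
  by rewrite mulr_ge0 ?dotp_ge0// mulr_ge0 ?pi_ge0 ?dil_ge0.
by rewrite mulr_ge0 ?pi_ge0 ?sqr_ge0.
Qed.

Definition mpar (J : nat) (xi : 'rV[R]_(n + n)) : R[i] :=
  \sum_(j < J) (g ^+ j)%:C%C * cexp (qpar (j : nat, 0) xi).

Lemma mpar_dil J (k : int) (xi : 'rV[R]_(n + n)) :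
  mpar J ((2 : R) ^ k *: xi) = \sum_(j < J) (g ^+ j)%:C%C * cexp (qpar (j : nat, k) xi).
Proof.
apply: eq_bigr => j _; congr (_ * _); congr cexp.
rewrite /qpar !subr0 addVZ !dotpZl !dotpZr /scl /dil/= expr0z.
by apply: complexP => /=; ring.
Qed.

Let b1 (i : nat * int) (x : V R (n + n)) : R := expR (- (nuc i ^+ 2 * dotp (addV x) (addV x))).

Lemma par_bound (k : nat) : exists2 C, 0 <= C & forall i x, ann x ->
  Zpar i x ^+ (2 * k) * cabs (cexp (qpar i x)) <= C * (1 + nuc i) ^+ (2 * k) * b1 i x.
Proof.
have [C1 C10 h1] := @pow_exp_le R (4 * k) (pi / 4) (divr_gt0 (pi_gt0 R) (ltr0n R 4)).
have [C2 C20 h2] := @poly_gauss R (2 * k).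
exists (C1 * C2); first by rewrite mulr_ge0 ?ltW.
move=> i x /andP[x1 _]; rewrite cabs_qpar; have y0 := ypar_ge0 i x.
have pi2 := pi_ge2 R; have yy := sqr_ge0 (y i x); have d0 := @dil_ge0 R i.2.
have m0 := ltW (nuc_gt0 i); have s0' := ltW (scl_gt0 i).
have xx : 4^-1 <= dotp x x.
  rewrite -enorm_sqr (_ : 4^-1 = 2^-1 ^+ 2 :> R); last by field.
  by rewrite lerXn2r ?nnegrE ?enorm_ge0 ?invr_ge0.
(* As pi >= 2, one factor exp(-y^2) is kept to absorb powers of 1 + y while another is traded for
   [b1], using nuc <= scl. *)
have ey : expR (- (pi * y i x ^+ 2)) <= expR (- y i x ^+ 2) * b1 i x.
  rewrite -expRD ler_expR -enorm_sqr -exprMn; have : (nuc i * enorm (addV x)) ^+ 2 <= y i x ^+ 2.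
    have e0 : 0 <= nuc i * enorm (addV x) by apply: mulr_ge0; [|exact: enorm_ge0].
    by rewrite lerXn2r ?nnegrE ?e0//; apply: ler_wpM2r; [exact: enorm_ge0|exact: nuc_le].
  by move: (_ ^+ 2) (y i x ^+ 2) yy => a b; nra.
have ed : expR (- (pi * dil i.2 * dotp x x)) <= expR (- (pi / 4 * dil i.2)).
  rewrite ler_expR lerN2 [leRHS]mulrAC; move: (@dil R i.2) d0 => e d0; apply: ler_wpM2r => //.
  by apply: ler_wpM2l => //; exact: pi_ge0.
have Zle : Zpar i x ^+ (2 * k) <= (1 + nuc i) ^+ (2 * k) * (1 + dil i.2) ^+ (4 * k) * (1 + y i x) ^+ (2 * k).
  have -> : (1 + @dil R i.2) ^+ (4 * k) = ((1 + dil i.2) ^+ 2) ^+ (2 * k).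
    by rewrite -exprM; congr (_ ^+ _); rewrite mulnA.
  have [Z1 _ _ _] := Zpar_le i x.
  have q0 : 0 <= (1 + nuc i) * (1 + @dil R i.2) ^+ 2 * (1 + y i x).
    by apply: mulr_ge0; [apply: mulr_ge0; rewrite ?sqr_ge0// addr_ge0|rewrite addr_ge0].
  rewrite -!exprMn lerXn2r ?nnegrE ?q0 ?(le_trans ler01 Z1)// /Zpar ler_wpM2r ?addr_ge0//.
  by rewrite (expr2 (1 + dil _)) mulrA ler_wpM2r ?addr_ge0// scl_le.
have A0 : 0 <= Zpar i x ^+ (2 * k) by rewrite exprn_ge0//; have [h _ _ _] := Zpar_le i x; exact: le_trans h.
have E0 := expR_ge0 (R := R); have B0 : 0 <= b1 i x := E0 _.
apply: le_trans (ler_pM A0 (mulr_ge0 (E0 _) (E0 _)) Zle (ler_pM (E0 _) (E0 _) ed ey)) _.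
have N0 : 0 <= (1 + nuc i) ^+ (2 * k) by rewrite exprn_ge0// addr_ge0.
rewrite [leLHS](_ : _ = ((1 + dil i.2) ^+ (4 * k) * expR (- (pi / 4 * dil i.2))) *
  ((1 + y i x) ^+ (2 * k) * expR (- y i x ^+ 2)) * ((1 + nuc i) ^+ (2 * k) * b1 i x)); last by ring.
rewrite -[leRHS]mulrA; apply: ler_wpM2r; first exact: mulr_ge0.
apply: ler_pM; rewrite ?h1 ?h2//.
  by rewrite mulr_ge0 ?E0// exprn_ge0// addr_ge0.
by rewrite mulr_ge0 ?E0// exprn_ge0// addr_ge0.
Qed.

Hypothesis s_le : s <= gam + n%:R / u.

Lemma Aus_par : exists2 C, 0 <= C & forall J, (Aus u s Theta (mpar J) <= (C * powR J.+2%:R u^-1)%:E)%E.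
Proof.
have u0 : 0 < u by exact: lt_trans ltr01 u1.
have g0 := gg0; have g1 := gg1; have g0' := ltW g0.
have [C1 C10 hconv] := @conv_addV R n.
pose b i (x : V R (n + n)) : R := C1 / (1 + nuc i * enorm (addV x)) ^+ n.
have b10 i x : 0 <= b1 i x <= 1.
  by rewrite /b1 expR_ge0 -[leRHS]expR0 ler_expR oppr_le0 mulr_ge0 ?sqr_ge0 ?dotp_ge0.
have mb1 i : measurable_fun setT (b1 i).
  apply: measurableT_comp => //; apply: measurableT_comp => //.
  by apply: measurable_funM => //; apply: measurable_dotp; exact: measurable_addVsub.
have b1b i (r : R) (x : V R (n + n)) : \int[mu (n + n)]_y (gq y * b1 i (x + r *: y)) <= b i x.
  exact: (hconv (nuc i) r x (ltW (nuc_gt0 i))).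
have L1 i : 1 <= 1 + nuc i by rewrite lerDl ltW ?nuc_gt0.
have Z1 i x : 1 <= Zpar i x by have [] := Zpar_le i x.
have [C C0 hS] := SB_family s0 sT suppT Z1 quad_par L1 par_bound mb1 b10 b1b.
pose r := powR 2 (n%:R / u); pose c := C1 * powR 2 s.
have c0 : 0 <= c by rewrite mulr_ge0 ?powR_ge0 ?ltW.
have r0 : 0 <= r by exact: powR_ge0.
pose A := C * (c * (1 - g)^-1); pose B := C * c.
have gi : 0 <= (1 - g)^-1 by rewrite invr_ge0 subr_ge0 ltW.
have A0 : 0 <= A := mulr_ge0 C0 (mulr_ge0 c0 gi).
have B0 : 0 <= B := mulr_ge0 C0 c0.
pose K := Num.sqrt (pi : R) ^+ n * \int[mu n]_x (wexp u x).
have K0 : 0 <= K.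
  by rewrite mulr_ge0 ?exprn_ge0 ?sqrtr_ge0//; apply: Rintegral_ge0 => x _; exact: expR_ge0.
have [C2 C20 hL] := @Lpn_dsum R (n + n) n u A B K n0 u1 A0 B0 K0.
exists C2 => // J; pose X (x : V R (n + n)) := enorm (addV x).
have mX : measurable_fun setT X by apply: measurable_enorm; exact: measurable_addVsub.
have X0 x : 0 <= X x by exact: enorm_ge0.
have term (j : nat) k x : g ^+ j * (powR (1 + nuc (j, k)) s * b (j, k) x) =
    C1 * (g ^+ j * powR (1 + nuc (j, k)) s / (1 + nuc (j, k) * X x) ^+ n) by rewrite /b /X; ring.
apply: (@Aus_le _ _ _ _ _ u1 _ _ (fun k (x : V R (n + n)) => expR (- (enorm x / 2)) * (A + B * dsum n r J (X x)))).
- by move=> k; apply: measurable_dsum_env.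
- move=> k.
  have cF i : cig (mu (n + n)) (fun x => cexp (qpar i x) * fhat Theta x).
    apply: supp_cig.
    + apply: cmeasM; first by apply: cmeas_cexp; have [] := quad_meas quad_par i.
      exact: cmeas_fhat (schwartz_cig sT).
    + have [B' hB'] := fhat_bounded (schwartz_cig sT) => r'; exists (1 * B') => x _.
      by rewrite cabsM; apply: ler_pM; rewrite ?cabs_ge0// cabs_qpar_le1.
    + by move=> x nx; rewrite suppT// mulr0.
  have E : (fun x => mpar J ((2 : R) ^ k *: x) * fhat Theta x) =
      (fun x : V R (n + n) => \sum_(j < J) ((g ^+ j)%:C%C * (cexp (qpar (j : nat, k) x) * fhat Theta x))).
    by apply/funext => x; rewrite mpar_dil mulr_suml; apply: eq_bigr => j _; rewrite mulrA.
  have cG (j : 'I_J) : cig (mu (n + n)) (fun x => (g ^+ j)%:C%C * (cexp (qpar (j : nat, k) x) * fhat Theta x)).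
    exact: (cigZ _ (cF (j : nat, k))).
  have cS := cig_sum (index_enum 'I_J) cG.
  apply: SB_le (SB_eq _ (SB_sum (index_enum 'I_J) (fun j : 'I_J => SB_scale (g ^+ j)%:C%C (hS (j : nat, k))))); last first.
    move=> xi; rewrite E (fhatE xi cS).
    transitivity ((sob_weight s xi)%:C%C * \sum_(j < J) cI (mu (n + n)) (fun x => (g ^+ j)%:C%C * (cexp (qpar (j : nat, k) x) * fhat Theta x) * chr xi x)).
      rewrite mulr_sumr; apply: eq_bigr => j _.
      rewrite (fhatE xi (cF (j : nat, k))) mulrCA; congr (_ * _).
      rewrite -(cIZ _ (cig_chr xi (cF (j : nat, k)))); apply: cI_eq => x.
      by rewrite mulrA.
    congr (_ * _).
    rewrite -(@cI_sum _ _ _ _ _ _ (fun (j : 'I_J) x => (g ^+ j)%:C%C * (cexp (qpar (j : nat, k) x) * fhat Theta x) * chr xi x)); last first.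
      by move=> j; exact: (cig_chr xi (cG j)).
    by apply: cI_eq => x; rewrite mulr_suml.
  move=> x /=; set ex := expR (- (enorm x / 2)); have ex0 : 0 <= ex by exact: expR_ge0.
  pose F (j : nat) : R := g ^+ j * powR (1 + nuc (j, k)) s / (1 + nuc (j, k) * X x) ^+ n.
  rewrite (eq_bigr (fun j : 'I_J => ex * C * C1 * F j)); last first.
    move=> j _; rewrite cabsR ger0_norm ?exprn_ge0// /F.
    by rewrite -(mulrA _ C1 (_ / _)) -term -/ex; ring.
  (* Below [kap] one has nuc <= 1, so a term is at most 2^s g^j. After the shift nuc is 2^j, and s
     <= gam + n/u gives g^j 2^(j s) <= r^j. *)
  have hF : \sum_(j < J) F j <= \sum_(j < J) (powR 2 s * g ^+ j) + \sum_(j < J) (powR 2 s * (r ^+ j / (1 + 2 ^+ j * X x) ^+ n)).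
    apply: (@sum_shift_le (kap k) J F (fun j => powR 2 s * g ^+ j) (fun j => powR 2 s * (r ^+ j / (1 + 2 ^+ j * X x) ^+ n))).
    - by move=> j; rewrite mulr_ge0 ?powR_ge0 ?exprn_ge0.
    - move=> j; rewrite mulr_ge0 ?powR_ge0// divr_ge0 ?exprn_ge0//.
      by rewrite addr_ge0// mulr_ge0// exprn_ge0.
    - move=> j jk; rewrite /F; set v := nuc (j, k); have v0 : 0 < v := nuc_gt0 _.
      have v1 : v <= 1.
        by rewrite /v /nuc/= ler_pdivrMr ?exprn_gt0// mul1r ler_weXn2l ?ler1n// ltnW.
      have D1 : 1 <= (1 + v * X x) ^+ n.
        by rewrite exprn_ege1// lerDl; apply: mulr_ge0 => //; exact: ltW.
      rewrite ler_pdivrMr ?(lt_le_trans ltr01 D1)// -[leLHS]mulr1.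
      apply: ler_pM; rewrite ?mulr_ge0 ?exprn_ge0 ?powR_ge0//.
      rewrite mulrC ler_wpM2r ?exprn_ge0//; apply: ge0_ler_powR; rewrite ?nnegrE ?(ltW s0) ?addr_ge0 ?(ltW v0)//.
      by lra.
    move=> j; rewrite /F.
    have -> : nuc ((j + kap k)%N, k) = 2 ^+ j by rewrite /nuc/= exprD mulfK// expf_neq0.
    rewrite mulrA; apply: ler_wpM2r.
      by rewrite invr_ge0 exprn_ge0// addr_ge0// mulr_ge0// exprn_ge0.
    apply: (@le_trans _ _ (g ^+ j * powR (2 * 2 ^+ j) s)).
      apply: ler_pM; rewrite ?exprn_ge0 ?powR_ge0//.
        by rewrite exprD ler_piMr ?exprn_ge0// exprn_ile1// ltW.
      apply: ge0_ler_powR; rewrite ?nnegrE ?(ltW s0) ?addr_ge0 ?mulr_ge0 ?exprn_ge0//.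
      by rewrite mulrDl mul1r lerD2r exprn_ege1// ler1n.
    rewrite powRM ?exprn_ge0// mulrCA ler_wpM2l ?powR_ge0//.
    rewrite -(powR_mulrn j g0') -(powR_mulrn j (ler0n R 2)) -(powR_mulrn j r0) /g /r -!powRrM.
    rewrite -powRD; last by rewrite pnatr_eq0 implybT.
    apply: ler_powR; first by rewrite ler1n.
    by rewrite (mulrC _ s) -mulrDl ler_wpM2r//; have := s_le; lra.
  rewrite -mulr_sumr; apply: (@le_trans _ _ (ex * C * C1 * (powR 2 s * (1 - g)^-1 + powR 2 s * dsum n r J (X x)))).
    apply: ler_wpM2l; first by rewrite !mulr_ge0// ltW.
    apply: (le_trans hF); rewrite -!mulr_sumr lerD// ler_wpM2l ?powR_ge0//.
    exact: geom_sum_le.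
  by rewrite /A /B /c; lra.
move=> k; apply: hL => // i; exact: dsum_int_addV.
Qed.

(** With plain Gaussian inputs [Tm] is a sum of nonnegative Gaussians of width about 2^j and height
    g^j 2^(-j n) = 2^(-j n / p), by the choice of gam. Positivity allows keeping on the j-th cube
    the j-th term alone, so no cancellation has to be excluded. *)
Lemma par_growth C : mult_bound p1 p2 p u s Theta C -> p^-1 <= u^-1.
Proof.
move=> H; have [Ca Ca0 hA] := Aus_par; have pi0 := pi_gt0 R.
have u0 : 0 < u by exact: lt_trans ltr01 u1.
have g0 := gg0; have g0' := ltW g0.
pose N1 := powR (Num.sqrt (1 * p1)^-1 ^+ n) p1^-1.
pose N2 := powR (Num.sqrt (1 * p2)^-1 ^+ n) p2^-1.
(* 4^-n collects the 2^-n of [Tm_fold] and the 2^-n from sqrt(al_j) <= 2 2^j; on the cube |x|^2 <= n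
   4^j <= n al_j, which gives exp(-pi n). *)
pose c0 : R := 4^-1 ^+ n * expR (- (pi * n%:R)).
have c00 : 0 < c0 by rewrite mulr_gt0 ?exprn_gt0 ?expR_gt0.
pose w : R := powR 2 (- (n%:R / p)); have w0 : 0 <= w by exact: powR_ge0.
pose v : R := 2^-1 ^+ n; have v0 : 0 < v by rewrite exprn_gt0.
apply: (@nat_growth R (c0 * powR v p^-1) (`|C| * Ca * N1 * N2)).
- by rewrite mulr_gt0 ?powR_gt0.
- by rewrite invr_ge0 ltW.
- by rewrite invr_ge0 ltW.
move=> J.
pose f := gauV 1 0 (0 : 'rV[R]_n); pose al (j : nat) : R := 1 + (2 ^+ j) ^+ 2.
have al0 j : 0 < al j by rewrite ltr_wpDr// sqr_ge0.
have fE (xi : 'rV[R]_n) : fhat f xi = (expR (- (pi * dotp xi xi)))%:C%C.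
  rewrite (fhat_gauV _ _ _ ltr01) expr1n (expr2 0) mul0r addr0 divr1 oppr0 mul0r add0r.
  by rewrite gJ_real// sqrtr1 invr1 expr1n mul1r gauV_real mulr1.
pose gg (z : V R n) : R[i] := \sum_(j < J) (g ^+ j)%:C%C * (expR (- (pi * (2 ^+ j) ^+ 2 * dotp z z)))%:C%C.
have mgauss (k : R) : measurable_fun setT (fun z : V R n => expR (- (k * dotp z z))).
  apply: measurableT_comp => //; apply: measurableT_comp => //.
  by apply: measurable_funM => //; exact: measurable_dotp.
have mgg : cmeas gg.
  apply: cmeas_sum => j; apply: cmeasM; first exact: cmeas_cst.
  by apply: cmeasR; exact: mgauss.
have [B gB] : exists B : R, forall z, cabs (gg z) <= B.
  exists (\sum_(j < J) g ^+ j) => z; rewrite /gg.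
  rewrite (eq_bigr (fun j : 'I_J => (g ^+ j * expR (- (pi * (2 ^+ j) ^+ 2 * dotp z z)))%:C%C)); last by move=> j _; rewrite realCM.
  rewrite -rmorph_sum/= cabsR ger0_norm; last by apply: sumr_ge0 => j _; rewrite mulr_ge0 ?expR_ge0 ?exprn_ge0.
  apply: ler_sum => j _; rewrite ler_piMr ?exprn_ge0// -[leRHS]expR0 ler_expR oppr_le0.
  by rewrite mulr_ge0 ?dotp_ge0// mulr_ge0 ?sqr_ge0// ltW.
have prod (xi : 'rV[R]_(n + n)) : fhat f (lsubmx xi) * fhat f (rsubmx xi) * mpar J xi =
    1 * ((expR (- (2 * pi * dotp xi xi)))%:C%C * gg (addV xi)).
  rewrite mul1r !fE -realCM -expRD /mpar /gg [LHS]mulr_sumr [RHS]mulr_sumr; apply: eq_bigr => j _.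
  rewrite !(mulrCA _ (g ^+ j)%:C%C); congr (_ * _).
  rewrite -!cexpR -!cexpD; congr cexp.
  rewrite /qpar /scl /dil/= !expr0z !subr0 (dotp_sub xi).
  by apply: complexP => /=; ring.
have cG j (x : 'rV[R]_n) : cig (mu n) (gauV (al j) 0 (- x)) by exact: cig_gauV.
pose T (x : 'rV[R]_n) : R := \sum_(j < J) v * (g ^+ j * ((Num.sqrt (al j))^-1 ^+ n * expR (- (pi / al j * dotp x x)))).
have TE : Tm (mpar J) f f = fun x => (T x)%:C%C.
  apply/funext => x; rewrite (Tm_fold x mgg gB prod) mul1r.
  have -> : cI (mu n) (fun z => (expR (- (pi * dotp z z)))%:C%C * gg z * chr (- x) z) =
      cI (mu n) (fun z => \sum_(j < J) (g ^+ j)%:C%C * gauV (al j) 0 (- x) z).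
    apply: cI_eq => z; rewrite /gg mulr_sumr mulr_suml; apply: eq_bigr => j _.
    have -> : gauV (al j) 0 (- x) z = gauV (al j) 0 0 z * chr (- x) z by rewrite gauV_chr add0r.
    suff -> : gauV (al j) 0 0 z = (expR (- (pi * dotp z z)))%:C%C * (expR (- (pi * (2 ^+ j) ^+ 2 * dotp z z)))%:C%C by ring.
    rewrite gauV_real -realCM -expRD; suff -> : - (pi * dotp z z) + - (pi * (2 ^+ j) ^+ 2 * dotp z z) = - (pi * al j * dotp z z) by [].
    by rewrite /al; ring.
  rewrite cI_sum; last by move=> j; exact: (cigZ _ (cG j x)).
  rewrite /T rmorph_sum/= mulr_sumr; apply: eq_bigr => j _.
  by rewrite (cIZ _ (cG j x)) (cI_gauV _ (al0 j)) !realCM.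
pose lb (x : V R n) : R := \sum_(j < J) w ^+ j * dyad j x.
have lb0 x : 0 <= lb x.
  apply: sumr_ge0 => j _; rewrite mulr_ge0 ?exprn_ge0// /dyad box_indE; exact: ler0n.
have TB x : c0 * lb x <= T x.
  rewrite /lb mulr_sumr /T; apply: ler_sum => j _; have sq0 : 0 < Num.sqrt (al j) by rewrite sqrtr_gt0.
  rewrite /dyad box_indE; case: forallP => [hx|_]; last first.
    by rewrite !mulr0 !mulr_ge0 ?exprn_ge0 ?expR_ge0 ?invr_ge0 ?(ltW v0) ?sqrtr_ge0.
  have e0 : 0 < (2 : R) ^+ j by rewrite exprn_gt0.
  have xx : dotp x x <= n%:R * (2 ^+ j) ^+ 2.
    rewrite /dotp -[n in leRHS]card_ord mulr_natl -sumr_const; apply: ler_sum => i _.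
    have /andP[x1 x2] := hx i; have x3 : 0 <= x ord0 i by apply: ltW; apply: le_lt_trans x1; rewrite divr_ge0 ?ltW.
    by rewrite -expr2 lerXn2r ?nnegrE ?(ltW e0).
  have sq : Num.sqrt (al j) <= 2 * 2 ^+ j.
    rewrite -(ler_pXn2r (ltn0Sn 1)) ?nnegrE ?sqrtr_ge0 ?mulr_ge0 ?(ltW e0)// sqr_sqrtr ?ltW//.
    have : 1 <= (2 : R) ^+ j by rewrite exprn_ege1// ler1n.
    by rewrite /al exprMn; move: ((2 : R) ^+ j) => t t1; nra.
  have wE : w ^+ j = g ^+ j * (2 ^+ j)^-1 ^+ n.
    have E2 : (2 ^+ j)^-1 ^+ n = powR 2 (- (j%:R * n%:R)) :> R.
      by rewrite powRN powRrM (powR_mulrn _ (powR_ge0 _ _)) (powR_mulrn _ (ler0n R 2)) exprVn.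
    rewrite E2 -(powR_mulrn j w0) -(powR_mulrn j g0') /w /g -!powRrM -powRD ?pnatr_eq0 ?implybT//.
    by rewrite gamE (_ : - (n%:R + gam) * j%:R = - gam * j%:R - j%:R * n%:R)//; ring.
  rewrite mulr1 wE /c0 [leLHS](_ : _ = (2^-1 ^+ n) * (g ^+ j * ((2 * 2 ^+ j)^-1 ^+ n * expR (- (pi * n%:R))))); last first.
    have -> : (4^-1 : R) = 2^-1 * 2^-1 by field.
    by rewrite invfM !exprMn; ring.
  rewrite ler_wpM2l ?(ltW v0)// ler_wpM2l ?exprn_ge0//; apply: ler_pM; rewrite ?expR_ge0//.
    have t0 : 0 < 2 * (2 : R) ^+ j by rewrite mulr_gt0.
    by rewrite lerXn2r ?nnegrE ?invr_ge0 ?(ltW sq0) ?(ltW t0)// lef_pV2 ?posrE.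
  rewrite ler_expR lerN2 -mulrA ler_wpM2l ?(ltW pi0)// mulrC ler_pdivrMr//.
  by apply: (le_trans xx); rewrite ler_wpM2l// /al lerDr.
have mT : measurable_fun setT (T : V R n -> R).
  by apply: measurable_sum => j; do 3 (apply: measurable_funM => //).
have mm : cmeas (mpar J : V R (n + n) -> R[i]).
  apply: cmeas_sum => j; apply: cmeasM; first exact: cmeas_cst.
  by apply: cmeas_cexp; have [] := quad_meas quad_par (j : nat, 0).
have bm : bounded_cfun (mpar J).
  have : forall K : nat, exists M : R, forall x, cabs (\sum_(j < K) (g ^+ j)%:C%C * cexp (qpar (j : nat, 0) x)) <= M.
    elim=> [|K [M hM]]; first by exists 0 => x; rewrite big_ord0 cabs0.
    exists (M + g ^+ K * 1) => x; rewrite big_ord_recr/=; apply: le_trans (cabsD _ _) _.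
    rewrite lerD// cabsM cabsR ger0_norm ?exprn_ge0// ler_wpM2l ?exprn_ge0//.
    exact: cabs_qpar_le1.
  exact.
have P0 : 0 <= Ca * powR J.+2%:R u^-1 by rewrite mulr_ge0 ?powR_ge0.
have sf : schwartz f by exact: schwartz_gauV.
have := mult_bound_use H P0 mm bm (hA J) sf sf
  (powR_ge0 _ _) (powR_ge0 _ _) (LpNorm_gauV 0 (0 : 'rV[R]_n) p1_gt0 ltr01) (LpNorm_gauV 0 (0 : 'rV[R]_n) p2_gt0 ltr01).
have mTC : cmeas (fun x : V R n => (T x)%:C%C) by exact: cmeasR.
rewrite TE (LpNormE _ mTC) -/N1 -/N2 => h.
have ij j : rig (mu n) (dyad j) /\ \int[mu n]_x dyad j x = v * (2 ^+ j) ^+ n.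
  have [|i1 e1] := @rig_box_ind (2 ^+ j / 2) (2 ^+ j).
    by rewrite ler_pdivrMr// ler_peMr ?exprn_ge0// ler1n.
  split => //; rewrite /dyad e1 -exprMn; congr (_ ^+ _); by field.
have lbp x : powR (lb x) p = \sum_(j < J) powR w p ^+ j * dyad j x by exact: powR_dyad_sum.
have mdy j : measurable_fun setT (dyad j) := rig_meas (ij j).1.
have is_ (K : nat) : rig (mu n) (fun x => \sum_(j < K) powR w p ^+ j * dyad j x) /\
    \int[mu n]_x (\sum_(j < K) powR w p ^+ j * dyad j x) = K%:R * v.
  elim: K => [|K [IH1 IH2]].
    split; first by under [X in rig _ X]eq_fun do rewrite big_ord0; exact: integrable0.
    by under eq_Rintegral do rewrite big_ord0; rewrite Rintegral_cst// mul0r mul0r.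
  have iK := rigZ (powR w p ^+ K) (ij K).1.
  split; first by under [X in rig _ X]eq_fun do rewrite big_ord_recr/=; exact: rigD.
  under eq_Rintegral do rewrite big_ord_recr/=.
  rewrite RintegralD// IH2 RintegralZl//; last exact: (ij K).1.
  (* The p-th power of the height cancels the volume of the cube up to v = 2^-n, so every j
     contributes equally. *)
  have wp : powR w p = (2 ^+ n)^-1.
    by rewrite /w -powRrM mulNr divfK ?gt_eqF// powRN powR_mulrn.
  have wv : powR w p ^+ K * (v * (2 ^+ K) ^+ n) = v.
    by rewrite wp exprVn mulrCA exprAC mulVf ?mulr1// !expf_neq0.
  by rewrite (ij K).2 wv -(@natr1 R K) mulrDl mul1r.
have ilb : rig (mu n) (fun x => powR (lb x) p).
  by have := (is_ J).1; congr rig; apply/funext => x; rewrite lbp.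
have := @le_Lpn R n p (fun x => c0 * lb x) (fun x => cabs (T x)%:C%C) (ltW p_gt0).
rewrite (Lpn_scale p_gt0 (ltW c00) lb0 ilb).
have -> : \int[mu n]_x powR (lb x) p = J%:R * v.
  by rewrite -(is_ J).2; apply: eq_Rintegral => x _; exact: lbp.
move=> /(_ _ _ _)/le_trans /(_ h); rewrite lee_fin => h2.
rewrite [leLHS](_ : _ = c0 * powR (J%:R * v) p^-1); last first.
  by rewrite powRM ?(ltW v0)//; ring.
rewrite [leRHS](_ : _ = `|C| * (Ca * powR J.+2%:R u^-1) * N1 * N2); last by ring.
apply: h2.
- by apply: measurable_funM => //; apply: measurable_sum => j; exact: measurable_funM.
- exact: cmeas_cabs.
by move=> x; rewrite (mulr_ge0 (ltW c00) (lb0 x))/= cabsR; apply: le_trans (TB x) (ler_norm _).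
Qed.

End ParaproductMultiplier.

(** * Derivation of the two conclusions *)

Theorem theorem6p9 (R : realType) (n : nat) (p1 p2 p u s : R)
  (Theta : 'rV[R]_(n + n) -> R[i]) :
  (0 < n)%N -> 1 < p1 -> 1 < p2 -> p^-1 = p1^-1 + p2^-1 ->
  1 < u -> 0 < s ->
  schwartz Theta ->
  (forall xi, ~ (2^-1 <= enorm xi <= 2) -> fhat Theta xi = 0) ->
  (exists C : R, forall m : 'rV[R]_(n + n) -> R[i],
      borel_meas m -> bounded_cfun m -> (Aus u s Theta m < +oo)%E ->
      forall f1 f2 : 'rV[R]_n -> R[i], schwartz f1 -> schwartz f2 ->
      (LpNorm p (Tm m f1 f2)
         <= C%:E * Aus u s Theta m * LpNorm p1 f1 * LpNorm p2 f2)%E) ->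
  Num.max (2 / u) (p^-1 - (1 - u^-1)) < s / n%:R /\
  Num.max (2^-1 - (1 - p^-1)) 0
    + (Num.max (2^-1 - p1^-1) 0 + Num.max (2^-1 - p2^-1) 0) <= s / n%:R.
Proof.
move=> n0 p11 p21 pE u1 s0 sT hT [C H].
have p1_gt0 : 0 < p1 by exact: lt_trans p11.
have p2_gt0 : 0 < p2 by exact: lt_trans p21.
have u0 : 0 < u by exact: lt_trans u1.
have p_gt0 : 0 < p by rewrite -invr_gt0 pE addr_gt0 ?invr_gt0.
have suppT : supp (fhat Theta) by exact: hT.
have HC : mult_bound p1 p2 p u s Theta C by exact: H.
have N0 : 0 < n%:R :> R by rewrite ltr0n.
have sA : 2 / u < s / n%:R.
  rewrite ltr_pdivlMr// ltNge; apply/negP => h.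
  apply: (bump_contra (Ordinal n0) u1 s0 p_gt0 p1_gt0 p2_gt0 sT suppT _ HC).
  by rewrite natrD; apply: (le_trans h); lra.
split.
  rewrite gt_max sA/= ltNge; apply/negP => h.
  have [ui pi'] : 0 < u^-1 /\ 0 < p^-1 by rewrite !invr_gt0.
  (* Combining 2/u < s/n with s/n <= 1/p - 1 + 1/u. This makes gam positive and will contradict 1/p
     <= 1/u from [par_growth]. *)
  have pu : u^-1 + 1 < p^-1 by lra.
  have g0 : 0 < n%:R * (p^-1 - 1) by rewrite mulr_gt0//; lra.
  have gE : n%:R / p = n%:R + n%:R * (p^-1 - 1) by rewrite mulrBr mulr1 addrC subrK.
  have sle : s <= n%:R * (p^-1 - 1) + n%:R / u.
    by rewrite -mulrDr mulrC -ler_pdivrMr//; apply: (le_trans h); lra.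
  by have := par_growth n0 u1 s0 p_gt0 p1_gt0 p2_gt0 sT suppT g0 gE sle HC; lra.
have maxE (a : R) : Num.max a 0 = (0 < a)%R%:R * a.
  by case: ltP => _; rewrite ?mul1r ?mul0r.
(* Each chirp is switched on exactly when its term is positive, which turns the linear inequality
   into the sum of maxima; note 1/2 - 1/p' = 1/p - 1/2. *)
rewrite ler_pdivlMr// mulrC; apply: le_trans (osc_exponent u1 s0 p_gt0 p1_gt0 p2_gt0 sT suppT
  (0 < 2^-1 - (1 - p^-1)) (0 < 2^-1 - p1^-1) (0 < 2^-1 - p2^-1) HC).
rewrite !maxE (_ : 2^-1 - (1 - p^-1) = p^-1 - 2^-1); last by field; rewrite gt_eqF.
by rewrite addrA.
Qed.
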